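(* Fix numbers $0<\varepsilon'<\varepsilon$. For $t\in\mathbb{C}$ with $0<|t|<\varepsilon^2$, let $\mathcal{A}_t\subset\mathbb{C}$ be the annulus $|t|/\varepsilon<|z|<\varepsilon$ and $\psi_t:\mathcal{A}_t\to\mathcal{A}_t$, $\psi_t(z)=t/z$. Let $\xi_t$ be a family of $\Lambda\mathfrak{sl}(n,\mathbb{C})$-valued holomorphic 1-forms on $\mathcal{A}_t$, depending holomorphically on $t\in D^*(0,\varepsilon^2)$, and let $\hat\xi_t=\psi_t^*\xi_t$. Assume that $\lim_{t\to0}\xi_t=\xi_0$ and $\lim_{t\to0}\hat\xi_t=\hat\xi_0$, where $\xi_0$ and $\hat\xi_0$ are holomorphic in $D(0,\varepsilon)$ and the limits are uniform on compact subsets of $D^*(0,\varepsilon)$. For $t$ in the universal cover $\widetilde{\mathbb{C}^*}$ of $\mathbb{C}^*$ (a point $t\in\mathbb{C}^*$ together with a determination of $\log t$), let $\beta_t$ be the path $\beta_t(s)=(\varepsilon')^{1-2s}e^{s\log t}$, $s\in[0,1]$, from $\varepsilon'$ to $t/\varepsilon'$, and let $\gamma(s)=\varepsilon' e^{2\pi i s}$. Define, for $t\in\widetilde{\mathbb{C}^*}$ small enough, $$\tilde F(t)=\mathcal{P}(\xi_t,\gamma)^{-\frac{\log t}{2\pi i}}\,\mathcal{P}(\xi_t,\beta_t).$$ Then: (1) $\tilde F(e^{2\pi i}t)=\tilde F(t)$, so $\tilde F$ descends to a well defined holomorphic function $F(t)$ on a punctured neighborhood of $0$; (2) $F$ extends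 holomorphically at $t=0$ with $F(0)=\mathcal{P}(\xi_0,\varepsilon',0)\,\mathcal{P}(\hat\xi_0,0,\varepsilon')$; (3) for real $t>0$, $\mathcal{P}(\xi_t,\beta_t)$ extends to a smooth function of $t$ and $t\log t$ with value $F(0)$ at $t=0$, and as $t\to0$, $$\mathcal{P}(\xi_t,\beta_t)=\Big(I_n+\frac{t\log t}{2\pi i}\,\frac{\partial}{\partial t}\mathcal{P}(\xi_t,\gamma)\big|_{t=0}\Big)F(0)+O(t).$$
   Context: Fix $\rho>1$; $\mathcal{W}$ is the Banach algebra of functions $f(\lambda)=\sum_{i\in\mathbb{Z}}f_i\lambda^i$ on the unit circle with norm $\sum_i|f_i|\rho^{|i|}<\infty$, and $\Lambda\mathfrak{sl}(n,\mathbb{C})$ denotes trace-free $n\times n$ matrices with entries in $\mathcal{W}$. For a path $c:[0,1]\to$ (domain of a matrix-valued 1-form $\xi$), the principal solution $\mathcal{P}(\xi,c)$ is $Y(1)$ where $Y'(s)=Y(s)\,\xi(c(s))(c'(s))$, $Y(0)=I_n$. $\mathcal{P}(\xi_0,\varepsilon',0)$ (resp. $\mathcal{P}(\hat\xi_0,0,\varepsilon')$) is the principal solution along a path in $D(0,\varepsilon)$ from $\varepsilon'$ to $0$ (resp. from $0$ to $\varepsilon'$), independent of the path since the forms are holomorphic in the disk. $e^{2\pi i}t$ denotes the deck transformation of $\widetilde{\mathbb{C}^*}$ increasing $\arg t$ by $2\pi$. For a matrix $X$ close to the identity and $a\in\mathbb{C}$, $X^{a}=\exp(a\log X)$. A function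 $f(t)$ of $t\ge0$ is a smooth function of $t$ and $t\log t$ if there is a smooth function $g(t,s)$ near $(0,0)$ with $f(t)=g(t,t\log t)$ for $t>0$ and $f(0)=g(0,0)$. $\frac{\partial}{\partial t}\mathcal{P}(\xi_t,\gamma)|_{t=0}$ denotes the derivative at $t=0$ of the map $t\mapsto\mathcal{P}(\xi_t,\gamma)$ extended to $t=0$. *)

(* Defs.v *)
From HB Require Import structures.
From mathcomp Require Import all_boot all_order all_algebra.
From mathcomp Require Import all_classical all_reals.
From mathcomp Require Import sequences exp trigo.
From mathcomp Require Import complex.
From Stdlib Require Import ClassicalEpsilon.

Set Implicit Arguments.
Unset Strict Implicit.
Unset Printing Implicit Defensive.

Import Order.TTheory GRing.Theory Num.Theory.
Local Open Scope ring_scope.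
Local Open Scope complex_scope.

Definition cabs {R : realType} (z : R[i]) : R := Normc.normc z.

Definition cexp {R : realType} (z : R[i]) : R[i] :=
  ((expR (complex.Re z))%:C * (cos (complex.Im z) +i* sin (complex.Im z)))%C.

Definition two_pi_i (R : realType) : R[i] := (0 +i* (2 * pi))%C.

(* The loop algebra Lambda gl(n,C) with entries in the Wiener-type     *)
(* algebra W_rho.  An element is represented by its Fourier            *)
(* coefficients  f = sum_{k in Z} f_k lambda^k,  f_k in M_n(C).         *)
(* The norm used is  ||f|| = sum_k mnorm(f_k) rho^|k|, with            *)
(* mnorm(M) = sum_{i,j} |M_ij|; it is equivalent to any norm on        *)
(* M_n(W) built from the W-norm of the entries.                         *)
(* NB: the pointwise ring structure that MathComp puts on function     *)
(* types is NOT used; the algebra product is lmul below.               *)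

Definition loop (R : realType) (n : nat) := int -> 'M[R[i]]_n.

Definition mnorm {R : realType} {n : nat} (M : 'M[R[i]]_n) : R :=
  \sum_(i < n) \sum_(j < n) cabs (M i j).

Definition wpart {R : realType} {n : nat} (rho : R) (f : loop R n) (N : nat) : R :=
  \sum_(k < N) (if val k == 0%N then mnorm (f 0)
                else (mnorm (f (k%:Z)) + mnorm (f (- (k%:Z)))) * rho ^+ k).

(* ||f|| <= e   (in particular f has finite norm) *)
Definition lle {R : realType} {n : nat} (rho : R) (f : loop R n) (e : R) : Prop :=
  forall N, wpart rho f N <= e.

Definition inL {R : realType} {n : nat} (rho : R) (f : loop R n) : Prop :=
  exists M, lle rho f M.

Definition is_sl {R : realType} {n : nat} (rho : R) (f : loop R n) : Prop :=
  inL rho f /\ forall k, \tr (f k) = 0.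

Definition lone {R : realType} {n : nat} : loop R n :=
  fun k => if k == 0 then 1%:M else 0.

Definition mconv {R : realType} {n : nat} (u : nat -> 'M[R[i]]_n) (l : 'M[R[i]]_n) :=
  forall e : R, 0 < e -> exists N, forall m, (N <= m)%N -> mnorm (u m - l) < e.

Definition mlim {R : realType} {n : nat} (u : nat -> 'M[R[i]]_n) : 'M[R[i]]_n :=
  epsilon (inhabits 0) (mconv u).

Definition lmul {R : realType} {n : nat} (f g : loop R n) : loop R n :=
  fun k => mlim (fun N : nat =>
    \sum_(j < (2 * N).+1) f (j%:Z - N%:Z) *m g (k - (j%:Z - N%:Z))).

Definition lconv {R : realType} {n : nat} (rho : R) (u : nat -> loop R n) (l : loop R n) :=
  forall e : R, 0 < e -> exists N, forall m, (N <= m)%N -> lle rho (u m - l) e.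

Definition llim {R : realType} {n : nat} (rho : R) (u : nat -> loop R n) : loop R n :=
  epsilon (inhabits 0) (lconv rho u).

Definition lpow {R : realType} {n : nat} (f : loop R n) (k : nat) : loop R n :=
  iter k (fun g => lmul g f) lone.

Definition lexp {R : realType} {n : nat} (rho : R) (f : loop R n) : loop R n :=
  llim rho (fun N => \sum_(k < N) ((k`!)%:R^-1 : R[i]) *: lpow f k).

Definition llog {R : realType} {n : nat} (rho : R) (X : loop R n) : loop R n :=
  llim rho (fun N => \sum_(k < N)
    (((-1) ^+ k / (k.+1)%:R) : R[i]) *: lpow (X - lone) k.+1).

Definition lcpow {R : realType} {n : nat} (rho : R) (X : loop R n) (a : R[i]) : loop R n :=
  lexp rho (a *: llog rho X).

Definition has_cderiv {R : realType} {n : nat} (rho : R) (f : R[i] -> loop R n)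
    (z : R[i]) (D : loop R n) : Prop :=
  inL rho D /\
  forall e : R, 0 < e -> exists d : R, 0 < d /\
    forall h : R[i], 0 < cabs h -> cabs h < d ->
      lle rho (h^-1 *: (f (z + h) - f z) - D) e.

Definition holo_on {R : realType} {n : nat} (rho : R) (U : R[i] -> Prop)
    (f : R[i] -> loop R n) : Prop :=
  forall z, U z -> inL rho (f z) /\ exists D, has_cderiv rho f z D.

(* The path c is given together with its derivative dc.                *)

Definition is_solution {R : realType} {n : nat} (rho : R) (a : R[i] -> loop R n)
    (c dc : R -> R[i]) (Y : R -> loop R n) : Prop :=
  Y 0 = lone /\
  (forall s, 0 <= s <= 1 -> inL rho (Y s)) /\
  forall s, 0 <= s <= 1 ->
    forall e : R, 0 < e -> exists d : R, 0 < d /\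
      forall h : R, h != 0 -> `|h| < d -> 0 <= s + h <= 1 ->
        lle rho ((h^-1)%:C *: (Y (s + h) - Y s) - lmul (Y s) (dc s *: a (c s))) e.

Definition principal {R : realType} {n : nat} (rho : R) (a : R[i] -> loop R n)
    (c dc : R -> R[i]) : loop R n :=
  epsilon (inhabits 0) (fun X => exists Y, is_solution rho a c dc Y /\ Y 1 = X).

(* Smoothness of M_n(W)-valued functions of two real variables         *)
(* on the open ball  B r = { (x,y) | x^2 + y^2 < r^2 }:                 *)
(* all iterated partial derivatives exist and are continuous on B r.   *)
(* A direction is a bool: false = first variable, true = second.       *)

Definition ball2 {R : realType} (r x y : R) : Prop := x ^+ 2 + y ^+ 2 < r ^+ 2.

Definition has_partial {R : realType} {n : nat} (rho : R) (i : bool)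
    (g : R -> R -> loop R n) (x y : R) (D : loop R n) : Prop :=
  forall e : R, 0 < e -> exists d : R, 0 < d /\
    forall h : R, h != 0 -> `|h| < d ->
      lle rho ((h^-1)%:C *:
        (g (x + (if i then 0 else h)) (y + (if i then h else 0)) - g x y) - D) e.

Definition cont_on2 {R : realType} {n : nat} (rho : R) (r : R)
    (g : R -> R -> loop R n) : Prop :=
  forall x y, ball2 r x y -> forall e : R, 0 < e -> exists d : R, 0 < d /\
    forall x' y', ball2 r x' y' -> `|x' - x| < d -> `|y' - y| < d ->
      lle rho (g x' y' - g x y) e.

Definition smooth_on2 {R : realType} {n : nat} (rho : R) (r : R)
    (g : R -> R -> loop R n) : Prop :=
  exists G : seq bool -> R -> R -> loop R n,
    G [::] = g /\
    forall w, (forall x y, ball2 r x y -> inL rho (G w x y)) /\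
              cont_on2 rho r (G w) /\
              forall (i : bool) x y, ball2 r x y -> has_partial rho i (G w) x y (G (i :: w) x y).

(* beta_t(s) = eps'^(1-2s) e^(s log t), with tau = log t *)
Definition beta_path {R : realType} (eps' : R) (tau : R[i]) (s : R) : R[i] :=
  cexp (((1 - 2 * s) * ln eps')%:C + s%:C * tau)%C.
Definition beta_dpath {R : realType} (eps' : R) (tau : R[i]) (s : R) : R[i] :=
  ((tau - (2 * ln eps')%:C) * beta_path eps' tau s)%C.

Definition gamma_path {R : realType} (eps' : R) (s : R) : R[i] :=
  (eps'%:C * cexp (s%:C * two_pi_i R))%C.
Definition gamma_dpath {R : realType} (eps' : R) (s : R) : R[i] :=
  (two_pi_i R * gamma_path eps' s)%C.

Definition seg_in {R : realType} (eps' : R) (s : R) : R[i] := ((1 - s) * eps')%:C.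
Definition seg_in_d {R : realType} (eps' : R) (s : R) : R[i] := (- eps')%:C.
Definition seg_out {R : realType} (eps' : R) (s : R) : R[i] := (s * eps')%:C.
Definition seg_out_d {R : realType} (eps' : R) (s : R) : R[i] := eps'%:C.

(* Objects of the theorem.  A holomorphic 1-form xi = a(z) dz is       *)
(* represented by its coefficient a; the family xi_t by a t z.         *)

(* hat xi_t = psi_t^* xi_t with psi_t(z) = t/z:  a(t, t/z) * (-t/z^2) dz *)
Definition pullback {R : realType} {n : nat} (a : R[i] -> R[i] -> loop R n)
    (t z : R[i]) : loop R n :=
  (- (t / z ^+ 2)) *: a t (t / z).

(* tilde F on the universal cover, parametrized by tau = log t  (t = e^tau) *)
Definition Ftilde {R : realType} {n : nat} (rho eps' : R)
    (a : R[i] -> R[i] -> loop R n) (tau : R[i]) : loop R n :=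
  lmul (lcpow rho (principal rho (a (cexp tau)) (gamma_path eps') (gamma_dpath eps'))
                  (- tau / two_pi_i R))
       (principal rho (a (cexp tau)) (beta_path eps' tau) (beta_dpath eps' tau)).

Definition Pgamma {R : realType} {n : nat} (rho eps' : R)
    (a : R[i] -> R[i] -> loop R n) (a0 : R[i] -> loop R n) (t : R[i]) : loop R n :=
  if t == 0 then principal rho a0 (gamma_path eps') (gamma_dpath eps')
  else principal rho (a t) (gamma_path eps') (gamma_dpath eps').

Definition Pbeta {R : realType} {n : nat} (rho eps' : R)
    (a : R[i] -> R[i] -> loop R n) (t : R) : loop R n :=
  principal rho (a t%:C) (beta_path eps' (ln t)%:C) (beta_dpath eps' (ln t)%:C).

(* Main.v *)
(** Everything is proved in an abstract Banach algebra B; loops are an instance for [1 < rho].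
    Write f_t for the coefficient of xi_t in the coordinate log z.  The maximum principle on
    the annulus bounds f_t uniformly, because both ends are controlled by the limits of xi_t
    and of its pullback, and Cauchy estimates in t and z improve the convergence to
    |f_t(z) - f_0(z)| = O(|t|/|z|).  The neck is cut at |z| = |t|^(1/2): on each half, gauging
    by a fundamental solution of the limit form leaves a perturbation of size
    O(|t|^(1/2) log |t|), so P(xi_t, beta_t) tends to the product of the two disc transports.
    Increasing log t by 2 pi i multiplies P(xi_t, beta_t) by the monodromy P(xi_t, gamma),
    which is the identity at t = 0 and holomorphic in t, hence equals exp(t K(t)) with K
    holomorphic.  So exp(- (log t / 2 pi i) t K(t)) P(xi_t, beta_t) is single valued, has a
    limit at 0, and extends to F by removal of the singularity; conversely
    P(xi_t, beta_t) = exp((t log t / 2 pi i) K(t)) F(t), which gives smoothness in (t, t log t)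
    and the expansion, since K(0) is the derivative of the monodromy at 0. *)
Require Import Defs.
From HB Require Import structures.
From mathcomp Require Import all_boot all_order all_algebra.
From mathcomp Require Import all_classical all_reals.
From mathcomp Require Import sequences exp trigo.
From mathcomp Require Import complex.
From mathcomp Require Import zify ring lra.
From Stdlib Require Import ClassicalEpsilon.

Set Implicit Arguments.
Unset Strict Implicit.
Unset Printing Implicit Defensive.

Import Order.TTheory GRing.Theory Num.Theory.
Local Open Scope ring_scope.
Local Open Scope complex_scope.

(** * Banach algebras over the complex numbers *)

(** The obstacle is the middle of the neck. There neither limit form controls [xi_t], and in the
    coordinate log z the path has length of order log |t|, so convergence on compact sets gives no
    bound on the transport. Holomorphy in t supplies the missing rate. On a fixed outer circle the
    difference from the limit form vanishes at t = 0, hence is O(|t|); on the inner circle it is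
    merely bounded, but there the Cauchy kernel contributes a factor of order |t|/|z|. The radius
    |t|^(1/2) is the one that z -> t/z exchanges with itself, so the second half of the neck is the
    first half for the pulled back family, run backwards. The limit of P(xi_t, beta_t) is
    established only for bounded arg t; single-valuedness then turns it into a limit at the
    puncture. Holomorphy of B-valued functions means complex differentiability at each point. Its
    consequences come from means over circles and from second-order remainders with explicit
    constants, and these constants are what allow passage to uniform limits. *)

Section Modulus.
Variable R : realType.
Implicit Types z w : R[i].

Lemma cabs_ge0 z : 0 <= cabs z.
Proof. by case: z => a b; rewrite /cabs /= sqrtr_ge0. Qed.

Lemma cabs0 : cabs (0 : R[i]) = 0.
Proof. exact: Normc.normc0. Qed.

Lemma cabs1 : cabs (1 : R[i]) = 1.
Proof. exact: Normc.normc1. Qed.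

Lemma cabs_eq0 z : cabs z = 0 -> z = 0.
Proof. exact: Normc.eq0_normc. Qed.

Lemma cabsM z w : cabs (z * w) = cabs z * cabs w.
Proof. exact: Normc.normcM. Qed.

Lemma cabsV z : cabs z^-1 = (cabs z)^-1.
Proof. exact: Normc.normcV. Qed.

Lemma cabsN z : cabs (- z) = cabs z.
Proof. exact: normcN. Qed.

Lemma cabsD z w : cabs (z + w) <= cabs z + cabs w.
Proof. exact: le_normcD. Qed.

Lemma cabsB z w : cabs (z - w) = cabs (w - z).
Proof. by rewrite -cabsN opprB. Qed.

Lemma cabsX z k : cabs (z ^+ k) = cabs z ^+ k.
Proof. by elim: k => [|k IH]; rewrite ?cabs1 // !exprS cabsM IH. Qed.

Lemma cabs_real (x : R) : cabs x%:C = `|x|.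
Proof. by rewrite /cabs /= expr0n /= addr0 sqrtr_sqr. Qed.

Lemma cabs_gt0 z : (0 < cabs z) = (z != 0).
Proof.
rewrite lt_neqAle cabs_ge0 andbT eq_sym; congr (~~ _).
by apply/eqP/eqP => [/cabs_eq0|->] //; exact: cabs0.
Qed.

Lemma cabs_Re z : `|complex.Re z| <= cabs z.
Proof.
case: z => a b; rewrite /cabs /= -sqrtr_sqr ler_sqrt ?addr_ge0 ?sqr_ge0 //.
by rewrite lerDl sqr_ge0.
Qed.

Lemma cabs_Im z : `|complex.Im z| <= cabs z.
Proof.
case: z => a b; rewrite /cabs /= -sqrtr_sqr ler_sqrt ?addr_ge0 ?sqr_ge0 //.
by rewrite lerDr sqr_ge0.
Qed.

Lemma cabs_le_ReIm z : cabs z <= `|complex.Re z| + `|complex.Im z|.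
Proof.
case: z => a b /=.
rewrite /cabs /= -[leLHS]ger0_norm ?sqrtr_ge0 // -ler_sqr ?nnegrE ?addr_ge0 //.
rewrite real_normK ?num_real // sqr_sqrtr ?addr_ge0 ?sqr_ge0 // sqrrD !real_normK ?num_real //.
by rewrite lerD2r lerDl mulrn_wge0 // mulr_ge0.
Qed.

End Modulus.

HB.mixin Record Lmodule_isBanach (R : realType) V of GRing.Lmodule R[i] V := {
  nm : V -> R;
  nmD : forall x y, nm (x + y) <= nm x + nm y;
  nmZ : forall (a : R[i]) x, nm (a *: x) = cabs a * nm x;
  nm_eq0 : forall x, nm x = 0 -> x = 0;
  nm_complete : forall u : nat -> V,
    (forall e : R, 0 < e -> exists N, forall j k, (N <= j)%N -> (N <= k)%N ->
       nm (u j - u k) <= e) ->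
    exists l, forall e : R, 0 < e -> exists N, forall k, (N <= k)%N ->
       nm (u k - l) <= e }.

#[short(type="banachType")]
HB.structure Definition Banach (R : realType) :=
  {V of GRing.Lmodule R[i] V & Lmodule_isBanach R V}.

(** The unit is not normalised: under a norm summing all entries, the identity matrix has norm equal
    to its size. The factors [nm 1] in later estimates come from this. *)
HB.mixin Record Banach_isAlgebra (R : realType) V
    of GRing.Algebra R[i] V & Banach R V := {
  nm_mul : forall x y : V, nm (x * y) <= nm x * nm y }.

#[short(type="balgType")]
HB.structure Definition BanachAlgebra (R : realType) :=
  {V of GRing.Algebra R[i] V & Banach R V & Banach_isAlgebra R V}.

Section NormTheory.
Variables (R : realType) (V : banachType R).
Implicit Types x y : V.

Lemma nm0 : nm (0 : V) = 0.
Proof. by rewrite -(scale0r (0 : V)) nmZ cabs0 mul0r. Qed.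

Lemma nmN x : nm (- x) = nm x.
Proof. by rewrite -scaleN1r nmZ cabsN cabs1 mul1r. Qed.

Lemma nm_ge0 x : 0 <= nm x.
Proof. have := nmD x (- x); rewrite subrr nm0 nmN; lra. Qed.

Lemma nmB x y : nm (x - y) = nm (y - x).
Proof. by rewrite -nmN opprB. Qed.

Lemma nm_sub x y : nm (x - y) <= nm x + nm y.
Proof. by rewrite -(nmN y) nmD. Qed.

Lemma nm_dist z x y : nm (x - y) <= nm (x - z) + nm (z - y).
Proof. by apply: le_trans (nmD _ _); rewrite addrA subrK. Qed.

Lemma nm_bound x y : nm x <= nm y + nm (x - y).
Proof. by apply: le_trans (nmD _ _); rewrite addrC subrK. Qed.

Lemma nm_le0 x : nm x <= 0 -> x = 0.
Proof. by move=> h; apply: nm_eq0; apply/eqP; rewrite eq_le h nm_ge0. Qed.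

Lemma nm_small x : (forall e : R, 0 < e -> nm x <= e) -> x = 0.
Proof. by move=> h; apply: nm_le0; apply/ler_addgt0Pl => e e0; rewrite addr0; exact: h. Qed.

Lemma nm_sum (I : Type) (r : seq I) (P : pred I) (F : I -> V) :
  nm (\sum_(i <- r | P i) F i) <= \sum_(i <- r | P i) nm (F i).
Proof.
elim/big_rec2: _ => [|i x y _ h]; first by rewrite nm0.
by apply: le_trans (nmD _ _) _; rewrite lerD2l.
Qed.

End NormTheory.

(** * Real induction and smallness arguments *)

Section Reals.
Variable R : realType.

Lemma pow2_gt_nat k : (k%:R : R) < 2 ^+ k.
Proof.
elim: k => [|k IH]; first by rewrite expr0.
rewrite exprS -natr1; have := exprn_ege1 k (ler1n R 2); lra.
Qed.

Lemma geo_small (K e : R) : 0 < e -> exists N, forall k, (N <= k)%N -> K / 2 ^+ k <= e.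
Proof.
move=> e0; exists (Num.bound `|K / e|) => k hk.
have p : 0 < (2 : R) ^+ k by rewrite exprn_gt0.
rewrite ler_pdivrMr //.
have h1 : K / e <= (Num.bound `|K / e|)%:R.
  by apply: le_trans (ler_norm _) _; exact/ltW/archi_boundP/normr_ge0.
have h2 : K / e <= 2 ^+ k.
  apply: le_trans h1 _; apply: le_trans (ltW (pow2_gt_nat _)).
  by rewrite ler_nat.
by move: h2; rewrite ler_pdivrMr // mulrC.
Qed.

Lemma le_of_small (x y K : R) : 0 <= K -> (forall e, 0 < e -> x <= y + K * e) -> x <= y.
Proof.
move=> K0 h; apply/ler_addgt0Pl => e e0.
have K1 : 0 < K + 1 by lra.
apply: le_trans (h (e / (K + 1)) _) _; first by rewrite divr_gt0.
rewrite addrC lerD2r mulrA ler_pdivrMr //; nra.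
Qed.

(** The supremum of the initial intervals on which [P] holds is attained by the left step and would
    be exceeded by the right step. This stands in for compactness of [0, 1] in the integration
    theory. *)
Lemma real_induction (P : R -> Prop) :
  P 0 ->
  (forall x, 0 <= x < 1 -> (forall y, 0 <= y <= x -> P y) ->
     exists2 d, 0 < d & forall y, x < y < x + d -> y <= 1 -> P y) ->
  (forall x, 0 < x <= 1 -> (forall y, 0 <= y < x -> P y) -> P x) ->
  forall x, 0 <= x <= 1 -> P x.
Proof.
move=> P0 Pr Pl.
pose E : set R := [set x | 0 <= x <= 1 /\ forall y, 0 <= y <= x -> P y]%classic.
have E0 : E 0.
  split; first lra.
  by move=> y hy; have -> : y = 0 by lra.
have Eub : ubound E 1 by move=> x [/andP[]].
have hs : has_sup E by split; [exists 0|exists 1].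
set c := sup E.
have c0 : 0 <= c by apply: (ub_le_sup _ E0); exists 1.
have c1 : c <= 1 by apply: (ge_sup _ Eub); exists 0.
have below y : 0 <= y < c -> P y.
  move=> /andP[y0 yc].
  have [x Ex yx] := sup_adherent (ltac:(lra) : 0 < c - y) hs.
  by apply: Ex.2; rewrite y0 /=; move: yx; rewrite -/c; lra.
have Pc : P c.
  have [->|cn] := eqVneq c 0; first exact: P0.
  by apply: Pl below; rewrite c1 andbT lt_neqAle eq_sym cn.
have upto y : 0 <= y <= c -> P y.
  move=> /andP[y0]; rewrite le_eqVlt => /predU1P[->//|yc].
  by apply: below; rewrite y0.
move=> x /andP[x0 x1].
have [xc|cx] := leP x c; first by apply: upto; rewrite x0.
have clt1 : c < 1 by exact: lt_le_trans x1.
have [d d0 hd] := Pr c (ltac:(by rewrite c0 clt1)) upto.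
pose y := Num.min x (c + d / 2).
have yc : c < y by rewrite lt_min cx /=; lra.
have yd : y < c + d by rewrite gt_min; apply/orP; right; lra.
have y1 : y <= 1 by rewrite ge_min x1.
have : E y.
  split; first lra.
  move=> w /andP[w0 wy].
  have [wc|cw] := leP w c; first by apply: upto; rewrite w0.
  by apply: hd; lra.
move=> /(ub_le_sup (ex_intro _ 1 Eub)); rewrite -/c; lra.
Qed.

End Reals.

(* The square-zero extension of the scalars by a module is a commutative
   ring, so that [ring] decides linear identities in the module. *)
Definition sqzero (K : comNzRingType) (V : lmodType K) : Type := (K * V)%type.

Section SquareZero.
Variables (K : comNzRingType) (V : lmodType K).
Local Notation T := (sqzero V).

HB.instance Definition _ := GRing.Zmodule.copy T (K * V)%type.

Definition sqzero_mul (x y : T) : T := (x.1 * y.1, x.1 *: y.2 + y.1 *: x.2).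

Fact sqzero_mulA : associative sqzero_mul.
Proof.
move=> [a u] [b v] [c w]; congr pair; rewrite /= ?mulrA //.
by rewrite !scalerDr !scalerA addrA [c * a]mulrC [c * b]mulrC.
Qed.

Fact sqzero_mulC : commutative sqzero_mul.
Proof. by move=> [a u] [b v]; rewrite /sqzero_mul /= mulrC addrC. Qed.

Fact sqzero_mul1 : left_id ((1, 0) : T) sqzero_mul.
Proof. by move=> [a u]; rewrite /sqzero_mul /= mul1r scale1r scaler0 addr0. Qed.

Fact sqzero_mulDl : left_distributive sqzero_mul +%R.
Proof.
move=> [a u] [b v] [c w]; congr pair; rewrite /= ?mulrDl //.
by rewrite scalerDl scalerDr addrACA.
Qed.

Fact sqzero_1neq0 : ((1, 0) : T) != 0.
Proof. by rewrite xpair_eqE oner_eq0. Qed.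

HB.instance Definition _ := GRing.Zmodule_isComNzRing.Build T
  sqzero_mulA sqzero_mulC sqzero_mul1 sqzero_mulDl sqzero_1neq0.

Definition sqzero_scal (a : K) : T := (a, 0).
Definition sqzero_vec (v : V) : T := (0, v).

Fact sqzero_scal_additive : zmod_morphism sqzero_scal.
Proof. by move=> a b; congr pair; rewrite /= subr0. Qed.
Fact sqzero_scal_monoid : monoid_morphism sqzero_scal.
Proof. by split=> // a b; congr pair; rewrite /= !scaler0 addr0. Qed.
Fact sqzero_vec_additive : zmod_morphism sqzero_vec.
Proof. by move=> a b; congr pair; rewrite /= subr0. Qed.

HB.instance Definition _ :=
  GRing.isZmodMorphism.Build K T sqzero_scal sqzero_scal_additive.
HB.instance Definition _ :=
  GRing.isMonoidMorphism.Build K T sqzero_scal sqzero_scal_monoid.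
HB.instance Definition _ :=
  GRing.isZmodMorphism.Build V T sqzero_vec sqzero_vec_additive.

Lemma sqzero_vecZ a v : sqzero_vec (a *: v) = sqzero_scal a * sqzero_vec v.
Proof. by congr pair; rewrite /= ?mulr0 // scale0r addr0. Qed.

Lemma sqzero_vec_inj : injective sqzero_vec.
Proof. by move=> u v []. Qed.

Lemma sqzero_vecD u v : sqzero_vec (u + v) = sqzero_vec u + sqzero_vec v.
Proof. exact: raddfD. Qed.
Lemma sqzero_vecN u : sqzero_vec (- u) = - sqzero_vec u.
Proof. exact: raddfN. Qed.
Lemma sqzero_vec0 : sqzero_vec 0 = 0.
Proof. exact: raddf0. Qed.

End SquareZero.

Ltac modring := apply: sqzero_vec_inj;
  rewrite ?(sqzero_vecD, sqzero_vecN, sqzero_vecZ, sqzero_vec0); ring.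

(** * Continuity and derivatives along subsets of the plane *)

Section Derivatives.
Variables (R : realType) (V : banachType R).
Implicit Types (S : R[i] -> Prop) (f g : R[i] -> V).

Definition unit_seg (z : R[i]) : Prop := exists2 x : R, 0 <= x <= 1 & z = x%:C.

Definition cts S f z := forall e : R, 0 < e -> exists2 d : R, 0 < d &
  forall w, S w -> cabs (w - z) < d -> nm (f w - f z) <= e.

(* Derivatives are taken along S, so that a path is a function on the subset [unit_seg]
   of the complex plane. *)
Definition der S f z (D : V) := forall e : R, 0 < e -> exists2 d : R, 0 < d &
  forall w, S w -> cabs (w - z) < d ->
    nm (f w - f z - (w - z) *: D) <= e * cabs (w - z).

Lemma cts_sub S S' f z : (forall w, S' w -> S w) -> cts S f z -> cts S' f z.
Proof. by move=> h c e /c [d d0 hd]; exists d => // w /h; exact: hd. Qed.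

Lemma der_sub S S' f z D : (forall w, S' w -> S w) -> der S f z D -> der S' f z D.
Proof. by move=> h c e /c [d d0 hd]; exists d => // w /h; exact: hd. Qed.

Lemma der_cts S f z D : der S f z D -> cts S f z.
Proof.
move=> h e e0; have [d d0 hd] := h 1 ltr01.
have p : 0 < 1 + nm D by have := nm_ge0 D; lra.
exists (Num.min d (e / (1 + nm D))) => [|w Sw].
  by rewrite lt_min d0 divr_gt0.
rewrite lt_min => /andP[wd we].
apply: le_trans (nm_bound _ ((w - z) *: D)) _.
rewrite nmZ; have := hd w Sw wd; rewrite mul1r => h1.
have : cabs (w - z) * (1 + nm D) < e by rewrite -ltr_pdivlMr.
lra.
Qed.

Lemma der_cst S (v : V) z : der S (fun=> v) z 0.
Proof.
move=> e e0; exists 1 => // w _ _.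
by rewrite subrr scaler0 subrr nm0 mulr_ge0 ?cabs_ge0 // ltW.
Qed.

Lemma derD S f g z D E :
  der S f z D -> der S g z E -> der S (fun w => f w + g w) z (D + E).
Proof.
move=> hf hg e e0.
have [d1 d10 h1] := hf (e / 2) ltac:(lra).
have [d2 d20 h2] := hg (e / 2) ltac:(lra).
exists (Num.min d1 d2); first by rewrite lt_min d10.
move=> w Sw; rewrite lt_min => /andP[w1 w2].
have -> : f w + g w - (f z + g z) - (w - z) *: (D + E) =
  (f w - f z - (w - z) *: D) + (g w - g z - (w - z) *: E).
  by modring.
have := h1 w Sw w1; have := h2 w Sw w2; have := nmD (f w - f z - (w - z) *: D) (g w - g z - (w - z) *: E).
lra.
Qed.

End Derivatives.

Section ComplexBanach.
Variable R : realType.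

Fact complex_complete (u : nat -> R[i]) :
  (forall e : R, 0 < e -> exists N, forall j k, (N <= j)%N -> (N <= k)%N ->
     cabs (u j - u k) <= e) ->
  exists l, forall e : R, 0 < e -> exists N, forall k, (N <= k)%N ->
     cabs (u k - l) <= e.
Proof.
move=> hu.
have real_case (v : nat -> R) :
  (forall e : R, 0 < e -> exists N, forall j k, (N <= j)%N -> (N <= k)%N ->
     `|v j - v k| <= e) ->
  exists l, forall e : R, 0 < e -> exists N, forall k, (N <= k)%N -> `|v k - l| <= e.
  move=> hv.
  pose A : set R := [set x | exists N, forall k, (N <= k)%N -> x <= v k]%classic.
  have near (e : R) : 0 < e -> exists N, A (v N - e) /\ ubound A (v N + e) /\
      forall k, (N <= k)%N -> `|v k - v N| <= e.
    move=> e0; have [N hN] := hv e e0; exists N; split; last split.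
    - by exists N => k hk; have := hN k N hk (leqnn N); rewrite ler_norml; lra.
    - move=> x [M hM].
      have := hN (maxn M N) N (leq_maxr _ _) (leqnn N).
      have := hM (maxn M N) (leq_maxl _ _); rewrite ler_norml; lra.
    - by move=> k hk; exact: hN.
  have [N0 [A0 [U0 _]]] := near 1 ltr01.
  have hs : has_sup A by split; eexists; eassumption.
  exists (sup A) => e e0.
  have [N [A1 [U1 h1]]] := near (e / 2) ltac:(lra).
  exists N => k hk.
  have := h1 k hk; have := ub_le_sup (ex_intro _ _ U0) A1.
  have := ge_sup (ex_intro _ _ A0) U1.
  rewrite !ler_norml; lra.
have [a ha] : exists a, forall e : R, 0 < e -> exists N, forall k, (N <= k)%N ->
    `|complex.Re (u k) - a| <= e.
  apply: real_case => e /hu [N hN]; exists N => j k hj hk.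
  by rewrite -raddfB; apply: le_trans (cabs_Re _) _; exact: hN.
have [b hb] : exists b, forall e : R, 0 < e -> exists N, forall k, (N <= k)%N ->
    `|complex.Im (u k) - b| <= e.
  apply: real_case => e /hu [N hN]; exists N => j k hj hk.
  by rewrite -raddfB; apply: le_trans (cabs_Im _) _; exact: hN.
exists (a +i* b) => e e0.
have [N hN] := ha (e / 2) ltac:(lra).
have [M hM] := hb (e / 2) ltac:(lra).
exists (maxn N M) => k; rewrite geq_max => /andP[kN kM].
apply: le_trans (cabs_le_ReIm _) _.
have := hN k kN; have := hM k kM; rewrite !raddfB /=; lra.
Qed.

HB.instance Definition _ := @Lmodule_isBanach.Build R R[i] (@cabs R)
  (@cabsD R) (@cabsM R) (@cabs_eq0 R) complex_complete.

End ComplexBanach.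

Lemma scaleCE (R : realType) (a b : R[i]) : a *: b = a * b.
Proof. by []. Qed.

Lemma nmC (R : realType) (z : R[i]) : nm z = cabs z.
Proof. by []. Qed.

Section DerivativeRules.
Variable R : realType.
Implicit Types (S : R[i] -> Prop) (V : banachType R).

Lemma cts_bound V S (f : R[i] -> V) z : cts S f z ->
  exists2 d : R, 0 < d & forall w, S w -> cabs (w - z) < d -> nm (f w) <= nm (f z) + 1.
Proof.
move=> h; have [d d0 hd] := h 1 ltr01; exists d => // w Sw wd.
by apply: le_trans (nm_bound _ (f z)) _; rewrite lerD2l; exact: hd.
Qed.

Lemma der_lip V S (f : R[i] -> V) z D : der S f z D ->
  exists2 d : R, 0 < d & forall w, S w -> cabs (w - z) < d ->
    nm (f w - f z) <= (nm D + 1) * cabs (w - z).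
Proof.
move=> h; have [d d0 hd] := h 1 ltr01; exists d => // w Sw wd.
apply: le_trans (nm_bound _ ((w - z) *: D)) _.
rewrite nmZ; have := hd w Sw wd; lra.
Qed.

Section Bilinear.
Variables (U V W : banachType R) (b : U -> V -> W).
Hypotheses (bDl : forall u v x, b (u + v) x = b u x + b v x)
  (bDr : forall u x y, b u (x + y) = b u x + b u y)
  (bZl : forall (a : R[i]) u x, b (a *: u) x = a *: b u x)
  (bZr : forall (a : R[i]) u x, b u (a *: x) = a *: b u x)
  (b_nm : forall u x, nm (b u x) <= nm u * nm x).

Let bNl u x : b (- u) x = - b u x.
Proof. by rewrite -(scaleN1r u) bZl scaleN1r. Qed.
Let bNr u x : b u (- x) = - b u x.
Proof. by rewrite -(scaleN1r x) bZr scaleN1r. Qed.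

Lemma cts_bilinear S f g z : cts S f z -> cts S g z -> cts S (fun w => b (f w) (g w)) z.
Proof.
move=> hf hg e e0.
have [d3 d30 h3] := cts_bound hf.
pose K := nm (f z) + 1 + nm (g z).
have K0 : 0 < K by rewrite /K; have := nm_ge0 (f z); have := nm_ge0 (g z); lra.
have eK : 0 < e / K by rewrite divr_gt0.
have [d1 d10 h1] := hf _ eK.
have [d2 d20 h2] := hg _ eK.
exists (Num.min d1 (Num.min d2 d3)); first by rewrite !lt_min d10 d20.
move=> w Sw; rewrite !lt_min => /and3P[w1 w2 w3].
have -> : b (f w) (g w) - b (f z) (g z) = b (f w) (g w - g z) + b (f w - f z) (g z).
  rewrite bDr bDl bNl bNr; modring.
have -> : e = (nm (f z) + 1) * (e / K) + e / K * nm (g z).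
  by rewrite [X in _ + X]mulrC -mulrDl mulrCA divff ?mulr1 ?lt0r_neq0.
apply: le_trans (nmD _ _) (lerD _ _); apply: le_trans (b_nm _ _) _.
  by apply: ler_pM; rewrite ?nm_ge0 //; [exact: h3|exact: h2].
by apply: ler_wpM2r; [exact: nm_ge0|exact: h1].
Qed.

(** The error splits into two first-order errors and the product of two increments. The bilinear
    form of the rule serves both the scalar action and the product of an algebra. *)
Lemma der_bilinear S f g z D E : der S f z D -> der S g z E ->
  der S (fun w => b (f w) (g w)) z (b (f z) E + b D (g z)).
Proof.
move=> hf hg e e0.
pose K := nm (f z) + nm (g z) + nm E + 1.
have K0 : 0 < K.
  by rewrite /K; have := nm_ge0 (f z); have := nm_ge0 (g z); have := nm_ge0 E; lra.
have eK : 0 < e / (3 * K) by apply: divr_gt0 => //; lra.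
have [d1 d10 h1] := hf _ eK.
have [d2 d20 h2] := hg _ eK.
have [d3 d30 h3] := der_cts hf eK.
have [d4 d40 h4] := der_lip hg.
exists (Num.min (Num.min d1 d4) (Num.min d2 d3)).
  by rewrite !lt_min d10 d20 d30 d40.
move=> w Sw; rewrite !lt_min => /andP[/andP[w1 w4] /andP[w2 w3]].
have -> : b (f w) (g w) - b (f z) (g z) - (w - z) *: (b (f z) E + b D (g z)) =
  b (f z) (g w - g z - (w - z) *: E) + b (f w - f z - (w - z) *: D) (g z) +
  b (f w - f z) (g w - g z).
  by rewrite !(bDl, bDr, bNl, bNr, bZl, bZr); modring.
have E3 : e = 3 * (K * (e / (3 * K))) by field; lra.
move: E3 h1 h2 h3; move: (e / (3 * K)) eK => q q0 E3 h1 h2 h3.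
apply: le_trans (nmD _ _) _; apply: le_trans (lerD (nmD _ _) (lexx _)) _.
have c0 := cabs_ge0 (w - z).
have := nm_ge0 E; have := nm_ge0 (g z); have := nm_ge0 (f z) => f0 g0 E0.
have q1 : nm (b (f z) (g w - g z - (w - z) *: E)) <= K * q * cabs (w - z).
  apply: le_trans (b_nm _ _) _; rewrite -mulrA.
  apply: ler_pM => //; [exact: nm_ge0|by rewrite /K; lra|exact: h2].
have q2 : nm (b (f w - f z - (w - z) *: D) (g z)) <= K * q * cabs (w - z).
  apply: le_trans (b_nm _ _) _; rewrite mulrC -mulrA.
  apply: ler_pM => //; [exact: nm_ge0|by rewrite /K; lra|exact: h1].
have q3 : nm (b (f w - f z) (g w - g z)) <= K * q * cabs (w - z).
  apply: le_trans (b_nm _ _) _; rewrite -mulrA mulrCA.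
  apply: ler_pM; [exact: nm_ge0|exact: nm_ge0|exact: h3|].
  apply: le_trans (h4 w Sw w4) _; apply: ler_wpM2r => //; rewrite /K; lra.
rewrite E3; lra.
Qed.

End Bilinear.

Lemma der_ext V S (f g : R[i] -> V) z D : f =1 g -> der S f z D -> der S g z D.
Proof. by move=> h; have -> : f = g by apply/funext. Qed.

Lemma der_id S z : der S (fun w : R[i] => w : R[i]) z 1.
Proof.
move=> e e0; exists 1 => // w _ _.
have -> : w - z - (w - z) *: (1 : R[i]) = 0 by rewrite /GRing.scale /= mulr1 subrr.
by rewrite nm0 mulr_ge0 ?cabs_ge0 // ltW.
Qed.

Lemma derM V S (u : R[i] -> R[i]) (f : R[i] -> V) z d D :
  der S u z d -> der S f z D -> der S (fun w => u w *: f w) z (u z *: D + d *: f z).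
Proof.
move=> hu hf; apply: (@der_bilinear R[i] V V (fun a v => a *: v)) hu hf.
- by move=> *; rewrite scalerDl.
- by move=> *; rewrite scalerDr.
- by move=> a u0 x; rewrite scalerA.
- by move=> a u0 x; rewrite !scalerA mulrC.
- by move=> *; rewrite nmZ.
Qed.

Lemma ctsM V S (u : R[i] -> R[i]) (f : R[i] -> V) z :
  cts S u z -> cts S f z -> cts S (fun w => u w *: f w) z.
Proof.
move=> hu hf; apply: (@cts_bilinear R[i] V V (fun a v => a *: v)) hu hf.
- by move=> *; rewrite scalerDl.
- by move=> *; rewrite scalerDr.
- by move=> a u0 x; rewrite scalerA.
- by move=> a u0 x; rewrite !scalerA mulrC.
- by move=> *; rewrite nmZ.
Qed.

Lemma der_mul (B : balgType R) S (f g : R[i] -> B) z D E :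
  der S f z D -> der S g z E -> der S (fun w => f w * g w) z (f z * E + D * g z).
Proof.
move=> hf hg; apply: (@der_bilinear B B B (fun a v => a * v)) hf hg.
- by move=> *; rewrite mulrDl.
- by move=> *; rewrite mulrDr.
- by move=> *; rewrite scalerAl.
- by move=> *; rewrite scalerAr.
- exact: nm_mul.
Qed.

Lemma cts_mul (B : balgType R) S (f g : R[i] -> B) z :
  cts S f z -> cts S g z -> cts S (fun w => f w * g w) z.
Proof.
move=> hf hg; apply: (@cts_bilinear B B B (fun a v => a * v)) hf hg.
- by move=> *; rewrite mulrDl.
- by move=> *; rewrite mulrDr.
- by move=> *; rewrite scalerAl.
- by move=> *; rewrite scalerAr.
- exact: nm_mul.
Qed.

Lemma derZ V S (a : R[i]) (f : R[i] -> V) z D :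
  der S f z D -> der S (fun w => a *: f w) z (a *: D).
Proof. by move=> /(derM (der_cst S a z)); rewrite scale0r addr0. Qed.

Lemma derN V S (f : R[i] -> V) z D : der S f z D -> der S (fun w => - f w) z (- D).
Proof.
by move=> /(derZ (-1)); rewrite scaleN1r; apply: der_ext => w; rewrite scaleN1r.
Qed.

Lemma derB V S (f g : R[i] -> V) z D E :
  der S f z D -> der S g z E -> der S (fun w => f w - g w) z (D - E).
Proof. by move=> hf /derN; exact: derD. Qed.

Lemma cts_cst V S (v : V) z : cts S (fun=> v) z.
Proof. exact: der_cts (der_cst S v z). Qed.

Lemma cts_id S z : cts S (fun w : R[i] => w : R[i]) z.
Proof. exact: der_cts (der_id S z). Qed.

Lemma ctsD V S (f g : R[i] -> V) z :
  cts S f z -> cts S g z -> cts S (fun w => f w + g w) z.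
Proof.
move=> hf hg e e0.
have [d1 d10 h1] := hf (e / 2) ltac:(lra).
have [d2 d20 h2] := hg (e / 2) ltac:(lra).
exists (Num.min d1 d2); first by rewrite lt_min d10.
move=> w Sw; rewrite lt_min => /andP[w1 w2].
have := h1 w Sw w1; have := h2 w Sw w2; have := nmD (f w - f z) (g w - g z).
by have -> : f w + g w - (f z + g z) = (f w - f z) + (g w - g z); [modring|lra].
Qed.

Lemma ctsZ V S (a : R[i]) (f : R[i] -> V) z : cts S f z -> cts S (fun w => a *: f w) z.
Proof. by move=> hf; exact: ctsM (cts_cst S a z) hf. Qed.

Lemma ctsN V S (f : R[i] -> V) z : cts S f z -> cts S (fun w => - f w) z.
Proof. by move=> hf e /hf [d d0 h]; exists d => // w Sw wd; rewrite -opprD nmN; exact: h. Qed.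

Lemma ctsB V S (f g : R[i] -> V) z :
  cts S f z -> cts S g z -> cts S (fun w => f w - g w) z.
Proof. by move=> hf /ctsN; exact: ctsD. Qed.

Lemma cts_comp V S S' (u : R[i] -> R[i]) (f : R[i] -> V) z :
  cts S u z -> (forall w, S w -> S' (u w)) -> cts S' f (u z) ->
  cts S (fun w => f (u w)) z.
Proof.
move=> hu hS hf e /hf [d d0 hd].
have [d' d'0 hd'] := hu (d / 2) ltac:(lra).
exists d' => // w Sw wd; apply: hd; first exact: hS.
by apply: le_lt_trans (hd' w Sw wd) _; lra.
Qed.

Lemma der_comp V S S' (u : R[i] -> R[i]) (f : R[i] -> V) z d D :
  der S u z d -> (forall w, S w -> S' (u w)) -> der S' f (u z) D ->
  der S (fun w => f (u w)) z (d *: D).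
Proof.
move=> hu hS hf e e0.
have [d1 d10 h1] := der_lip hu.
pose K := cabs d + 1 + nm D.
have K0 : 0 < K by rewrite /K; have := cabs_ge0 d; have := nm_ge0 D; lra.
have eK : 0 < e / (2 * K) by apply: divr_gt0 => //; lra.
have [d2 d20 h2] := hf _ eK.
have [d3 d30 h3] := hu _ eK.
have [d4 d40 h4] := der_cts hu (ltac:(lra) : 0 < d2 / 2).
exists (Num.min d1 (Num.min d3 d4)); first by rewrite !lt_min d10 d30.
move=> w Sw; rewrite !lt_min => /and3P[w1 w3 w4].
have -> : f (u w) - f (u z) - (w - z) *: (d *: D) =
  (f (u w) - f (u z) - (u w - u z) *: D) + (u w - u z - (w - z) *: d) *: D.
  by rewrite scaleCE; modring.
apply: le_trans (nmD _ _) _; rewrite nmZ.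
have E : e = K * (e / (2 * K)) + K * (e / (2 * K)) by field; lra.
move: E h2 h3; move: (e / (2 * K)) eK => q q0 E h2 h3.
have a1 : cabs (u w - u z) < d2 by apply: le_lt_trans (h4 w Sw w4) _; lra.
have := h2 _ (hS _ Sw) a1; have := h1 w Sw w1; have := h3 w Sw w3.
rewrite !nmC => b1 b2 b3.
have c0 := cabs_ge0 (w - z); have D0 := nm_ge0 D; have d0 := cabs_ge0 d.
have b4 : q * cabs (u w - u z) <= q * ((cabs d + 1) * cabs (w - z)).
  by apply: ler_wpM2l b2; lra.
have b5 : cabs (u w - u z - (w - z) *: d) * nm D <= q * cabs (w - z) * nm D.
  exact: ler_wpM2r.
have P : 0 <= q * cabs (w - z) by rewrite mulr_ge0 // ltW.
have -> : e * cabs (w - z) = q * cabs (w - z) * (2 * K) by rewrite E; ring.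
have P1 : 0 <= q * cabs (w - z) * (cabs d + nm D + 1) by rewrite mulr_ge0 //; lra.
have E1 : q * ((cabs d + 1) * cabs (w - z)) + q * cabs (w - z) * nm D = q * cabs (w - z) * K.
  by rewrite /K; ring.
have E2 : q * cabs (w - z) * (2 * K) = q * cabs (w - z) * K + q * cabs (w - z) * (cabs d + nm D + 1).
  by rewrite /K; ring.
move: b3 E1 E2 P1 b4 b5; clear; lra.
Qed.

Lemma der_affine S (a b : R[i]) z : der S (fun w => a + w * b : R[i]) z b.
Proof.
have := derD (der_cst S a z) (derM (der_id S z) (der_cst S b z)).
rewrite scaler0 scale1r !add0r; exact: der_ext.
Qed.

Lemma der_inv S z : z != 0 -> der S (fun w : R[i] => w^-1) z (- z ^- 2).
Proof.
move=> z0 e e0.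
have p : 0 < cabs z by rewrite cabs_gt0.
pose d := Num.min (cabs z / 2) (e * cabs z ^+ 3 / 2).
have p3 : 0 < cabs z ^+ 3 by rewrite exprn_gt0.
exists d; first by rewrite /d lt_min !divr_gt0 ?mulr_gt0 //.
move=> w _; rewrite lt_min => /andP[w1 w2].
have w0 : cabs z / 2 < cabs w.
  have := cabsD (z - w) w; rewrite subrK cabsB; lra.
have wn : w != 0 by rewrite -cabs_gt0; apply: lt_trans w0; lra.
have -> : w^-1 - z^-1 - (w - z) *: (- z ^- 2) = (w - z) ^+ 2 / (w * z ^+ 2).
  by rewrite /GRing.scale /=; field; rewrite z0 wn.
rewrite nmC cabsM cabsV cabsM !cabsX ler_pdivrMr; last first.
  by rewrite mulr_gt0 ?exprn_gt0 // cabs_gt0.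
rewrite expr2 [leRHS]mulrAC; apply: ler_wpM2r; first exact: cabs_ge0.
apply: le_trans (ltW w2) _.
rewrite -!mulrA; apply: ler_wpM2l; first exact: ltW.
rewrite [leLHS](_ : _ = (cabs z / 2) * cabs z ^+ 2); last by ring.
by rewrite ler_wpM2r ?ltW // exprn_gt0.
Qed.

End DerivativeRules.

(** * Integration along segments *)

Section MeanValue.
Variable R : realType.
Implicit Type V : banachType R.

Lemma unit_seg0 : unit_seg (0 : R[i]).
Proof. by exists 0 => //; lra. Qed.

Lemma unit_seg1 : unit_seg (1 : R[i]).
Proof. by exists 1 => //; lra. Qed.

Lemma cabs_realB (x y : R) : cabs (x%:C - y%:C) = `|x - y|.
Proof. by rewrite -rmorphB cabs_real. Qed.

Lemma local_lipschitz V (G : R -> V) (K : R) :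
  (forall s, 0 <= s <= 1 -> exists2 d : R, 0 < d &
     forall s', 0 <= s' <= 1 -> `|s' - s| < d -> nm (G s' - G s) <= K * `|s' - s|) ->
  forall s x, 0 <= s <= 1 -> 0 <= x <= 1 -> s <= x -> nm (G x - G s) <= K * (x - s).
Proof.
move=> hG s x s01; move: x; apply: real_induction.
- by move=> s0; rewrite (_ : s = 0) ?subrr ?nm0 ?mulr0 //; lra.
- move=> x x01 IH; have [sx|xs] := leP s x; last first.
    by exists (s - x) => [|y hy _]; lra.
  have [d d0 hd] := hG x ltac:(lra); exists d => // y hy y1 _.
  have := hd y ltac:(lra); rewrite ger0_norm => [/(_ ltac:(lra)) h1|]; last by lra.
  have := IH x ltac:(lra) sx; have := nm_dist (G x) (G y) (G s); lra.
- move=> x x01 IH; rewrite le_eqVlt => /predU1P[<-|sx].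
    by rewrite !subrr nm0 mulr0.
  have [d d0 hd] := hG x ltac:(lra).
  pose y := Num.max s (x - d / 2).
  have y1 : s <= y by rewrite le_max lexx.
  have y2 : x - d / 2 <= y by rewrite le_max lexx orbT.
  have y3 : y < x by rewrite gt_max sx /=; lra.
  have := hd y ltac:(lra); rewrite ler0_norm => [/(_ ltac:(lra)) h1|]; last by lra.
  have := IH y ltac:(lra) y1; have := nm_dist (G y) (G x) (G s).
  by rewrite (nmB (G x) (G y)); lra.
Qed.

(** The function [c] is a lower slope for the majorant [g]. Strictness of [nm (D x) < c x], needed
    only where the bound already holds, leaves room for the error in the derivative. Affine [g]
    gives the mean value inequality; exponential [g] gives Gronwall's inequality and the contraction
    of Picard's iteration. *)
Lemma comparison V (f : R[i] -> V) (D : R -> V) (g c : R -> R) :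
  (forall x, 0 <= x <= 1 -> der (@unit_seg R) f x%:C (D x)) ->
  nm (f 0) <= g 0 ->
  (forall x, 0 <= x <= 1 -> nm (f x%:C) <= g x -> nm (D x) < c x) ->
  (forall x h, 0 <= x -> 0 <= h -> x + h <= 1 -> g x + h * c x <= g (x + h)) ->
  forall x, 0 <= x <= 1 -> nm (f x%:C) <= g x.
Proof.
move=> hf f0 hD hg; apply: real_induction => //.
- move=> x x01 IH.
  have fx : nm (f x%:C) <= g x by apply: IH; lra.
  have Dx := hD x ltac:(lra) fx.
  have [d d0 hd] := hf x ltac:(lra) (c x - nm (D x)) ltac:(lra).
  exists d => // y hy y1.
  have Sy : unit_seg y%:C by exists y => //; lra.
  have := hd _ Sy; rewrite cabs_realB gtr0_norm => [/(_ ltac:(lra)) h1|]; last by lra.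
  have h2 : nm ((y%:C - x%:C) *: D x) = (y - x) * nm (D x).
    by rewrite nmZ cabs_realB gtr0_norm //; lra.
  have h3 := nm_bound (f y%:C - f x%:C) ((y%:C - x%:C) *: D x).
  have h4 := nm_bound (f y%:C) (f x%:C).
  have := hg x (y - x) ltac:(lra) ltac:(lra) ltac:(lra).
  have -> : x + (y - x) = y by ring.
  rewrite h2 in h3; move: h1 h3 h4 fx; clear; lra.
- move=> x x01 IH; apply/ler_addgt0Pl => e e0.
  have [d d0 hd] := der_cts (hf x ltac:(lra)) e0.
  pose y := Num.max 0 (x - d / 2).
  have y1 : 0 <= y by rewrite le_max lexx.
  have y2 : x - d / 2 <= y by rewrite le_max lexx orbT.
  have y3 : y < x by rewrite gt_max; apply/andP; split; lra.
  have Sy : unit_seg y%:C by exists y => //; lra.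
  have := hd _ Sy; rewrite cabs_realB ler0_norm => [/(_ ltac:(lra)) h1|]; last by lra.
  have fy := IH y ltac:(lra); have Dy := hD y ltac:(lra) fy.
  have := hg y (x - y) ltac:(lra) ltac:(lra) ltac:(lra).
  have -> : y + (x - y) = x by ring.
  have : 0 <= (x - y) * c y by apply: mulr_ge0; have := nm_ge0 (D y); lra.
  have := nm_bound (f x%:C) (f y%:C); rewrite nmB; move: h1 fy; clear; lra.
Qed.

Lemma mvi V (f D : R[i] -> V) (k : R) :
  (forall z, unit_seg z -> der (@unit_seg R) f z (D z)) ->
  (forall z, unit_seg z -> nm (D z) <= k) ->
  forall x, 0 <= x <= 1 -> nm (f x%:C - f 0) <= k * x.
Proof.
move=> hf hD x x01; apply: (@le_of_small _ _ _ x); first by lra.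
(* The slope [k + e] provides the strict inequality that [comparison] asks for. *)
move=> e e0; rewrite [x * e]mulrC -mulrDl.
apply: (@comparison V (fun z => f z - f 0) (fun y => D y%:C)
  (fun y => (k + e) * y) (fun=> k + e)) => //.
- move=> y y01; rewrite -[D _]subr0.
  by apply: derB (der_cst _ _ _); apply: hf; exists y.
- by rewrite subrr nm0 mulr0.
- by move=> y y01 _; have := hD y%:C; move=> /(_ (ex_intro2 _ _ y y01 erefl)); lra.
- by move=> y h *; rewrite [h * _]mulrC -mulrDr.
Qed.

Lemma mvi1 V (f D : R[i] -> V) (k : R) :
  (forall z, unit_seg z -> der (@unit_seg R) f z (D z)) ->
  (forall z, unit_seg z -> nm (D z) <= k) -> nm (f 1 - f 0) <= k.
Proof. by move=> hf hD; have := mvi hf hD (ltac:(lra) : 0 <= (1 : R) <= 1); rewrite mulr1. Qed.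

Lemma der0_cst V (f : R[i] -> V) :
  (forall z, unit_seg z -> der (@unit_seg R) f z 0) ->
  forall z, unit_seg z -> f z = f 0.
Proof.
move=> hf _ [x x01 ->]; apply/eqP; rewrite -subr_eq0; apply/eqP/nm_le0.
have := mvi (D := fun=> 0) (k := 0) hf _ x01; rewrite mul0r; apply.
by move=> z _; rewrite nm0.
Qed.

Lemma gronwall V (f D : R[i] -> V) (k m N : R) : 0 <= k -> 0 <= m ->
  (forall z, unit_seg z -> der (@unit_seg R) f z (D z)) ->
  (forall z, unit_seg z -> nm (D z) <= k * nm (f z) + m) -> nm (f 0) <= N ->
  forall z, unit_seg z -> nm (f z) <= (N + m) * expR (k + 1).
Proof.
move=> k0 m0 hf hD f0 _ [x x01 ->].
have N0 : 0 <= N by apply: le_trans f0; exact: nm_ge0.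
apply: (@le_of_small _ _ _ (expR (k + 1))); first exact: expR_ge0.
move=> e e0; rewrite [_ * e]mulrC -mulrDl.
have A0 : 0 < N + m + e by lra.
have E y : 0 <= y -> N + m + e <= (N + m + e) * expR ((k + 1) * y).
  move=> y0; apply: ler_peMr; first exact: ltW.
  have := expR_ge1Dx ((k + 1) * y).
  have : 0 <= (k + 1) * y by rewrite mulr_ge0 //; lra.
  lra.
apply: (@le_trans _ _ ((N + m + e) * expR ((k + 1) * x))); last first.
  apply: ler_wpM2l; first exact: ltW.
  rewrite ler_expR -[leRHS]mulr1; apply: ler_wpM2l; lra.
(* The majorant stays above [m], so raising the rate from [k] to [k + 1] absorbs the source term and
   makes the inequality strict. *)
apply: (@comparison V f (fun y => D y%:C) (fun y => (N + m + e) * expR ((k + 1) * y))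
  (fun y => (k + 1) * ((N + m + e) * expR ((k + 1) * y)))) => //.
- by move=> y y01; apply: hf; exists y.
- by apply: le_trans f0 _; apply: le_trans (E 0 _); lra.
- move=> y y01 fy; have Sy : unit_seg y%:C by exists y.
  apply: le_lt_trans (hD _ Sy) _; have := E y ltac:(lra).
  have : k * nm (f y%:C) <= k * ((N + m + e) * expR ((k + 1) * y)) by rewrite ler_wpM2l.
  lra.
- move=> y h y0 h0 yh; rewrite mulrDr expRD.
  have := expR_ge1Dx ((k + 1) * h) => h1.
  have P : 0 <= (N + m + e) * expR ((k + 1) * y) by rewrite mulr_ge0 ?expR_ge0 // ltW.
  have := ler_wpM2l P h1; rewrite mulrA; lra.
Qed.

Definition convexC (S : R[i] -> Prop) := forall z w, S z -> S w ->
  forall x : R, 0 <= x <= 1 -> S (z + x%:C * (w - z)).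

Lemma mvi_convex V (S : R[i] -> Prop) (f D : R[i] -> V) (k : R) : convexC S ->
  (forall z, S z -> der S f z (D z)) -> (forall z, S z -> nm (D z) <= k) ->
  forall z w, S z -> S w -> nm (f w - f z) <= k * cabs (w - z).
Proof.
move=> cS hf hD z w Sz Sw.
have hS s : unit_seg s -> S (z + s * (w - z)) by move=> [x x01 ->]; exact: cS.
have -> : f w - f z = f (z + 1 * (w - z)) - f (z + 0 * (w - z)).
  by rewrite mul1r mul0r addr0 [z + _]addrC subrK.
apply: (mvi1 (f := fun s => f (z + s * (w - z)))
  (D := fun s => (w - z) *: D (z + s * (w - z)))).
  move=> s hs; apply: (der_comp (der_affine _ _ _ _) hS).
  exact/hf/hS.
move=> s hs; rewrite nmZ mulrC ler_wpM2r ?cabs_ge0 //; exact/hD/hS.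
Qed.

Lemma cts_bounded V (f : R[i] -> V) :
  (forall z, unit_seg z -> cts (@unit_seg R) f z) ->
  exists2 M : R, 0 <= M & forall z, unit_seg z -> nm (f z) <= M.
Proof.
move=> hf.
have ext y x (M : R) : (forall s, 0 <= s <= y -> nm (f s%:C) <= M) ->
    forall N : R, (forall s, y <= s <= x -> nm (f s%:C) <= N) ->
    exists M, forall s, 0 <= s <= x -> nm (f s%:C) <= M.
  move=> h1 N h2; exists (Num.max M N) => s hs; rewrite le_max.
  have [sy|ys] := leP s y; first by rewrite h1 //; lra.
  by rewrite h2 ?orbT //; lra.
suff [M hM] : exists M : R, forall s, 0 <= s <= 1 -> nm (f s%:C) <= M.
  exists M; first by apply: le_trans (nm_ge0 _) (hM 0 _); lra.
  by move=> _ [x x01 ->]; exact: hM.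
apply: (@real_induction _ (fun x => exists M : R, forall s, 0 <= s <= x -> nm (f s%:C) <= M));
  last by lra.
- by exists (nm (f 0)) => s hs; have -> : s = 0 by lra.
- move=> x x01 IH.
  have [d d0 hd] := cts_bound (hf x%:C (ex_intro2 _ _ x (ltac:(lra) : 0 <= x <= 1) erefl)).
  exists d => // y hy y1; have [M hM] := IH x ltac:(lra).
  apply: (ext x y M hM (nm (f x%:C) + 1)) => s hs; apply: hd.
    by exists s => //; lra.
  by rewrite cabs_realB ger0_norm; lra.
- move=> x x01 IH.
  have [d d0 hd] := cts_bound (hf x%:C (ex_intro2 _ _ x (ltac:(lra) : 0 <= x <= 1) erefl)).
  pose y := Num.max 0 (x - d / 2).
  have y1 : 0 <= y by rewrite le_max lexx.
  have y2 : x - d / 2 <= y by rewrite le_max lexx orbT.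
  have y3 : y < x by rewrite gt_max; apply/andP; split; lra.
  have [M hM] := IH y ltac:(lra).
  apply: (ext y x M hM (nm (f x%:C) + 1)) => s hs; apply: hd.
    by exists s => //; lra.
  by rewrite cabs_realB ler0_norm; lra.
Qed.

End MeanValue.

Section Primitives.
Variables (R : realType) (V : banachType R).
Local Notation seg01 := (@unit_seg R).

(** The explicit rate is the point: applied at each value of a parameter with the same [K], it
    yields uniform convergence. *)
Lemma geometric_limit (u : nat -> V) (K : R) :
  (forall k, nm (u k.+1 - u k) <= K / 2 ^+ k) ->
  exists l, forall k, nm (l - u k) <= 2 * K / 2 ^+ k.
Proof.
move=> hu.
have p k : 0 < (2 : R) ^+ k by rewrite exprn_gt0.
have step k j : nm (u (k + j)%N - u k) <= 2 * K / 2 ^+ k - 2 * K / 2 ^+ (k + j).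
  elim: j => [|j IH]; first by rewrite addn0 !subrr nm0.
  rewrite addnS; apply: le_trans (nm_dist (u (k + j)%N) _ _) _.
  apply: le_trans (lerD (hu _) IH) _.
  have -> : 2 * K / 2 ^+ (k + j).+1 = K / 2 ^+ (k + j).
    by rewrite exprS; field; exact: lt0r_neq0.
  lra.
have K0 : 0 <= K.
  have := le_trans (nm_ge0 _) (hu 0%N); by rewrite expr0 divr1.
have tail k j : (k <= j)%N -> nm (u j - u k) <= 2 * K / 2 ^+ k.
  move=> /subnKC <-; apply: le_trans (step _ _) _.
  by rewrite gerBl divr_ge0 ?mulr_ge0 // ltW.
have [l hl] : exists l, forall e : R, 0 < e -> exists N, forall k, (N <= k)%N ->
    nm (u k - l) <= e.
  apply: nm_complete => e e0.
  have [N hN] := geo_small (2 * (2 * K)) e0; exists N => j k hj hk.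
  apply: le_trans (nm_dist (u N) _ _) _.
  have := tail _ _ hj; have := tail _ _ hk; rewrite (nmB (u k)).
  have := hN N (leqnn N); rewrite -mulrA; lra.
exists l => k; apply/ler_addgt0Pl => e e0.
have [N hN] := hl e e0.
have := hN (maxn N k) (leq_maxl _ _); have := tail k _ (leq_maxr N k).
have := nm_dist (u (maxn N k)) l (u k); rewrite (nmB l (u (maxn N k))); lra.
Qed.

(** A function with derivative [f] up to the error [e] at every point. Such functions are built by
    gluing affine pieces along a real induction, and exact primitives are their limits; this
    replaces Riemann sums. *)
Definition eps_primitive (f : R[i] -> V) (e x : R) (F : R -> V) :=
  forall s, 0 <= s <= x -> exists2 d : R, 0 < d & forall s', 0 <= s' <= x ->
    `|s' - s| < d -> nm (F s' - F s - (s' - s)%:C *: f s%:C) <= e * `|s' - s|.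

Lemma eps_primitive_glue f e y x F c : 0 <= y -> y <= x ->
  eps_primitive f e y F ->
  (forall s, y <= s <= x -> nm (c - f s%:C) <= e) ->
  exists F', eps_primitive f e x F'.
Proof.
move=> y0 yx hF hc.
pose G s := if s <= y then F s else F y + (s - y)%:C *: c.
have GE s : y <= s -> G s = F y + (s - y)%:C *: c.
  rewrite /G; case: (leP s y) => // sy ys; have -> : s = y by apply/eqP; rewrite eq_le sy ys.
  by rewrite subrr scale0r addr0.
exists G => s hs; have [sy|ys] := ltP s y.
  have [d d0 hd] := hF s ltac:(lra).
  exists (Num.min d (y - s)); first by rewrite lt_min d0 /=; lra.
  move=> s' hs'; rewrite lt_min => /andP[h1 h2].
  have : `|s' - s| < y - s by []; rewrite ltr_norml => h3.
  by rewrite /G !ifT; [apply: hd => //; lra|lra|lra].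
have right s' : y <= s' -> nm (G s' - G s - (s' - s)%:C *: f s%:C) <= e * `|s' - s|.
  move=> ys'; rewrite !GE //.
  have -> : F y + (s' - y)%:C *: c - (F y + (s - y)%:C *: c) - (s' - s)%:C *: f s%:C =
     (s' - s)%:C *: (c - f s%:C).
    by rewrite !rmorphB; modring.
  by rewrite nmZ cabs_real mulrC ler_wpM2r // hc //; lra.
move: ys; rewrite le_eqVlt => /predU1P[ys|ys]; last first.
  exists (s - y) => [|s' hs']; first lra.
  by rewrite ltr_norml => h; apply: right; lra.
subst s; have [d d0 hd] := hF y ltac:(lra).
exists d => // s' hs' h; have [s'y|ys'] := leP s' y; last exact/right/ltW.
rewrite /G s'y lexx; apply: hd => //; lra.
Qed.

Lemma eps_primitive_exists f e : (forall z, seg01 z -> cts seg01 f z) -> 0 < e ->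
  exists F, eps_primitive f e 1 F.
Proof.
move=> hf e0.
apply: (@real_induction _ (fun x => exists F, eps_primitive f e x F)); last by lra.
- exists (fun=> 0) => s hs; exists 1 => // s' hs' _.
  have -> : s = 0 by lra. have -> : s' = 0 by lra.
  by rewrite !subrr scale0r subrr nm0 normr0 mulr0.
- move=> x x01 IH.
  have [d d0 hd] := hf x%:C (ex_intro2 _ _ x (ltac:(lra) : 0 <= x <= 1) erefl) e e0.
  exists d => // y hy y1; have [F hF] := IH x ltac:(lra).
  apply: (@eps_primitive_glue f e x y F (f x%:C)) => //; [lra|lra|].
  move=> s hs; rewrite nmB; apply: hd; first by exists s => //; lra.
  by rewrite cabs_realB ger0_norm; lra.
- move=> x x01 IH.
  have [d d0 hd] := hf x%:C (ex_intro2 _ _ x (ltac:(lra) : 0 <= x <= 1) erefl) e e0.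
  pose y := Num.max 0 (x - d / 2).
  have y1 : 0 <= y by rewrite le_max lexx.
  have y2 : x - d / 2 <= y by rewrite le_max lexx orbT.
  have y3 : y < x by rewrite gt_max; apply/andP; split; lra.
  have [F hF] := IH y ltac:(lra).
  apply: (@eps_primitive_glue f e y x F (f x%:C)) => //; [lra|].
  move=> s hs; rewrite nmB; apply: hd; first by exists s => //; lra.
  by rewrite cabs_realB ler0_norm; lra.
Qed.

Lemma primitive_exists f : (forall z, seg01 z -> cts seg01 f z) ->
  exists2 F : R[i] -> V, F 0 = 0 & forall z, seg01 z -> der seg01 F z (f z).
Proof.
move=> hf.
have p k : 0 < ((2 : R) ^+ k)^-1 by rewrite invr_gt0 exprn_gt0.
have /choice [F hF] : forall k : nat, exists F, eps_primitive f ((2 : R) ^+ k)^-1 1 F.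
  by move=> k; exact: eps_primitive_exists.
(* The difference of two approximate primitives has a Lipschitz constant equal to the sum of their
   errors, so increments from 0 converge geometrically. *)
have lip j k s x : 0 <= s <= 1 -> 0 <= x <= 1 -> s <= x ->
    nm ((F j x - F k x) - (F j s - F k s)) <= ((2 ^+ j)^-1 + (2 ^+ k)^-1) * (x - s).
  move: s x; apply: (local_lipschitz (G := fun x => F j x - F k x)) => s s01.
  have [d1 d10 h1] := hF j s s01; have [d2 d20 h2] := hF k s s01.
  exists (Num.min d1 d2) => [|s' hs']; first by rewrite lt_min d10.
  rewrite lt_min => /andP[w1 w2].
  have -> : F j s' - F k s' - (F j s - F k s) =
    (F j s' - F j s - (s' - s)%:C *: f s%:C) - (F k s' - F k s - (s' - s)%:C *: f s%:C).
    by modring.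
  rewrite mulrDl; apply: le_trans (nm_sub _ _) (lerD _ _); [exact: h1|exact: h2].
have /choice [G hG] : forall s : R, exists l : V, 0 <= s <= 1 ->
    forall k, nm (l - (F k s - F k 0)) <= 2 * 2 / 2 ^+ k.
  move=> s; case: (boolP (0 <= s <= 1)) => [s01|_]; last by exists 0.
  have [k|l hl] := @geometric_limit (fun k => F k s - F k 0) 2; last by exists l.
  have -> : F k.+1 s - F k.+1 0 - (F k s - F k 0) =
     (F k.+1 s - F k s) - (F k.+1 0 - F k 0) by modring.
  apply: le_trans (lip _ _ 0 s _ s01 _) _; [lra|lra|].
  rewrite subr0; apply: (@le_trans _ _ ((2 ^+ k.+1)^-1 + (2 ^+ k)^-1)).
    rewrite -[leRHS]mulr1 ler_wpM2l //; last by lra.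
    by have := p k; have := p k.+1; lra.
  rewrite exprS invfM; have := p k; lra.
exists (fun z => G (complex.Re z) - G 0); first by rewrite subrr.
(* The limit differs from [F k] by a function with Lipschitz constant of order 2^-k.
   Differentiability of the limit needs this, uniform closeness would not suffice. *)
have lipG k s x : 0 <= s <= 1 -> 0 <= x <= 1 -> s <= x ->
    nm ((G x - F k x) - (G s - F k s)) <= 2 / 2 ^+ k * (x - s).
  move=> s01 x01 sx; apply/ler_addgt0Pl => e e0.
  have [N hN] := geo_small (2 * (2 * 2)) e0.
  pose j := maxn N k.
  have h1 := hG s s01 j; have h2 := hG x x01 j; have h3 := lip j k s x s01 x01 sx.
  have -> : G x - F k x - (G s - F k s) =
    ((G x - (F j x - F j 0)) - (G s - (F j s - F j 0))) +
    (F j x - F k x - (F j s - F k s)) by modring.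
  apply: le_trans (nmD _ _) (lerD _ _).
    apply: le_trans (nm_sub _ _) _; have := hN j (leq_maxl _ _); lra.
  apply: le_trans h3 _; apply: ler_wpM2r; first by lra.
  have : (2 ^+ j)^-1 <= ((2 : R) ^+ k)^-1.
    by rewrite lef_pV2 ?posrE ?exprn_gt0 // ler_eXn2l ?leq_maxr //; lra.
  lra.
move=> _ [s s01 ->] e e0.
have [N hN] := geo_small 3 e0.
have [d d0 hd] := hF N s s01.
exists d => // _ [x x01 ->]; rewrite cabs_realB /= => xd.
have -> : G x - G 0 - (G s - G 0) - (x%:C - s%:C) *: f s%:C =
  ((G x - F N x) - (G s - F N s)) + (F N x - F N s - (x%:C - s%:C) *: f s%:C).
  by modring.
have := hd x x01 xd; rewrite rmorphB => h1.
have h2 : nm (G x - F N x - (G s - F N s)) <= 2 / 2 ^+ N * `|x - s|.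
  have [sx|xs] := leP s x; first by rewrite ger0_norm ?subr_ge0 //; exact: lipG.
  by rewrite nmB distrC gtr0_norm ?subr_gt0 //; apply: lipG => //; exact: ltW.
apply: le_trans (nmD _ _) _; apply: le_trans (lerD h2 h1) _.
rewrite -mulrDl ler_wpM2r //; have := hN N (leqnn N); lra.
Qed.

(** The integral over [0, 1] as the increment of some primitive; [IntE] shows that the choice is
    immaterial. *)
Definition Int (f : R[i] -> V) : V := epsilon (inhabits 0) (fun I =>
  exists2 F : R[i] -> V, (forall z, seg01 z -> der seg01 F z (f z)) & I = F 1 - F 0).

Lemma IntE f F : (forall z, seg01 z -> der seg01 F z (f z)) -> Int f = F 1 - F 0.
Proof.
move=> hF.
have [G hG ->] : exists2 G : R[i] -> V, (forall z, seg01 z -> der seg01 G z (f z)) &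
    Int f = G 1 - G 0.
  apply: (epsilon_spec (inhabits (0 : V)) (fun I => exists2 G : R[i] -> V,
    (forall z, seg01 z -> der seg01 G z (f z)) & I = G 1 - G 0)).
  by exists (F 1 - F 0), F.
have h z : seg01 z -> der seg01 (fun w => F w - G w) z 0.
  by move=> hz; rewrite -(subrr (f z)); apply: derB; [exact: hF|exact: hG].
have e1 : F 1 - G 1 = F 0 - G 0 by exact: der0_cst h _ (unit_seg1 R).
have -> : G 1 - G 0 = F 1 - F 0 - ((F 1 - G 1) - (F 0 - G 0)) by modring.
by rewrite e1 subrr subr0.
Qed.

Definition cts01 (f : R[i] -> V) := forall z, seg01 z -> cts seg01 f z.

Lemma IntZ a f : cts01 f -> Int (fun z => a *: f z) = a *: Int f.
Proof.
move=> /primitive_exists [F F0 hF].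
rewrite (IntE hF) (IntE (F := fun z => a *: F z)); first by modring.
by move=> z hz; apply: derZ; exact: hF.
Qed.

Lemma IntB f g : cts01 f -> cts01 g -> Int (fun z => f z - g z) = Int f - Int g.
Proof.
move=> /primitive_exists [F F0 hF] /primitive_exists [G G0 hG].
rewrite (IntE hF) (IntE hG) (IntE (F := fun z => F z - G z)); first by modring.
by move=> z hz; apply: derB; [exact: hF|exact: hG].
Qed.

Lemma Int_cst c : Int (fun=> c) = c.
Proof.
rewrite (IntE (F := fun z => z *: c)); first by rewrite scale1r scale0r subr0.
by move=> z _; have := derM (der_id seg01 z) (der_cst seg01 c z); rewrite scaler0 add0r scale1r.
Qed.

Lemma Int_le f k : cts01 f -> (forall z, seg01 z -> nm (f z) <= k) -> nm (Int f) <= k.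
Proof.
move=> /primitive_exists [F F0 hF] hk; rewrite (IntE hF); exact: mvi1 hF hk.
Qed.

Lemma Int_eq f g : (forall z, seg01 z -> f z = g z) -> Int f = Int g.
Proof.
move=> h; rewrite /Int; congr epsilon; apply/funext => I; apply/propext.
by split=> -[F hF ->]; exists F => // z hz; [rewrite -h|rewrite h] => //; exact: hF.
Qed.

End Primitives.

(** * Cauchy's theorem for convex domains *)

Section Goursat.
Variables (R : realType) (V : banachType R).
Local Notation seg01 := (@unit_seg R).
Implicit Types (S : R[i] -> Prop) (f : R[i] -> V).

Definition hol S f := forall z, S z -> exists D, der S f z D.
Definition closedC S := forall z : R[i],
  (forall e : R, 0 < e -> exists2 w, S w & cabs (w - z) <= e) -> S z.

(** The line integral of [f dz] over the straight segment from [z] to [w]. *)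
Definition SI f (z w : R[i]) : V := (w - z) *: Int (fun s => f (z + s * (w - z))).

Lemma seg_in_convex S z w s : convexC S -> S z -> S w -> seg01 s -> S (z + s * (w - z)).
Proof. by move=> cS Sz Sw [x x01 ->]; exact: cS. Qed.

Lemma cts_seg S f z w : convexC S -> (forall z, S z -> cts S f z) -> S z -> S w ->
  cts01 (fun s => f (z + s * (w - z))).
Proof.
move=> cS cf Sz Sw s hs.
apply: (@cts_comp _ _ _ S (fun s => z + s * (w - z)) f).
- exact: der_cts (der_affine _ _ _ _).
- by move=> s'; exact: seg_in_convex.
- by apply: cf; exact: seg_in_convex.
Qed.

(** All integrals over subsegments are read off one primitive along the whole segment; reversal and
    bisection then become identities between its values. *)
Lemma SI_along f z w F : cts01 (fun s => f (z + s * (w - z))) ->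
  (forall s, seg01 s -> der seg01 F s (f (z + s * (w - z)))) ->
  forall p q, seg01 p -> seg01 q ->
  SI f (z + p * (w - z)) (z + q * (w - z)) = (w - z) *: (F q - F p).
Proof.
move=> cf hF p q hp hq.
have hpq s : seg01 s -> seg01 (p + s * (q - p)).
  case: hp hq => [x x01 ->] [y y01 ->] [t t01 ->].
  exists (x + t * (y - x)); last by rewrite rmorphD rmorphM rmorphB.
  case/andP: t01 => t0 t1; case/andP: x01 => x0 x1; case/andP: y01 => y0 y1.
  have a1 : 0 <= t * y by rewrite mulr_ge0.
  have a2 : 0 <= (1 - t) * x by rewrite mulr_ge0 // subr_ge0.
  have a3 : t * y <= t * 1 by rewrite ler_wpM2l.
  have a4 : (1 - t) * x <= (1 - t) * 1 by rewrite ler_wpM2l // subr_ge0.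
  lra.
rewrite /SI.
have -> : z + q * (w - z) - (z + p * (w - z)) = (w - z) * (q - p) by ring.
rewrite -scalerA; congr (_ *: _).
have E : (fun s => f (z + p * (w - z) + s * ((w - z) * (q - p)))) =
   (fun s => f (z + (p + s * (q - p)) * (w - z))).
  by apply/funext => s; congr f; ring.
rewrite E -IntZ; last first.
  move=> s hs; apply: (@cts_comp _ _ _ seg01 (fun s => p + s * (q - p))
     (fun s => f (z + s * (w - z)))) => //.
    exact: der_cts (der_affine _ _ _ _).
  by apply: cf; exact: hpq.
rewrite (IntE (F := fun s => F (p + s * (q - p)))).
  by rewrite mul1r mul0r addr0 [p + _]addrC subrK.
move=> s hs.
apply: (@der_comp _ _ _ seg01 (fun s => p + s * (q - p)) F) => //.
  exact: der_affine.
by apply: hF; exact: hpq.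
Qed.

Section OnConvex.
Variables (S : R[i] -> Prop) (f : R[i] -> V).
Hypotheses (cS : convexC S) (cf : forall z, S z -> cts S f z).

Lemma unit_seg_half : seg01 (2^-1).
Proof. by exists (2^-1); [lra|rewrite fmorphV rmorph_nat]. Qed.

Lemma SI_rev z w : S z -> S w -> SI f w z = - SI f z w.
Proof.
move=> Sz Sw; have [F F0 hF] := primitive_exists (cts_seg cS cf Sz Sw).
have h := SI_along (cts_seg cS cf Sz Sw) hF.
have := h 1 0 (unit_seg1 R) (unit_seg0 R); have := h 0 1 (unit_seg0 R) (unit_seg1 R).
rewrite mul1r mul0r addr0 [z + _]addrC subrK => -> ->; modring.
Qed.

Lemma SI_split z w : S z -> S w ->
  SI f z w = SI f z (z + 2^-1 * (w - z)) + SI f (z + 2^-1 * (w - z)) w.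
Proof.
move=> Sz Sw; have [F F0 hF] := primitive_exists (cts_seg cS cf Sz Sw).
have h := SI_along (cts_seg cS cf Sz Sw) hF.
have := h 0 1 (unit_seg0 R) (unit_seg1 R).
have := h 0 2^-1 (unit_seg0 R) unit_seg_half.
have := h 2^-1 1 unit_seg_half (unit_seg1 R).
rewrite mul1r mul0r addr0 [z + (w - z)]addrC subrK => -> -> ->; modring.
Qed.

Lemma SI_primitive F z w : (forall z, S z -> der S F z (f z)) -> S z -> S w ->
  SI f z w = F w - F z.
Proof.
move=> hF Sz Sw; rewrite /SI -IntZ; last exact: (cts_seg (S := S)).
rewrite (IntE (F := fun s => F (z + s * (w - z)))).
  by rewrite mul1r mul0r addr0 [z + _]addrC subrK.
move=> s hs; apply: (@der_comp _ _ _ S (fun s => z + s * (w - z)) F).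
- exact: der_affine.
- by move=> s'; exact: seg_in_convex.
- by apply: hF; exact: seg_in_convex.
Qed.

Lemma SI_le z w k : S z -> S w ->
  (forall s, seg01 s -> nm (f (z + s * (w - z))) <= k) -> nm (SI f z w) <= cabs (w - z) * k.
Proof.
move=> Sz Sw hk; rewrite nmZ ler_wpM2l ?cabs_ge0 //; apply: Int_le hk.
exact: (cts_seg (S := S)).
Qed.

(** A triangle is encoded by a corner [p], fixed edge directions [u], [v] and a scale [d]. Bisection
    then changes only [p] and [d]: three pieces have scale [d / 2] and the middle one, being
    reflected, has scale [- (d / 2)]. *)
Definition triangle (u v p d : R[i]) : V :=
  SI f p (p + d * u) + SI f (p + d * u) (p + d * v) + SI f (p + d * v) p.

Definition triangle_in (u v p d : R[i]) := [/\ S p, S (p + d * u) & S (p + d * v)].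

Lemma triangle_split u v p d : triangle_in u v p d ->
  [/\ triangle_in u v p (d / 2), triangle_in u v (p + d / 2 * u) (d / 2),
      triangle_in u v (p + d / 2 * v) (d / 2)
    & triangle_in u v (p + d / 2 * (u + v)) (- (d / 2))] /\
  triangle u v p d = triangle u v p (d / 2) + triangle u v (p + d / 2 * u) (d / 2) +
    triangle u v (p + d / 2 * v) (d / 2) + triangle u v (p + d / 2 * (u + v)) (- (d / 2)).
Proof.
move=> [Sa Sb Sc].
set a := p; set b := p + d * u in Sb *; set c := p + d * v in Sc *.
set x := p + d / 2 * u; set y := p + d / 2 * v; set m := p + d / 2 * (u + v).
have ex : x = a + 2^-1 * (b - a) by rewrite /x /a /b; field.
have ey : y = c + 2^-1 * (a - c) by rewrite /y /c /a; field.
have em : m = b + 2^-1 * (c - b) by rewrite /m /b /c; field.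
have Sx : S x by rewrite ex; apply: seg_in_convex => //; exact: unit_seg_half.
have Sy : S y by rewrite ey; apply: seg_in_convex => //; exact: unit_seg_half.
have Sm : S m by rewrite em; apply: seg_in_convex => //; exact: unit_seg_half.
rewrite /triangle_in /triangle -/a -/b -/c -/x -/y.
have -> : x + d / 2 * u = b by rewrite /x /b; field.
have -> : x + d / 2 * v = m by rewrite /x /m; field.
have -> : y + d / 2 * u = m by rewrite /y /m; field.
have -> : y + d / 2 * v = c by rewrite /y /c; field.
have -> : m + - (d / 2) * u = y by rewrite /m /y; field.
have -> : m + - (d / 2) * v = x by rewrite /m /x; field.
split=> //.
rewrite (SI_split Sa Sb) -ex (SI_split Sb Sc) -em (SI_split Sc Sa) -ey.
rewrite (SI_rev Sx Sm) (SI_rev Sx Sy) (SI_rev Sm Sy).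
modring.
Qed.

End OnConvex.

Lemma SI_B S f g z w : convexC S -> (forall z, S z -> cts S f z) ->
  (forall z, S z -> cts S g z) -> S z -> S w ->
  SI (fun z => f z - g z) z w = SI f z w - SI g z w.
Proof.
move=> cS cf cg Sz Sw; rewrite /SI -scalerBr -IntB //; exact: (cts_seg (S := S)).
Qed.

(** An explicit primitive of the first-order expansion at [l], so that this expansion integrates to
    zero over triangles. *)
Lemma der_affine_primitive S (l : R[i]) (c D : V) z :
  der S (fun w => w *: c + ((w - l) ^+ 2 / 2) *: D) z (c + (z - l) *: D).
Proof.
have d1 : der S (fun w : R[i] => w - l : R[i]) z 1.
  by have := derB (der_id S z) (der_cst S l z); rewrite subr0.
have := derD (derM (der_id S z) (der_cst S c z))
  (derM (derM d1 (derZ 2^-1 d1)) (der_cst S D z)).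
rewrite !scaler0 !add0r scale1r !scaleCE mulr1 mul1r.
rewrite [(z - l) / 2 + _](_ : _ = z - l); last by field.
by apply: der_ext => w; congr (_ + _ *: _); rewrite !scaleCE expr2; field.
Qed.

(** Goursat's bisection: the selected triangles shrink to a point [l] of the closed set [S]. There
    the affine part of [f] integrates to zero, and the remainder is quadratically small in the
    diameter, which compensates the factor 4^N. *)
Lemma goursat S f u v p : convexC S -> closedC S -> hol S f ->
  triangle_in S u v p 1 -> triangle f u v p 1 = 0.
Proof.
move=> cS clS hf T0.
have cf z : S z -> cts S f z by move=> /hf [D]; exact: der_cts.
(* One of the four pieces carries at least a quarter of the norm. Pairs that do not describe a
   triangle in [S] are left unchanged, which makes [next] total. *)
have /choice [next hnext] : forall st : R[i] * R[i], exists st', triangle_in S u v st.1 st.2 ->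
    [/\ triangle_in S u v st'.1 st'.2, cabs st'.2 = cabs st.2 / 2,
     cabs (st'.1 - st.1) <= cabs st.2 * (cabs u + cabs v) &
     nm (triangle f u v st.1 st.2) <= 4 * nm (triangle f u v st'.1 st'.2)].
  move=> [q d] /=; case: (pselect (triangle_in S u v q d)) => [Tq|nT]; last by exists (q, d).
  have [[T1 T2 T3 T4] E] := triangle_split cS cf Tq.
  have hd : cabs (d / 2) = cabs d / 2.
    by rewrite cabsM cabsV -(rmorph_nat (real_complex R) 2) cabs_real ger0_norm.
  have cu := cabs_ge0 u; have cv := cabs_ge0 v; have cd := cabs_ge0 d.
  have bu : cabs (d / 2 * u) <= cabs d * (cabs u + cabs v).
    by rewrite cabsM hd -mulrA ler_wpM2l //; lra.
  have bv : cabs (d / 2 * v) <= cabs d * (cabs u + cabs v).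
    by rewrite cabsM hd -mulrA ler_wpM2l //; lra.
  have buv : cabs (d / 2 * (u + v)) <= cabs d * (cabs u + cabs v).
    by rewrite cabsM hd -mulrA ler_wpM2l //; have := cabsD u v; lra.
  have b0 : cabs (q - q) <= cabs d * (cabs u + cabs v).
    by rewrite subrr cabs0 mulr_ge0 // addr_ge0.
  have ee x : q + x - q = x by ring.
  set t1 := triangle f u v q (d / 2) in E.
  set t2 := triangle f u v (q + d / 2 * u) (d / 2) in E.
  set t3 := triangle f u v (q + d / 2 * v) (d / 2) in E.
  set t4 := triangle f u v (q + d / 2 * (u + v)) (- (d / 2)) in E.
  have N : nm (triangle f u v q d) <= nm t1 + nm t2 + nm t3 + nm t4.
    rewrite E; apply: le_trans (nmD _ _) _; rewrite lerD2r.
    apply: le_trans (nmD _ _) _; rewrite lerD2r; exact: nmD.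
  case: (leP (nm (triangle f u v q d)) (4 * nm t1)) => [?|h1]; first by exists (q, d / 2).
  case: (leP (nm (triangle f u v q d)) (4 * nm t2)) => [?|h2].
    by exists (q + d / 2 * u, d / 2); rewrite /= ee.
  case: (leP (nm (triangle f u v q d)) (4 * nm t3)) => [?|h3].
    by exists (q + d / 2 * v, d / 2); rewrite /= ee.
  exists (q + d / 2 * (u + v), - (d / 2)); rewrite /= ee cabsN; split=> //.
  rewrite -/t4; lra.
pose st k := iter k next (p, 1 : R[i]).
have stS k : st k.+1 = next (st k) by [].
have st_in k : triangle_in S u v (st k).1 (st k).2.
  by elim: k => [//|k IH]; rewrite stS; have [] := hnext _ IH.
have st_d k : cabs (st k).2 = 1 / 2 ^+ k.
  elim: k => [|k IH]; first by rewrite [LHS]cabs1 expr0 divr1.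
  have [_ -> _ _] := hnext _ (st_in k); rewrite IH exprS; field.
  by rewrite lt0r_neq0 // exprn_gt0.
have st_T k : nm (triangle f u v p 1) <= 4 ^+ k * nm (triangle f u v (st k).1 (st k).2).
  elim: k => [|k IH]; first by rewrite expr0 mul1r.
  have [_ _ _ h] := hnext _ (st_in k).
  apply: le_trans IH _; rewrite exprSr -mulrA ler_wpM2l //; exact: exprn_ge0.
pose K := cabs u + cabs v.
have K0 : 0 <= K by rewrite addr_ge0 ?cabs_ge0.
have [l hl] : exists l : R[i], forall k, nm (l - (st k).1) <= 2 * K / 2 ^+ k.
  apply: geometric_limit => k; have [_ _ h _] := hnext _ (st_in k).
  by rewrite nmC; apply: le_trans h _; rewrite st_d /K; lra.
have Sl : S l.
  apply: clS => e e0; have [N hN] := geo_small (2 * K) e0.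
  exists (st N).1; first by have [] := st_in N.
  by rewrite cabsB; apply: le_trans (hl N) _; exact: hN.
have [D hD] := hf l Sl.
apply: nm_small => e e0.
(* The constant 9 comes from three sides of length at most [r], on each of which the remainder is at
   most [q * (3 * r)], with [r] = K / 2^N. *)
have q0 : 0 < e / (9 * K ^+ 2 + 1) by rewrite divr_gt0 // ltr_wpDl // mulr_ge0 // sqr_ge0.
have [d d0 hd] := hD _ q0.
have [N hN] := geo_small (3 * K) (ltac:(lra) : 0 < d / 2).
have {hN} := hN N (leqnn N) => hN.
set q := e / _ in q0 hd.
apply: le_trans (st_T N) _.
have := st_in N; have := st_d N; have := hl N; rewrite nmC.
case: (st N) => [x h] /= lx h2 [Sx Sxu Sxv].
pose aff (w : R[i]) := f l + (w - l) *: D.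
pose affp (w : R[i]) := w *: f l + ((w - l) ^+ 2 / 2) *: D.
have daff z : S z -> der S affp z (aff z) by move=> _; exact: der_affine_primitive.
have caff z : S z -> cts S aff z.
  move=> Sz; apply: ctsD (cts_cst _ _ _) (ctsM _ (cts_cst _ _ _)).
  exact: ctsB (cts_id _ _) (cts_cst _ _ _).
have cg z : S z -> cts S (fun w => f w - aff w) z.
  by move=> Sz; apply: ctsB; [exact: cf|exact: caff].
have Eg : triangle f u v x h = triangle (fun w => f w - aff w) u v x h.
  rewrite /triangle !(SI_B cS cf caff) // !(SI_primitive cS caff daff) //.
  modring.
rewrite Eg.
have P : 0 < (2 : R) ^+ N by rewrite exprn_gt0.
pose r := K / 2 ^+ N.
have r0 : 0 <= r by rewrite divr_ge0 // ltW.
have side a b : S a -> S b -> cabs (a - l) <= 3 * r -> cabs (b - l) <= 3 * r ->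
    cabs (b - a) <= r -> nm (SI (fun w => f w - aff w) a b) <= r * (q * (3 * r)).
  move=> Sa Sb la lb ab; apply: (@le_trans _ _ (cabs (b - a) * (q * (3 * r)))); last first.
    apply: ler_wpM2r => //; apply: mulr_ge0; first exact: ltW.
    by rewrite mulr_ge0.
  apply: (SI_le cS cg) => // s hs.
  have Ss : S (a + s * (b - a)) by exact: seg_in_convex.
  have ls : cabs (a + s * (b - a) - l) <= 3 * r.
    case: hs => [t t01 ->].
    have -> : a + t%:C * (b - a) - l = (1 - t)%:C * (a - l) + t%:C * (b - l).
      by rewrite rmorphB rmorph1; ring.
    apply: le_trans (cabsD _ _) _; rewrite !cabsM !cabs_real !ger0_norm; try lra.
    have : (1 - t) * cabs (a - l) <= (1 - t) * (3 * r) by rewrite ler_wpM2l //; lra.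
    have : t * cabs (b - l) <= t * (3 * r) by rewrite ler_wpM2l //; lra.
    lra.
  have ld : cabs (a + s * (b - a) - l) < d.
    apply: le_lt_trans ls _; rewrite /r mulrA; lra.
  rewrite /aff opprD addrA; apply: le_trans (hd _ Ss ld) _.
  by rewrite ler_wpM2l // ltW.
have lx' : cabs (x - l) <= 2 * r by rewrite cabsB /r mulrA.
have rE w : cabs w <= K -> cabs (h * w) <= r.
  move=> wK; rewrite cabsM h2 /r mulrAC mul1r; apply: ler_wpM2r => //.
  by rewrite invr_ge0 ltW.
have uK : cabs u <= K by rewrite lerDl cabs_ge0.
have vK : cabs v <= K by rewrite lerDr cabs_ge0.
have uvK : cabs (v - u) <= K by rewrite /K -(cabsN u) addrC; exact: cabsD.
have xw w : cabs w <= K -> cabs (x + h * w - l) <= 3 * r.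
  move=> /rE wr; rewrite addrAC; have := cabsD (x - l) (h * w); lra.
have xl : cabs (x - l) <= 3 * r by lra.
have := side x (x + h * u) Sx Sxu xl (xw u uK).
rewrite [x + _ - x]addrC addKr => /(_ (rE u uK)) s1.
have := side (x + h * u) (x + h * v) Sxu Sxv (xw u uK) (xw v vK).
have -> : x + h * v - (x + h * u) = h * (v - u) by ring.
move=> /(_ (rE _ uvK)) s2.
have := side (x + h * v) x Sxv Sx (xw v vK) xl.
rewrite cabsB [x + _ - x]addrC addKr => /(_ (rE v vK)) s3.
have tri : nm (triangle (fun w => f w - aff w) u v x h) <= 3 * (r * (q * (3 * r))).
  apply: le_trans (nmD _ _) _; apply: le_trans (lerD (nmD _ _) (lexx _)) _.
  by move: s1 s2 s3; clear; lra.
apply: le_trans (ler_wpM2l _ tri) _; first exact: exprn_ge0.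
have -> : 4 ^+ N * (3 * (r * (q * (3 * r)))) = q * (9 * K ^+ 2).
  have -> : (4 : R) ^+ N = 2 ^+ N * 2 ^+ N by rewrite -exprMn; congr (_ ^+ _); ring.
  by rewrite /r; field; exact: lt0r_neq0.
have Q : 0 < 9 * K ^+ 2 + 1 by rewrite ltr_wpDl // mulr_ge0 // sqr_ge0.
have -> : e = q * (9 * K ^+ 2 + 1) by rewrite /q mulfVK // lt0r_neq0.
by rewrite ler_wpM2l ?ltW // ltrDl.
Qed.

Lemma hol_primitive S f : convexC S -> closedC S -> hol S f ->
  exists F : R[i] -> V, forall z, S z -> der S F z (f z).
Proof.
move=> cS clS hf.
have cf z : S z -> cts S f z by move=> /hf [D]; exact: der_cts.
case: (pselect (exists z0, S z0)) => [[z0 Sz0]|nS]; last first.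
  by exists (fun=> 0) => z Sz; case: nS; exists z.
exists (SI f z0) => z Sz e e0; have [d d0 hd] := cf z Sz e e0.
exists d => // w Sw wd.
have T : triangle_in S (z - z0) (w - z0) z0 1.
  by split => //; rewrite mul1r addrC subrK.
have := goursat cS clS hf T; rewrite /triangle !mul1r ![z0 + _]addrC !subrK.
rewrite (SI_rev cS cf Sz0 Sw) => E.
have -> : SI f z0 w - SI f z0 z = SI f z w.
  have -> : SI f z w = (SI f z0 z + SI f z w - SI f z0 w) + SI f z0 w - SI f z0 z by modring.
  by rewrite E add0r.
rewrite /SI -scalerBr nmZ mulrC ler_wpM2r ?cabs_ge0 //.
rewrite -[X in _ - X]Int_cst -IntB; [|exact: (cts_seg (S := S))|by move=> s _; exact: cts_cst].
apply: Int_le => [s hs|s hs].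
  by apply: ctsB (cts_cst _ _ _); exact: (cts_seg (S := S)).
apply: hd; first exact: seg_in_convex.
rewrite [z + _ - z]addrC addKr; case: hs => [x x01 ->].
rewrite cabsM cabs_real ger0_norm; last by lra.
apply: le_lt_trans wd; rewrite ler_piMl ?cabs_ge0 //; lra.
Qed.

End Goursat.

(** * The complex exponential *)

Module RealDerivative.
From mathcomp Require Import topology normedtype derive.
Import numFieldNormedType.Exports.
Local Open Scope classical_set_scope.

(** Real differentiability rewritten as a linear error estimate, the form in which exp, cos and sin
    enter the complex exponential. *)
Lemma is_derive_eps (R : realType) (f : R -> R) (x df e : R) :
  is_derive x 1 f df -> 0 < e -> exists2 d : R, 0 < d &
    forall h : R, `|h| < d -> `|f (x + h) - f x - h * df| <= e * `|h|.
Proof.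
move=> hf e0; have := @ex_derive _ _ _ _ _ _ _ hf; rewrite /derivable => hc.
have : (fun h : R => h^-1 *: (f (h *: (1 : R) + x) - f x)) @ 0^' --> df.
  by have <- := @derive_val _ _ _ _ _ _ _ hf; exact: hc.
move=> /cvgrPdist_le /(_ e e0); rewrite near_withinE => /nbhs_normP [d /= d0 hd].
exists d => // h hlt.
have [->|h0] := eqVneq h 0; first by rewrite addr0 mul0r subr0 subrr normr0 mulr0.
have : ball_ Num.norm 0 d h by rewrite /ball_ /= sub0r normrN.
move=> /hd /(_ h0); rewrite /GRing.scale /= mulr1 addrC => h1.
have -> : f (x + h) - f x - h * df = - (h * (df - h^-1 * (f (h + x) - f x))).
  by rewrite [x + h]addrC; field.
by rewrite normrN normrM mulrC ler_wpM2r // addrC.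
Qed.

Lemma asin_continuous_eps (R : realType) (e : R) : 0 < e -> exists2 d : R, 0 < d &
  forall y : R, `|y| < d -> `|asin y| <= e.
Proof.
move=> e0; have := @continuous_asin R 0 ltac:(rewrite oppr_lt0 ltr01 //).
have a0 : asin (0 : R) = 0.
  by rewrite -[in LHS](sin0 R) sinK // in_itv /=; have := pi_gt0 R; lra.
move=> /cvgrPdist_le /(_ e e0) /nbhs_normP [d /= d0 hd]; exists d => // y yd.
have : ball_ Num.norm 0 d y by rewrite /ball_ /= sub0r normrN.
by move=> /hd; rewrite a0 sub0r normrN.
Qed.

End RealDerivative.

Section ComplexExponential.
Variable R : realType.
Implicit Types z w : R[i].

Lemma cexpD z w : cexp (z + w) = cexp z * cexp w.
Proof.
case: z => a b; case: w => c d; rewrite /cexp /= expRD cosD sinD.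
by apply/eqP; rewrite eq_complex /=; apply/andP; split; apply/eqP; ring.
Qed.

Lemma cexp0 : cexp (0 : R[i]) = 1.
Proof. by rewrite /cexp /= expR0 cos0 sin0; apply/eqP; rewrite eq_complex /= !mul1r !mul0r subr0 addr0 !eqxx. Qed.

Lemma cexp_real (x : R) : cexp x%:C = (expR x)%:C.
Proof. by rewrite /cexp /= cos0 sin0; apply/eqP; rewrite eq_complex /= !mulr0 mulr1 subr0 mul0r addr0 !eqxx. Qed.

Lemma cabs_cexp z : cabs (cexp z) = expR (complex.Re z).
Proof.
rewrite /cexp cabsM cabs_real ger0_norm ?expR_ge0 // /cabs /=.
by rewrite cos2Dsin2 sqrtr1 mulr1.
Qed.

Lemma cexp_neq0 z : cexp z != 0.
Proof. by rewrite -cabs_gt0 cabs_cexp expR_gt0. Qed.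

Lemma cexpN z : cexp (- z) = (cexp z)^-1.
Proof.
apply: (mulfI (cexp_neq0 z)); rewrite -cexpD subrr cexp0 mulfV //; exact: cexp_neq0.
Qed.

Lemma cexp_2pi : cexp (two_pi_i R) = 1.
Proof.
rewrite /cexp /two_pi_i /= expR0.
have -> : 2 * pi = 0 + (pi : R) *+ 2 by rewrite mulr2n; ring.
rewrite cosD2pi sinD2pi cos0 sin0.
by apply/eqP; rewrite eq_complex /= !mul1r !mul0r subr0 addr0 !eqxx.
Qed.

Lemma cexp_periodic z : cexp (z + two_pi_i R) = cexp z.
Proof. by rewrite cexpD cexp_2pi mulr1. Qed.

Lemma two_pi_i_neq0 : two_pi_i R != 0.
Proof.
rewrite eq_complex /= eqxx /=; apply: lt0r_neq0.
by rewrite mulr_gt0 // pi_gt0.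
Qed.

Lemma der_cexp S z : der S (@cexp R) z (cexp z).
Proof.
(* By the addition formula only the expansion at the origin has to be estimated. *)
suff h0 e : 0 < e -> exists2 d : R, 0 < d & forall h, cabs h < d ->
    cabs (cexp h - 1 - h) <= e * cabs h.
  move=> e e0; have P : 0 < cabs (cexp z) by rewrite cabs_cexp expR_gt0.
  have [d d0 hd] := h0 (e / cabs (cexp z)) ltac:(by rewrite divr_gt0).
  exists d => // w _ wd; have := hd _ wd.
  have -> : cexp w - cexp z - (w - z) *: cexp z = cexp z * (cexp (w - z) - 1 - (w - z)).
    have E : cexp w = cexp z * cexp (w - z) by rewrite -cexpD addrC subrK.
    by rewrite scaleCE E; ring.
  rewrite nmC cabsM => /(ler_wpM2l (ltW P)) /le_trans; apply.
  by rewrite mulrA mulrCA divff ?lt0r_neq0 // mulr1.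
move=> e0.
pose q := Num.min 1 (e / 32).
have q0 : 0 < q by rewrite /q lt_min ltr01 divr_gt0.
have q1 : q <= 1 by rewrite /q ge_min lexx.
have qe : 32 * q <= e.
  have : q <= e / 32 by rewrite /q ge_min lexx orbT.
  lra.
clearbody q.
have [d1 d10 h1] := RealDerivative.is_derive_eps (is_derive_expR (0 : R)) q0.
have [d2 d20 h2] := RealDerivative.is_derive_eps (is_derive_cos (0 : R)) q0.
have [d3 d30 h3] := RealDerivative.is_derive_eps (is_derive_sin (0 : R)) q0.
exists (Num.min (Num.min d1 d2) (Num.min d3 q)); first by rewrite !lt_min d10 d20 d30 q0.
move=> h; rewrite !lt_min => /andP[/andP[hd1 hd2] /andP[hd3 hq]].
have hx := cabs_Re h; have hy := cabs_Im h; have hc := cabs_ge0 h.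
have := h1 _ (le_lt_trans hx hd1).
have := h2 _ (le_lt_trans hy hd2).
have := h3 _ (le_lt_trans hy hd3).
rewrite !add0r expR0 cos0 sin0 !(oppr0, mulr0, addr0, mulr1).
set x := complex.Re h in hx *; set y := complex.Im h in hy *; set c := cabs h in hc hx hy hd1 hd2 hd3 hq *.
move=> hs hco he.
have yc : q * `|y| <= q * c by rewrite ler_wpM2l // ltW.
have xc : q * `|x| <= q * c by rewrite ler_wpM2l // ltW.
have c1 : `|cos y| <= 1 by rewrite ler_norml cos_geN1 cos_le1.
have qc : q * c <= c by rewrite ler_piMl.
have e4 : 0 <= q * c by rewrite mulr_ge0 // ltW.
have ex1 : `|expR x - 1| <= 2 * c.
  have -> : expR x - 1 = (expR x - 1 - x) + x by ring.
  by apply: le_trans (ler_normD _ _) _; lra.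
have s1 : `|sin y| <= 2 * c.
  have -> : sin y = (sin y - y) + y by ring.
  by apply: le_trans (ler_normD _ _) _; lra.
have rE : complex.Re (cexp h - 1 - h) = (expR x - 1 - x) * cos y + (1 + x) * (cos y - 1).
  rewrite !raddfB /cexp /= -/x -/y; ring.
have iE : complex.Im (cexp h - 1 - h) = (expR x - 1) * sin y + (sin y - y).
  rewrite !raddfB /cexp /= -/x -/y; ring.
apply: le_trans (cabs_le_ReIm _) _; rewrite rE iE.
have b1 : `|(expR x - 1 - x) * cos y + (1 + x) * (cos y - 1)| <= 4 * (q * c).
  apply: le_trans (ler_normD _ _) _; rewrite !normrM.
  have e1 : `|expR x - 1 - x| * `|cos y| <= q * c.
    by rewrite -[leRHS]mulr1; apply: ler_pM => //; lra.
  have e2 : `|1 + x| * `|cos y - 1| <= 2 * (q * c).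
    apply: ler_pM => //; last by lra.
    by apply: le_trans (ler_normD _ _) _; rewrite normr1; lra.
  lra.
have b2 : `|(expR x - 1) * sin y + (sin y - y)| <= 5 * (q * c).
  apply: le_trans (ler_normD _ _) _; rewrite normrM.
  have e1 : `|expR x - 1| * `|sin y| <= 2 * c * (2 * c) by apply: ler_pM.
  have e2 : c * c <= q * c by rewrite ler_wpM2r // ltW.
  lra.
have e3 : 32 * q * c <= e * c by rewrite ler_wpM2r.
rewrite -mulrA in e3; lra.
Qed.

Lemma cexp_kernel z w : cexp z = cexp w -> exists k : int, z = w + k%:~R * two_pi_i R.
Proof.
move=> E.
have : cexp (z - w) = 1 by rewrite cexpD cexpN E mulfV // cexp_neq0.
set v := z - w => vE.
have -> : z = w + v by rewrite /v; ring.
have rv : complex.Re v = 0.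
  have := cabs_cexp v; rewrite vE cabs1 -expR0 => /expR_inj.
  by move=> ->.
have P : 0 < 2 * (pi : R) by rewrite mulr_gt0 // pi_gt0.
pose k := Num.floor (complex.Im v / (2 * pi)).
pose u := v - k%:~R * two_pi_i R.
have mulkI (j : int) : complex.Re (j%:~R * two_pi_i R) = 0 /\
    complex.Im (j%:~R * two_pi_i R) = j%:~R * (2 * pi) :> R.
  rewrite -(rmorph_int (real_complex R) j) /two_pi_i /=; split; ring.
have uE : cexp u = 1.
  rewrite /u cexpD vE mul1r cexpN.
  suff -> : cexp (k%:~R * two_pi_i R) = 1 by rewrite invr1.
  have nat_case (j : nat) : cexp (j%:R * two_pi_i R) = 1.
    elim: j => [|j IH]; first by rewrite mul0r cexp0.
    by rewrite -natr1 mulrDl mul1r cexpD IH cexp_2pi mulr1.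
  case: (k) => j; first exact: nat_case.
  by rewrite NegzE mulrNz mulNr cexpN nat_case invr1.
have ru : complex.Re u = 0 by rewrite /u raddfB /= (mulkI k).1 rv subr0.
have iu : 0 <= complex.Im u < 2 * pi.
  rewrite /u raddfB /= (mulkI k).2.
  have := floor_itv (complex.Im v / (2 * pi)); rewrite -/k.
  rewrite intrD1 ler_pdivlMr // ltr_pdivrMr // mulrDl mul1r; lra.
have u0 : complex.Im u = 0.
  move: uE; rewrite /cexp ru expR0 mul1r; set y := complex.Im u in iu *.
  move=> /eqP; rewrite eq_complex /= => /andP[/eqP cy /eqP sy].
  have ppi := pi_gt0 R.
  have [//|y0] := eqVneq y 0; exfalso.
  have [ylt|yge] := ltP y pi.
    have y1 : 0 < y by rewrite lt_def y0; lra.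
    by have := @sin_gt0_pi R y; rewrite sy ltxx y1 ylt => /(_ isT).
  have [yp|yp] := eqVneq y pi; first by move: cy; rewrite yp cospi; lra.
  have := @sin_gt0_pi R (y - pi).
  have := sinDpi (y - pi); rewrite subrK sy => /eqP; rewrite eq_sym oppr_eq0 => /eqP ->.
  rewrite ltxx; move=> /(_ _) h; apply: (Bool.diff_false_true); apply: h.
  by rewrite subr_gt0 lt_def yp yge /=; lra.
exists k; congr (_ + _); apply/eqP; rewrite -subr_eq0 -/u eq_complex ru u0 !eqxx.
by [].
Qed.

(** The principal logarithm, with the argument given by the arcsine; this is correct where the real
    part is positive. *)
Definition clog (u : R[i]) : R[i] :=
  ln (cabs u) +i* asin (complex.Im u / cabs u).

Lemma cexp_clog u : 0 < complex.Re u -> cexp (clog u) = u.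
Proof.
move=> ru; have c0 : 0 < cabs u by apply: lt_le_trans ru (le_trans (ler_norm _) (cabs_Re u)).
have cE : complex.Re u ^+ 2 + complex.Im u ^+ 2 = cabs u ^+ 2.
  case: (u) => a b; by rewrite /cabs /= sqr_sqrtr // addr_ge0 // sqr_ge0.
have y1 : -1 <= complex.Im u / cabs u <= 1.
  by rewrite -ler_norml normrM normfV (ger0_norm (ltW c0)) ler_pdivrMr // mul1r cabs_Im.
rewrite /cexp /clog /= lnK // asinK ?in_itv //= cos_asin //.
have -> : Num.sqrt (1 - (complex.Im u / cabs u) ^+ 2) = complex.Re u / cabs u.
  have -> : 1 - (complex.Im u / cabs u) ^+ 2 = (complex.Re u / cabs u) ^+ 2.
    by rewrite !expr_div_n; apply/eqP; rewrite subr_eq -mulrDl cE divff // sqrf_eq0 lt0r_neq0.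
  by rewrite sqrtr_sqr ger0_norm // divr_ge0 // ltW.
apply/eqP; rewrite eq_complex /= !mul0r subr0 addr0.
by rewrite ![cabs u * _]mulrC !divfK ?lt0r_neq0 // !eqxx.
Qed.

Lemma clog_small e : 0 < e -> exists2 d : R, 0 < d & forall h, cabs h < d ->
  0 < complex.Re (1 + h) /\ cabs (clog (1 + h)) <= e.
Proof.
move=> e0.
have [d1 d10 h1] := RealDerivative.asin_continuous_eps (ltac:(lra) : 0 < e / 2).
pose q := Num.min (1 / 2) (Num.min (d1 / 2) (e / 4)).
have q0 : 0 < q by rewrite /q !lt_min; apply/and3P; split; lra.
have q1 : q <= 1 / 2 by rewrite /q ge_min lexx.
have q2 : q <= d1 / 2 by rewrite /q !ge_min lexx orbT.
have q3 : q <= e / 4 by rewrite /q !ge_min lexx !orbT.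
exists q => // h hq; have hx := cabs_Re h; have hy := cabs_Im h.
have a1 : 1 - cabs h <= cabs (1 + h).
  by have := cabsD (1 + h) (- h); rewrite addrK cabs1 cabsN; lra.
have a2 : cabs (1 + h) <= 1 + cabs h by have := cabsD 1 h; rewrite cabs1.
have P : 0 < cabs (1 + h) by lra.
split; first by move: hx; rewrite raddfD /= ler_norml; lra.
apply: le_trans (cabs_le_ReIm _) _; rewrite /clog /=.
have b1 : `|asin (complex.Im (1 + h) / cabs (1 + h))| <= e / 2.
  apply: h1; rewrite normrM normfV (gtr0_norm P) ltr_pdivrMr // raddfD /= add0r.
  have : d1 * (1 / 2) <= d1 * cabs (1 + h) by rewrite ler_wpM2l //; [exact: ltW|lra].
  lra.
have b2 : `|ln (cabs (1 + h))| <= e / 2.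
  have up := le_ln1Dx (ltac:(lra) : -1 < cabs (1 + h) - 1).
  rewrite addrC subrK in up.
  have iP : 0 < (cabs (1 + h))^-1 by rewrite invr_gt0.
  have dn := le_ln1Dx (ltac:(lra) : -1 < (cabs (1 + h))^-1 - 1).
  rewrite addrC subrK lnV ?posrE // in dn.
  have i2 : (cabs (1 + h))^-1 - 1 <= 2 * cabs h.
    have : (cabs (1 + h))^-1 * (1 - cabs h) <= 1.
      by rewrite mulrC ler_pdivrMr // mul1r.
    have : (cabs (1 + h))^-1 <= 2.
      by rewrite -[2]invrK lef_pV2 ?posrE ?invr_gt0 //; lra.
    set i := (cabs (1 + h))^-1 in iP dn * => i2 i3.
    have : i * cabs h <= 2 * cabs h by rewrite ler_wpM2r // cabs_ge0.
    lra.
  by rewrite ler_norml; lra.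
lra.
Qed.

End ComplexExponential.

(** * Regularity of holomorphic functions *)

Section Holomorphic.
Variables (R : realType) (V : banachType R).
Local Notation seg01 := (@unit_seg R).
Local Notation full := (fun _ : R[i] => True).
Implicit Types (f g : R[i] -> V) (c z w : R[i]).

Definition dif f z := exists D, der full f z D.

Lemma der_near f g z D d : 0 < d -> (forall w, cabs (w - z) < d -> f w = g w) ->
  der full f z D -> der full g z D.
Proof.
move=> d0 h hf e /hf [d' d'0 hd']; exists (Num.min d d'); first by rewrite lt_min d0.
move=> w _; rewrite lt_min => /andP[w1 w2].
by rewrite -!h //; [exact: hd'|rewrite subrr cabs0].
Qed.

Lemma dif_near f g z d : 0 < d -> (forall w, cabs (w - z) < d -> f w = g w) ->
  dif f z -> dif g z.
Proof. by move=> d0 h [D hD]; exists D; exact: der_near h hD. Qed.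

Lemma der_unique f z D E : der full f z D -> der full f z E -> D = E.
Proof.
move=> hD hE; apply/eqP; rewrite -subr_eq0; apply/eqP/nm_small => e e0.
have [d1 d10 h1] := hD (e / 2) ltac:(lra).
have [d2 d20 h2] := hE (e / 2) ltac:(lra).
pose d := Num.min d1 d2 / 2.
have d0 : 0 < d by rewrite divr_gt0 // lt_min d10.
have dd1 : d < d1.
  have : Num.min d1 d2 <= d1 by rewrite ge_min lexx.
  rewrite /d in d0 *; lra.
have dd2 : d < d2.
  have : Num.min d1 d2 <= d2 by rewrite ge_min lexx orbT.
  rewrite /d in d0 *; lra.
have := h1 (z + d%:C) I; have := h2 (z + d%:C) I.
rewrite [z + _ - z]addrC addKr cabs_real gtr0_norm // => /(_ dd2) b2 /(_ dd1) b1.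
have : d * nm (D - E) <= d * e.
  rewrite -[d in leLHS](gtr0_norm d0) -cabs_real -nmZ.
  have -> : d%:C *: (D - E) = (f (z + d%:C) - f z - d%:C *: E) - (f (z + d%:C) - f z - d%:C *: D).
    by modring.
  by apply: le_trans (nm_sub _ _) _; lra.
by rewrite ler_pM2l.
Qed.

Definition D1 f z : V := epsilon (inhabits 0) (der full f z).

Lemma D1P f z : dif f z -> der full f z (D1 f z).
Proof. exact: epsilon_spec. Qed.

Lemma D1E f z D : der full f z D -> D1 f z = D.
Proof. by move=> h; apply: (der_unique _ h); apply: D1P; exists D. Qed.

Lemma dif_cts S f z : dif f z -> cts S f z.
Proof. by case=> D /der_cts; apply: cts_sub. Qed.

Lemma disc_convex c (r : R) : convexC (fun z => cabs (z - c) < r).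
Proof.
move=> z w hz hw x x01.
have -> : z + x%:C * (w - z) - c = (1 - x)%:C * (z - c) + x%:C * (w - c).
  by rewrite rmorphB rmorph1; ring.
apply: le_lt_trans (cabsD _ _) _; rewrite !cabsM !cabs_real !ger0_norm; try lra.
have [->|x0] := eqVneq x 0; first by rewrite subr0 mul1r mul0r addr0.
have xp : 0 < x by rewrite lt_def x0; lra.
have : x * cabs (w - c) < x * r by rewrite ltr_pM2l.
have : (1 - x) * cabs (z - c) <= (1 - x) * r by rewrite ler_wpM2l //; [lra|exact: ltW].
lra.
Qed.

Definition circ c (r : R) (s : R[i]) : R[i] := c + r%:C * cexp (s * two_pi_i R).

(** The mean of [f] over a circle, that is the Cauchy integral of f(z) / (z - c) divided by 2 pi
    i. *)
Definition cm f c (r : R) : V := Int (fun s => f (circ c r s)).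

Lemma cabs_cexp_unit s : seg01 s -> cabs (cexp (s * two_pi_i R)) = 1.
Proof.
by move=> [x _ ->]; rewrite cabs_cexp /two_pi_i /= mul0r mulr0 subr0 expR0.
Qed.

Lemma cabs_circ c r s : 0 <= r -> seg01 s -> cabs (circ c r s - c) = r.
Proof.
move=> r0 hs; rewrite /circ [c + _]addrC addrK cabsM cabs_cexp_unit // mulr1.
by rewrite cabs_real ger0_norm.
Qed.

Lemma cts_circ S c r s : cts S (circ c r) s.
Proof.
apply: ctsD; first exact: cts_cst.
apply: (@ctsM _ R[i] S (fun=> r%:C) (fun s => cexp (s * two_pi_i R)) s (cts_cst _ _ _)).
apply: (@cts_comp _ _ _ full (fun s => s * two_pi_i R) (@cexp R)) => //.
  exact: (@ctsM _ R[i] S (fun s => s) (fun=> two_pi_i R) s (cts_id _ _) (cts_cst _ _ _)).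
exact: der_cts (der_cexp _ _).
Qed.

Lemma cts01_circ f c r : 0 <= r -> (forall z, cabs (z - c) = r -> cts full f z) ->
  cts01 (fun s => f (circ c r s)).
Proof.
move=> r0 hf s hs; apply: (@cts_comp _ _ _ full (circ c r) f) => //.
  exact: cts_circ.
by apply: hf; exact: cabs_circ.
Qed.

Lemma cm_le f c r k : 0 <= r -> (forall z, cabs (z - c) = r -> cts full f z) ->
  (forall z, cabs (z - c) = r -> nm (f z) <= k) -> nm (cm f c r) <= k.
Proof.
move=> r0 hf hk; apply: Int_le; first exact: cts01_circ.
by move=> s hs; apply: hk; exact: cabs_circ.
Qed.

Lemma cm_cst v c r : cm (fun=> v) c r = v.
Proof. exact: Int_cst. Qed.

Lemma cmB f g c r : 0 <= r -> (forall z, cabs (z - c) = r -> cts full f z) ->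
  (forall z, cabs (z - c) = r -> cts full g z) ->
  cm (fun z => f z - g z) c r = cm f c r - cm g c r.
Proof. by move=> r0 hf hg; rewrite /cm IntB //; exact: cts01_circ. Qed.

(* In the coordinate w = log (z - c) the mean over a circle is an increment
   G (w + 2 pi i) - G w of a primitive G, whose derivative vanishes by periodicity. *)
Lemma cm_const f c r1 r2 : 0 < r1 -> r1 <= r2 ->
  (forall z, r1 <= cabs (z - c) <= r2 -> dif f z) -> cm f c r1 = cm f c r2.
Proof.
move=> r10 r12 hf.
have r20 : 0 < r2 by exact: lt_le_trans r12.
pose S (w : R[i]) := ln r1 <= complex.Re w <= ln r2.
pose g w := f (c + cexp w).
have SE w : S w -> r1 <= cabs (c + cexp w - c) <= r2.
  rewrite /S [c + _]addrC addrK cabs_cexp => /andP[h1 h2].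
  by rewrite -[r1]lnK // -[r2]lnK // !ler_expR h1 h2.
have cS : convexC S.
  move=> z w /andP[z1 z2] /andP[w1 w2] x x01; rewrite /S.
  have -> : complex.Re (z + x%:C * (w - z)) = (1 - x) * complex.Re z + x * complex.Re w.
    by case: (z) => a b; case: (w) => a' b' /=; ring.
  have : x * complex.Re w <= x * ln r2 by rewrite ler_wpM2l //; lra.
  have : x * ln r1 <= x * complex.Re w by rewrite ler_wpM2l //; lra.
  have : (1 - x) * complex.Re z <= (1 - x) * ln r2 by rewrite ler_wpM2l //; lra.
  have : (1 - x) * ln r1 <= (1 - x) * complex.Re z by rewrite ler_wpM2l //; lra.
  lra.
have clS : closedC S.
  move=> z hz; rewrite /S; apply/andP; split; apply/ler_addgt0Pr => e e0.
    have [w /andP[w1 w2] wz] := hz e e0.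
    have := le_trans (cabs_Re (w - z)) wz; rewrite raddfB ler_norml /=; lra.
  have [w /andP[w1 w2] wz] := hz e e0.
  have := le_trans (cabs_Re (w - z)) wz; rewrite raddfB ler_norml /=; lra.
have hg : hol S g.
  move=> w Sw; have [D hD] := hf _ (SE w Sw).
  exists (cexp w *: D); apply: (@der_comp _ _ _ full (fun w => c + cexp w) f) => //.
  by have := derD (der_cst S c w) (der_cexp S w); rewrite add0r.
have [G hG] := hol_primitive cS clS hg.
have Sper w : S w -> S (w + two_pi_i R).
  by rewrite /S raddfD /= addr0.
have hG' w : S w -> der S (fun w => G (w + two_pi_i R) - G w) w 0.
  move=> Sw; rewrite -(subrr (g w)); apply: derB (hG _ Sw).
  rewrite -[g w]scale1r.
  apply: (@der_comp _ _ _ S (fun w => w + two_pi_i R) G) => //.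
    by have := derD (der_id S w) (der_cst S (two_pi_i R) w); rewrite addr0.
  by have := hG _ (Sper _ Sw); rewrite /g cexp_periodic.
have Sln r : r1 <= r <= r2 -> S (ln r)%:C.
  move=> /andP[h1 h2]; rewrite /S /= !ler_ln ?posrE ?h1 //; exact: lt_le_trans h1.
have cmE r : r1 <= r <= r2 ->
    two_pi_i R *: cm f c r = G ((ln r)%:C + two_pi_i R) - G (ln r)%:C.
  move=> hr; have r0 : 0 < r by case/andP: hr => h _; exact: lt_le_trans h.
  have Sr := Sln r hr; have cg z : S z -> cts S g z by move=> /hg [D]; exact: der_cts.
  rewrite -(SI_primitive cS cg hG Sr (Sper _ Sr)) /SI.
  have -> : (ln r)%:C + two_pi_i R - (ln r)%:C = two_pi_i R by ring.
  congr (_ *: Int _); apply/funext => s.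
  by rewrite /g /circ cexpD cexp_real lnK.
have E := mvi_convex cS hG' (k := 0).
have S1 : S (ln r1)%:C by apply: Sln; rewrite lexx.
have S2 : S (ln r2)%:C by apply: Sln; rewrite lexx andbT.
have := E (fun z _ => ltac:(by rewrite nm0)) _ _ S1 S2.
rewrite mul0r => /nm_le0 /eqP; rewrite subr_eq0 -!cmE ?lexx ?r12 // => /eqP h.
by apply: (scalerI (two_pi_i_neq0 R)).
Qed.

(** The means over small circles tend to the value at the centre. At [c] itself only continuity is
    assumed, because the lemma is applied to difference quotients. *)
Lemma cm_center f c r : 0 < r -> cts full f c ->
  (forall z, 0 < cabs (z - c) <= r -> dif f z) -> cm f c r = f c.
Proof.
move=> r0 hc hf; apply/eqP; rewrite -subr_eq0; apply/eqP/nm_small => e e0.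
have [d d0 hd] := hc e e0.
pose r' := Num.min r (d / 2).
have r'0 : 0 < r' by rewrite /r' lt_min r0; lra.
have r'r : r' <= r by rewrite /r' ge_min lexx.
have r'd : r' <= d / 2 by rewrite /r' ge_min lexx orbT.
rewrite -(@cm_const f c r' r) //; last first.
  by move=> z /andP[h1 h2]; apply: hf; rewrite h2 andbT; exact: lt_le_trans h1.
have cf z : cabs (z - c) = r' -> cts full f z.
  by move=> hz; apply: dif_cts; apply: hf; rewrite hz r'0.
rewrite -[X in _ - X](cm_cst _ c r') -cmB //; [|exact: ltW|by move=> *; exact: cts_cst].
apply: cm_le => [|z hz|z hz]; first exact: ltW.
  by apply: ctsB; [exact: cf|exact: cts_cst].
by apply: hd => //; rewrite hz; lra.
Qed.

Definition quot f c z : V := if z == c then D1 f c else (z - c)^-1 *: (f z - f c).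

Lemma quot_cts f c : dif f c -> cts full (quot f c) c.
Proof.
move=> /D1P hf e e0; have [d d0 hd] := hf e e0; exists d => // w _ wd.
rewrite /quot eqxx; have [_|wc] := eqVneq w c.
  by rewrite subrr nm0; exact: ltW.
have P : 0 < cabs (w - c) by rewrite cabs_gt0 subr_eq0.
have -> : (w - c)^-1 *: (f w - f c) - D1 f c = (w - c)^-1 *: (f w - f c - (w - c) *: D1 f c).
  by rewrite [RHS]scalerBr scalerA mulVf ?scale1r // subr_eq0.
by rewrite nmZ cabsV mulrC ler_pdivrMr //; exact: hd.
Qed.

Lemma quot_dif f c z : z != c -> dif f z -> dif (quot f c) z.
Proof.
move=> zc [D hD].
have P : 0 < cabs (z - c) by rewrite cabs_gt0 subr_eq0.
apply: (@dif_near (fun z => (z - c)^-1 *: (f z - f c)) _ _ (cabs (z - c))) => //.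
  move=> w; rewrite /quot; case: eqP => // ->; rewrite cabsB ltxx //.
eexists; apply: derM; last by apply: derB hD (der_cst _ _ _).
apply: (@der_comp _ _ _ full (fun w => w - c) (fun w => w^-1)) => //.
  exact: derB (der_id _ _) (der_cst _ _ _).
by apply: der_inv; rewrite subr_eq0.
Qed.

Lemma quot_nm f c z M : z != c -> nm (f z) <= M -> nm (f c) <= M ->
  nm (quot f c z) <= 2 * M / cabs (z - c).
Proof.
move=> zc h1 h2; have P : 0 < cabs (z - c) by rewrite cabs_gt0 subr_eq0.
rewrite /quot (negbTE zc) nmZ cabsV mulrC ler_wpM2r ?invr_ge0 ?cabs_ge0 //.
by apply: le_trans (nm_sub _ _) _; lra.
Qed.

(** The difference quotient, completed by the derivative, is continuous at [c] and so is recovered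
    from its mean. This plays the role of Cauchy's formula for the derivative. *)
Lemma D1_cm f c r : 0 < r -> (forall z, cabs (z - c) <= r -> dif f z) ->
  D1 f c = cm (quot f c) c r.
Proof.
move=> r0 hf; have fc : dif f c by apply: hf; rewrite subrr cabs0 ltW.
rewrite cm_center //; first by rewrite /quot eqxx.
  exact: quot_cts.
by move=> z /andP[h1 h2]; apply: quot_dif; [rewrite -subr_eq0 -cabs_gt0|exact: hf].
Qed.

Section Estimates.
Variables (f : R[i] -> V) (c : R[i]) (r M : R).
Hypotheses (r0 : 0 < r) (hf : forall z, cabs (z - c) < r -> dif f z)
  (hM : forall z, cabs (z - c) < r -> nm (f z) <= M).

Lemma cauchy_estimate : nm (D1 f c) <= 4 * M / r.
Proof.
have rp := r0.
rewrite (@D1_cm f c (r / 2) ltac:(lra) (fun z hz => hf (ltac:(lra)))).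
have zc z : cabs (z - c) = r / 2 -> z != c.
  by move=> hz; rewrite -subr_eq0 -cabs_gt0 hz; lra.
apply: cm_le => [|z hz|z hz]; first lra.
  by apply: dif_cts; apply: quot_dif; [exact: zc|apply: hf; lra].
have := @quot_nm f c z M (zc z hz) (hM (ltac:(lra))).
rewrite hz; have -> : 2 * M / (r / 2) = 4 * M / r by field; exact: lt0r_neq0.
by apply; apply: hM; rewrite subrr cabs0.
Qed.

End Estimates.

Section Taylor.
Variables (f : R[i] -> V) (c : R[i]) (r M : R).
Hypotheses (r0 : 0 < r) (hf : forall z, cabs (z - c) < r -> dif f z)
  (hM : forall z, cabs (z - c) < r -> nm (f z) <= M).

Let in_disc z w d : cabs (z - c) < d -> cabs (w - z) < r - d -> cabs (w - c) < r.
Proof. by move=> h1 h2; have := cabsD (w - z) (z - c); rewrite subrKA; lra. Qed.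

Lemma D1_bound z : cabs (z - c) < r / 2 -> nm (D1 f z) <= 8 * M / r.
Proof.
have rp := r0.
move=> hz; have -> : 8 * M / r = 4 * M / (r / 2) by field; exact: lt0r_neq0.
apply: cauchy_estimate => [|w hw|w hw]; first lra.
  by apply: hf; apply: in_disc hz _; lra.
by apply: hM; apply: in_disc hz _; lra.
Qed.

Lemma M_ge0 : 0 <= M.
Proof. by apply: le_trans (nm_ge0 (f c)) (hM _); rewrite subrr cabs0. Qed.

Lemma hol_lipschitz z w : cabs (z - c) < r / 2 -> cabs (w - c) < r / 2 ->
  nm (f w - f z) <= 8 * M / r * cabs (w - z).
Proof.
have rp := r0.
apply: (mvi_convex (S := fun z => cabs (z - c) < r / 2) (D := D1 f)).
- exact: disc_convex.
- move=> v hv; apply: (der_sub (S := full)) => //; apply: D1P; apply: hf; lra.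
- exact: D1_bound.
Qed.

(** Both derivatives are means over circles of the same radius [r / 4], whose kernels agree after
    translation. Hence only the Lipschitz bound for [f] enters, twice, divided by [r / 4]; no second
    derivative is used. *)
Lemma D1_lipschitz z : cabs (z - c) < r / 4 ->
  nm (D1 f z - D1 f c) <= 64 * M / r ^+ 2 * cabs (z - c).
Proof.
have rp := r0.
move=> hz.
have q0 : 0 < r / 4 by lra.
have cd v w : cabs (v - c) < r / 4 -> cabs (w - v) <= r / 4 -> cabs (w - c) < r / 2.
  by move=> h1 h2; have := cabsD (w - v) (v - c); rewrite subrKA; lra.
have cc : cabs (c - c) < r / 4 by rewrite subrr cabs0.
have dv v : cabs (v - c) < r / 4 -> forall w, cabs (w - v) <= r / 4 -> dif f w.
  by move=> hv w hw; apply: hf; have := cd v w hv hw; lra.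
have ne v w : cabs (w - v) = r / 4 -> w != v.
  by move=> h; rewrite -subr_eq0 -cabs_gt0 h.
have cq v : cabs (v - c) < r / 4 -> cts01 (fun s => quot f v (circ v (r / 4) s)).
  move=> hv; apply: cts01_circ; first exact: ltW.
  by move=> w hw; apply: dif_cts; apply: quot_dif; [exact: ne|apply: (dv v); rewrite ?hw].
rewrite (D1_cm q0 (dv z hz)) (D1_cm q0 (dv c cc)) /cm -IntB; [|exact: cq|exact: cq].
apply: Int_le => [s hs|s hs]; first by apply: ctsB; exact: cq.
have hcz := cabs_circ z (ltW q0) hs; have hcc := cabs_circ c (ltW q0) hs.
rewrite /quot (negbTE (ne _ _ hcz)) (negbTE (ne _ _ hcc)).
have E : circ z (r / 4) s - z = circ c (r / 4) s - c by rewrite /circ; ring.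
rewrite E; set u := (_ - c)^-1.
have -> : u *: (f (circ z (r / 4) s) - f z) - u *: (f (circ c (r / 4) s) - f c) =
    u *: ((f (circ z (r / 4) s) - f (circ c (r / 4) s)) - (f z - f c)) by modring.
rewrite nmZ /u cabsV hcc.
have l1 : nm (f (circ z (r / 4) s) - f (circ c (r / 4) s)) <= 8 * M / r * cabs (z - c).
  have -> : z - c = circ z (r / 4) s - circ c (r / 4) s by rewrite /circ; ring.
  by apply: hol_lipschitz; [apply: (cd c); rewrite ?hcc|apply: (cd z); rewrite ?hcz].
have l2 : nm (f z - f c) <= 8 * M / r * cabs (z - c).
  by apply: hol_lipschitz; [rewrite subrr cabs0; lra|lra].
have -> : 64 * M / r ^+ 2 * cabs (z - c) = (r / 4)^-1 * (2 * (8 * M / r * cabs (z - c))).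
  by field; exact: lt0r_neq0.
apply: ler_wpM2l; first by rewrite invr_ge0 ltW.
by apply: le_trans (nm_sub _ _) _; lra.
Qed.

Lemma taylor2 h : cabs h < r / 4 ->
  nm (f (c + h) - f c - h *: D1 f c) <= 64 * M / r ^+ 2 * cabs h ^+ 2.
Proof.
have rp := r0.
move=> hh.
have sh s : seg01 s -> cabs (c + s * h - c) <= cabs h.
  move=> [x x01 ->]; rewrite [c + _]addrC addrK cabsM cabs_real ger0_norm; last by lra.
  by rewrite ler_piMl ?cabs_ge0 //; lra.
have -> : f (c + h) - f c - h *: D1 f c =
   (f (c + 1 * h) - (1 * h) *: D1 f c) - (f (c + 0 * h) - (0 * h) *: D1 f c).
  by rewrite !mul1r !mul0r addr0 scale0r subr0 addrAC.
apply: (mvi1 (f := fun s => f (c + s * h) - (s * h) *: D1 f c)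
  (D := fun s => h *: (D1 f (c + s * h) - D1 f c))).
  move=> s hs; rewrite scalerBr; apply: derB.
    apply: (@der_comp _ _ _ full (fun s => c + s * h) f) => //; first exact: der_affine.
    by apply: D1P; apply: hf; have := sh s hs; lra.
  have := derM (derM (der_id seg01 s) (der_cst seg01 h s)) (der_cst seg01 (D1 f c) s).
  by rewrite !scaler0 !add0r scale1r.
move=> s hs; rewrite nmZ.
have -> : 64 * M / r ^+ 2 * cabs h ^+ 2 = cabs h * (64 * M / r ^+ 2 * cabs h) by ring.
apply: ler_wpM2l; first exact: cabs_ge0.
apply: le_trans (D1_lipschitz _) _; first by have := sh s hs; lra.
apply: ler_wpM2l; last exact: sh.
by rewrite divr_ge0 ?sqr_ge0 // mulr_ge0 // M_ge0.
Qed.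

End Taylor.

(** The common bound [M] gives all approximants the same constant [K] in the second-order remainder.
    Their derivatives at [c] are therefore Cauchy, and the expansion passes to the limit. *)
Lemma weierstrass f c r M : 0 < r ->
  (forall e : R, 0 < e -> exists g, [/\ forall z, cabs (z - c) < r -> dif g z,
     forall z, cabs (z - c) < r -> nm (g z) <= M &
     forall z, cabs (z - c) < r -> nm (f z - g z) <= e]) -> dif f c.
Proof.
move=> r0 H.
have p k : 0 < ((2 : R) ^+ k)^-1 by rewrite invr_gt0 exprn_gt0.
have /choice [g hg] := fun k => H _ (p k).
pose K := 64 * M / r ^+ 2.
have T k h : cabs h < r / 4 -> nm (g k (c + h) - g k c - h *: D1 (g k) c) <= K * cabs h ^+ 2.
  by move=> hh; have [h1 h2 _] := hg k; apply: (taylor2 r0 h1 h2).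
have K0 : 0 <= K.
  have [h1 h2 _] := hg 0%N; rewrite /K divr_ge0 ?sqr_ge0 // mulr_ge0 //.
  exact: M_ge0 r0 h2.
have hfg k z : cabs (z - c) < r -> nm (f z - g k z) <= (2 ^+ k)^-1.
  by have [_ _] := hg k; apply.
have cc : cabs (c - c) < r by rewrite subrr cabs0.
have ch h : cabs h < r / 4 -> cabs (c + h - c) < r.
  by rewrite [c + _]addrC addrK; lra.
have S k h : cabs h < r / 4 ->
    nm (f (c + h) - f c - h *: D1 (g k) c) <= K * cabs h ^+ 2 + 2 / 2 ^+ k.
  move=> hh.
  have -> : f (c + h) - f c - h *: D1 (g k) c = (g k (c + h) - g k c - h *: D1 (g k) c) +
      ((f (c + h) - g k (c + h)) - (f c - g k c)) by modring.
  apply: le_trans (nmD _ _) (lerD (T k h hh) _).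
  apply: le_trans (nm_sub _ _) _.
  have := hfg k _ (ch h hh); have := hfg k _ cc; lra.
have [D hD] : exists D, forall e : R, 0 < e -> exists N, forall k, (N <= k)%N ->
    nm (D1 (g k) c - D) <= e.
  apply: nm_complete => e e0.
  (* The increment [t] is fixed first, to control the Taylor remainders; the index is chosen
     afterwards, so that the approximation error is small compared with [t]. *)
  pose t := Num.min (r / 8) (e / (4 * (K + 1))).
  have K1 : 0 < 4 * (K + 1) by lra.
  have t0 : 0 < t by rewrite /t lt_min; apply/andP; split; [lra|rewrite divr_gt0].
  have tr : t < r / 4.
    have : t <= r / 8 by rewrite /t ge_min lexx.
    lra.
  have te : 4 * (K + 1) * t <= e.
    by rewrite mulrC -ler_pdivlMr // /t ge_min lexx orbT.
  have [N hN] := geo_small 4 (ltac:(by rewrite mulr_gt0 // divr_gt0) : 0 < t * (e / 4)).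
  exists N => j k hj hk.
  have ht : cabs (t%:C : R[i]) = t by rewrite cabs_real gtr0_norm.
  have s1 := S j t%:C; have s2 := S k t%:C; rewrite ht in s1 s2.
  have {}s1 := s1 tr; have {}s2 := s2 tr.
  have : t * nm (D1 (g j) c - D1 (g k) c) <= t * e.
    rewrite -[t in leLHS]ht -nmZ.
    have -> : t%:C *: (D1 (g j) c - D1 (g k) c) =
      (f (c + t%:C) - f c - t%:C *: D1 (g k) c) - (f (c + t%:C) - f c - t%:C *: D1 (g j) c).
      by modring.
    apply: le_trans (nm_sub _ _) _.
    have := hN j hj; have := hN k hk => n1 n2.
    have q1 : t * (4 * (K + 1) * t) <= t * e by rewrite ler_wpM2l // ltW.
    have q2 : 0 <= t * t by rewrite mulr_ge0 ?ltW.
    have q3 : 0 <= K * t ^+ 2 by rewrite mulr_ge0 ?sqr_ge0.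
    rewrite !expr2 in s1 s2 q3.
    have -> : t * e = t * e / 2 + t * e / 2 by field.
    lra.
  by rewrite ler_pM2l.
exists D => e e0.
pose t := Num.min (r / 4) (e / (K + 1)).
have K1 : 0 < K + 1 by lra.
exists t; first by rewrite /t lt_min; apply/andP; split; [lra|rewrite divr_gt0].
move=> w _ wt.
have wr : cabs (w - c) < r / 4 by apply: lt_le_trans wt _; rewrite /t ge_min lexx.
have we : (K + 1) * cabs (w - c) <= e.
  by rewrite mulrC -ler_pdivlMr //; apply: le_trans (ltW wt) _; rewrite /t ge_min lexx orbT.
have wn := cabs_ge0 (w - c).
apply: (@le_of_small _ _ _ (cabs (w - c) + 1)); first lra.
move=> q q0.
have [N hN] := hD q q0; have [N' hN'] := geo_small 2 q0.
pose k := maxn N N'.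
have n1 := hN k (leq_maxl _ _); have n2 := hN' k (leq_maxr _ _).
have := S k _ wr; rewrite [c + _]addrC subrK => s1.
have -> : f w - f c - (w - c) *: D = (f w - f c - (w - c) *: D1 (g k) c) +
   (w - c) *: (D1 (g k) c - D) by modring.
apply: le_trans (nmD _ _) _; rewrite nmZ.
have b1 : cabs (w - c) * nm (D1 (g k) c - D) <= cabs (w - c) * q by rewrite ler_wpM2l.
have b2 : (K + 1) * cabs (w - c) * cabs (w - c) <= e * cabs (w - c) by rewrite ler_wpM2r.
have b3 : 0 <= cabs (w - c) * cabs (w - c) by rewrite mulr_ge0.
move: s1 n2 b1 b2 b3; rewrite expr2; clear; lra.
Qed.

Lemma dif_locally_bounded f c r : 0 < r -> (forall z, cabs (z - c) < r -> dif f z) ->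
  exists M, exists2 d, 0 < d <= r & forall z, cabs (z - c) < d -> nm (f z) <= M.
Proof.
move=> r0 hf; have cc : cabs (c - c) < r by rewrite subrr cabs0.
have [d d0 hd] := cts_bound (dif_cts full (hf c cc)).
exists (nm (f c) + 1), (Num.min d r).
  by rewrite lt_min d0 r0 ge_min lexx orbT.
by move=> z; rewrite lt_min => /andP[h _]; exact: hd.
Qed.

(** Difference quotients with a fixed increment are differentiable and approximate the derivative
    uniformly, by the second-order remainder; [weierstrass] then applies. *)
Lemma dif_D1 f c r : 0 < r -> (forall z, cabs (z - c) < r -> dif f z) -> dif (D1 f) c.
Proof.
move=> r0 hf0.
have [M [d /andP[d0 dr] hM]] := dif_locally_bounded r0 hf0.
have hf z : cabs (z - c) < d -> dif f z by move=> h; apply: hf0; exact: lt_le_trans dr.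
have M0 := M_ge0 d0 hM.
pose K := 64 * M / (d / 2) ^+ 2.
have K0 : 0 <= K by rewrite /K divr_ge0 ?sqr_ge0 // mulr_ge0.
apply: (@weierstrass _ _ (d / 2) (8 * M / d + 1)); first lra.
move=> e e0.
pose t := Num.min (d / 16) (Num.min 1 e / (K + 1)).
have K1 : 0 < K + 1 by lra.
have t0 : 0 < t.
  by rewrite /t lt_min; apply/andP; split; [lra|rewrite divr_gt0 // lt_min ltr01].
have td : t <= d / 16 by rewrite /t ge_min lexx.
have Kt : K * t <= Num.min 1 e.
  have : (K + 1) * t <= Num.min 1 e by rewrite mulrC -ler_pdivlMr // /t ge_min lexx orbT.
  lra.
have Kt1 : K * t <= 1 by apply: le_trans Kt _; rewrite ge_min lexx.
have Kte : K * t <= e by apply: le_trans Kt _; rewrite ge_min lexx orbT.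
have ht : cabs (t%:C : R[i]) = t by rewrite cabs_real gtr0_norm.
have tn : (t%:C : R[i]) != 0 by rewrite -cabs_gt0 ht.
have err z : cabs (z - c) < d / 2 -> nm (D1 f z - t%:C^-1 *: (f (z + t%:C) - f z)) <= K * t.
  move=> hz.
  have sub w : cabs (w - z) < d / 2 -> cabs (w - c) < d.
    by move=> hw; have := cabsD (w - z) (z - c); rewrite subrKA; lra.
  have := @taylor2 f z (d / 2) M ltac:(lra) (fun w hw => hf w (sub w hw))
    (fun w hw => hM w (sub w hw)) t%:C.
  rewrite ht -/K => /(_ ltac:(lra)) T.
  rewrite -(ler_pM2l t0).
  have -> : t * nm (D1 f z - t%:C^-1 *: (f (z + t%:C) - f z)) =
      nm (- (f (z + t%:C) - f z - t%:C *: D1 f z)).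
    have -> : - (f (z + t%:C) - f z - t%:C *: D1 f z) =
        t%:C *: (D1 f z - t%:C^-1 *: (f (z + t%:C) - f z)).
      by rewrite scalerBr scalerA mulfV // scale1r opprB.
    by rewrite nmZ ht.
  rewrite nmN; apply: le_trans T _; rewrite expr2; lra.
exists (fun z => t%:C^-1 *: (f (z + t%:C) - f z)); split=> z hz.
- have [D hD] : dif f z by apply: hf; lra.
  have [E hE] : dif f (z + t%:C).
    by apply: hf; have := cabsD (z - c) t%:C; rewrite ht addrAC; lra.
  exists (t%:C^-1 *: (1 *: E - D)); apply: derZ; apply: derB hD.
  apply: (@der_comp _ _ _ full (fun z => z + t%:C) f) => //.
  by have := derD (der_id full z) (der_cst full t%:C z); rewrite addr0.
- have := err z hz; have := nm_bound (t%:C^-1 *: (f (z + t%:C) - f z)) (D1 f z).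
  have := D1_bound d0 hf hM hz; rewrite nmB; lra.
- by apply: le_trans (err z hz) _.
Qed.

(* The factor z - c makes f differentiable at c; it is divided out again
   with a Taylor expansion of order three. *)
Lemma removable f c r : 0 < r -> cts full f c ->
  (forall z, 0 < cabs (z - c) < r -> dif f z) -> dif f c.
Proof.
move=> r0 fc hf.
pose g z := (z - c) *: f z.
have gc : der full g c (f c).
  move=> e /fc [d d0 hd]; exists d => // w Sw wd.
  rewrite /g subrr scale0r subr0 -scalerBr nmZ mulrC ler_wpM2r ?cabs_ge0 //; exact: hd.
have hg z : cabs (z - c) < r -> dif g z.
  move=> hz; have [->|zc] := eqVneq z c; first by exists (f c).
  have [D hD] : dif f z by apply: hf; rewrite hz cabs_gt0 subr_eq0 zc.
  eexists; apply: derM hD; exact: derB (der_id _ _) (der_cst _ _ _).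
have hg1 z : cabs (z - c) < r -> dif (D1 g) z.
  move=> hz; apply: (@dif_D1 _ _ (r - cabs (z - c))); first by rewrite subr_gt0.
  by move=> w hw; apply: hg; have := cabsD (w - z) (z - c); rewrite subrKA; lra.
have [M [d /andP[d0 dr] hM]] := dif_locally_bounded r0 hg1.
have hgd z : cabs (z - c) < d -> dif (D1 g) z by move=> h; apply: hg1; exact: lt_le_trans dr.
have T := taylor2 d0 hgd hM; have M0 := M_ge0 d0 hM.
set K := 64 * M / d ^+ 2 in T.
have K0 : 0 <= K by rewrite /K divr_ge0 ?sqr_ge0 // mulr_ge0.
set G2 := D1 (D1 g) c in T.
have g1c : D1 g c = f c by exact: D1E gc.
(* The second-order expansion of [D1 g], integrated along a segment, gives the third-order expansion
   of [g]. Since g(c + h) = h f(c + h), dividing by [h] leaves the expansion of [f] with derivative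
   [2^-1 *: G2]. *)
have T3 h : cabs h < d / 4 -> nm (h *: f (c + h) - h *: f c - (h ^+ 2 / 2) *: G2) <= K * cabs h ^+ 3.
  move=> hh.
  have sh s : seg01 s -> cabs (s * h) <= cabs h.
    move=> [x x01 ->]; rewrite cabsM cabs_real ger0_norm; last by lra.
    by rewrite ler_piMl ?cabs_ge0 //; lra.
  pose k s := g (c + s * h) - (s * h) *: f c - (s ^+ 2 * (h ^+ 2 / 2)) *: G2.
  have -> : h *: f (c + h) - h *: f c - (h ^+ 2 / 2) *: G2 = k 1 - k 0.
    rewrite /k /g !mul1r !mul0r expr1n expr0n !addr0 subrr !mul1r !mul0r !scale0r !subr0.
    by rewrite [c + h]addrC addrK.
  apply: (mvi1 (f := k) (D := fun s => h *: (D1 g (c + s * h) - f c - (s * h) *: G2))).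
    move=> s hs.
    have d1 : der seg01 (fun s => s * h : R[i]) s h.
      by have := derM (der_id seg01 s) (der_cst seg01 h s); rewrite scaler0 add0r scale1r.
    have d2 : der seg01 (fun s => s ^+ 2 * (h ^+ 2 / 2) : R[i]) s (s * h ^+ 2).
      have := derM (derM (der_id seg01 s) (der_id seg01 s)) (der_cst seg01 (h ^+ 2 / 2) s).
      rewrite scaler0 add0r !scaleCE [(_ + _) * _](_ : _ = s * h ^+ 2); last by field.
      by apply: der_ext => w; rewrite !scaleCE expr2.
    have d3 : der seg01 (fun s => g (c + s * h)) s (h *: D1 g (c + s * h)).
      apply: (@der_comp _ _ _ full (fun s => c + s * h) g) => //; first exact: der_affine.
      apply: D1P; apply: hg; rewrite [c + _]addrC addrK; have := sh s hs; lra.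
    have := derB (derB d3 (derM d1 (der_cst seg01 (f c) s))) (derM d2 (der_cst seg01 G2 s)).
    rewrite !scaler0 !add0r.
    have -> : h *: (D1 g (c + s * h) - f c - (s * h) *: G2) =
      h *: D1 g (c + s * h) - h *: f c - (s * h ^+ 2) *: G2 by modring.
    by [].
  move=> s hs; rewrite nmZ exprS mulrCA ler_wpM2l ?cabs_ge0 //.
  have := T (s * h); rewrite g1c => /(_ ltac:(by have := sh s hs; lra)) /le_trans; apply.
  by rewrite ler_wpM2l // lerXn2r ?nnegrE ?cabs_ge0 //; exact: sh.
exists (2^-1 *: G2) => e e0.
pose t := Num.min (d / 4) (e / (K + 1)).
have K1 : 0 < K + 1 by lra.
exists t; first by rewrite /t lt_min; apply/andP; split; [lra|rewrite divr_gt0].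
move=> w _ wt.
have [->|wc] := eqVneq w c.
  by rewrite !subrr scale0r subr0 nm0 cabs0 mulr0.
have P : 0 < cabs (w - c) by rewrite cabs_gt0 subr_eq0.
have wr : cabs (w - c) < d / 4 by apply: lt_le_trans wt _; rewrite /t ge_min lexx.
have we : (K + 1) * cabs (w - c) <= e.
  by rewrite mulrC -ler_pdivlMr //; apply: le_trans (ltW wt) _; rewrite /t ge_min lexx orbT.
have := T3 _ wr; rewrite [c + _]addrC subrK.
have -> : (w - c) *: f w - (w - c) *: f c - ((w - c) ^+ 2 / 2) *: G2 =
   (w - c) *: (f w - f c - (w - c) *: (2^-1 *: G2)).
  by rewrite scalerA; modring.
rewrite nmZ exprS mulrCA ler_pM2l // => /le_trans; apply.
rewrite expr2 mulrA ler_wpM2r ?cabs_ge0 //; lra.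
Qed.

Lemma quot_dif_center f c r : 0 < r -> (forall z, cabs (z - c) < r -> dif f z) ->
  dif (quot f c) c.
Proof.
move=> r0 hf; apply: (removable r0).
  by apply: quot_cts; apply: hf; rewrite subrr cabs0.
by move=> z /andP[h1 h2]; apply: quot_dif; [rewrite -subr_eq0 -cabs_gt0|exact: hf].
Qed.

End Holomorphic.

(** * Linear differential equations *)

Section Annulus.
Variables (R : realType) (V : banachType R).
Local Notation seg01 := (@unit_seg R).
Local Notation full := (fun _ : R[i] => True).

Lemma Int_scalel (u : R[i] -> R[i]) (v : V) : cts01 u ->
  Int (fun s => u s *: v) = Int u *: v.
Proof.
move=> /primitive_exists [F F0 hF].
rewrite (IntE hF) (IntE (F := fun z => F z *: v)); first by rewrite -scalerBl.
by move=> z hz; have := derM (hF z hz) (der_cst seg01 v z); rewrite scaler0 add0r.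
Qed.

Section Kernel.
Variable z0 : R[i].
(** The numerator [z] converts a mean over a circle about 0 into a contour integral with kernel 1 /
    (z - z0). *)
Let k z : R[i] := z / (z - z0).

Lemma kernel_dif z : z != z0 -> dif k z.
Proof.
move=> zz; eexists; apply: derM (der_id _ _) _.
apply: (@der_comp _ _ _ full (fun w => w - z0) (fun w => w^-1)) => //.
  exact: derB (der_id _ _) (der_cst _ _ _).
by apply: der_inv; rewrite subr_eq0.
Qed.

(** The mean is the same for all radii beyond |z0|, and it tends to 1 as the radius grows. *)
Lemma cm_kernel_out r : cabs z0 < r -> cm k 0 r = 1.
Proof.
move=> hr; have a0 := cabs_ge0 z0.
have ne z : r <= cabs (z - 0) -> z != z0.
  by rewrite subr0 => h; apply: contraTneq h => ->; rewrite -ltNge.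
apply/eqP; rewrite -subr_eq0; apply/eqP/nm_small => e e0.
pose r' := r + (cabs z0 + 1) / e.
have P : 0 < (cabs z0 + 1) / e by apply: divr_gt0 => //; lra.
have r'r : r <= r' by rewrite /r'; lra.
rewrite (@cm_const _ _ k 0 r r'); [|lra|done|]; last first.
  by move=> z /andP[h _]; apply: kernel_dif; exact: ne.
have ck z : cabs (z - 0) = r' -> cts full k z.
  by move=> hz; apply/dif_cts/kernel_dif/ne; rewrite hz.
rewrite -[X in _ - X](cm_cst (1 : R[i]) 0 r') -cmB //; [|lra|by move=> *; exact: cts_cst].
apply: cm_le => [|z hz|z hz]; first lra.
  by apply: ctsB; [exact: ck|exact: cts_cst].
have zn : z - z0 != 0 by rewrite subr_eq0; apply: ne; rewrite hz.
have -> : k z - 1 = z0 / (z - z0) by rewrite /k; field.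
rewrite nmC cabsM cabsV ler_pdivrMr ?cabs_gt0 //.
have : r' <= cabs (z - z0) + cabs z0.
  by rewrite -hz subr0; have := cabsD (z - z0) z0; rewrite subrK.
rewrite /r' => h; have : (cabs z0 + 1) / e <= cabs (z - z0) by lra.
by rewrite ler_pdivrMr // [e * _]mulrC; lra.
Qed.

Lemma cm_kernel_in r : 0 < r < cabs z0 -> cm k 0 r = 0.
Proof.
move=> /andP[r0 hr].
have ne z : cabs (z - 0) <= r -> z != z0.
  by rewrite subr0 => h; apply: contraTneq h => ->; rewrite -ltNge.
rewrite cm_center //; first by rewrite /k mul0r.
  by apply: dif_cts; apply: kernel_dif; apply: ne; rewrite subrr cabs0 ltW.
by move=> z /andP[_ h]; apply: kernel_dif; exact: ne.
Qed.

End Kernel.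

(** Multiplied by z, the completed difference quotient at [z0] is differentiable on the whole
    annulus, so it has equal means over the two boundary circles; expanding these means gives
    Cauchy's formula. The weight [r1 / (cabs z0 - r1)] of the inner circle is kept explicit because
    it is the source of decay on the neck. *)
Lemma cauchy_annulus (f : R[i] -> V) z0 r1 r2 M1 M2 : 0 < r1 -> r1 < cabs z0 < r2 ->
  (forall z, r1 <= cabs z <= r2 -> dif f z) ->
  (forall z, cabs z = r1 -> nm (f z) <= M1) ->
  (forall z, cabs z = r2 -> nm (f z) <= M2) ->
  nm (f z0) <= M2 * (r2 / (r2 - cabs z0)) + M1 * (r1 / (cabs z0 - r1)).
Proof.
move=> r10 /andP[z1 z2] hf h1 h2.
pose k z : R[i] := z / (z - z0).
have zpos : 0 < cabs z0 by lra.
have r20 : 0 < r2 by lra.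
pose d := Num.min (cabs z0 - r1) (r2 - cabs z0).
have d0 : 0 < d by rewrite /d lt_min !subr_gt0 z1 z2.
have hd z : cabs (z - z0) < d -> r1 <= cabs z <= r2.
  rewrite /d lt_min => /andP[a1 a2].
  have := cabsD (z - z0) z0; rewrite subrK.
  have := cabsD (z0 - z) z; rewrite subrK (cabsB z0); lra.
have hq : dif (quot f z0) z0.
  by apply: (quot_dif_center d0) => z /hd; exact: hf.
pose h z := z *: quot f z0 z.
have hh z : r1 <= cabs z <= r2 -> dif h z.
  move=> hz; have [D hD] : dif (quot f z0) z.
    by have [->//|zz] := eqVneq z z0; apply: quot_dif => //; exact: hf.
  by eexists; apply: derM (der_id _ _) hD.
have E : cm h 0 r1 = cm h 0 r2.
  by apply: cm_const => //; [lra|move=> z; rewrite subr0; exact: hh].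
have ne z r : cabs (z - 0) = r -> r != cabs z0 -> z != z0.
  by rewrite subr0 => <-; apply: contra => /eqP ->.
have cmh r : r1 <= r <= r2 -> r != cabs z0 ->
    cm h 0 r = cm (fun z => k z *: f z) 0 r - cm k 0 r *: f z0.
  move=> hr rz; have rp : 0 <= r by lra.
  have ck z : cabs (z - 0) = r -> cts full k z.
    by move=> hz; apply: dif_cts; apply: kernel_dif; exact: (ne z r).
  have cf z : cabs (z - 0) = r -> cts full f z.
    by move=> hz; apply: dif_cts; apply: hf; rewrite -[z]subr0 hz.
  rewrite -[cm k 0 r *: _]Int_scalel; last exact: cts01_circ.
  rewrite -/(cm (fun z => k z *: f z0) 0 r) -cmB //; last first.
  - by move=> z hz; apply: ctsM (cts_cst _ _ _); exact: ck.
  - by move=> z hz; apply: ctsM; [exact: ck|exact: cf].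
  apply: Int_eq => s hs; have zz := ne _ _ (cabs_circ 0 rp hs) rz.
  by rewrite /h /quot (negbTE zz) scalerA -scalerBr.
have E2 := cmh r2 ltac:(lra) ltac:(by apply/eqP; lra).
have E1 := cmh r1 ltac:(lra) ltac:(by apply/eqP; lra).
rewrite cm_kernel_out // scale1r in E2.
rewrite cm_kernel_in ?r10 // scale0r subr0 in E1.
have -> : f z0 = cm (fun z => k z *: f z) 0 r2 - cm (fun z => k z *: f z) 0 r1.
  by rewrite -E1 E E2; modring.
apply: le_trans (nm_sub _ _) (lerD _ _).
  apply: cm_le => [|z hz|z hz]; first lra.
    by apply: ctsM; apply: dif_cts; [apply: kernel_dif; apply: (ne z r2) => //; apply/eqP; lra|
      apply: hf; rewrite -[z]subr0 hz; lra].
  rewrite subr0 in hz; rewrite nmZ mulrC.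
  have zz : r2 - cabs z0 <= cabs (z - z0).
    by rewrite -hz; have := cabsD (z - z0) z0; rewrite subrK; lra.
  apply: ler_pM; rewrite ?nm_ge0 ?cabs_ge0 //; first exact: h2.
  rewrite /k cabsM cabsV hz ler_wpM2l //; first lra.
  by rewrite lef_pV2 ?posrE //; lra.
apply: cm_le => [|z hz|z hz]; first lra.
  by apply: ctsM; apply: dif_cts; [apply: kernel_dif; apply: (ne z r1) => //; apply/eqP; lra|
    apply: hf; rewrite -[z]subr0 hz; lra].
rewrite subr0 in hz; rewrite nmZ mulrC.
have zz : cabs z0 - r1 <= cabs (z - z0).
  by rewrite -hz cabsB; have := cabsD (z0 - z) z; rewrite subrK; lra.
apply: ler_pM; rewrite ?nm_ge0 ?cabs_ge0 //; first exact: h1.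
rewrite /k cabsM cabsV hz ler_wpM2l //; first lra.
by rewrite lef_pV2 ?posrE //; lra.
Qed.

End Annulus.

(** * Linear equations with values in a Banach algebra *)

Section LinearODE.
Variables (R : realType) (B : balgType R).
Local Notation seg01 := (@unit_seg R).
Implicit Types (b c Y : R[i] -> B).

Lemma uniform_limit_cts (V : banachType R) (f : R[i] -> V) :
  (forall e : R, 0 < e -> exists2 g : R[i] -> V, cts01 g &
     forall z, seg01 z -> nm (f z - g z) <= e) -> cts01 f.
Proof.
move=> H z hz e e0; have [g cg hg] := H (e / 3) ltac:(lra).
have [d d0 hd] := cg z hz (e / 3) ltac:(lra).
exists d => // w hw wd; have := hd w hw wd; have := hg w hw; have := hg z hz.
have := nm_dist (g w) (f w) (f z); have := nm_dist (g z) (g w) (f z).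
rewrite (nmB (g z) (f z)); lra.
Qed.

Lemma picard_contraction (f g b : R[i] -> B) (M Q : R) : 0 <= M -> 0 <= Q ->
  (forall s, seg01 s -> nm (b s) <= M) -> f 0 = 0 ->
  (forall s, seg01 s -> der seg01 f s (g s * b s)) ->
  (forall x : R, 0 <= x <= 1 -> nm (g x%:C) <= 2 * Q * expR (2 * (M + 1) * x)) ->
  forall x : R, 0 <= x <= 1 -> nm (f x%:C) <= Q * expR (2 * (M + 1) * x).
Proof.
move=> M0 Q0 hM f0 df hg x x01; set l := 2 * (M + 1) in hg *.
apply: (@le_of_small _ _ _ x); first lra.
move=> e e0.
apply: (@comparison R B f (fun y => g y%:C * b y%:C)
  (fun y => Q * expR (l * y) + y * e) (fun y => l * (Q * expR (l * y)) + e)) => //.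
- by move=> y y01; apply: df; exists y.
- by rewrite f0 nm0 mulr0 mul0r addr0 expR0 mulr1.
- move=> y y01 _; have hy : seg01 y%:C by exists y.
  apply: le_lt_trans (nm_mul _ _) _.
  have := ler_pM (nm_ge0 _) (nm_ge0 _) (hg y y01) (hM _ hy).
  have : 0 <= Q * expR (l * y) by rewrite mulr_ge0 // expR_ge0.
  by rewrite /l; lra.
- move=> y h y0' h0 yh; rewrite [l * (y + h)]mulrDr expRD.
  have := expR_ge1Dx (l * h) => h1.
  have P : 0 <= Q * expR (l * y) by rewrite mulr_ge0 // expR_ge0.
  have -> : Q * expR (l * y) + y * e + h * (l * (Q * expR (l * y)) + e) =
    Q * expR (l * y) * (1 + l * h) + (y + h) * e by ring.
  by rewrite lerD2r mulrA ler_wpM2l.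
Qed.

Lemma ode_exists b c (y0 : B) : cts01 b -> cts01 c ->
  exists Y, Y 0 = y0 /\ forall s, seg01 s -> der seg01 Y s (Y s * b s + c s).
Proof.
move=> cb cc; have [M M0 hM] := cts_bounded cb.
have /choice [next hnext] : forall Z : R[i] -> B, exists Z', cts01 Z ->
    Z' 0 = y0 /\ forall s, seg01 s -> der seg01 Z' s (Z s * b s + c s).
  move=> Z; case: (pselect (cts01 Z)) => [cZ|]; last by exists Z.
  have [|F F0 hF] := @primitive_exists R B (fun s => Z s * b s + c s).
    by move=> s hs; apply: ctsD; [apply: cts_mul; [exact: cZ|exact: cb]|exact: cc].
  exists (fun s => y0 + F s) => _; split; first by rewrite F0 addr0.
  by move=> s hs; have := derD (der_cst seg01 y0 s) (hF s hs); rewrite add0r.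
pose Z k := iter k next (fun=> y0).
have cZ k : cts01 (Z k).
  elim: k => [|k IH]; first by move=> s _; exact: cts_cst.
  by have [_ h] := hnext _ IH; move=> s hs; exact: der_cts (h s hs).
have Z0 k : Z k 0 = y0 by case: k => [//|k]; have [] := hnext _ (cZ k).
have dZ k s : seg01 s -> der seg01 (Z k.+1) s (Z k s * b s + c s).
  by move=> hs; have [_ h] := hnext _ (cZ k); exact: h.
have [A A0 hA] : exists2 A : R, 0 <= A & forall s, seg01 s -> nm (Z 1%N s - Z 0%N s) <= A.
  by apply: cts_bounded => s hs; apply: ctsB; exact: cZ.
pose l := 2 * (M + 1).
have step k : forall x : R, 0 <= x <= 1 ->
    nm (Z k.+1 x%:C - Z k x%:C) <= A / 2 ^+ k * expR (l * x).
  elim: k => [|k IH] x x01.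
    rewrite expr0 divr1; apply: le_trans (hA _ _) _; first by exists x.
    rewrite ler_peMr //; have := expR_ge1Dx (l * x).
    have : 0 <= l * x by rewrite mulr_ge0 // /l; lra.
    lra.
  have Q0 : 0 <= A / 2 ^+ k.+1 by rewrite divr_ge0 // exprn_ge0.
  apply: (@picard_contraction (fun s => Z k.+2 s - Z k.+1 s) (fun s => Z k.+1 s - Z k s) b) => //.
  - by rewrite !Z0 subrr.
  - move=> s hs; have := derB (dZ k.+1 s hs) (dZ k s hs).
    by rewrite mulrBl; congr der; modring.
  - move=> y /IH; have -> // : A / 2 ^+ k = 2 * (A / 2 ^+ k.+1).
    by rewrite exprS; field; rewrite lt0r_neq0 // exprn_gt0.
have lim s : exists z, seg01 s -> forall k, nm (z - Z k s) <= 2 * (A * expR l) / 2 ^+ k.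
  case: (pselect (seg01 s)) => [hs|]; last by exists 0.
  have [|z hz] := @geometric_limit R B (fun k => Z k s) (A * expR l); last by exists z.
  move=> k; case: hs => x x01 ->; apply: le_trans (step k x x01) _.
  rewrite mulrAC ler_wpM2r ?invr_ge0 ?exprn_ge0 // ler_wpM2l // ler_expR.
  rewrite -[leRHS]mulr1 ler_wpM2l //; [rewrite /l; lra|lra].
have /choice [Y hY] := lim.
have cY : cts01 Y.
  apply: uniform_limit_cts => e e0; have [N hN] := geo_small (2 * (A * expR l)) e0.
  by exists (Z N) => // s hs; apply: le_trans (hY s hs N) _; exact: hN.
have [Y0 dY] := hnext _ cY.
exists (next Y); split=> // s hs.
(* Both [Y] and [next Y] lie within a multiple of 2^-N of [Z N.+1], hence the limit is a fixed
   point. *)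
suff E : next Y s = Y s by rewrite E; exact: dY.
apply/eqP; rewrite -subr_eq0; apply/eqP/nm_small => e e0.
have [N hN] := geo_small (2 * (A * expR l) * (M + 1)) e0.
have hN' := hN N (leqnn N).
pose q := 2 * (A * expR l) / 2 ^+ N.
have q0 : 0 <= q by rewrite /q divr_ge0 ?exprn_ge0 // mulr_ge0 // mulr_ge0 // expR_ge0.
have qe : q * M + q <= e.
  by have -> : q * M + q = 2 * (A * expR l) * (M + 1) / 2 ^+ N by rewrite /q; ring.
have h1 : nm (next Y s - Z N.+1 s) <= q * M.
  case: (hs) => x x01 E.
  have H : nm (next Y x%:C - Z N.+1 x%:C - 0) <= q * M * x.
    have -> : next Y x%:C - Z N.+1 x%:C - 0 = next Y x%:C - Z N.+1 x%:C - (next Y 0 - Z N.+1 0).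
      by rewrite Y0 Z0 subrr.
    apply: (@mvi R B (fun s => next Y s - Z N.+1 s) (fun s => (Y s - Z N s) * b s)) => //.
      move=> w hw; have := derB (dY w hw) (dZ N w hw).
      by rewrite mulrBl; congr der; modring.
    move=> w hw; apply: le_trans (nm_mul _ _) _; apply: ler_pM; rewrite ?nm_ge0 //.
      exact: hY.
    exact: hM.
  rewrite subr0 -E in H; apply: le_trans H _; rewrite ler_piMr //; last by lra.
  exact: mulr_ge0.
have h2 : nm (Y s - Z N.+1 s) <= q.
  apply: le_trans (hY s hs N.+1) _; rewrite /q exprS invfM mulrA.
  have : 0 <= q by [].
  rewrite /q; lra.
have := nm_dist (Z N.+1 s) (next Y s) (Y s); rewrite (nmB (Z N.+1 s) (Y s)).
lra.
Qed.

Lemma ode_unique b c Y Y' : cts01 b -> Y 0 = Y' 0 ->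
  (forall s, seg01 s -> der seg01 Y s (Y s * b s + c s)) ->
  (forall s, seg01 s -> der seg01 Y' s (Y' s * b s + c s)) ->
  forall s, seg01 s -> Y s = Y' s.
Proof.
move=> cb E0 hY hY' s hs; have [M M0 hM] := cts_bounded cb.
apply/eqP; rewrite -subr_eq0; apply/eqP/nm_le0.
have := @gronwall R B (fun s => Y s - Y' s) (fun s => (Y s - Y' s) * b s) M 0 0 M0 (lexx _).
rewrite addr0 mul0r; apply=> //; last by rewrite E0 subrr nm0.
  move=> w hw; have := derB (hY w hw) (hY' w hw).
  by rewrite mulrBl; congr der; modring.
move=> w hw; rewrite addr0 mulrC; apply: le_trans (nm_mul _ _) _.
by rewrite ler_wpM2l ?nm_ge0 // hM.
Qed.

Definition sol b Y := Y 0 = 1 /\ forall s, seg01 s -> der seg01 Y s (Y s * b s).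

(** The equation Y' = Y b has its coefficient on the right, so transports along successive paths
    multiply from left to right. *)
Definition transport b : B := epsilon (inhabits 0) (fun X => exists2 Y, sol b Y & X = Y 1).

Lemma sol_exists b : cts01 b -> exists Y, sol b Y.
Proof.
move=> cb; have [Y [Y0 hY]] := @ode_exists b (fun=> 0) 1 cb (fun z _ => cts_cst _ _ _).
by exists Y; split=> // s hs; have := hY s hs; rewrite addr0.
Qed.

Lemma ode_unique_hom b Y Y' : cts01 b -> Y 0 = Y' 0 ->
  (forall s, seg01 s -> der seg01 Y s (Y s * b s)) ->
  (forall s, seg01 s -> der seg01 Y' s (Y' s * b s)) ->
  forall s, seg01 s -> Y s = Y' s.
Proof.
move=> cb E h h'; apply: (@ode_unique b (fun=> 0)) => // s hs; rewrite addr0.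
  exact: h.
exact: h'.
Qed.

Lemma transportE b Y : cts01 b -> sol b Y -> transport b = Y 1.
Proof.
move=> cb hY.
have [Y' [Y'0 h'] ->] : exists2 Y', sol b Y' & transport b = Y' 1.
  apply: (epsilon_spec (inhabits (0 : B)) (fun X => exists2 Y, sol b Y & X = Y 1)).
  by exists (Y 1), Y.
case: hY => Y0 h; apply: (ode_unique_hom cb) => //; last exact: unit_seg1.
by rewrite Y0.
Qed.

Lemma sol_bound b Y M : 0 <= M -> (forall s, seg01 s -> nm (b s) <= M) -> sol b Y ->
  forall s, seg01 s -> nm (Y s) <= nm (1 : B) * expR (M + 1).
Proof.
move=> M0 hM [Y0 h] s hs.
have := @gronwall R B Y (fun s => Y s * b s) M 0 (nm (1 : B)) M0 (lexx _) h.
rewrite addr0; apply => //; last by rewrite Y0.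
move=> w hw; rewrite addr0 mulrC; apply: le_trans (nm_mul _ _) _.
by rewrite ler_wpM2l ?nm_ge0 // hM.
Qed.

(* The difference Y - Y' solves a linear equation with small source. *)
Lemma sol_diff b b' Y Y' M e : 0 <= M -> 0 <= e ->
  (forall s, seg01 s -> nm (b s) <= M) -> (forall s, seg01 s -> nm (b' s) <= M) ->
  (forall s, seg01 s -> nm (b' s - b s) <= e) -> sol b Y -> sol b' Y' ->
  forall s, seg01 s ->
    nm (Y' s - Y s) <= nm (1 : B) * expR (M + 1) * e * expR (M + 1).
Proof.
move=> M0 e0 hb hb' he hY hY' s hs.
have Yb := sol_bound M0 hb' hY'.
case: hY hY' => Y0 h [Y'0 h'].
have C0 : 0 <= nm (1 : B) * expR (M + 1) by rewrite mulr_ge0 ?nm_ge0 ?expR_ge0.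
have := @gronwall R B (fun s => Y' s - Y s)
  (fun s => (Y' s - Y s) * b s + Y' s * (b' s - b s)) M (nm (1 : B) * expR (M + 1) * e) 0
  M0 (mulr_ge0 C0 e0).
rewrite add0r; apply => //; last by rewrite Y0 Y'0 subrr nm0.
  move=> w hw; have := derB (h' w hw) (h w hw).
  by congr der; rewrite mulrBl mulrBr; modring.
move=> w hw; apply: le_trans (nmD _ _) (lerD _ _).
  by rewrite mulrC; apply: le_trans (nm_mul _ _) _; rewrite ler_wpM2l ?nm_ge0 // hb.
by apply: le_trans (nm_mul _ _) _; apply: ler_pM; rewrite ?nm_ge0 ?Yb ?he.
Qed.

Section ParameterDependence.
Variables (b : R[i] -> R[i] -> B) (c : R[i]) (r M : R).
Hypotheses (r_gt0 : 0 < r)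
  (b_dif : forall t s, cabs (t - c) < r -> seg01 s -> dif (b ^~ s) t)
  (b_le : forall t s, cabs (t - c) < r -> seg01 s -> nm (b t s) <= M)
  (b_cts : forall t, cabs (t - c) < r -> cts01 (b t)).

(** The derivative in the parameter is a uniform limit, in [s], of difference quotients with fixed
    increment, each of which is continuous in [s]. *)
Lemma cts_param_D1 : cts01 (fun s => D1 (b ^~ s) c).
Proof.
have r0 := r_gt0; have hd := @b_dif; have hM := @b_le; have hc := @b_cts.
have cc : cabs (c - c) < r by rewrite subrr cabs0.
have M0 : 0 <= M by apply: le_trans (nm_ge0 _) (hM c 0 cc (unit_seg0 R)).
pose db s := D1 (b ^~ s) c.
pose K := 64 * M / r ^+ 2.
have K0 : 0 <= K by rewrite /K divr_ge0 ?sqr_ge0 // mulr_ge0.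
pose L := 8 * M / r.
have L0 : 0 <= L by rewrite /L divr_ge0 ?mulr_ge0 // ltW.
have T s h : seg01 s -> cabs h < r / 4 ->
    nm (b (c + h) s - b c s - h *: db s) <= K * cabs h ^+ 2.
  move=> hs; apply: (@taylor2 R B (b ^~ s) c r M) => // z hz; [exact: hd|exact: hM].
have Lip s h : seg01 s -> cabs h < r / 4 -> nm (b (c + h) s - b c s) <= L * cabs h.
  move=> hs hh.
  have -> : cabs h = cabs (c + h - c) by rewrite [c + h]addrC addrK.
  apply: (@hol_lipschitz R B (b ^~ s) c r M) => // [z hz|z hz||].
  - exact: hd.
  - exact: hM.
  - by rewrite subrr cabs0; lra.
  - by rewrite [c + h]addrC addrK; lra.
have dbM s : seg01 s -> nm (db s) <= L.
  move=> hs; apply: (@D1_bound R B (b ^~ s) c r M) => // [z hz|z hz|].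
  - exact: hd.
  - exact: hM.
  - by rewrite subrr cabs0; lra.
have chc h : cabs h < r / 4 -> cabs (c + h - c) < r by rewrite [c + h]addrC addrK; lra.
rewrite -/db.
apply: uniform_limit_cts => e e0.
pose t := Num.min (r / 8) (e / (K + 1)).
have K1 : 0 < K + 1 by lra.
have t0 : 0 < t by rewrite /t lt_min; apply/andP; split; [lra|rewrite divr_gt0].
have tr : t <= r / 8 by rewrite /t ge_min lexx.
have te : (K + 1) * t <= e by rewrite mulrC -ler_pdivlMr // /t ge_min lexx orbT.
have ht : cabs (t%:C : R[i]) = t by rewrite cabs_real gtr0_norm.
have tn : (t%:C : R[i]) != 0 by rewrite -cabs_gt0 ht.
exists (fun s => t%:C^-1 *: (b (c + t%:C) s - b c s)).
  move=> s hs; apply: ctsZ; apply: ctsB; apply: hc => //; apply: chc; rewrite ht; lra.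
move=> s hs; rewrite -(ler_pM2l t0).
have -> : t * nm (db s - t%:C^-1 *: (b (c + t%:C) s - b c s)) =
    nm (- (b (c + t%:C) s - b c s - t%:C *: db s)).
  have -> : - (b (c + t%:C) s - b c s - t%:C *: db s) =
      t%:C *: (db s - t%:C^-1 *: (b (c + t%:C) s - b c s)).
    by rewrite scalerBr scalerA mulfV // scale1r opprB.
  by rewrite nmZ ht.
rewrite nmN; apply: le_trans (T s t%:C hs _) _; rewrite ht; first lra.
have : t * ((K + 1) * t) <= t * e by rewrite ler_wpM2l // ltW.
by have := sqr_ge0 t; rewrite expr2; lra.
Qed.

(* With V' = V b + Y (db/dt), the error E = Y_(t+h) - Y_t - h V satisfies a
   linear equation whose source is quadratic in h. *)
Lemma transport_der Y V : sol (b c) Y -> V 0 = 0 ->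
  (forall s, seg01 s -> der seg01 V s (V s * b c s + Y s * D1 (b ^~ s) c)) ->
  der (fun=> True) (fun t => transport (b t)) c (V 1).
Proof.
move=> hY V0 hV.
have r0 := r_gt0; have hd := @b_dif; have hM := @b_le; have hc := @b_cts.
have cc : cabs (c - c) < r by rewrite subrr cabs0.
have M0 : 0 <= M by apply: le_trans (nm_ge0 _) (hM c 0 cc (unit_seg0 R)).
pose db s := D1 (b ^~ s) c.
pose K := 64 * M / r ^+ 2.
have K0 : 0 <= K by rewrite /K divr_ge0 ?sqr_ge0 // mulr_ge0.
pose L := 8 * M / r.
have L0 : 0 <= L by rewrite /L divr_ge0 ?mulr_ge0 // ltW.
have T s h : seg01 s -> cabs h < r / 4 ->
    nm (b (c + h) s - b c s - h *: db s) <= K * cabs h ^+ 2.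
  move=> hs; apply: (@taylor2 R B (b ^~ s) c r M) => // z hz; [exact: hd|exact: hM].
have Lip s h : seg01 s -> cabs h < r / 4 -> nm (b (c + h) s - b c s) <= L * cabs h.
  move=> hs hh.
  have -> : cabs h = cabs (c + h - c) by rewrite [c + h]addrC addrK.
  apply: (@hol_lipschitz R B (b ^~ s) c r M) => // [z hz|z hz||].
  - exact: hd.
  - exact: hM.
  - by rewrite subrr cabs0; lra.
  - by rewrite [c + h]addrC addrK; lra.
have dbM s : seg01 s -> nm (db s) <= L.
  move=> hs; apply: (@D1_bound R B (b ^~ s) c r M) => // [z hz|z hz|].
  - exact: hd.
  - exact: hM.
  - by rewrite subrr cabs0; lra.
have chc h : cabs h < r / 4 -> cabs (c + h - c) < r by rewrite [c + h]addrC addrK; lra.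
pose C := nm (1 : B) * expR (M + 1).
have C0 : 0 <= C by rewrite /C mulr_ge0 ?nm_ge0 ?expR_ge0.
pose Q := (C * K + C * L * expR (M + 1) * L).
have Q0 : 0 <= Q.
  by apply: addr_ge0; do ?[exact: K0|exact: L0|exact: C0|exact: expR_ge0|apply: mulr_ge0].
pose W := Q * expR (M + 1).
have W0 : 0 <= W by rewrite /W mulr_ge0 ?expR_ge0.
move=> e e0.
pose d := Num.min (r / 4) (e / (W + 1)).
exists d; first by rewrite /d lt_min; apply/andP; split; [lra|rewrite divr_gt0 //; lra].
move=> w _ wd; pose h := w - c.
have hr : cabs h < r / 4 by apply: lt_le_trans wd _; rewrite /d ge_min lexx.
have he : (W + 1) * cabs h <= e.
  rewrite mulrC -ler_pdivlMr; last by lra.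
  by apply: le_trans (ltW wd) _; rewrite /d ge_min lexx orbT.
have wE : w = c + h by rewrite /h [c + _]addrC subrK.
have [Yh hYh] := sol_exists (hc _ (chc h hr)).
rewrite (transportE (hc c cc) hY) wE (transportE (hc _ (chc h hr)) hYh).
have -> : c + h - c = h by rewrite [c + h]addrC addrK.
have h0 := cabs_ge0 h.
have G s : seg01 s -> nm (Yh s - Y s) <= C * L * expR (M + 1) * cabs h.
  move=> hs; have -> : C * L * expR (M + 1) * cabs h = C * (L * cabs h) * expR (M + 1) by ring.
  apply: (@sol_diff (b c) (b (c + h))) => //; first exact: mulr_ge0.
  - by move=> v hv; exact: hM.
  - by move=> v hv; apply: hM => //; exact: chc.
  - by move=> v hv; exact: Lip.
have Yb := sol_bound M0 (fun s hs => hM _ s (chc h hr) hs) hYh.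
case: hY hYh => Y0 hY [Yh0 hYh].
have E : nm (Yh 1 - Y 1 - h *: V 1) <= (0 + Q * cabs h ^+ 2) * expR (M + 1).
  apply: (@gronwall R B (fun s => Yh s - Y s - h *: V s)
    (fun s => (Yh s - Y s - h *: V s) * b c s +
      (Yh s * (b (c + h) s - b c s - h *: db s) + h *: ((Yh s - Y s) * db s))) M) => //.
  - by rewrite mulr_ge0 ?sqr_ge0.
  - move=> s hs; have := derB (derB (hYh s hs) (hY s hs)) (derZ h (hV s hs)).
    congr der; rewrite !(mulrBl, mulrBr, scalerDr, scalerBr) -?scalerAl -?scalerAr.
    modring.
  - move=> s hs; apply: le_trans (nmD _ _) (lerD _ _).
      by rewrite mulrC; apply: le_trans (nm_mul _ _) _; rewrite ler_wpM2l ?nm_ge0 ?hM.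
    apply: le_trans (nmD _ _) _.
    have -> : Q * cabs h ^+ 2 = C * (K * cabs h ^+ 2) +
        cabs h * (C * L * expR (M + 1) * cabs h * L) by rewrite /Q; ring.
    apply: lerD.
      by apply: le_trans (nm_mul _ _) _; apply: ler_pM; rewrite ?nm_ge0 ?Yb ?T.
    rewrite nmZ ler_wpM2l //; apply: le_trans (nm_mul _ _) _.
    by apply: ler_pM; rewrite ?nm_ge0 ?G ?dbM.
  - by rewrite V0 Y0 Yh0 subrr scaler0 subrr nm0.
  - exact: unit_seg1.
apply: le_trans E _; rewrite add0r.
have -> : Q * cabs h ^+ 2 * expR (M + 1) = W * cabs h * cabs h by rewrite /W; ring.
by rewrite ler_wpM2r //; lra.
Qed.

Lemma transport_dif : dif (fun t => transport (b t)) c.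
Proof.
have cc : cabs (c - c) < r by rewrite subrr cabs0 r_gt0.
have hc := @b_cts; have [Y hY] := sol_exists (hc c cc).
have cY : cts01 Y by case: hY => _ h s hs; exact: der_cts (h s hs).
have [V [V0 hV]] := @ode_exists (b c) (fun s => Y s * D1 (b ^~ s) c) 0 (hc c cc)
   (fun s hs => cts_mul (cY s hs) (cts_param_D1 hs)).
by exists (V 1); exact: transport_der hY V0 hV.
Qed.

End ParameterDependence.

End LinearODE.

(** * Transport along segments, exponential *)

Section DifRules.
Variable R : realType.
Local Notation full := (fun _ : R[i] => True).
Implicit Types V : banachType R.

Lemma dif_cst V (v : V) z : dif (fun=> v) z.
Proof. by exists 0; exact: der_cst. Qed.

Lemma dif_id (z : R[i]) : dif (fun w : R[i] => w : R[i]) z.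
Proof. by exists 1; exact: der_id. Qed.

Lemma difD V (f g : R[i] -> V) z : dif f z -> dif g z -> dif (fun w => f w + g w) z.
Proof. by move=> [D hD] [E hE]; exists (D + E); exact: derD. Qed.

Lemma difB V (f g : R[i] -> V) z : dif f z -> dif g z -> dif (fun w => f w - g w) z.
Proof. by move=> [D hD] [E hE]; exists (D - E); exact: derB. Qed.

Lemma difZ V (a : R[i]) (f : R[i] -> V) z : dif f z -> dif (fun w => a *: f w) z.
Proof. by move=> [D hD]; exists (a *: D); exact: derZ. Qed.

Lemma difM V (u : R[i] -> R[i]) (f : R[i] -> V) z :
  dif u z -> dif f z -> dif (fun w => u w *: f w) z.
Proof. by move=> [D hD] [E hE]; eexists; exact: derM hD hE. Qed.

Lemma dif_mul (B : balgType R) (f g : R[i] -> B) z :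
  dif f z -> dif g z -> dif (fun w => f w * g w) z.
Proof. by move=> [D hD] [E hE]; eexists; exact: der_mul hD hE. Qed.

Lemma dif_exp (B : balgType R) (f : R[i] -> B) k z : dif f z -> dif (fun w => f w ^+ k) z.
Proof.
move=> hf; elim: k => [|k IH]; first exact: dif_cst.
have -> : (fun w => f w ^+ k.+1) = (fun w => f w * f w ^+ k).
  by apply/funext => w; rewrite exprS.
exact: dif_mul.
Qed.

Lemma dif_sum V k (F : nat -> R[i] -> V) z : (forall i, dif (F i) z) ->
  dif (fun w => \sum_(i < k) F i w) z.
Proof.
move=> hF; elim: k => [|k IH].
  have -> : (fun w => \sum_(i < 0) F i w) = fun=> 0 by apply/funext => w; rewrite big_ord0.
  exact: dif_cst.
have -> : (fun w => \sum_(i < k.+1) F i w) = (fun w => \sum_(i < k) F i w + F k w).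
  by apply/funext => w; rewrite big_ord_recr.
exact: difD.
Qed.

Lemma dif_comp V (u : R[i] -> R[i]) (f : R[i] -> V) z :
  dif u z -> dif f (u z) -> dif (fun w => f (u w)) z.
Proof.
by move=> [D hD] [E hE]; eexists; apply: (@der_comp _ _ _ full u f _ _ _ hD) => //; exact: hE.
Qed.

Lemma dif_affine (a b : R[i]) z : dif (fun w => a + w * b : R[i]) z.
Proof. by exists b; exact: der_affine. Qed.

Lemma dif_cexp (z : R[i]) : dif (@cexp R) z.
Proof. by exists (cexp z); exact: der_cexp. Qed.

End DifRules.

Section ParallelTransport.
Variables (R : realType) (B : balgType R).
Local Notation seg01 := (@unit_seg R).
Local Notation full := (fun _ : R[i] => True).

(** Transport of the form [b dz] along the straight segment. On a convex domain it represents
    transport along every path with the same end points, by [Seg_path]. *)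
Definition Seg (b : R[i] -> B) (z w : R[i]) : B :=
  transport (fun s => (w - z) *: b (z + s * (w - z))).

Definition openC (U : R[i] -> Prop) := forall z, U z -> exists2 r : R, 0 < r &
  forall w, cabs (w - z) < r -> U w.

Variables (U : R[i] -> Prop) (b : R[i] -> B) (M : R).
Hypotheses (cU : convexC U) (oU : openC U) (difb : forall z, U z -> dif b z)
  (leb : forall z, U z -> nm (b z) <= M).

Lemma cts_seg_coef z w : U z -> U w -> cts01 (fun s => (w - z) *: b (z + s * (w - z))).
Proof.
move=> Uz Uw s hs; apply: ctsZ.
apply: (@cts_comp _ _ _ full (fun s => z + s * (w - z)) b) => //.
  exact: der_cts (der_affine _ _ _ _).
by apply: dif_cts; apply: difb; exact: seg_in_convex.
Qed.

Lemma Seg_id z : U z -> Seg b z z = 1.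
Proof.
move=> Uz; rewrite /Seg (transportE (Y := fun=> 1)) //; first exact: cts_seg_coef.
split=> // s hs; rewrite subrr scale0r mulr0; exact: der_cst.
Qed.

(* The variation of the transport along the segment from z to w with respect to w is
   V s = Y s * (s b), which solves V' = V b_w + Y (d b_w / dw). *)
Lemma Seg_der z w : U z -> U w -> der full (Seg b z) w (Seg b z w * b w).
Proof.
move=> Uz Uw; have [r r0 hr] := oU Uw.
have cw := cts_seg_coef Uz Uw.
have [Y hY] := sol_exists cw.
have Ec v s : U v -> seg01 s -> U (z + s * (v - z)) by move=> Uv hs; exact: seg_in_convex.
have hD s : seg01 s -> der full (fun t => (t - z) *: b (z + s * (t - z))) w
    (b (z + s * (w - z)) + (w - z) *: (s *: D1 b (z + s * (w - z)))).
  move=> hs.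
  have d1 : der full (fun t : R[i] => t - z : R[i]) w 1.
    by have := derB (der_id full w) (der_cst full z w); rewrite subr0.
  have d2 : der full (fun t : R[i] => z + s * (t - z) : R[i]) w s.
    have := derD (der_cst full z w) (derZ s d1).
    by rewrite add0r scaleCE mulr1.
  have d3 := D1P (difb (Ec w s Uw hs)).
  have := derM d1 (@der_comp _ _ _ full (fun t => z + s * (t - z)) b w s _ d2 (fun _ _ => I) d3).
  by rewrite scale1r addrC.
rewrite [X in der _ X _ _](_ : Seg b z = fun t => transport (fun s => (t - z) *: b (z + s * (t - z)))) //.
have -> : Seg b z w * b w = Y 1 * (1 *: b (z + 1 * (w - z))).
  by rewrite /Seg (transportE cw hY) mul1r scale1r [z + _]addrC subrK.
have M0 : 0 <= M by apply: le_trans (nm_ge0 _) (leb Uz).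
apply: (@transport_der R B (fun t s => (t - z) *: b (z + s * (t - z))) w r
  ((cabs (w - z) + r) * M) r0 _ _ _ Y (fun s => Y s * (s *: b (z + s * (w - z))))) => //.
- move=> t s /hr Ut hs; apply: difM.
    by apply: difB; [exact: dif_id|exact: dif_cst].
  apply: (@dif_comp _ _ (fun t => z + s * (t - z)) b); last by apply: difb; exact: Ec.
  apply: difD; first exact: dif_cst.
  by apply: (@difZ R R[i] s (fun t => t - z)); apply: difB; [exact: dif_id|exact: dif_cst].
- move=> t s tr hs; have Ut := hr t tr; rewrite nmZ; apply: ler_pM; rewrite ?cabs_ge0 ?nm_ge0 //.
    by have := cabsD (t - w) (w - z); rewrite subrKA; lra.
  by apply: leb; exact: Ec.
- by move=> t /hr Ut; exact: cts_seg_coef.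
- by rewrite scale0r mulr0.
- move=> s hs; case: hY => Y0 hY.
  have d1 : der seg01 (fun s => b (z + s * (w - z))) s ((w - z) *: D1 b (z + s * (w - z))).
    apply: (@der_comp _ _ _ full (fun s => z + s * (w - z)) b) => //; first exact: der_affine.
    by apply: D1P; apply: difb; exact: Ec.
  have := der_mul (hY s hs) (derM (der_id seg01 s) d1).
  rewrite (D1E (hD s hs)) scale1r; congr der.
  rewrite -!scalerAr -!scalerAl -!mulrA !mulrDr -!scalerAr; modring.
Qed.

(** Path independence without homotopies: by [Seg_der] and the chain rule, the segment transport to
    the moving point [c s] solves the equation along [c]. *)
Lemma Seg_path (c dc : R[i] -> R[i]) : (forall s, seg01 s -> U (c s)) ->
  (forall s, seg01 s -> der seg01 c s (dc s)) -> cts01 dc ->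
  transport (fun s => dc s *: b (c s)) = Seg b (c 0) (c 1).
Proof.
move=> hU hc cdc.
rewrite (transportE (Y := fun s => Seg b (c 0) (c s))) //.
  move=> s hs; apply: ctsM; first exact: cdc.
  apply: (@cts_comp _ _ _ full c b) => //; first exact: der_cts (hc s hs).
  by apply: dif_cts; apply: difb; exact: hU.
have U0 := hU 0 (unit_seg0 R).
split; first exact: Seg_id.
move=> s hs; rewrite -scalerAr.
apply: (@der_comp _ _ _ full c (Seg b (c 0))) => //; first exact: hc.
by apply: Seg_der => //; exact: hU.
Qed.

(** Along the segment from [w] to [v] both sides, as functions of the end point, solve the same
    equation with the same initial value. *)
Lemma Seg_mul z w v : U z -> U w -> U v -> Seg b z w * Seg b w v = Seg b z v.
Proof.
move=> Uz Uw Uv.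
have cv := cts_seg_coef Uw Uv.
have [Y hY] := sol_exists cv.
rewrite [Seg b w v](transportE cv hY).
case: hY => Y0 hY.
have := @ode_unique_hom R B (fun s => (v - w) *: b (w + s * (v - w)))
  (fun s => Seg b z w * Y s) (fun s => Seg b z (w + s * (v - w))) cv.
rewrite Y0 mulr1 mul0r addr0 => /(_ erefl).
have Us s : seg01 s -> U (w + s * (v - w)) by move=> hs; exact: seg_in_convex.
move=> H; rewrite {}H; last exact: unit_seg1.
- by rewrite mul1r [w + _]addrC subrK.
- by move=> s hs; have := der_mul (der_cst seg01 (Seg b z w) s) (hY s hs); rewrite mul0r addr0 mulrA.
- move=> s hs; rewrite -scalerAr.
  apply: (@der_comp _ _ _ full (fun s => w + s * (v - w)) (Seg b z)) => //.
    exact: der_affine.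
  exact: Seg_der Uz (Us s hs).
Qed.

Lemma Seg_le z w : U z -> U w ->
  nm (Seg b z w) <= nm (1 : B) * expR (cabs (w - z) * M + 1).
Proof.
move=> Uz Uw; have cv := cts_seg_coef Uz Uw.
have [Y hY] := sol_exists cv.
rewrite /Seg (transportE cv hY).
have M0 : 0 <= M by apply: le_trans (nm_ge0 _) (leb Uz).
apply: (sol_bound _ _ hY (unit_seg1 R)); first by rewrite mulr_ge0 ?cabs_ge0.
move=> s hs; rewrite nmZ ler_wpM2l ?cabs_ge0 // leb //; exact: seg_in_convex.
Qed.

End ParallelTransport.

Section Exponential.
Variables (R : realType) (B : balgType R).
Local Notation seg01 := (@unit_seg R).
Local Notation full := (fun _ : R[i] => True).
Implicit Types A X : B.

(** Taking the exponential as a time-one solution makes its bounds, its functional equation and its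
    dependence on parameters instances of the theory of linear equations. *)
Definition bexp A : B := transport (fun=> A).

Lemma cts01_cst A : cts01 (fun=> A).
Proof. by move=> s _; exact: cts_cst. Qed.

Lemma exp_sol A : exists2 Y, sol (fun=> A) Y & bexp A = Y 1.
Proof.
have [Y hY] := sol_exists (cts01_cst A).
by exists Y => //; exact: transportE (cts01_cst A) hY.
Qed.

Lemma sol_commute A X Y : A * X = X * A -> sol (fun=> A) Y ->
  forall s, seg01 s -> Y s * X = X * Y s.
Proof.
move=> AX [Y0 hY].
apply: (ode_unique_hom (cts01_cst A)) => [|s hs|s hs]; first by rewrite Y0 mulr1 mul1r.
  have := der_mul (hY s hs) (der_cst seg01 X s).
  by rewrite mulr0 add0r -!mulrA AX.
have := der_mul (der_cst seg01 X s) (hY s hs).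
by rewrite mul0r addr0 mulrA.
Qed.

Lemma bexp_commute A X : A * X = X * A -> bexp A * X = X * bexp A.
Proof.
by move=> AX; have [Y hY ->] := exp_sol A; exact: (sol_commute AX hY (unit_seg1 R)).
Qed.

Lemma bexpD A X : A * X = X * A -> bexp (A + X) = bexp A * bexp X.
Proof.
move=> AX; have [Y hY ->] := exp_sol A; have [Z hZ ->] := exp_sol X.
apply: (@transportE R B _ (fun s => Y s * Z s)); first exact: cts01_cst.
have ZA := sol_commute (esym AX) hZ.
case: hY hZ => Y0 hY [Z0 hZ]; split; first by rewrite Y0 Z0 mulr1.
move=> s hs; have := der_mul (hY s hs) (hZ s hs).
by rewrite mulrDr -!mulrA -(ZA s hs) addrC !mulrA.
Qed.

Lemma bexp0 : bexp 0 = 1.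
Proof.
apply: (@transportE R B _ (fun=> 1)); first exact: cts01_cst.
by split=> // s hs; rewrite mulr0; exact: der_cst.
Qed.

Lemma bexpN A : bexp A * bexp (- A) = 1.
Proof. by rewrite -bexpD ?subrr ?bexp0 // mulrN mulNr. Qed.

Lemma bexp_le A (m : R) : nm A <= m -> nm (bexp A) <= nm (1 : B) * expR (m + 1).
Proof.
move=> hm; have [Y hY ->] := exp_sol A.
by apply: (sol_bound _ _ hY (unit_seg1 R)) => //; apply: le_trans hm; exact: nm_ge0.
Qed.

Lemma bexp_small : exists2 K : R, 0 <= K & forall A, nm A <= 1 ->
  nm (bexp A - 1 - A) <= K * nm A ^+ 2 /\ nm (bexp A - 1) <= K * nm A.
Proof.
pose K := nm (1 : B) * expR (1 + 1) * expR (1 + 1).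
have K0 : 0 <= K by rewrite !mulr_ge0 ?nm_ge0 ?expR_ge0.
exists K => // A A1; have [Y hY ->] := exp_sol A.
have d1 s : seg01 s -> nm (Y s - 1) <= K * nm A.
  move=> hs; have -> : K * nm A = nm (1 : B) * expR (1 + 1) * nm A * expR (1 + 1).
    by rewrite /K; ring.
  apply: (@sol_diff R B (fun=> 0) (fun=> A) (fun=> 1) Y) => //.
  - exact: nm_ge0.
  - by rewrite nm0.
  - by rewrite subr0.
  - by split=> // w _; rewrite mulr0; exact: der_cst.
split; last exact: d1 (unit_seg1 R).
case: hY => Y0 hY.
have -> : Y 1 - 1 - A = (Y 1 - 1 *: A) - (Y 0 - 0 *: A).
  by rewrite scale1r scale0r subr0 Y0 addrAC.
apply: (mvi1 (f := fun s => Y s - s *: A) (D := fun s => (Y s - 1) * A)) => s hs.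
  have := derB (hY s hs) (derM (der_id seg01 s) (der_cst seg01 A s)).
  by rewrite scaler0 add0r scale1r mulrBl mul1r.
apply: le_trans (nm_mul _ _) _; rewrite expr2 mulrA ler_wpM2r ?nm_ge0 //; exact: d1.
Qed.

Definition exp_series A N : B := \sum_(k < N) (k`!%:R^-1 : R[i]) *: A ^+ k.

(** The partial sums of exp(sA) are Picard iterates: the derivative of one is the preceding one
    times A. The contraction estimate therefore applies to their distance from the solution. *)
Lemma exp_series_cvg A (e : R) : 0 < e -> exists N, forall k, (N <= k)%N ->
  nm (exp_series A k - bexp A) <= e.
Proof.
move=> e0; have [Y hY ->] := exp_sol A.
pose S N (s : R[i]) : B := \sum_(k < N) (s ^+ k / k`!%:R) *: A ^+ k.
have S0 N : S N.+1 0 = 1.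
  rewrite /S big_ord_recl expr0 fact0 divr1 scale1r big1 ?addr0 // => k _.
  by rewrite expr0n /= mul0r scale0r.
have dS N s : der seg01 (S N.+1) s (S N s * A).
  have dpow k : der seg01 (fun s : R[i] => s ^+ k.+1 / k.+1`!%:R : R[i]) s (s ^+ k / k`!%:R).
    have fn j : (j`!%:R : R[i]) != 0 by rewrite pnatr_eq0 -lt0n fact_gt0.
    elim: k => [|k IH].
      rewrite expr0 divr1; apply: der_ext (der_id _ _) => w.
      by rewrite expr1 factS fact0 muln1 divr1.
    have := derZ (k.+2%:R^-1) (derM (der_id seg01 s) IH).
    rewrite !scaleCE.
    have kn : (k.+2%:R : R[i]) != 0 by rewrite pnatr_eq0.
    have kn1 : (k.+1%:R : R[i]) != 0 by rewrite pnatr_eq0.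
    have -> : k.+2%:R^-1 * (s * (s ^+ k / k`!%:R) + 1 * (s ^+ k.+1 / k.+1`!%:R)) =
        s ^+ k.+1 / k.+1`!%:R.
      rewrite factS natrM exprS -[k.+2%:R]natr1; field.
      by rewrite fn !nat1r natr1 kn1 kn.
    apply: der_ext => w; rewrite !scaleCE [in RHS]factS natrM [in RHS]exprS invfM; move: (k.+2%:R^-1) => x; ring.

  elim: N => [|N IH].
    rewrite /S big_ord0 mul0r.
    have -> : (fun s : R[i] => \sum_(k < 1) (s ^+ k / k`!%:R) *: A ^+ k) = fun=> 1.
      by apply/funext => w; rewrite big_ord1 expr0 fact0 divr1 scale1r.
    exact: der_cst.
  have -> : S N.+2 = fun s => S N.+1 s + (s ^+ N.+1 / N.+1`!%:R) *: A ^+ N.+1.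
    by apply/funext => w; rewrite /S big_ord_recr.
  have := derD IH (derM (dpow N) (der_cst seg01 (A ^+ N.+1) s)).
  congr der; rewrite scaler0 add0r [S N.+1 s]/S big_ord_recr /= mulrDl -/(S N s).
  by rewrite -scalerAl exprSr.
have cY : cts01 Y by case: hY => _ h s hs; exact: der_cts (h s hs).
have [Q Q0 hQ] := cts_bounded cY.
case: hY => Y0 hY.
have step N : forall x : R, 0 <= x <= 1 ->
    nm (Y x%:C - S N x%:C) <= Q / 2 ^+ N * expR (2 * (nm A + 1) * x).
  elim: N => [|N IH].
    move=> x x01; rewrite expr0 divr1 /S big_ord0 subr0.
    apply: le_trans (hQ _ _) _; first by exists x.
    rewrite ler_peMr //; have := expR_ge1Dx (2 * (nm A + 1) * x).
    have : 0 <= 2 * (nm A + 1) * x.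
      by rewrite mulr_ge0 //; [have := nm_ge0 A; lra|lra].
    lra.
  apply: (@picard_contraction R B (fun s => Y s - S N.+1 s) (fun s => Y s - S N s) (fun=> A)) => //.
  - exact: nm_ge0.
  - by rewrite divr_ge0 // exprn_ge0.
  - by rewrite Y0 S0 subrr.
  - by move=> s hs; rewrite mulrBl; apply: derB; [exact: hY|exact: dS].
  - move=> x /IH; have -> // : Q / 2 ^+ N = 2 * (Q / 2 ^+ N.+1).
    by rewrite exprS; field; rewrite lt0r_neq0 // exprn_gt0.
have [N hN] := geo_small (Q * expR (2 * (nm A + 1) * 1)) e0.
exists N => k /hN h; rewrite nmB.
have -> : exp_series A k = S k 1%:C.
  by rewrite /S; apply: eq_bigr => j _; rewrite rmorph1 expr1n mul1r.
apply: le_trans (step k 1 ltac:(lra)) _.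
by rewrite mulrAC.
Qed.

Lemma dif_bexp (A : R[i] -> B) c r M : 0 < r ->
  (forall t, cabs (t - c) < r -> dif A t) -> (forall t, cabs (t - c) < r -> nm (A t) <= M) ->
  dif (fun t => bexp (A t)) c.
Proof.
move=> r0 dA hM; apply: (@transport_dif R B (fun t _ => A t) c r M) => //.
- by move=> t s ht _; exact: dA.
- by move=> t s ht _; exact: hM.
- by move=> t _; exact: cts01_cst.
Qed.

End Exponential.

(** * Logarithm *)

Section Logarithm.
Variables (R : realType) (B : balgType R).
Local Notation seg01 := (@unit_seg R).
Implicit Types x y : B.

Definition log_series x N : B := \sum_(k < N) ((-1) ^+ k / k.+1%:R : R[i]) *: x ^+ k.+1.

(** Carrying the rate in the definition makes the limit unique and the convergence uniform over the
    ball of radius 1/2. *)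
Definition log_limit x L := forall N, nm (L - log_series x N) <= 2 * nm x / 2 ^+ N.

Definition blog x : B := epsilon (inhabits 0) (log_limit x).

Lemma nm_exp_half x k : nm x <= 2^-1 -> nm (x ^+ k.+1) <= nm x / 2 ^+ k.
Proof.
move=> hx; elim: k => [|k IH]; first by rewrite expr1 expr0 divr1.
rewrite exprS; apply: le_trans (nm_mul _ _) _.
have -> : nm x / 2 ^+ k.+1 = 2^-1 * (nm x / 2 ^+ k).
  by rewrite exprS; field; rewrite lt0r_neq0 // exprn_gt0.
by apply: ler_pM => //; exact: nm_ge0.
Qed.

Section Small.
Variable x : B.
Hypothesis x_small : nm x <= 2^-1.

(** Partial sums of x (1 + s x)^-1, the derivative of s -> log (1 + s x). *)
Let u N (s : R[i]) : B := \sum_(k < N) (- s) ^+ k *: x ^+ k.+1.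

Let q_exists : exists q : R[i] -> B, forall s, seg01 s ->
  forall N, nm (q s - u N s) <= 2 * nm x / 2 ^+ N.
Proof.
have /choice [q hq] : forall s, exists z, seg01 s -> forall N, nm (z - u N s) <= 2 * nm x / 2 ^+ N.
  move=> s; case: (pselect (seg01 s)) => [hs|]; last by exists 0.
  have [|z hz] := @geometric_limit R B (fun N => u N s) (nm x); last by exists z.
  move=> k; have -> : u k.+1 s - u k s = (- s) ^+ k *: x ^+ k.+1.
    by rewrite /u big_ord_recr /=; modring.
  rewrite nmZ cabsX cabsN.
  apply: le_trans (nm_exp_half k x_small); rewrite ler_piMl ?nm_ge0 //.
  case: hs => r r01 ->; rewrite cabs_real ger0_norm; last by lra.
  by rewrite exprn_ile1 //; lra.
by exists q.
Qed.

(** The logarithm is the value at 1 of the primitive [P] of q(s) = x (1 + s x)^-1. Then exp(P(s))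
    and 1 + s x satisfy the same equation Y' = Y q, which identifies the exponential of the
    logarithm without composing power series. *)
Lemma blogP : [/\ log_limit x (blog x), bexp (blog x) = 1 + x &
  nm (blog x - x) <= 2 * nm x ^+ 2].
Proof.
have hx := x_small.
have [q hq] := q_exists.
have small N : forall e : R, 0 < e -> exists2 N', (N <= N')%N & 2 * nm x / 2 ^+ N' <= e.
  move=> e e0; have [N' hN'] := geo_small (2 * nm x) e0.
  by exists (maxn N N'); [exact: leq_maxl|apply: hN'; exact: leq_maxr].
have ux N s : u N s * x = x * u N s.
  rewrite /u mulr_suml mulr_sumr; apply: eq_bigr => k _.
  by rewrite -scalerAl -scalerAr -exprS -exprSr.
(* Commutation with the partial sums passes to their limit; the commutation relations below rest on
   this. *)
have comm_of_u y s : seg01 s -> (forall N, u N s * y = y * u N s) -> q s * y = y * q s.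
  move=> hs hy; apply/eqP; rewrite -subr_eq0; apply/eqP/nm_small => e e0.
  have P : 0 < 2 * nm y + 1 by have := nm_ge0 y; lra.
  have [N _ hN] := small 0%N (e / (2 * nm y + 1)) ltac:(by rewrite divr_gt0).
  have -> : q s * y - y * q s = (q s - u N s) * y - y * (q s - u N s).
    by rewrite mulrBl mulrBr hy; modring.
  apply: le_trans (nm_sub _ _) _.
  have b1 := nm_mul (q s - u N s) y; have b2 := nm_mul y (q s - u N s).
  have b3 := le_trans (hq s hs N) hN.
  rewrite mulrC in b2.
  have E : e = e / (2 * nm y + 1) * (2 * nm y + 1) by rewrite divfK // lt0r_neq0.
  have v0 : 0 < e / (2 * nm y + 1) by rewrite divr_gt0.
  move: (e / (2 * nm y + 1)) v0 E b3 => v v0 E b3.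
  have b4 := ler_wpM2r (nm_ge0 y) b3; have := nm_ge0 (q s - u N s).
  move: b1 b2 b4 v0 E; clear; lra.
have qx s : seg01 s -> q s * x = x * q s by move=> hs; exact: comm_of_u.
have unit s : seg01 s -> (1 + s *: x) * q s = x.
  move=> hs; apply/eqP; rewrite -subr_eq0; apply/eqP/nm_small => e e0.
  have s1 : cabs s <= 1.
    by case: hs => r r01 ->; rewrite cabs_real ger0_norm; lra.
  have [N _ hN] := small 0%N (e / (nm (1 : B) + 3)) ltac:(by rewrite divr_gt0 //; have := nm_ge0 (1 : B); lra).
  have uE : (1 + s *: x) * u N s = x - (- s) ^+ N *: x ^+ N.+1.
    elim: (N) => [|j IH]; first by rewrite /u big_ord0 mulr0 expr0 scale1r expr1 subrr.
    rewrite /u big_ord_recr /= -/(u j s) mulrDr IH mulrDl mul1r -scalerAl -scalerAr -exprS scalerA.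
    by rewrite [(- s) ^+ j.+1]exprS; modring.
  have -> : (1 + s *: x) * q s - x = (q s - u N s) + s *: (x * (q s - u N s)) - (- s) ^+ N *: x ^+ N.+1.
    have -> : (1 + s *: x) * q s = (1 + s *: x) * u N s + (1 + s *: x) * (q s - u N s).
      by rewrite -mulrDr [u N s + _]addrC subrK.
    by rewrite uE mulrDl mul1r -scalerAl; modring.
  have b1 := hq s hs N.
  have b2 : nm (s *: (x * (q s - u N s))) <= 2 * nm x / 2 ^+ N.
    rewrite nmZ; apply: le_trans (_ : 1 * (1 * nm (q s - u N s)) <= _); last by rewrite !mul1r.
    apply: ler_pM; rewrite ?cabs_ge0 ?nm_ge0 //; apply: le_trans (nm_mul _ _) _.
    by rewrite ler_wpM2r ?nm_ge0 //; lra.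
  have b3 : nm ((- s) ^+ N *: x ^+ N.+1) <= 2 * nm x / 2 ^+ N.
    rewrite nmZ cabsX cabsN; apply: le_trans (_ : 1 * (nm x / 2 ^+ N) <= _).
      by apply: ler_pM; rewrite ?exprn_ge0 ?cabs_ge0 ?nm_ge0 ?nm_exp_half // exprn_ile1 ?cabs_ge0.
    rewrite mul1r -mulrA ler_peMl ?divr_ge0 ?nm_ge0 ?exprn_ge0 //; lra.
  apply: le_trans (nm_sub _ _) _; have := nmD (q s - u N s) (s *: (x * (q s - u N s))).
  have P : 0 < nm (1 : B) + 3 by have := nm_ge0 (1 : B); lra.
  have E : e = e / (nm (1 : B) + 3) * (nm (1 : B) + 3) by rewrite divfK // lt0r_neq0.
  have v0 : 0 < e / (nm (1 : B) + 3) by rewrite divr_gt0.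
  have := mulr_ge0 (ltW v0) (nm_ge0 (1 : B)).
  rewrite [X in _ -> _ -> _ <= X]E; move: (e / _) v0 hN b1 b2 b3 => v v0 hN b1 b2 b3 *; lra.
have cq : cts01 q.
  apply: uniform_limit_cts => e e0; have [N _ hN] := small 0%N e e0.
  exists (u N); last by move=> s hs; apply: le_trans (hq s hs N) hN.
  move=> s hs; apply: (@dif_cts R B _ _ s).
  apply: (@dif_sum R B N (fun k s => (- s) ^+ k *: x ^+ k.+1)) => k.
  apply: difM (dif_cst _ _).
  elim: k => [|k IH]; first exact: dif_cst.
  have -> : (fun s : R[i] => (- s) ^+ k.+1) = (fun s => (- s) *: ((- s) ^+ k : R[i])).
    by apply/funext => w; rewrite exprS.
  apply: difM IH; have := @difZ R R[i] (-1) (fun w => w) s (dif_id s).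
  by have -> : (fun w : R[i] => -1 *: w) = (fun w => - w) by apply/funext => w; rewrite scaleN1r.
have [P P0 hP] := primitive_exists cq.
pose S N (s : R[i]) : B := \sum_(k < N) ((-1) ^+ k * s ^+ k.+1 / k.+1%:R) *: x ^+ k.+1.
have S0 N : S N 0 = 0.
  by rewrite /S big1 // => k _; rewrite expr0n /= mulr0 mul0r scale0r.
have dS N s : der seg01 (S N) s (u N s).
  have dpow k : der seg01 (fun s : R[i] => (-1) ^+ k * s ^+ k.+1 / k.+1%:R : R[i]) s ((- s) ^+ k).
    have base : forall j, der seg01 (fun s : R[i] => s ^+ j.+1 : R[i]) s (j.+1%:R * s ^+ j).
      elim=> [|j IH]; first by rewrite expr0 mulr1; exact: der_id.
      have := derM (der_id seg01 s) IH; rewrite !scaleCE.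
      have -> : s * (j.+1%:R * s ^+ j) + 1 * s ^+ j.+1 = j.+2%:R * s ^+ j.+1.
        by rewrite -[j.+2%:R]natr1 exprS; ring.
      by apply: der_ext => w; rewrite scaleCE -exprS.
    have kn1 : (k.+1%:R : R[i]) != 0 by rewrite pnatr_eq0.
    have := derZ ((-1) ^+ k / k.+1%:R) (base k); rewrite scaleCE.
    have -> : (-1) ^+ k / k.+1%:R * (k.+1%:R * s ^+ k) = (- s) ^+ k.
      by rewrite mulrA divfK // -exprMn mulN1r.
    by apply: der_ext => w; rewrite scaleCE mulrAC.
  elim: N => [|N IH].
    rewrite /u big_ord0.
    have -> : S 0%N = fun=> 0 by apply/funext => w; rewrite /S big_ord0.
    exact: der_cst.
  have -> : S N.+1 = fun s => S N s + ((-1) ^+ N * s ^+ N.+1 / N.+1%:R) *: x ^+ N.+1.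
    by apply/funext => w; rewrite /S big_ord_recr.
  have := derD IH (derM (dpow N) (der_cst seg01 (x ^+ N.+1) s)).
  by congr der; rewrite scaler0 add0r /u big_ord_recr.
have SE N : S N 1 = log_series x N.
  by rewrite /S; apply: eq_bigr => k _; rewrite expr1n mulr1.
have PL : log_limit x (P 1).
  move=> N; rewrite -SE.
  have -> : P 1 - S N 1 = (P 1 - S N 1) - (P 0 - S N 0) by rewrite P0 S0 subrr subr0.
  apply: (mvi1 (f := fun s => P s - S N s) (D := fun s => q s - u N s)).
    by move=> s hs; apply: derB; [exact: hP|exact: dS].
  by move=> s hs; exact: hq.
have bE : blog x = P 1.
  have h : log_limit x (blog x).
    by apply: (epsilon_spec (inhabits (0 : B)) (log_limit x)); exists (P 1).
  apply/eqP; rewrite -subr_eq0; apply/eqP/nm_small => e e0.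
  have [N _ hN] := small 0%N (e / 2) ltac:(lra).
  have := nm_dist (log_series x N) (blog x) (P 1); rewrite (nmB (log_series x N) (P 1)).
  have := h N; have := PL N; lra.
have Pcomm y : (forall s, seg01 s -> q s * y = y * q s) ->
    forall s, seg01 s -> P s * y = y * P s.
  move=> hy s hs; apply/eqP; rewrite -subr_eq0; apply/eqP.
  have := @der0_cst R B (fun s => P s * y - y * P s) _ s hs.
  rewrite P0 mul0r mulr0 subrr; apply => w hw.
  have := derB (der_mul (hP w hw) (der_cst seg01 y w)) (der_mul (der_cst seg01 y w) (hP w hw)).
  by rewrite !mul0r mulr0 add0r addr0 hy // subrr.
have Px := Pcomm x qx.
have uP N s s' : seg01 s' -> u N s * P s' = P s' * u N s.
  move=> hs'; rewrite /u mulr_suml mulr_sumr; apply: eq_bigr => k _.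
  rewrite -scalerAl -scalerAr; congr (_ *: _).
  elim: (k.+1) => [|j IH]; first by rewrite expr0 mul1r mulr1.
  by rewrite exprS -mulrA IH mulrA -Px // -mulrA.
(* Values of [P] at different times commute, so [bexp] of an increment of [P] splits off as a factor
   and can be expanded to second order. *)
have PP s s' : seg01 s -> seg01 s' -> P s * P s' = P s' * P s.
  by move=> hs hs'; apply: Pcomm hs => w hw; apply: comm_of_u => // N; exact: uP.
have [K K0 hK] := bexp_small B.
have dW s : seg01 s -> der seg01 (fun s => bexp (P s)) s (bexp (P s) * q s).
  move=> hs e e0.
  pose b := nm (bexp (P s)); have b0 : 0 <= b by exact: nm_ge0.
  pose c := b * K * (nm (q s) + 1) ^+ 2.
  have c0 : 0 <= c by apply: mulr_ge0; [exact: mulr_ge0|exact: sqr_ge0].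
  have eb : 0 < e / (2 * (b + 1)) by rewrite divr_gt0 //; lra.
  have [d1 d10 h1] := hP s hs _ eb.
  have [d2 d20 h2] := der_lip (hP s hs).
  have [d3 d30 h3] := der_cts (hP s hs) ltr01.
  exists (Num.min (Num.min d1 d2) (Num.min d3 (e / (2 * (c + 1))))).
    by rewrite !lt_min d10 d20 d30 /= divr_gt0 //; lra.
  move=> w hw; rewrite !lt_min => /andP[/andP[w1 w2] /andP[w3 w4]].
  set h := P w - P s; have hc : P s * h = h * P s.
    by rewrite /h mulrBr mulrBl PP.
  have -> : P w = P s + h by rewrite /h [P s + _]addrC subrK.
  rewrite bexpD //.
  have -> : bexp (P s) * bexp h - bexp (P s) - (w - s) *: (bexp (P s) * q s) =
     bexp (P s) * (bexp h - 1 - h) + bexp (P s) * (h - (w - s) *: q s).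
    by rewrite !mulrBr mulr1 -scalerAr; modring.
  have [k1 _] := hK h (h3 w hw w3).
  have l1 := h2 w hw w2; have l2 := h1 w hw w1; rewrite -/h in l1 l2.
  apply: le_trans (nmD _ _) _.
  have cw := cabs_ge0 (w - s).
  have t1 : nm (bexp (P s) * (bexp h - 1 - h)) <= c * cabs (w - s) * cabs (w - s).
    apply: le_trans (nm_mul _ _) _.
    have -> : c * cabs (w - s) * cabs (w - s) = b * (K * ((nm (q s) + 1) * cabs (w - s)) ^+ 2).
      by rewrite /c; ring.
    apply: ler_pM; rewrite ?nm_ge0 //; apply: le_trans k1 _; rewrite ler_wpM2l //.
    by rewrite lerXn2r ?nnegrE ?nm_ge0 // (le_trans (nm_ge0 h)).
  have t2 : nm (bexp (P s) * (h - (w - s) *: q s)) <= e / 2 * cabs (w - s).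
    apply: le_trans (nm_mul _ _) _.
    apply: le_trans (_ : (b + 1) * (e / (2 * (b + 1)) * cabs (w - s)) <= _).
      by apply: ler_pM; rewrite ?nm_ge0 //; rewrite /b; lra.
    rewrite mulrA; have -> // : (b + 1) * (e / (2 * (b + 1))) = e / 2.
    by field; rewrite lt0r_neq0 //; lra.
  have t3 : c * cabs (w - s) <= e / 2.
    have : (c + 1) * cabs (w - s) <= e / 2.
      rewrite mulrC -ler_pdivlMr; last by lra.
      by apply: le_trans (ltW w4) _; rewrite invfM mulrA.
    lra.
  have := ler_wpM2r cw t3; lra.
(* For the right-hand side the equation Y' = Y q is the identity (1 + s x) q(s) = x. *)
have W1 : bexp (P 1) = 1 + 1 *: x.
  apply: (ode_unique_hom (Y := fun s => bexp (P s)) (Y' := fun s => 1 + s *: x) cq) => //.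
  - by rewrite P0 bexp0 scale0r addr0.
  - move=> s hs; rewrite unit //.
    have := derD (der_cst seg01 (1 : B) s) (derM (der_id seg01 s) (der_cst seg01 x s)).
    by rewrite scaler0 !add0r scale1r.
  - exact: unit_seg1.
rewrite bE; split=> //; first by rewrite W1 scale1r.
have -> : P 1 - x = (P 1 - 1 *: x) - (P 0 - 0 *: x).
  by rewrite P0 scale1r scale0r !subr0.
apply: (mvi1 (f := fun s => P s - s *: x) (D := fun s => q s - x)) => s hs.
  have := derB (hP s hs) (derM (der_id seg01 s) (der_cst seg01 x s)).
  by rewrite scaler0 add0r scale1r.
have -> : q s - x = - (s *: (x * q s)).
  by rewrite -[X in _ - X](unit s hs) mulrDl mul1r -scalerAl; modring.
rewrite nmN nmZ.
have s1 : cabs s <= 1.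
  by case: hs => r r01 ->; rewrite cabs_real ger0_norm; lra.
have q1 : nm (q s) <= 2 * nm x.
  by have := hq s hs 0%N; rewrite /u big_ord0 subr0 expr0 divr1.
apply: le_trans (_ : 1 * (nm x * (2 * nm x)) <= _).
  apply: ler_pM; rewrite ?cabs_ge0 ?nm_ge0 //; apply: le_trans (nm_mul _ _) _.
  by rewrite ler_wpM2l ?nm_ge0.
by rewrite expr2; lra.
Qed.

End Small.

Lemma blog_le x : nm x <= 2^-1 -> nm (blog x) <= 2 * nm x.
Proof.
move=> hx; have [_ _ h] := blogP hx; have := nm_bound (blog x) x.
have : nm x ^+ 2 <= 2^-1 * nm x by rewrite expr2 ler_wpM2r ?nm_ge0.
lra.
Qed.

Lemma dif_blog (X : R[i] -> B) c r : 0 < r ->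
  (forall t, cabs (t - c) < r -> dif X t) ->
  (forall t, cabs (t - c) < r -> nm (X t) <= 2^-1) -> dif (fun t => blog (X t)) c.
Proof.
move=> r0 dX hX; apply: (@weierstrass R B _ c r 2) => // e e0.
have [N hN] := geo_small 1 e0.
exists (fun t => log_series (X t) N); split=> t ht.
- rewrite /log_series; apply: (@dif_sum R B N (fun k t => ((-1) ^+ k / k.+1%:R : R[i]) *: X t ^+ k.+1)) => k.
  by apply: difZ; apply: dif_exp; exact: dX.
- have [h _ _] := blogP (hX t ht); have := h N; have := blog_le (hX t ht); have := hX t ht.
  have := nm_bound (log_series (X t) N) (blog (X t)); rewrite nmB => h1 h2 h3 h4.
  have : 2 * nm (X t) / 2 ^+ N <= 1.
    rewrite ler_pdivrMr ?exprn_gt0 // mul1r.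
    have : 1 <= (2 : R) ^+ N by rewrite exprn_ege1 // ler1n.
    lra.
  lra.
- have [h _ _] := blogP (hX t ht); apply: le_trans (h N) _.
  apply: le_trans (hN N (leqnn N)); rewrite ler_wpM2r ?invr_ge0 ?exprn_ge0 //.
  have := hX t ht; lra.
Qed.

End Logarithm.

(** * Joint differentiability of separately holomorphic functions *)

Section TwoVariables.
Variables (R : realType) (V : banachType R).
Local Notation full := (fun _ : R[i] => True).

(** Local boundedness makes the Taylor remainders in each variable uniform in the other one. What
    remains is the continuity in [t] of the derivative in [z], and the chain rule follows. *)
Lemma joint_dif (f : R[i] -> R[i] -> V) (u v : R[i] -> R[i]) (c : R[i]) (r M : R) :
  0 < r ->
  (forall t z, cabs (t - u c) < r -> cabs (z - v c) < r ->
     [/\ dif (f t) z, dif (f ^~ z) t & nm (f t z) <= M]) ->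
  dif u c -> dif v c -> dif (fun w => f (u w) (v w)) c.
Proof.
move=> r0 hf [du hu] [dv hv].
set t0 := u c in hf *; set z0 := v c in hf *.
have tt : cabs (t0 - t0) < r by rewrite subrr cabs0.
have zz : cabs (z0 - z0) < r by rewrite subrr cabs0.
have M0 : 0 <= M by have [_ _ h] := hf t0 z0 tt zz; exact: le_trans (nm_ge0 _) h.
pose K := 64 * M / r ^+ 2.
have K0 : 0 <= K by rewrite /K divr_ge0 ?sqr_ge0 // mulr_ge0.
pose L := 8 * M / r.
have L0 : 0 <= L by rewrite /L divr_ge0 ?mulr_ge0 // ltW.
have T t h : cabs (t - t0) < r -> cabs h < r / 4 ->
    nm (f t (z0 + h) - f t z0 - h *: D1 (f t) z0) <= K * cabs h ^+ 2.
  by move=> ht hh; apply: (@taylor2 R V (f t) z0 r M) => // z hz; have [] := hf t z ht hz.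
have Lz t h : cabs (t - t0) < r -> cabs h < r / 4 -> nm (f t (z0 + h) - f t z0) <= L * cabs h.
  move=> ht hh; have -> : cabs h = cabs (z0 + h - z0) by rewrite [z0 + h]addrC addrK.
  apply: (@hol_lipschitz R V (f t) z0 r M) => // [z hz|z hz||].
  - by have [] := hf t z ht hz.
  - by have [] := hf t z ht hz.
  - by rewrite subrr cabs0; lra.
  - by rewrite [z0 + h]addrC addrK; lra.
have Lt z k : cabs (z - z0) < r -> cabs k < r / 4 -> nm (f (t0 + k) z - f t0 z) <= L * cabs k.
  move=> hz hk; have -> : cabs k = cabs (t0 + k - t0) by rewrite [t0 + k]addrC addrK.
  apply: (@hol_lipschitz R V (f ^~ z) t0 r M) => // [t ht|t ht||].
  - by have [] := hf t z ht hz.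
  - by have [] := hf t z ht hz.
  - by rewrite subrr cabs0; lra.
  - by rewrite [t0 + k]addrC addrK; lra.
have Tt k : cabs k < r / 4 ->
    nm (f (t0 + k) z0 - f t0 z0 - k *: D1 (f ^~ z0) t0) <= K * cabs k ^+ 2.
  by move=> hk; apply: (@taylor2 R V (f ^~ z0) t0 r M) => // t ht; have [] := hf t z0 ht zz.
(* The derivatives in [z] at two values of [t] are compared through difference quotients with a
   fixed increment [s]: the remainders cost a multiple of [s], and the Lipschitz bound in [t] does
   the rest. *)
have Dc e : 0 < e -> exists2 d : R, 0 < d & forall k, cabs k < d ->
    nm (D1 (f (t0 + k)) z0 - D1 (f t0) z0) <= e.
  move=> e0.
  pose s := Num.min (r / 8) (e / (4 * (K + 1))).
  have K1 : 0 < 4 * (K + 1) by lra.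
  have s0 : 0 < s by rewrite /s lt_min; apply/andP; split; [lra|rewrite divr_gt0].
  have sr : s <= r / 8 by rewrite /s ge_min lexx.
  have se : s * (4 * (K + 1)) <= e by rewrite -ler_pdivlMr // /s ge_min lexx orbT.
  clearbody s.
  have hs : cabs (s%:C : R[i]) = s by rewrite cabs_real gtr0_norm.
  have L1 : 0 < 4 * (L + 1) by lra.
  exists (Num.min (r / 4) (s * e / (4 * (L + 1)))).
    by rewrite lt_min; apply/andP; split; [lra|rewrite divr_gt0 // mulr_gt0].
  move=> k; rewrite lt_min => /andP[k1 k2].
  rewrite ltr_pdivlMr // in k2.
  have kr : cabs (t0 + k - t0) < r by rewrite [t0 + k]addrC addrK; lra.
  have T1 := T (t0 + k) s%:C kr; have T2 := T t0 s%:C tt.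
  rewrite hs in T1 T2; have {}T1 := T1 ltac:(lra); have {}T2 := T2 ltac:(lra).
  have szr : cabs (z0 + s%:C - z0) < r by rewrite [z0 + _]addrC addrK hs; lra.
  have l1 := Lt _ _ szr k1; have l2 := Lt _ _ zz k1.
  rewrite -(ler_pM2l s0) -[s in leLHS]hs -nmZ.
  have -> : s%:C *: (D1 (f (t0 + k)) z0 - D1 (f t0) z0) =
    (f t0 (z0 + s%:C) - f t0 z0 - s%:C *: D1 (f t0) z0)
    - (f (t0 + k) (z0 + s%:C) - f (t0 + k) z0 - s%:C *: D1 (f (t0 + k)) z0)
    + ((f (t0 + k) (z0 + s%:C) - f t0 (z0 + s%:C)) - (f (t0 + k) z0 - f t0 z0)) by modring.
  apply: le_trans (nmD _ _) _; apply: le_trans (lerD (nm_sub _ _) (nm_sub _ _)) _.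
  have q1 : s * (s * (4 * (K + 1))) <= s * e by rewrite ler_wpM2l // ltW.
  have q2 : 0 <= s * s by rewrite mulr_ge0 ?ltW.
  have q3 := cabs_ge0 k.
  rewrite !expr2 in T1 T2.
  move: T1 T2 l1 l2 q1 q2 q3 k2; clear; lra.
exists (du *: D1 (f ^~ z0) t0 + dv *: D1 (f t0) z0) => e e0.
pose A := nm (D1 (f ^~ z0) t0) + nm (D1 (f t0) z0) + cabs du + cabs dv + 2.
have A2 : 2 <= A.
  rewrite /A; have := nm_ge0 (D1 (f ^~ z0) t0); have := nm_ge0 (D1 (f t0) z0).
  have := cabs_ge0 du; have := cabs_ge0 dv; lra.
pose q := e / (4 * A).
have q0 : 0 < q by rewrite /q divr_gt0 //; lra.
have E : e = 4 * (q * A) by rewrite /q; field; rewrite lt0r_neq0 //; lra.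
clearbody q.
pose m := q / (A * (K + 1)).
have m0 : 0 < m by rewrite /m divr_gt0 // mulr_gt0 //; lra.
have mE : m * (K + 1) * A = q.
  rewrite /m; field; apply/andP; split; rewrite lt0r_neq0 //; lra.
clearbody m.
have [d1 d10 h1] := hu q q0.
have [d2 d20 h2] := hv q q0.
have [d3 d30 h3] := der_lip hu.
have [d4 d40 h4] := der_lip hv.
have [d5 d50 h5] := Dc q q0.
pose n := Num.min (Num.min (r / 8) (m / 2)) (d5 / 2).
have n0 : 0 < n by rewrite /n !lt_min; apply/andP; split; [apply/andP; split|]; lra.
have nr : n <= r / 8 by rewrite /n !ge_min lexx.
have nm' : n <= m / 2 by rewrite /n !ge_min lexx orbT.
have nd : n <= d5 / 2 by rewrite /n ge_min lexx orbT.
clearbody n.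
have [d6 d60 h6] := der_cts hu n0.
have [d7 d70 h7] := der_cts hv n0.
exists (Num.min (Num.min (Num.min d1 d2) (Num.min d3 d4)) (Num.min d6 d7)).
  by rewrite !lt_min d10 d20 d30 d40 d60 d70.
move=> w _; rewrite !lt_min => /andP[/andP[/andP[w1 w2] /andP[w3 w4]] /andP[w6 w7]].
pose k := u w - t0; pose h := v w - z0.
have uE : u w = t0 + k by rewrite /k [t0 + _]addrC subrK.
have vE : v w = z0 + h by rewrite /h [z0 + _]addrC subrK.
have kn : cabs k <= n by have := h6 w I w6; rewrite nmC.
have hn : cabs h <= n by have := h7 w I w7; rewrite nmC.
have e1 := h1 w I w1; have e2 := h2 w I w2.
have e3 := h3 w I w3; have e4 := h4 w I w4.
rewrite -/t0 -/z0 -/k -/h !nmC in e1 e2 e3 e4.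
set cw := cabs (w - c) in e1 e2 e3 e4 *.
have cw0 : 0 <= cw by exact: cabs_ge0.
clear h1 h2 h3 h4 h6 h7 w1 w2 w3 w4 w6 w7 d10 d20 d30 d40 d60 d70 Lz Lt Dc tt zz.
have k4 : cabs k < r / 4 by move: kn nr r0; clear; lra.
have h4 : cabs h < r / 4 by move: hn nr r0; clear; lra.
have k5 : cabs k < d5 by move: kn nd d50; clear; lra.
have kr : cabs (t0 + k - t0) < r by rewrite [t0 + k]addrC addrK; move: k4 r0; clear; lra.
have T1 := T (t0 + k) h kr h4; have T2 := Tt k k4; have T3 := h5 k k5.
clear T Tt h5 d5 d50 nd nr kr k4 h4 k5.
rewrite uE vE.
have -> : f (t0 + k) (z0 + h) - f t0 z0 - (w - c) *: (du *: D1 (f^~ z0) t0 + dv *: D1 (f t0) z0) =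
  (f (t0 + k) (z0 + h) - f (t0 + k) z0 - h *: D1 (f (t0 + k)) z0)
  + h *: (D1 (f (t0 + k)) z0 - D1 (f t0) z0)
  + (f (t0 + k) z0 - f t0 z0 - k *: D1 (f ^~ z0) t0)
  + (k - (w - c) *: du) *: D1 (f ^~ z0) t0 + (h - (w - c) *: dv) *: D1 (f t0) z0.
  by rewrite !scaleCE; modring.
have A1 : 0 <= A by lra.
have kA : cabs k <= A * cw.
  apply: le_trans e3 _; apply: ler_wpM2r => //; rewrite /A.
  have := nm_ge0 (D1 (f ^~ z0) t0); have := nm_ge0 (D1 (f t0) z0).
  have := cabs_ge0 dv; lra.
have hA : cabs h <= A * cw.
  apply: le_trans e4 _; apply: ler_wpM2r => //; rewrite /A.
  have := nm_ge0 (D1 (f ^~ z0) t0); have := nm_ge0 (D1 (f t0) z0).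
  have := cabs_ge0 du; lra.
have sq x : 0 <= x -> x <= n -> x <= A * cw -> K * x ^+ 2 <= q * cw / 2.
  move=> x0 xn xA; rewrite expr2.
  have : K * (x * x) <= (K + 1) * (m / 2 * (A * cw)).
    apply: ler_pM => //; [exact: mulr_ge0|lra|].
    by apply: ler_pM => //; lra.
  have -> : (K + 1) * (m / 2 * (A * cw)) = m * (K + 1) * A * cw / 2 by ring.
  by rewrite mE.
have b1 := le_trans T1 (sq _ (cabs_ge0 h) hn hA).
have b3 := le_trans T2 (sq _ (cabs_ge0 k) kn kA).
have b2 : nm (h *: (D1 (f (t0 + k)) z0 - D1 (f t0) z0)) <= A * cw * q.
  by rewrite nmZ; apply: ler_pM; rewrite ?cabs_ge0 ?nm_ge0.
have b4 : nm ((k - (w - c) *: du) *: D1 (f ^~ z0) t0) <= q * cw * nm (D1 (f ^~ z0) t0).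
  by rewrite nmZ ler_wpM2r ?nm_ge0.
have b5 : nm ((h - (w - c) *: dv) *: D1 (f t0) z0) <= q * cw * nm (D1 (f t0) z0).
  by rewrite nmZ ler_wpM2r ?nm_ge0.
do 3 (apply: le_trans (nmD _ _) _; rewrite -lerBrDr).
apply: le_trans (nmD _ _) _.
have Q : 0 <= q * cw by rewrite mulr_ge0 // ltW.
have QA : q * cw * (nm (D1 (f ^~ z0) t0) + nm (D1 (f t0) z0) + 2) <= q * cw * A.
  rewrite ler_wpM2l // /A; have := cabs_ge0 du; have := cabs_ge0 dv; lra.
have QA2 : q * cw * 2 <= q * cw * A by rewrite ler_wpM2l.
rewrite E; move: b1 b2 b3 b4 b5 Q QA QA2; clear; lra.
Qed.

End TwoVariables.

(** * Families of forms on a neck *)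

Section Families.
Variables (R : realType) (B : balgType R).
Local Notation seg01 := (@unit_seg R).
Local Notation full := (fun _ : R[i] => True).
Implicit Types (f : R[i] -> R[i] -> B) (g : R[i] -> B) (r d M : R) (t z : R[i]).

Definition neck (r : R) (t z : R[i]) := cabs t / r < cabs z < r.

(* f t z stands for z a_t(z), the coefficient of the form in the coordinate log z. *)
Definition family (r d M : R) f g : Prop :=
  [/\ forall t z, 0 < cabs t < d -> neck r t z ->
        [/\ dif (f t) z, dif (f ^~ z) t & nm (f t z) <= M],
      forall z, cabs z < r -> [/\ dif g z, nm (g z) <= M & nm (z *: g z) <= M]
    & forall z, 0 < cabs z < r -> forall e : R, 0 < e -> exists2 d' : R, 0 < d' &
        forall t, 0 < cabs t < d' -> nm (f t z - z *: g z) <= e].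

Lemma family_M_ge0 r d M f g : 0 < r -> family r d M f g -> 0 <= M.
Proof.
by move=> r0 [_ h _]; have [_ h0 _] := h 0 ltac:(by rewrite cabs0); exact: le_trans (nm_ge0 _) h0.
Qed.

Definition fill f g t z := if t == 0 then z *: g z else f t z.

(** For fixed [z] the point [z] lies in the neck for every [t] with |t| < r |z|, so [t] = 0 is an
    isolated point at which the completed function is continuous, and it is removable. *)
Lemma fill_dif r d M f g z t : 0 < d -> 0 < r -> family r d M f g ->
  0 < cabs z < r -> cabs t < Num.min d (r * cabs z) ->
  dif (fun t => fill f g t z) t /\ nm (fill f g t z) <= M.
Proof.
move=> d0 r0 [fam1 fam2 fam3] zr; rewrite lt_min => /andP[td tz].
have z0 : 0 < cabs z by case/andP: zr.
have inn w : cabs w < r * cabs z -> neck r w z.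
  by move=> h; rewrite /neck ltr_pdivrMr // [_ * r]mulrC h; case/andP: zr.
have off w : w != 0 -> cabs w < d -> cabs w < r * cabs z -> dif (fun t => fill f g t z) w.
  move=> wn wd wz; have wp : 0 < cabs w by rewrite cabs_gt0.
  have [_ h _] := fam1 w z ltac:(by rewrite wp) (inn w wz).
  apply: (@dif_near R B (f ^~ z) _ w (cabs w)) => // v hv.
  rewrite /fill; case: eqP => // v0; move: hv; rewrite v0 sub0r cabsN ltxx //.
have [->|tn] := eqVneq t 0.
  split; last by rewrite /fill eqxx; have [_ _] := fam2 z ltac:(by case/andP: zr).
  apply: (@removable R B _ 0 (Num.min d (r * cabs z))).
  - by rewrite lt_min d0 mulr_gt0.
  - move=> e e0; have [d' d'0 h] := fam3 z zr e e0.
    exists d' => // w _; rewrite subr0 => wd; rewrite {2}/fill eqxx /fill.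
    case: eqP => [_|/eqP wn]; first by rewrite subrr nm0 ltW.
    by apply: h; rewrite wd cabs_gt0 wn.
  - move=> w; rewrite subr0 lt_min => /and3P[w0 w1 w2]; apply: off => //.
    by rewrite -cabs_gt0.
split; first exact: off.
rewrite /fill (negbTE tn); have [_ _ h] := fam1 t z ltac:(by rewrite cabs_gt0 tn) (inn t tz).
exact: h.
Qed.

(** The annulus estimate is applied to the difference from the limit form. The outer circle
    contributes O(|t|), as the difference vanishes at t = 0. On the inner circle of radius |t| / r1
    the difference is only bounded by [2 * M], but its weight there is O(|t| / |z|). *)
Lemma family_rate r d M f g r0 : 0 < d -> 0 < r0 -> r0 < r -> family r d M f g ->
  exists C, exists2 d', 0 <= C & 0 < d' <= d /\ forall t z, 0 < cabs t < d' ->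
    cabs t / r0 <= cabs z <= r0 -> nm (f t z - z *: g z) <= C * (cabs t / cabs z).
Proof.
move=> d0 r00 r0r fam.
have rp : 0 < r by lra.
have M0 := family_M_ge0 rp fam.
(* The intermediate radius keeps [z] away from both boundary circles, in proportion to |z| for the
   inner one. *)
pose r1 := (r0 + r) / 2.
have r1a : r0 < r1 by rewrite /r1; lra.
have r1b : r1 < r by rewrite /r1; lra.
have r10 : 0 < r1 by lra.
clearbody r1.
pose d1 := Num.min d (r * r1).
have d10 : 0 < d1 by rewrite /d1 lt_min d0 mulr_gt0.
have d1d : d1 <= d by rewrite /d1 ge_min lexx.
pose C1 := 8 * M / d1; have C10 : 0 <= C1 by rewrite /C1 divr_ge0 ?mulr_ge0 // ltW.
pose k := r1 / (r1 - r0); have k0 : 0 <= k by rewrite /k divr_ge0 //; lra.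
pose C2 := 2 * M / (r1 - r0); have C20 : 0 <= C2 by rewrite /C2 divr_ge0 ?mulr_ge0 //; lra.
exists (C1 * k * r0 + C2), (Num.min (d1 / 2) (r1 * r1)).
  by apply: addr_ge0 => //; do ?[exact: C10|exact: k0|exact: ltW r00|apply: mulr_ge0].
split.
  rewrite lt_min; apply/andP; split; first by apply/andP; split; [lra|rewrite mulr_gt0].
  by rewrite ge_min; apply/orP; left; lra.
move=> t z /andP[t0]; rewrite lt_min => /andP[td tr] /andP[z1 z2].
have zp : 0 < cabs z by apply: lt_le_trans z1; rewrite divr_gt0.
have tz : cabs t <= cabs z * r0 by rewrite -ler_pdivrMr.
have [fam1 fam2 _] := fam.
have tr1 : cabs t / r1 < cabs t / r0 by rewrite ltr_pM2l // ltf_pV2 ?posrE.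
have trr : cabs t / r < cabs t / r1 by rewrite ltr_pM2l // ltf_pV2 ?posrE.
have htd : 0 < cabs t < d by rewrite t0; lra.
have inn w : cabs t / r1 <= cabs w <= r1 -> neck r t w.
  by move=> /andP[h1 h2]; rewrite /neck; apply/andP; split; lra.
have a0w w : cabs w <= r1 -> nm (w *: g w) <= M.
  by move=> h; have [_ _] := fam2 w ltac:(lra).
have zlow : cabs t / r1 < cabs z by lra.
have zr1 : cabs z < r1 by lra.
have := @cauchy_annulus R B (fun z => f t z - z *: g z) z (cabs t / r1) r1 (2 * M) (C1 * cabs t)
  (divr_gt0 t0 r10) ltac:(by rewrite zlow zr1).
have dz : cabs z * (r1 - r0) / r1 <= cabs z - cabs t / r1.
  rewrite mulrBr mulrBl mulfK ?lt0r_neq0 // lerB // ler_wpM2r // invr_ge0 ltW //.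
have dzp : 0 < cabs z * (r1 - r0) / r1 by rewrite divr_gt0 // mulr_gt0 // subr_gt0.
move=> H; apply: le_trans (H _ _ _) _.
- move=> w hw; have [h _ _] := fam1 t w htd (inn w hw).
  have [h' _ _] := fam2 w ltac:(by case/andP: hw => _; lra).
  by apply: difB h _; apply: difM h'; exact: dif_id.
- move=> w hw; have hw' : cabs t / r1 <= cabs w <= r1 by rewrite hw lexx; lra.
  have [_ _ h] := fam1 t w htd (inn w hw').
  have h' := a0w w ltac:(by case/andP: hw'); apply: le_trans (nm_sub _ _) _; lra.
(* On the outer circle the Lipschitz bound in [t] is taken between [t] and 0, where [fill] is the
   limit form. *)
- move=> w hw.
  have wr : 0 < cabs w < r by rewrite hw r10.
  have D s : cabs (s - 0) < d1 -> dif (fun t => fill f g t w) s /\ nm (fill f g s w) <= M.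
    by rewrite subr0 => h; apply: fill_dif fam wr _ => //; rewrite hw.
  have := @hol_lipschitz R B (fun t => fill f g t w) 0 d1 M d10 (fun s h => (D s h).1) (fun s h => (D s h).2) 0 t.
  rewrite subrr subr0 cabs0 => /(_ ltac:(lra) td).
  by rewrite /fill eqxx (negbTE (_ : t != 0)) // -cabs_gt0.
have b1 : C1 * cabs t * (r1 / (r1 - cabs z)) <= C1 * k * r0 * (cabs t / cabs z).
  have -> : C1 * k * r0 * (cabs t / cabs z) = C1 * cabs t * (k * (r0 / cabs z)) by ring.
  apply: ler_wpM2l; first by rewrite mulr_ge0 // ltW.
  apply: (@le_trans _ _ k).
    rewrite /k; apply: ler_wpM2l; first exact: ltW.
    by rewrite lef_pV2 ?posrE ?subr_gt0 //; lra.
  rewrite ler_peMr // ler_pdivlMr // mul1r //.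
have b2 : 2 * M * (cabs t / r1 / (cabs z - cabs t / r1)) <= C2 * (cabs t / cabs z).
  have -> : C2 * (cabs t / cabs z) = 2 * M * (cabs t / r1 / (cabs z * (r1 - r0) / r1)).
    rewrite /C2; field; rewrite !lt0r_neq0 ?subr_gt0 //.
  apply: ler_wpM2l; first by rewrite mulr_ge0.
  apply: ler_wpM2l; first by rewrite divr_ge0 // ltW.
  rewrite lef_pV2 ?posrE //; lra.
rewrite [(_ + C2) * _]mulrDl; lra.
Qed.

Lemma neck_open r d t0 z0 : 0 < r -> 0 < cabs t0 < d -> neck r t0 z0 ->
  exists2 q : R, 0 < q & forall t z, cabs (t - t0) < q -> cabs (z - z0) < q ->
    0 < cabs t < d /\ neck r t z.
Proof.
move=> r0 /andP[t1 t2] /andP[]; rewrite ltr_pdivrMr // => n1 n2.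
pose m := cabs z0 * r - cabs t0.
have m0 : 0 < m by rewrite /m subr_gt0.
pose q := Num.min (Num.min (cabs t0) (d - cabs t0)) (Num.min (m / (1 + r)) (r - cabs z0)).
have q0 : 0 < q by rewrite /q !lt_min t1 !subr_gt0 t2 n2 divr_gt0 //; lra.
exists q => // t z; rewrite /q !lt_min => /andP[/andP[a1 a2] /andP[a3 a4]] /andP[_ /andP[b3 b4]].
have r1 : 0 < 1 + r by lra.
rewrite ltr_pdivlMr // in a3; rewrite ltr_pdivlMr // in b3.
have c1 := cabsD (t - t0) t0; have c2 := cabsD (t0 - t) t; rewrite subrK in c1; rewrite subrK (cabsB t0) in c2.
have c3 := cabsD (z - z0) z0; have c4 := cabsD (z0 - z) z; rewrite subrK in c3; rewrite subrK (cabsB z0) in c4.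
split; first by lra.
rewrite /neck ltr_pdivrMr //; apply/andP; split; last lra.
have e1 : cabs z0 * r <= (cabs (z - z0) + cabs z) * r by rewrite ler_wpM2r // ltW.
have e2 := cabs_ge0 (t - t0); have e3 := cabs_ge0 (z - z0).
have e4 : 0 <= cabs (t - t0) * r by rewrite mulr_ge0 // ltW.
have e5 : m = cabs z0 * r - cabs t0 by [].
pose x := Num.max (cabs (t - t0)) (cabs (z - z0)).
have x1 : cabs (t - t0) <= x by rewrite le_max lexx.
have x2 : cabs (z - z0) * r <= x * r.
  by apply: ler_wpM2r; [exact: ltW|rewrite le_max lexx orbT].
have x3 : x * (1 + r) < m by rewrite /x; case: (leP (cabs (t - t0)) (cabs (z - z0))).
lra.
Qed.

Lemma family_joint r d M f g (u v : R[i] -> R[i]) (c : R[i]) : 0 < r -> family r d M f g ->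
  0 < cabs (u c) < d -> neck r (u c) (v c) -> dif u c -> dif v c ->
  dif (fun w => f (u w) (v w)) c.
Proof.
move=> r0 [fam1 _ _] h1 h2; have [q q0 hq] := neck_open r0 h1 h2.
apply: (@joint_dif R B f u v c q M) => // t z ht hz.
by have [a b] := hq t z ht hz; exact: fam1.
Qed.

Lemma neck_swap r t z : 0 < r -> t != 0 -> neck r t z -> z != 0 /\ neck r t (t / z).
Proof.
move=> r0 tn /andP[h1 h2].
have tp : 0 < cabs t by rewrite cabs_gt0.
have zp : 0 < cabs z by apply: lt_trans h1; rewrite divr_gt0.
split; first by rewrite -cabs_gt0.
rewrite /neck cabsM cabsV; apply/andP; split; first by rewrite ltr_pM2l // ltf_pV2 ?posrE.
by rewrite ltr_pdivrMr // [r * _]mulrC -ltr_pdivrMr.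
Qed.

(** Since log (t / z) = log t - log z, the pullback changes the coefficient in log z to
    [- f t (t / z)]. The neck is invariant under z -> t / z, so the bounds are inherited, and only
    the limit is a new datum. *)
Lemma family_hat r d M f g (g' : R[i] -> B) : 0 < r -> family r d M f g ->
  (forall z, cabs z < r -> [/\ dif g' z, nm (g' z) <= M & nm (z *: g' z) <= M]) ->
  (forall z, 0 < cabs z < r -> forall e : R, 0 < e -> exists2 d' : R, 0 < d' &
        forall t, 0 < cabs t < d' -> nm (- f t (t / z) - z *: g' z) <= e) ->
  family r d M (fun t z => - f t (t / z)) g'.
Proof.
move=> r0 fam h1 h2; split=> // t z td tz.
have tn : t != 0 by rewrite -cabs_gt0; case/andP: td.
have [zn nk] := neck_swap r0 tn tz.
have opp (h : R[i] -> B) x : dif h x -> dif (fun w => - h w) x.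
  by move=> [D hD]; exists (- D); exact: derN.
split.
- apply: opp; apply: (@family_joint r d M f g (fun=> t) (fun z => t / z)) => //.
    exact: dif_cst.
  apply: (@difM R R[i] (fun=> t) (fun z => z^-1)); first exact: dif_cst.
  by exists (- z ^- 2); exact: der_inv.
- apply: opp; apply: (@family_joint r d M f g (fun t => t) (fun t => t / z)) => //.
    exact: dif_id.
  apply: (@difM R R[i] (fun t => t) (fun=> z^-1)); [exact: dif_id|exact: dif_cst].
- by rewrite nmN; case: fam => h _ _; have [] := h t _ td nk.
Qed.

End Families.

(** * The universal cover of the neck *)

Section Strip.
Variable R : realType.

Lemma cexp_int (k : int) : cexp (k%:~R * two_pi_i R) = 1.
Proof.
have nat_case (j : nat) : cexp (j%:R * two_pi_i R) = 1.
  elim: j => [|j IH]; first by rewrite mul0r cexp0.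
  by rewrite -natr1 mulrDl mul1r cexpD IH cexp_2pi mulr1.
case: k => j; first exact: nat_case.
by rewrite NegzE mulrNz mulNr cexpN nat_case invr1.
Qed.

Lemma cexp_surj (z : R[i]) : z != 0 -> exists2 u : R[i], cexp u = z & 0 <= complex.Im u <= 2 * pi.
Proof.
move=> zn.
have P : 0 < 2 * (pi : R) by rewrite mulr_gt0 // pi_gt0.
suff [u hu] : exists u, cexp u = z.
  pose k := Num.floor (complex.Im u / (2 * pi)).
  exists (u + (- k)%:~R * two_pi_i R); first by rewrite cexpD cexp_int mulr1.
  have -> : complex.Im (u + (- k)%:~R * two_pi_i R) = complex.Im u - k%:~R * (2 * pi).
    by rewrite raddfD /= -(rmorph_int (real_complex R)) /= rmorphN; ring.
  have := floor_itv (complex.Im u / (2 * pi)); rewrite -/k.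
  rewrite intrD1 ler_pdivlMr // ltr_pdivrMr // mulrDl mul1r; lra.
have pos (v : R[i]) : 0 < complex.Re v -> exists u, cexp u = v.
  by move=> /cexp_clog <-; exists (clog v).
have half : cexp (0 +i* pi) = -1 :> R[i].
  by rewrite /cexp /= expR0 cospi sinpi; apply/eqP; rewrite eq_complex /= !mul1r !mul0r subr0 addr0 oppr0 !eqxx.
have neg (v : R[i]) : complex.Re v < 0 -> exists u, cexp u = v.
  move=> hv; have [|u hu] := pos (- v); first by rewrite raddfN oppr_gt0.
  by exists (u + (0 +i* pi)); rewrite cexpD hu half mulrN1 opprK.
have quart : cexp (0 +i* (pi / 2)) = 'i :> R[i].
  by rewrite /cexp /= expR0 cos_pihalf sin_pihalf; apply/eqP; rewrite eq_complex /= !mul1r !mul0r subr0 addr0 !eqxx.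
case: (ltgtP (complex.Re z) 0) => [/neg //|/pos //|re0].
have im0 : complex.Im z != 0.
  by apply: contra zn => im0; rewrite eq_complex re0 im0 eqxx.
have iv : complex.Re (- 'i * z) = complex.Im z by case: (z) => x y /=; ring.
have [u hu] : exists u, cexp u = - 'i * z.
  by move: im0; rewrite neq_lt -iv => /orP[/neg|/pos].
exists (u + (0 +i* (pi / 2))); rewrite cexpD hu quart.
by rewrite mulrC mulrA mulrN -expr2 sqr_i opprK mul1r.
Qed.

(** The neck in the coordinate w = log z. For t != 0 it is a convex vertical strip, so transport
    along straight segments covers all paths, including those that wind around 0. *)
Definition strip (r : R) (t w : R[i]) := neck r t (cexp w).

Lemma strip_convex r t : 0 < r -> t != 0 -> convexC (strip r t).
Proof.
move=> r0 tn; have tr : 0 < cabs t / r by rewrite divr_gt0 // cabs_gt0.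
have E w : strip r t w <-> ln (cabs t / r) < complex.Re w < ln r.
  have l1 : cabs t / r = expR (ln (cabs t / r)) by rewrite lnK.
  have l2 : r = expR (ln r) by rewrite lnK.
  have e1 : (cabs t / r < expR (complex.Re w)) = (ln (cabs t / r) < complex.Re w).
    by rewrite {1}l1 ltr_expR.
  have e2 : (expR (complex.Re w) < r) = (complex.Re w < ln r) by rewrite {1}l2 ltr_expR.
  by rewrite /strip /neck cabs_cexp e1 e2.
move=> z w /E hz /E hw x x01; apply/E.
have -> : complex.Re (z + x%:C * (w - z)) = (1 - x) * complex.Re z + x * complex.Re w.
  by case: (z) => a b; case: (w) => a' b' /=; ring.
have [->|xn] := eqVneq x 0; first by rewrite subr0 mul1r mul0r addr0.
have xp : 0 < x by rewrite lt_def xn; lra.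
move: (ln (cabs t / r)) (ln r) hz hw => l1 l2 hz hw.
have h1 : x * l1 < x * complex.Re w by rewrite ltr_pM2l //; lra.
have h2 : x * complex.Re w < x * l2 by rewrite ltr_pM2l //; lra.
have h3 : (1 - x) * l1 <= (1 - x) * complex.Re z by rewrite ler_wpM2l //; lra.
have h4 : (1 - x) * complex.Re z <= (1 - x) * l2 by rewrite ler_wpM2l //; lra.
lra.
Qed.

Lemma strip_open r t : openC (strip r t).
Proof.
move=> w /andP[h1 h2].
pose e := Num.min (cabs (cexp w) - cabs t / r) (r - cabs (cexp w)).
have e0 : 0 < e by rewrite /e lt_min !subr_gt0 h1 h2.
have [d d0 hd] := dif_cts (fun=> True) (dif_cexp w) (ltac:(lra) : 0 < e / 2).
exists d => // v vd; have := hd v I vd; rewrite nmC => hv.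
have a1 : e <= cabs (cexp w) - cabs t / r by rewrite /e ge_min lexx.
have a2 : e <= r - cabs (cexp w) by rewrite /e ge_min lexx orbT.
have := cabsD (cexp v - cexp w) (cexp w); rewrite subrK.
have := cabsD (cexp w - cexp v) (cexp v); rewrite subrK (cabsB (cexp w)).
rewrite /strip /neck; lra.
Qed.

Lemma disc0_convex (r : R) : convexC (fun z => cabs z < r).
Proof.
move=> z w hz hw x x01; have := @disc_convex R 0 r z w; rewrite !subr0.
by move=> /(_ hz hw x x01); rewrite subr0.
Qed.

Lemma disc0_open (r : R) : openC (fun z : R[i] => cabs z < r).
Proof.
move=> z hz; exists (r - cabs z); first by rewrite subr_gt0.
by move=> w hw; have := cabsD (w - z) z; rewrite subrK; lra.
Qed.

(** Only compactness of an interval is used: it bounds [f] on one circle, continuity bounds [f] near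
    0, and the annulus estimate covers the region in between. *)
Lemma disc_bounded (V : banachType R) (f : R[i] -> V) (r r' : R) : 0 < r -> r < r' ->
  (forall z, cabs z < r' -> dif f z) ->
  exists2 M : R, 0 <= M & forall z, cabs z <= r -> nm (f z) <= M.
Proof.
move=> r0 rr hf.
have r'0 : 0 < r' by lra.
have [M1 [d /andP[d0 dr] hM1]] := @dif_locally_bounded R V f 0 r' r'0
  ltac:(by move=> z; rewrite subr0; exact: hf).
pose s := (r + r') / 2.
have sr : r < s by rewrite /s; lra.
have sr' : s < r' by rewrite /s; lra.
have s0 : 0 < s by lra.
clearbody s.
have [M2 M20 hM2] : exists2 M2 : R, 0 <= M2 & forall z, cabs z = s -> nm (f z) <= M2.
  have [|M2 M20 hM2] := @cts_bounded R V (fun x => f (circ 0 s x)).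
    by apply: cts01_circ; [exact: ltW|move=> z; rewrite subr0 => hz; apply: dif_cts; apply: hf; lra].
  exists M2 => // z hz.
  have zn : z != 0 by rewrite -cabs_gt0 hz.
  have [u hu hI] := cexp_surj zn.
  have ru : complex.Re u = ln s by rewrite -hz -hu cabs_cexp expRK.
  have P : 0 < 2 * (pi : R) by rewrite mulr_gt0 // pi_gt0.
  have -> : z = circ 0 s (complex.Im u / (2 * pi))%:C.
    rewrite -hu /circ add0r -{1}[s]lnK // -cexp_real -cexpD -ru; congr cexp.
    rewrite {1}[u]complexE; congr (_ + _).
    apply/eqP; rewrite eq_complex /=; apply/andP; split; apply/eqP; first by ring.
    by rewrite divfK ?lt0r_neq0 //; ring.
  apply: hM2; exists (complex.Im u / (2 * pi)) => //.
  by rewrite ler_pdivlMr // ler_pdivrMr // mul0r mul1r.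
pose e := d / 2.
have e0 : 0 < e by rewrite /e; lra.
pose Q := M2 * (s / (s - r)) + `|M1|.
have k1 : 1 <= s / (s - r) by rewrite ler_pdivlMr ?subr_gt0 // mul1r; lra.
have q1 : 0 <= M2 * (s / (s - r)) by rewrite mulr_ge0 //; lra.
exists (Q + `|M1|) => [|z hz]; first by rewrite /Q !addr_ge0.
have [zd|dz] := ltP (cabs z) d.
  have := hM1 z; rewrite subr0 => /(_ zd); have := ler_norm M1; have := normr_ge0 M1.
  rewrite /Q; lra.
have ed : e < d by rewrite /e; lra.
have := @cauchy_annulus R V f z e s M1 M2 e0 ltac:(lra).
move=> H; apply: le_trans (H _ _ _) _.
- by move=> w hw; apply: hf; lra.
- by move=> w hw; apply: hM1; rewrite subr0 hw.
- exact: hM2.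
have h1 : M2 * (s / (s - cabs z)) <= M2 * (s / (s - r)).
  apply: ler_wpM2l => //; apply: ler_wpM2l; first exact: ltW.
  by rewrite lef_pV2 ?posrE ?subr_gt0 //; lra.
have h2 : M1 * (e / (cabs z - e)) <= `|M1| * 1.
  apply: le_trans (ler_norm _) _; rewrite normrM ler_wpM2l //.
  have p : 0 < cabs z - e by rewrite subr_gt0; lra.
  rewrite ger0_norm; last by rewrite divr_ge0 // ltW.
  by rewrite ler_pdivrMr // mul1r /e; lra.
rewrite /Q; have := normr_ge0 M1; lra.
Qed.

End Strip.

(** * Transport through the neck *)

Section NeckTransport.
Variables (R : realType) (B : balgType R).
Local Notation seg01 := (@unit_seg R).
Local Notation full := (fun _ : R[i] => True).

(** With x = log |t| this says that |t|^(1/2) beats log |t|. The room [A] accommodates a bounded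
    argument and the fixed base point. *)
Lemma log_decay (A e : R) : 0 <= A -> 0 < e -> exists2 d : R, 0 < d &
  forall x : R, expR x < d -> (`|x| + A) * expR (x / 2) <= e.
Proof.
move=> A0 e0; pose q := e / (4 + A).
have q0 : 0 < q by rewrite /q divr_gt0 //; lra.
have qE : q * (4 + A) = e by rewrite /q divfK // lt0r_neq0 //; lra.
clearbody q.
exists (Num.min 1 (q ^+ 4)); first by rewrite lt_min ltr01 exprn_gt0.
move=> x; rewrite lt_min => /andP[x1 x2].
have xn : x < 0 by move: x1; rewrite -expR0 ltr_expR.
have E4 : expR x = expR (x / 4) ^+ 4 by rewrite -expRM_natl; congr expR; field.
have hq : expR (x / 4) < q.
  rewrite ltNge; apply/negP => h; move: x2; rewrite E4 ltNge => /negP; apply.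
  by rewrite lerXn2r // nnegrE ?expR_ge0 // ltW.
have E2 : expR (x / 2) = expR (x / 4) * expR (x / 4) by rewrite -expRD; congr expR; field.
have p := expR_gt0 (x / 4).
have p1 : expR (x / 4) <= 1 by rewrite -[leRHS]expR0 ler_expR; lra.
have a1 : expR (x / 2) <= expR (x / 4) by rewrite E2 ler_piMl // ltW.
have a2 : `|x| * expR (x / 2) <= 4 * expR (x / 4).
  rewrite ltr0_norm //.
  have h := expR_ge1Dx (- x / 4).
  have E : expR (- x / 4) * expR (x / 2) = expR (x / 4).
    by rewrite -expRD; congr expR; field.
  have := ler_wpM2r (expR_ge0 (x / 2)) h; rewrite E mulrDl mul1r.
  have := expR_ge0 (x / 2); lra.
have a3 : A * expR (x / 2) <= A * expR (x / 4) by rewrite ler_wpM2l.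
have a4 : (4 + A) * expR (x / 4) <= (4 + A) * q by rewrite ler_wpM2l ?ltW //; lra.
rewrite mulrDl; lra.
Qed.

(** The derivative of [Z * P] when P' = D c P G and Z' is [Z] times the conjugate of D (F - c G) by
    [P]: the limit form [G] cancels and the equation with coefficient D F remains. *)
Lemma gauge_identity (Z P S F G : B) (D c : R[i]) : S * P = 1 ->
  Z * ((D * c) *: (P * G)) + Z * (P * (D *: (F - c *: G)) * S) * P = Z * P * (D *: F).
Proof.
move=> SP; rewrite -!mulrA SP mulr1 !(scalerBr, scalerA) !mulrBr -!scalerAr.
modring.
Qed.

Section OneFamily.
Variables (r e' d M : R) (f : R[i] -> R[i] -> B) (g : R[i] -> B).
Hypotheses (e'_gt0 : 0 < e') (e'_lt : e' < r) (d_gt0 : 0 < d) (fam : family r d M f g).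

Definition logcoef t w := f t (cexp w).
Definition basept : R[i] := (ln e')%:C.

Lemma cexp_basept : cexp basept = e'%:C.
Proof. by rewrite cexp_real lnK. Qed.

Lemma r_gt0 : 0 < r.
Proof. exact: lt_trans e'_lt. Qed.

Lemma basept_strip t : 0 < cabs t < r * e' -> strip r t basept.
Proof.
move=> /andP[t0 t1]; have r0 := r_gt0; have ep := e'_gt0.
by rewrite /strip /neck cexp_basept cabs_real gtr0_norm // ltr_pdivrMr // [e' * r]mulrC t1 e'_lt.
Qed.

Lemma endpt_strip tau : cabs (cexp tau) < r * e' -> strip r (cexp tau) (tau - basept).
Proof.
move=> t1; have r0 := r_gt0; have ep := e'_gt0.
have t0 : 0 < cabs (cexp tau) by rewrite cabs_gt0 cexp_neq0.
rewrite /strip /neck cexpD cexpN cexp_basept cabsM cabsV cabs_real gtr0_norm //.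
by rewrite ltr_pM2l // ltf_pV2 ?posrE // e'_lt ltr_pdivrMr.
Qed.

Lemma logcoef_dif t w : 0 < cabs t < d -> strip r t w -> dif (logcoef t) w.
Proof.
move=> td hw; have [fam1 _ _] := fam; have [h _ _] := fam1 _ _ td hw.
exact: dif_comp (dif_cexp w) h.
Qed.

Lemma logcoef_le t w : 0 < cabs t < d -> strip r t w -> nm (logcoef t w) <= M.
Proof. by move=> td hw; have [fam1 _ _] := fam; have [] := fam1 _ _ td hw. Qed.

(** In the coordinate log z the path beta_t is the straight segment from log e' to tau - log e', so
    this is P(xi_t, beta_t) as a function of tau = log t. *)
Definition neckpt (tau : R[i]) : B := Seg (logcoef (cexp tau)) basept (tau - basept).

Definition monodromy (t : R[i]) : B :=
  transport (fun s => two_pi_i R *: fill f g t (e'%:C * cexp (s * two_pi_i R))).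

Let ng (t : R[i]) : t != 0 -> 0 < cabs t. Proof. by rewrite cabs_gt0. Qed.

Lemma circle_norm s : seg01 s -> cabs (e'%:C * cexp (s * two_pi_i R)) = e'.
Proof. by move=> hs; rewrite cabsM cabs_cexp_unit // mulr1 cabs_real gtr0_norm // e'_gt0. Qed.


Lemma der_circle_pt s : der seg01 (fun s => e'%:C * cexp (s * two_pi_i R) : R[i]) s
  (two_pi_i R * (e'%:C * cexp (s * two_pi_i R))).
Proof.
have d1 : der seg01 (fun s => 0 + s * two_pi_i R : R[i]) s (two_pi_i R) by exact: der_affine.
have := derZ e'%:C (@der_comp R R[i] seg01 full _ (@cexp R) s _ _ d1 (fun _ _ => I) (der_cexp _ _)).
by rewrite !scaleCE add0r mulrCA; apply: der_ext => w; rewrite scaleCE add0r.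
Qed.

Lemma monodromy_coef_cts t : cabs t < Num.min d (r * e') ->
  cts01 (fun s => two_pi_i R *: fill f g t (e'%:C * cexp (s * two_pi_i R))).
Proof.
have r0 := r_gt0; have ep := e'_gt0.
rewrite lt_min => /andP[td tr] s hs; apply: ctsZ.
apply: (@cts_comp R B seg01 full (fun s => e'%:C * cexp (s * two_pi_i R)) (fill f g t)) => //.
  exact: der_cts (der_circle_pt s).
have hz := circle_norm hs.
have [t0|tn] := eqVneq t 0.
  have -> : fill f g t = fun z => z *: g z.
    by apply/funext => z; rewrite /fill t0 eqxx.
  apply: dif_cts; apply: difM; first exact: dif_id.
  by have [_ h _] := fam; have [] := h (e'%:C * cexp (s * two_pi_i R)); rewrite ?hz.
have -> : fill f g t = f t by apply/funext => z; rewrite /fill (negbTE tn).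
have [h _ _] := fam; have [] // := h t (e'%:C * cexp (s * two_pi_i R)).
- by rewrite ng.
- by rewrite /neck hz e'_lt ltr_pdivrMr // [e' * r]mulrC tr.
- by move=> h1 _ _; exact: dif_cts.
Qed.

Lemma monodromy_dif t : cabs t < Num.min d (r * e') -> dif monodromy t.
Proof.
have r0 := r_gt0; have ep := e'_gt0.
move=> tm; pose q := Num.min d (r * e') - cabs t.
have q0 : 0 < q by rewrite /q subr_gt0.
have inq w : cabs (w - t) < q -> cabs w < Num.min d (r * e').
  by move=> h; have := cabsD (w - t) t; rewrite subrK; rewrite /q in h; lra.
have fd w s : cabs (w - t) < q -> seg01 s ->
  dif (fun w => fill f g w (e'%:C * cexp (s * two_pi_i R))) w /\
  nm (fill f g w (e'%:C * cexp (s * two_pi_i R))) <= M.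
  move=> /inq h hs; apply: (fill_dif d_gt0 r0 fam); rewrite circle_norm //.
  by rewrite e'_lt e'_gt0.
apply: (@transport_dif R B (fun t s => two_pi_i R *: fill f g t (e'%:C * cexp (s * two_pi_i R)))
  t q (cabs (two_pi_i R) * M)) => //.
- by move=> w s hw hs; apply: difZ; have [] := fd w s hw hs.
- by move=> w s hw hs; rewrite nmZ ler_wpM2l ?cabs_ge0 //; have [] := fd w s hw hs.
- by move=> w /inq hw; exact: monodromy_coef_cts.
Qed.

Lemma disc_dif z : cabs z < r -> dif g z.
Proof. by move=> hz; have [_ h _] := fam; have [] := h z hz. Qed.

Lemma disc_le z : cabs z < r -> nm (g z) <= M.
Proof. by move=> hz; have [_ h _] := fam; have [] := h z hz. Qed.

Let cD := @disc0_convex R r.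
Let oD := @disc0_open R r.
Let discSeg_mul := fun z w v => @Seg_mul R B _ g M cD oD disc_dif disc_le z w v.

Lemma basept_disc : cabs (e'%:C : R[i]) < r.
Proof. by rewrite cabs_real gtr0_norm ?e'_gt0 ?e'_lt. Qed.

(** At t = 0 the form extends over the disc, where transport depends only on the end points, and
    those of the circle coincide. *)
Lemma monodromy0 : monodromy 0 = 1.
Proof.
pose c s : R[i] := e'%:C * cexp (s * two_pi_i R).
have -> : monodromy 0 = transport (fun s => (two_pi_i R * c s) *: g (c s)).
  by congr transport; apply/funext => s; rewrite /fill eqxx scalerA.
rewrite (Seg_path cD oD disc_dif disc_le (c := c)).
- by rewrite /c mul0r mul1r cexp0 cexp_2pi !mulr1; apply: (Seg_id cD disc_dif); exact: basept_disc.
- by move=> s hs; rewrite circle_norm // e'_lt.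
- by move=> s hs; exact: der_circle_pt.
- move=> s hs; apply: (@ctsZ R R[i] seg01 (two_pi_i R) c); exact: der_cts (der_circle_pt s).
Qed.

Lemma monodromy_Seg t : t != 0 ->
  monodromy t = Seg (logcoef t) basept (basept + two_pi_i R).
Proof.
move=> tn; congr transport; apply/funext => s.
rewrite /fill (negbTE tn) /logcoef cexpD cexp_basept.
by rewrite [basept + _ - _]addrC addKr.
Qed.

(** In the strip, the segment for tau + 2 pi i is equivalent to the broken line through
    [basept + two_pi_i R]. The first leg is the monodromy, the second a translate by the period of
    the segment for tau. *)
Lemma neckpt_periodic tau : cabs (cexp tau) < Num.min d (r * e') ->
  neckpt (tau + two_pi_i R) = monodromy (cexp tau) * neckpt tau.
Proof.
move=> tm; have r0 := r_gt0.
have t0 : 0 < cabs (cexp tau) by rewrite cabs_gt0 cexp_neq0.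
move: (tm); rewrite lt_min => /andP[td tr].
have htd : 0 < cabs (cexp tau) < d by rewrite t0.
set t := cexp tau in tm t0 td tr htd *.
have S0 : strip r t basept by apply: basept_strip; rewrite t0.
have per w : strip r t w -> strip r t (w + two_pi_i R).
  by rewrite /strip cexp_periodic.
have S2 := endpt_strip tr.
rewrite /neckpt cexp_periodic monodromy_Seg ?cexp_neq0 // -/t.
have -> : Seg (logcoef t) basept (tau - basept) =
    Seg (logcoef t) (basept + two_pi_i R) (tau + two_pi_i R - basept).
  congr transport; apply/funext => s.
  have -> : tau + two_pi_i R - basept - (basept + two_pi_i R) = tau - basept - basept by ring.
  congr (_ *: _); rewrite /logcoef [basept + two_pi_i R + _]addrAC cexp_periodic //.
rewrite (Seg_mul (strip_convex r0 _) (@strip_open R r t) (fun w => logcoef_dif htd (w := w))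
  (fun w => logcoef_le htd (w := w))) //.
- by rewrite -cabs_gt0.
- exact: per.
- by rewrite addrAC; exact: per.
Qed.

Lemma neckpt_dif tau : cabs (cexp tau) < Num.min d (r * e') -> dif neckpt tau.
Proof.
move=> tm; have r0 := r_gt0.
pose m := Num.min d (r * e'); rewrite -/m in tm.
have [q q0 hq] := dif_cts full (dif_cexp tau) (ltac:(rewrite divr_gt0 ?subr_gt0 //) : 0 < (m - cabs (cexp tau)) / 2).
have inq w : cabs (w - tau) < q -> cabs (cexp w) < m.
  move=> /(hq w I); rewrite nmC => h; have := cabsD (cexp w - cexp tau) (cexp tau).
  by rewrite subrK; lra.
pose c t s := basept + s * (t - basept - basept).
have ht w : cabs (w - tau) < q -> 0 < cabs (cexp w) < d.
  by move=> /inq; rewrite /m lt_min cabs_gt0 cexp_neq0 => /andP[].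
have hs w s : cabs (w - tau) < q -> seg01 s -> strip r (cexp w) (c w s).
  move=> hw hs; have h := inq w hw; rewrite /m lt_min in h; case/andP: h => h1 h2.
  apply: (@seg_in_convex R (strip r (cexp w)) basept (w - basept) s) => //.
    by apply: strip_convex => //; exact: cexp_neq0.
    by apply: basept_strip; rewrite h2 cabs_gt0 cexp_neq0.
  exact: endpt_strip.
have dc s w : dif (fun w => c w s) w.
  apply: difD; first exact: dif_cst.
  apply: (@difZ R R[i] s (fun w => w - basept - basept)).
  by apply: difB; [apply: difB; [exact: dif_id|exact: dif_cst]|exact: dif_cst].
apply: (@transport_dif R B
  (fun t s => (t - basept - basept) *: logcoef (cexp t) (c t s)) tau q
  ((cabs (tau - basept - basept) + q) * M)) => //.
- move=> w s hw hsg; apply: difM.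
    by apply: difB; [apply: difB; [exact: dif_id|exact: dif_cst]|exact: dif_cst].
  apply: (@family_joint R B r d M f g (@cexp R) (fun w => cexp (c w s))) => //.
  + exact: ht.
  + exact: hs.
  + exact: dif_cexp.
  + by apply: (dif_comp (u := fun w => c w s) (f := @cexp R)) => //; exact: dif_cexp.
- move=> w s hw hsg; rewrite nmZ; apply: ler_pM; rewrite ?cabs_ge0 ?nm_ge0 //.
    have -> : w - basept - basept = (w - tau) + (tau - basept - basept) by ring.
    by apply: le_trans (cabsD _ _) _; lra.
  by apply: logcoef_le; [exact: ht|exact: hs].
- move=> w hw; have h := inq w hw; rewrite /m lt_min in h; case/andP: h => h1 h2.
  apply: (cts_seg_coef (U := strip r (cexp w))).
  + by apply: strip_convex => //; exact: cexp_neq0.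
  + by move=> v hv; apply: logcoef_dif => //; exact: ht.
  + by apply: basept_strip; rewrite h2 cabs_gt0 cexp_neq0.
  + exact: endpt_strip.
Qed.

(* Half of the neck: the transport of f is that of the limit form in the disc,
   perturbed by the gauge-transformed difference, which is O(|t|^(1/2) log|t|). *)
Lemma half_neck e : 0 < e -> exists2 q : R, 0 < q & forall tau,
  `|complex.Im tau| <= 2 * pi -> expR (complex.Re tau) < q ->
  nm (Seg (logcoef (cexp tau)) basept (tau / 2) - Seg g e'%:C 0) <= e.
Proof.
move=> e0; have r0 := r_gt0; have ep := e'_gt0; have er := e'_lt.
have M0 := family_M_ge0 r0 fam.
pose Phi := Seg g e'%:C; pose Psi z := Seg g z e'%:C.
have [C [d' C0 [/andP[d'0 d'd] hC]]] := @family_rate R B r d M f g ((e' + r) / 2) d_gt0 ltac:(lra) ltac:(lra) fam.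
pose Q := nm (1 : B) * expR (2 * r * M + 1).
have Q0 : 0 <= Q by rewrite /Q mulr_ge0 ?nm_ge0 ?expR_ge0.
have bd := basept_disc.
have SQ z w : cabs z < r -> cabs w < r -> nm (Seg g z w) <= Q.
  move=> hz hw; apply: le_trans (Seg_le cD disc_dif disc_le hz hw) _.
  rewrite /Q ler_wpM2l ?nm_ge0 // ler_expR lerD2r ler_wpM2r //.
  by have := cabsD w (- z); rewrite cabsN; lra.
have dPhi z : cabs z < r -> der full Phi z (Phi z * g z).
  by move=> hz; apply: (Seg_der cD oD disc_dif disc_le).
have PsiPhi z : cabs z < r -> Psi z * Phi z = 1.
  by move=> hz; rewrite discSeg_mul //; apply: (Seg_id cD disc_dif).
have PhiPsi z : cabs z < r -> Phi z * Psi z = 1.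
  by move=> hz; rewrite discSeg_mul //; apply: (Seg_id cD disc_dif).
have PhiQ z : cabs z < r -> nm (Phi z) <= Q by exact: SQ.
have PsiQ z : cabs z < r -> nm (Psi z) <= Q by move=> hz; exact: SQ.
have Phi_base : Phi e'%:C = 1 by exact: (Seg_id cD disc_dif).
rewrite -/(Phi 0); clearbody Phi Psi Q.
have QQ : 0 <= Q * Q by exact: mulr_ge0.
have QC : 0 <= Q * Q * C by exact: mulr_ge0.
have QQ1 : 0 < Q * Q + 1 by rewrite ltr_wpDl.
have QC1 : 0 < Q * Q * C + 1 by rewrite ltr_wpDl.
(* Differentiability of [Seg] is known in its end point. Continuity in the starting point comes from
   the resolvent-type identity for the inverse. *)
have cPsi z : cabs z < r -> cts full Psi z.
  move=> hz q q0; have [k k0 hk] := oD hz.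
  have q1 : 0 < q / (Q * Q + 1) by rewrite divr_gt0.
  have [k' k'0 hk'] := der_cts (dPhi z hz) q1.
  exists (Num.min k k') => [|w _]; first by rewrite lt_min k0.
  rewrite lt_min => /andP[/hk hw /(hk' w I) h].
  have -> : Psi w - Psi z = - (Psi w * (Phi w - Phi z) * Psi z).
    by rewrite mulrBr mulrBl PsiPhi // mul1r -mulrA PhiPsi // mulr1 opprB.
  rewrite nmN; apply: le_trans (nm_mul _ _) _.
  have h1 : nm (Psi w * (Phi w - Phi z)) <= Q * (q / (Q * Q + 1)).
    by apply: le_trans (nm_mul _ _) _; apply: ler_pM; rewrite ?nm_ge0 ?PsiQ.
  have h2 : nm (Psi z) <= Q by exact: PsiQ.
  apply: le_trans (ler_pM (nm_ge0 _) (nm_ge0 _) h1 h2) _.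
  have E : q = q / (Q * Q + 1) * (Q * Q + 1) by rewrite divfK // lt0r_neq0.
  rewrite [leRHS]E; move: (q / _) q1 => v v0; lra.
(* This is the constant of [sol_diff] for coefficients bounded by 1. *)
pose K1 := nm (1 : B) * expR (1 + 1) * expR (1 + 1).
have K10 : 0 <= K1 by rewrite /K1 !mulr_ge0 ?nm_ge0 ?expR_ge0.
have z0r : cabs (0 : R[i]) < r by rewrite cabs0.
have [k k0 hk] := der_cts (dPhi 0 z0r) (ltac:(lra) : 0 < e / 2).
pose q := Num.min 1 (e / (2 * (K1 * Q + 1))).
have q0 : 0 < q.
  rewrite /q lt_min ltr01 /= divr_gt0 // mulr_gt0 // ltr_wpDl //; exact: mulr_ge0.
have q1 : q <= 1 by rewrite /q ge_min lexx.
have qe : K1 * q * Q <= e / 2.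
  have : q * (2 * (K1 * Q + 1)) <= e.
    rewrite -ler_pdivlMr; first by rewrite /q ge_min lexx orbT.
    by apply: mulr_gt0 => //; apply: ltr_wpDl => //; exact: mulr_ge0.
  lra.
clearbody q.
(* [A / 2] bounds the part of the length of the half segment that does not grow with log |t|. *)
pose A := 2 * (pi + `|ln e'|).
have A0 : 0 <= A by rewrite /A mulr_ge0 // addr_ge0 // ltW // pi_gt0.
have [p p0 hp] := @log_decay A (q / (Q * Q * C + 1)) A0
  ltac:(by rewrite divr_gt0).
(* The bounds by squares say that |t|^(1/2) is below [e'], so that the half path descends, and below
   [k], so that it ends where [Phi] is close to [Phi 0]. *)
pose m := Num.min (Num.min d' p) (Num.min (e' * e') (k * k)).
have m0 : 0 < m by rewrite /m !lt_min d'0 p0 !mulr_gt0.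
exists m => // tau hI.
have [x xE] : exists x, complex.Re tau = x by exists (complex.Re tau).
rewrite xE /m !lt_min => /andP[/andP[x1 x2] /andP[x3 x4]].
have tE : cabs (cexp tau) = expR x by rewrite cabs_cexp xE.
set t := cexp tau in tE *.
have h2 : expR (x / 2) * expR (x / 2) = expR x by rewrite -expRD; congr expR; field.
have xe : expR (x / 2) < e'.
  rewrite ltNge; apply/negP => h; move: x3; rewrite -h2 ltNge => /negP; apply.
  by apply: ler_pM => //; exact: ltW.
have xk : expR (x / 2) < k.
  rewrite ltNge; apply/negP => h; move: x4; rewrite -h2 ltNge => /negP; apply.
  by apply: ler_pM => //; exact: ltW.
have xln : x / 2 < ln e' by rewrite -ltr_expR lnK.
have ht : 0 < cabs t < d' by rewrite tE expR_gt0.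
have htd : 0 < cabs t < d by rewrite tE expR_gt0 -tE; case/andP: ht => _ h; exact: lt_le_trans d'd.
pose D := tau / 2 - basept.
pose z s := cexp (basept + s * D).
have rex s : seg01 s -> x / 2 <= complex.Re (basept + s * D) <= ln e'.
  move=> [y y01 ->]; rewrite /D /basept.
  have -> : complex.Re ((ln e')%:C + y%:C * (tau / 2 - (ln e')%:C)) = (1 - y) * ln e' + y * (x / 2).
    have -> : tau / 2 = (2^-1 : R)%:C * tau by rewrite fmorphV rmorph_nat mulrC.
    by rewrite -xE; case: (tau) => a b /=; field.
  have : y * (x / 2) <= y * ln e'.
    by apply: ler_wpM2l; [case/andP: y01|exact: ltW].
  have : (1 - y) * (x / 2) <= (1 - y) * ln e'.
    by apply: ler_wpM2l; [rewrite subr_ge0; case/andP: y01|exact: ltW].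
  lra.
have zlow s : seg01 s -> expR (x / 2) <= cabs (z s).
  by move=> /rex /andP[h _]; rewrite cabs_cexp ler_expR.
have zup s : seg01 s -> cabs (z s) <= e'.
  by move=> /rex /andP[_ h]; rewrite cabs_cexp -[e']lnK // ler_expR.
have zr s : seg01 s -> cabs (z s) < r by move=> /zup; lra.
have znk s : seg01 s -> neck r t (z s).
  move=> hs; rewrite /neck zr // andbT ltr_pdivrMr // tE -h2.
  apply: (@lt_le_trans _ _ (expR (x / 2) * r)); last by rewrite ler_wpM2r ?zlow // ltW.
  by rewrite ltr_pM2l ?expR_gt0 //; lra.
(* On this half |z| >= |t|^(1/2), which turns the rate |t| / |z| into |t|^(1/2). *)
have rate s : seg01 s -> nm (f t (z s) - z s *: g (z s)) <= C * expR (x / 2).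
  move=> hs; apply: le_trans (hC t (z s) ht _) _.
    apply/andP; split; last by have := zup s hs; lra.
    rewrite ler_pdivrMr; last by lra.
    rewrite tE -h2; apply: ler_pM; rewrite ?expR_ge0 ?zlow //; lra.
  rewrite ler_wpM2l // ler_pdivrMr; last by apply: lt_le_trans (zlow s hs); exact: expR_gt0.
  by rewrite tE -h2 ler_wpM2l ?expR_ge0 ?zlow.
have Dle : cabs D <= `|x| / 2 + A / 2.
  rewrite /D /basept; apply: le_trans (cabsD _ _) _; rewrite cabsN cabs_real.
  have : cabs (tau / 2) <= (`|x| + 2 * pi) / 2.
    rewrite cabsM cabsV -(rmorph_nat (real_complex R) 2) cabs_real ger0_norm //.
    apply: ler_wpM2r; first by rewrite invr_ge0.
    by apply: le_trans (cabs_le_ReIm _) _; rewrite -xE; lra.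
  rewrite /A; lra.
(* Writing the solution as [Z * Phi] leaves for [Z] an equation with this coefficient, the
   perturbation conjugated by the bounded fundamental solution. *)
pose beta s := Phi (z s) * (D *: (f t (z s) - z s *: g (z s))) * Psi (z s).
have betaq s : seg01 s -> nm (beta s) <= q.
  move=> hs; have h : nm (D *: (f t (z s) - z s *: g (z s))) <= (`|x| / 2 + A / 2) * (C * expR (x / 2)).
    by rewrite nmZ; apply: ler_pM; rewrite ?cabs_ge0 ?nm_ge0 ?rate.
  have h1 : nm (Phi (z s)) <= Q by apply: PhiQ; exact: zr.
  have h3 : nm (Psi (z s)) <= Q by apply: PsiQ; exact: zr.
  apply: le_trans (nm_mul _ _) _.
  apply: le_trans (ler_pM (nm_ge0 _) (nm_ge0 _) (le_trans (nm_mul _ _) (ler_pM (nm_ge0 _) (nm_ge0 _) h1 h)) h3) _.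
  have hp' := hp x x2.
  have := ler_wpM2l QC hp'.
  have E : q = q / (Q * Q * C + 1) * (Q * Q * C + 1) by rewrite divfK // lt0r_neq0.
  have v0 : 0 < q / (Q * Q * C + 1) by rewrite divr_gt0.
  have n0 : 0 <= (`|x| + A) * expR (x / 2) by rewrite mulr_ge0 ?expR_ge0 // addr_ge0.
  have n1 := mulr_ge0 QC n0.
  rewrite [in X in _ -> _ <= X]E; move: (q / _) v0 => v v0 h4; lra.
have dz s : der seg01 z s (D * z s).
  exact: (@der_comp R R[i] seg01 full (fun s => basept + s * D) (@cexp R) s _ _ (der_affine _ _ _ _) (fun _ _ => I) (der_cexp _ _)).
have cz s : cts seg01 z s by exact: der_cts (dz s).
have cbeta : cts01 beta.
  move=> s hs; apply: cts_mul.
    apply: cts_mul.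
      apply: (@cts_comp R B seg01 full z Phi) => //; apply: der_cts (dPhi _ _); exact: zr.
    apply: ctsZ; apply: ctsB.
      apply: (@cts_comp R B seg01 full z (f t)) => //.
      by have [h _ _] := fam; have [h' _ _] := h t (z s) htd (znk s hs); exact: dif_cts.
    apply: ctsM => //; apply: (@cts_comp R B seg01 full z g) => //.
    by apply: dif_cts; apply: disc_dif; exact: zr.
  by apply: (@cts_comp R B seg01 full z Psi) => //; apply: cPsi; exact: zr.
have [Z hZ] := sol_exists cbeta.
have Z1 : nm (Z 1 - 1) <= K1 * q.
  have -> : K1 * q = nm (1 : B) * expR (1 + 1) * q * expR (1 + 1) by rewrite /K1; ring.
  apply: (@sol_diff R B (fun=> 0) beta (fun=> 1) Z) => //.
  - exact: ltW.
  - by move=> s _; rewrite nm0.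
  - by move=> s hs; apply: le_trans (betaq s hs) _.
  - by move=> s hs; rewrite subr0; exact: betaq.
  - by split=> // s _; rewrite mulr0; exact: der_cst.
  - exact: unit_seg1.
have zE0 : z 0 = e'%:C by rewrite /z mul0r addr0 cexp_basept.
have zE1 : z 1 = cexp (tau / 2) by rewrite /z mul1r /D [basept + _]addrC subrK.
have TE : Seg (logcoef t) basept (tau / 2) = Z 1 * Phi (z 1).
  apply: (@transportE R B _ (fun s => Z s * Phi (z s))).
    move=> s hs; apply: ctsZ; apply: (@cts_comp R B seg01 full z (f t)) => //.
    by have [h _ _] := fam; have [h' _ _] := h t (z s) htd (znk s hs); exact: dif_cts.
  case: hZ => Z0 hZ; split.
    by rewrite Z0 zE0 mul1r.
  move=> s hs.
  have dP : der seg01 (fun s => Phi (z s)) s ((D * z s) *: (Phi (z s) * g (z s))).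
    by apply: (@der_comp R B seg01 full z Phi) => //; apply: dPhi; exact: zr.
  have := der_mul (hZ s hs) dP; congr der.
  exact: gauge_identity (PsiPhi _ (zr s hs)).
rewrite TE.
have zk : cabs (z 1 - 0) < k.
  rewrite subr0 zE1 cabs_cexp.
  have -> : complex.Re (tau / 2) = x / 2; last by [].
  have -> : tau / 2 = (2^-1 : R)%:C * tau by rewrite fmorphV rmorph_nat mulrC.
  by rewrite -xE; case: (tau) => a b /=; field.
have := hk (z 1) I zk => h3.
have -> : Z 1 * Phi (z 1) - Phi 0 = (Z 1 - 1) * Phi (z 1) + (Phi (z 1) - Phi 0).
  by rewrite mulrBl mul1r addrA subrK.
apply: le_trans (nmD _ _) _.
have h4 : nm ((Z 1 - 1) * Phi (z 1)) <= K1 * q * Q.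
  apply: le_trans (nm_mul _ _) _; apply: ler_pM; rewrite ?nm_ge0 // PhiQ // zr //.
  exact: unit_seg1.
lra.
Qed.

End OneFamily.

End NeckTransport.

Section LocalLog.
Variable R : realType.

Lemma clog1 : clog (1 : R[i]) = 0.
Proof.
rewrite /clog cabs1 ln1 /= mul0r.
have -> : asin (0 : R) = 0.
  by rewrite -[in LHS](sin0 R) sinK // in_itv /=; have := pi_gt0 R; lra.
by [].
Qed.

(** An inverse function argument: [clog] is small near 1, and there the expansion of the exponential
    is inverted by absorbing its error. *)
Lemma dif_clog1 : dif (fun h : R[i] => clog (1 + h)) 0.
Proof.
exists 1 => e e0.
pose q := Num.min (1 / 2) (e / 2).
have q0 : 0 < q by rewrite /q lt_min; apply/andP; split; lra.
have q1 : q <= 1 / 2 by rewrite /q ge_min lexx.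
have q2 : 2 * q <= e.
  have : q <= e / 2 by rewrite /q ge_min lexx orbT.
  lra.
clearbody q.
have [s s0 hs] := der_cexp (fun=> True) (0 : R[i]) q0.
have [k k0 hk] := clog_small (ltac:(lra) : 0 < s / 2).
exists k => // h _; rewrite subr0 => hh.
have [re cl] := hk h hh.
have cE := cexp_clog re.
have := hs (clog (1 + h)) I; rewrite subr0 => /(_ ltac:(lra)).
rewrite cexp0 cE scaleCE mulr1 nmC => h1.
have -> : clog (1 + h) - clog (1 + 0) - h *: (1 : R[i]) = - (1 + h - 1 - clog (1 + h)).
  by rewrite addr0 clog1 scaleCE; ring.
rewrite nmN nmC; apply: (le_trans h1).
set l := clog (1 + h) in h1 *.
have h2 : cabs l <= 2 * cabs h.
  have := cabsD (l - h) h; rewrite subrK.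
  have -> : l - h = - (1 + h - 1 - l) by ring.
  rewrite cabsN => a1; have a2 : q * cabs l <= 1 / 2 * cabs l by rewrite ler_wpM2r ?cabs_ge0.
  lra.
have a1 : q * cabs l <= q * (2 * cabs h) by rewrite ler_wpM2l // ltW.
have a2 : 2 * q * cabs h <= e * cabs h by rewrite ler_wpM2r ?cabs_ge0.
lra.
Qed.

End LocalLog.

(** * The limit along the neck and descent to the punctured disc *)

Section NeckLimit.
Variables (R : realType) (B : balgType R).
Local Notation seg01 := (@unit_seg R).
Local Notation full := (fun _ : R[i] => True).
Variables (r e' d M : R) (f : R[i] -> R[i] -> B) (g g' : R[i] -> B).
Hypotheses (e'_gt0 : 0 < e') (e'_lt : e' < r) (d_gt0 : 0 < d).
Hypotheses (fam : family r d M f g) (fam' : family r d M (fun t z => - f t (t / z)) g').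

Definition neck_value : B := Seg g e'%:C 0 * Seg g' 0 e'%:C.

Local Notation basept := (basept e').
Local Notation hat := (fun t z => - f t (t / z)).

(** Cut at tau / 2, the second half is the inverse of the first half for the family pulled back by z
    -> t / z. The same estimate serves both halves, and inversion is continuous. *)
Lemma neck_limit e : 0 < e -> exists2 q : R, 0 < q & forall tau,
  `|complex.Im tau| <= 2 * pi -> expR (complex.Re tau) < q ->
  nm (neckpt e' f tau - neck_value) <= e.
Proof.
move=> e0; have ep := e'_gt0; have er := e'_lt; have r0 : 0 < r by lra.
pose p := nm (Seg g' 0 e'%:C); have p0 : 0 <= p by exact: nm_ge0.
pose P := nm (Seg g e'%:C 0); have P0 : 0 <= P by exact: nm_ge0.
(* [S] dominates the coefficients of the final estimate; [h * S <= 1] moreover gives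
   [h * p <= 1 / 2], which the absorption below needs. *)
pose S := 2 * p + 2 * p * p * P + 1.
have pp : 0 <= 2 * p * p * P.
  by apply: mulr_ge0 => //; apply: mulr_ge0 => //; exact: mulr_ge0.
have S1 : 1 <= S by rewrite /S; lra.
have S0 : 0 < S by lra.
pose h := Num.min (1 / S) (e / S).
have h0 : 0 < h by rewrite /h lt_min !divr_gt0.
have h1 : h * S <= 1 by rewrite -ler_pdivlMr // /h ge_min lexx.
have h2 : h * S <= e by rewrite -ler_pdivlMr // /h ge_min lexx orbT.
clearbody h.
have [q1 q10 H1] := half_neck e'_gt0 e'_lt d_gt0 fam h0.
have [q2 q20 H2] := half_neck e'_gt0 e'_lt d_gt0 fam' h0.
exists (Num.min (Num.min q1 q2) (Num.min d (r * e'))).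
  by rewrite !lt_min q10 q20 d_gt0 mulr_gt0.
move=> tau hI; rewrite !lt_min => /andP[/andP[x1 x2] /andP[x3 x4]].
rewrite -cabs_cexp in x3 x4; set t := cexp tau in x3 x4 *.
have tn : t != 0 by exact: cexp_neq0.
have htd : 0 < cabs t < d by rewrite cabs_gt0 tn.
have Sb : strip r t basept by apply: (basept_strip e'_gt0 e'_lt); rewrite cabs_gt0 tn.
have Se : strip r t (tau - basept) by exact: (endpt_strip e'_gt0 e'_lt).
have cS := strip_convex r0 tn; have oS := @strip_open R r t.
have Sm : strip r t (tau / 2).
  have -> : tau / 2 = basept + 2^-1 * (tau - basept - basept) by field.
  by apply: (seg_in_convex (S := strip r t)) => //; exact: unit_seg_half.
have df w : strip r t w -> dif (logcoef f t) w by exact: (logcoef_dif fam htd).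
have lf w : strip r t w -> nm (logcoef f t w) <= M by exact: (logcoef_le fam htd).
have dh w : strip r t w -> dif (logcoef hat t) w by exact: (logcoef_dif fam' htd).
have lh w : strip r t w -> nm (logcoef hat t w) <= M by exact: (logcoef_le fam' htd).
(* The substitution w -> tau - w fixes tau / 2 and exchanges the two ends; the sign of dw is the
   sign in the pulled back family. *)
have rev : Seg (logcoef f t) (tau / 2) (tau - basept) = Seg (logcoef hat t) (tau / 2) basept.
  congr transport; apply/funext => s; rewrite /logcoef scalerN -scaleNr.
  have -> : tau - basept - tau / 2 = - (basept - tau / 2) by field.
  congr (_ *: f t _); rewrite /t -cexpN -cexpD; congr cexp; by field.
rewrite /neckpt -/t -(Seg_mul cS oS df lf Sb Sm Se) rev.
have {}H1 := H1 tau hI x1; have {}H2 := H2 tau hI x2.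
rewrite -/t in H1 H2.
set G := Seg (logcoef f t) basept (tau / 2) in H1 *.
set K := Seg (logcoef hat t) (tau / 2) basept.
set H := Seg (logcoef hat t) basept (tau / 2) in H2.
have KH : K * H = 1 by rewrite (Seg_mul cS oS dh lh) // (Seg_id cS dh).
have cD := @disc0_convex R r; have oD := @disc0_open R r.
have b0 : cabs (0 : R[i]) < r by rewrite cabs0.
have be : cabs (e'%:C : R[i]) < r by rewrite cabs_real gtr0_norm.
have PP : Seg g' e'%:C 0 * Seg g' 0 e'%:C = 1.
  rewrite (Seg_mul cD oD (@disc_dif _ _ _ _ _ _ _ fam') (@disc_le _ _ _ _ _ _ _ fam')) //.
  by rewrite (Seg_id cD (@disc_dif _ _ _ _ _ _ _ fam')).
rewrite /neck_value; rewrite -/P in P0; rewrite -/p in p0.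
move: PP H1 H2 @p p0 @P P0 @S pp S1 S0 h1 h2.
move: (Seg g' 0 e'%:C) (Seg g e'%:C 0) (Seg g' e'%:C 0) => Psi Phi Phi' PP H1 H2 p p0 P P0 S pp S1 S0 h1 h2.
clearbody G K H.
(* No bound on the inverse [K] is known beforehand. The identity has [K] on both sides, and its
   right-hand side is at most half of [nm K], which yields the bound by absorption. *)
have KE : K - Psi = K * (Phi' - H) * Psi by rewrite mulrBr mulrBl KH mul1r -mulrA PP mulr1.
have hp : h * p <= 1 / 2.
  have : 0 <= h * (2 * p * p * P) by rewrite mulr_ge0 // ltW.
  move: h1; rewrite /S; lra.
have k0 := nm_ge0 K.
have K1 : nm (K - Psi) <= nm K * (h * p).
  rewrite KE; apply: le_trans (nm_mul _ _) _; rewrite mulrA ler_wpM2r ?nm_ge0 //.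
  by apply: le_trans (nm_mul _ _) _; rewrite ler_wpM2l // nmB.
have K2 : nm K <= 2 * p.
  have := nm_bound K Psi; have : nm K * (h * p) <= nm K * (1 / 2) by rewrite ler_wpM2l.
  rewrite -/p; lra.
have -> : G * K - Phi * Psi = (G - Phi) * K + Phi * (K - Psi).
  by rewrite mulrBl mulrBr; modring.
apply: le_trans (nmD _ _) _.
have a1 : nm ((G - Phi) * K) <= h * (2 * p).
  by apply: le_trans (nm_mul _ _) _; apply: ler_pM; rewrite ?nm_ge0.
have a2 : nm (Phi * (K - Psi)) <= P * (2 * p * (h * p)).
  apply: le_trans (nm_mul _ _) _; apply: ler_pM; rewrite ?nm_ge0 //.
  apply: le_trans K1 _; apply: ler_wpM2r => //; apply: mulr_ge0 => //; exact: ltW.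
move: a1 a2 h2 h0; rewrite /S; lra.
Qed.

Definition neck_log (t : R[i]) : B := blog (monodromy e' f g t - 1).

Definition neck_lift (tau : R[i]) : B :=
  bexp ((- tau / two_pi_i R) *: neck_log (cexp tau)) * neckpt e' f tau.

Let m := Num.min d (r * e').

Let m_gt0 : 0 < m.
Proof. by rewrite lt_min d_gt0 mulr_gt0 // (lt_trans e'_gt0). Qed.

Let mon_dif t : cabs t < m -> dif (monodromy e' f g) t.
Proof. exact: (monodromy_dif e'_gt0 e'_lt d_gt0 fam). Qed.

Lemma monodromy_small : exists2 q : R, 0 < q <= m &
  exists2 C : R, 0 <= C & forall t, cabs t < q ->
    nm (monodromy e' f g t - 1) <= 2^-1 /\ nm (monodromy e' f g t - 1) <= C * cabs t.
Proof.
have mp := m_gt0; move: mon_dif; move: m mp => p p0 md.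
have D0 : dif (monodromy e' f g) 0 by apply: md; rewrite cabs0.
have mon0 := monodromy0 e'_gt0 e'_lt fam.
have [q q0 hq] := dif_cts full D0 (ltac:(lra) : 0 < (2^-1 : R)).
have [DD hD] := D0.
have [q' q'0 hq'] := der_lip hD.
exists (Num.min p (Num.min q q')).
  by rewrite !lt_min p0 q0 q'0 ge_min lexx.
exists (nm DD + 1); first by have := nm_ge0 DD; lra.
move=> t; rewrite !lt_min => /and3P[t1 t2 t3].
have := hq t I; have := hq' t I; rewrite mon0 subr0 => h1 h2.
by split; [exact: h2|exact: h1].
Qed.

Section Descent.
Variables (q C : R).
Hypotheses (q_gt0 : 0 < q) (q_le : q <= m) (C_ge0 : 0 <= C)
  (mon_half : forall t, cabs t < q -> nm (monodromy e' f g t - 1) <= 2^-1)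
  (mon_lin : forall t, cabs t < q -> nm (monodromy e' f g t - 1) <= C * cabs t).

Lemma neck_log_exp t : cabs t < q -> bexp (neck_log t) = monodromy e' f g t.
Proof.
by move=> /mon_half h; have [_ E _] := blogP h; rewrite /neck_log E addrC subrK.
Qed.

Lemma neck_log_le t : cabs t < q -> nm (neck_log t) <= 2 * C * cabs t.
Proof.
by move=> ht; apply: le_trans (blog_le (mon_half ht)) _; have := mon_lin ht; rewrite -mulrA; lra.
Qed.

Lemma neck_log_le1 t : cabs t < q -> nm (neck_log t) <= 1.
Proof. by move=> ht; apply: le_trans (blog_le (mon_half ht)) _; have := mon_half ht; lra. Qed.

Lemma neck_log_dif t : cabs t < q -> dif neck_log t.
Proof.
move=> ht; have qm := q_le.
apply: (@dif_blog R B (fun t => monodromy e' f g t - 1) t (q - cabs t)).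
- by rewrite subr_gt0.
- move=> w hw; apply: difB (dif_cst _ _); apply: mon_dif.
  by have := cabsD (w - t) t; rewrite subrK; lra.
- move=> w hw; apply: mon_half; by have := cabsD (w - t) t; rewrite subrK; lra.
Qed.

Lemma neck_lift_periodic tau : expR (complex.Re tau) < q ->
  neck_lift (tau + two_pi_i R) = neck_lift tau.
Proof.
move=> ht; have qm := q_le; have tp := two_pi_i_neq0 R.
rewrite /neck_lift cexp_periodic.
have tq : cabs (cexp tau) < q by rewrite cabs_cexp.
rewrite (neckpt_periodic e'_gt0 e'_lt fam); last by apply: lt_le_trans qm.
rewrite -(neck_log_exp tq) mulrA; congr (_ * _).
set L := neck_log _.
have -> : (- (tau + two_pi_i R) / two_pi_i R) *: L = (- tau / two_pi_i R) *: L + - L.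
  have -> : - (tau + two_pi_i R) / two_pi_i R = - tau / two_pi_i R - 1 by field.
  modring.
rewrite bexpD; last by move: (- tau / _) => z; rewrite mulrN mulNr -scalerAr -scalerAl.
have LL : (- L) * L = L * (- L) by rewrite mulrN mulNr.
by rewrite -mulrA (bexp_commute (X := bexp L)); [rewrite bexpN mulr1|
  rewrite -(bexp_commute (A := L)) // mulrN mulNr].
Qed.

Lemma neck_lift_int tau (k : int) : expR (complex.Re tau) < q ->
  neck_lift (tau + k%:~R * two_pi_i R) = neck_lift tau.
Proof.
have re (j : int) w : complex.Re (w + j%:~R * two_pi_i R) = complex.Re w.
  by rewrite raddfD /= -(rmorph_int (real_complex R)) /=; ring.
have nat_case (j : nat) w : expR (complex.Re w) < q ->
    neck_lift (w + j%:R * two_pi_i R) = neck_lift w.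
  move=> hw; elim: j => [|j IH]; first by rewrite mul0r addr0.
  rewrite -natr1 mulrDl mul1r addrA neck_lift_periodic //.
  by rewrite (re j).
move=> ht; case: k => j; first exact: nat_case.
rewrite NegzE; set w := tau + _.
have wE : tau = w + j.+1%:R * two_pi_i R by rewrite /w mulrNz mulNr subrK.
have := re (- j.+1%:Z) tau; rewrite -[_ + _]/w => rw; clearbody w.
by rewrite [in RHS]wE nat_case // rw.
Qed.

Lemma neck_lift_dif tau : expR (complex.Re tau) < q -> dif neck_lift tau.
Proof.
move=> ht; have qm := q_le; have qp := q_gt0.
rewrite -cabs_cexp in ht.
apply: dif_mul; last by apply: (neckpt_dif e'_gt0 e'_lt fam); exact: lt_le_trans qm.
have [s s0 hs] := dif_cts full (dif_cexp tau) (ltac:(rewrite divr_gt0 ?subr_gt0 //) : 0 < (q - cabs (cexp tau)) / 2).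
have inq w : cabs (w - tau) < s -> cabs (cexp w) < q.
  move=> /(hs w I); rewrite nmC => h; have := cabsD (cexp w - cexp tau) (cexp tau).
  by rewrite subrK; lra.
apply: (@dif_bexp R B (fun tau => (- tau / two_pi_i R) *: neck_log (cexp tau)) tau s
  ((cabs tau + s) / cabs (two_pi_i R))) => //.
- move=> w hw; apply: difM; last first.
    by apply: dif_comp (dif_cexp w) _; apply: neck_log_dif; exact: inq.
  have := dif_affine 0 (- (two_pi_i R)^-1) w; apply: dif_near ltr01 _ => v _.
  by rewrite add0r mulrN mulNr.
- move=> w hw; rewrite nmZ -[leRHS]mulr1; apply: ler_pM; rewrite ?cabs_ge0 ?nm_ge0 //.
    rewrite cabsM cabsN cabsV ler_wpM2r ?invr_ge0 ?cabs_ge0 //.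
    by have := cabsD (w - tau) tau; rewrite subrK; lra.
  by apply: neck_log_le1; exact: inq.
Qed.

(** The imaginary part is kept in a bounded interval because [neck_limit] requires it. The branch
    need not be continuous: by [neck_fun_lift] every logarithm gives the same value. *)
Definition log_branch (t : R[i]) : R[i] :=
  epsilon (inhabits 0) (fun u => cexp u = t /\ 0 <= complex.Im u <= 2 * pi).

Lemma log_branchP t : t != 0 ->
  cexp (log_branch t) = t /\ 0 <= complex.Im (log_branch t) <= 2 * pi.
Proof.
move=> tn; apply: (epsilon_spec (inhabits 0) (fun u => cexp u = t /\ 0 <= complex.Im u <= 2 * pi)).
by have [u h1 h2] := cexp_surj tn; exists u.
Qed.

Definition neck_fun (t : R[i]) : B := if t == 0 then neck_value else neck_lift (log_branch t).

Lemma neck_fun0 : neck_fun 0 = neck_value.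
Proof. by rewrite /neck_fun eqxx. Qed.

Lemma neck_fun_lift tau : expR (complex.Re tau) < q -> neck_fun (cexp tau) = neck_lift tau.
Proof.
move=> ht; rewrite /neck_fun (negbTE (cexp_neq0 tau)).
have [h _] := log_branchP (cexp_neq0 tau); have [k ->] := cexp_kernel h.
exact: neck_lift_int.
Qed.

(** The logarithm of the monodromy is O(|t|), so the exponent of the correcting factor is O(|t| log
    |t|) and this factor tends to 1. *)
Lemma neck_fun_cts0 : cts full neck_fun 0.
Proof.
move=> e e0; have qp := q_gt0; have C0 := C_ge0.
have [d1 d10 h1] := neck_limit (ltac:(lra) : 0 < e / 2).
have [d2 d20 h2] := neck_limit (ltr01 : 0 < (1 : R)).
have [K K0 hK] := bexp_small B.
pose v := nm neck_value + 1.
have v0 : 0 < v by rewrite /v; have := nm_ge0 neck_value; lra.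
pose c := cabs (two_pi_i R).
have c0 : 0 < c by rewrite /c cabs_gt0 two_pi_i_neq0.
pose k := Num.min 1 (e / (2 * (K + 1) * v)).
have k0 : 0 < k by rewrite /k lt_min ltr01 divr_gt0 // !mulr_gt0 //; lra.
have k1 : k <= 1 by rewrite /k ge_min lexx.
have k2 : K * k * v <= e / 2.
  have h : k * (2 * (K + 1) * v) <= e.
    rewrite -ler_pdivlMr; first by rewrite /k ge_min lexx orbT.
    by rewrite !mulr_gt0 //; lra.
  have : 0 <= k * v by rewrite mulr_ge0 ?ltW.
  clearbody k v; lra.
clearbody k.
pose A := 2 * (pi : R).
have A0 : 0 <= A by rewrite /A mulr_ge0 // ltW // pi_gt0.
have kp : 0 < k * c / (2 * C + 1) by rewrite divr_gt0 ?mulr_gt0 //; lra.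
have [p p0 hp] := log_decay A0 kp.
exists (Num.min (Num.min d1 d2) (Num.min (Num.min 1 q) p)).
  by rewrite !lt_min d10 d20 ltr01 qp p0.
move=> w _; rewrite subr0 !lt_min => /andP[/andP[w1 w2] /andP[/andP[w3 w4] w5]].
rewrite neck_fun0 /neck_fun; case: eqP => [_|/eqP wn]; first by rewrite subrr nm0 ltW.
have [uE uI] := log_branchP wn; move: (log_branch w) uE uI => u uE uI.
have [x xE] : exists x, complex.Re u = x by exists (complex.Re u).
have wx : cabs w = expR x by rewrite -uE cabs_cexp xE.
have uI' : `|complex.Im u| <= 2 * pi by rewrite ger0_norm; case/andP: uI.
have N1 := h1 u uI'; have N2 := h2 u uI'.
rewrite xE -wx in N1 N2; move/(_ w1): N1 => N1; move/(_ w2): N2 => N2.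
rewrite /neck_lift uE; set Z := _ *: _; set N := neckpt e' f u.
have Nv : nm N <= v by have := nm_bound N neck_value; rewrite /v -/N in N2 *; lra.
have Zk : nm Z <= k.
  rewrite /Z nmZ cabsM cabsN cabsV -/c.
  have L := neck_log_le w4.
  have ux : cabs u <= `|x| + A.
    by apply: le_trans (cabs_le_ReIm u) _; rewrite xE /A; lra.
  have hx := hp x ltac:(by rewrite -wx).
  rewrite ler_pdivlMr in hx; last lra.
  (* Half of the available decay is given up, so that [log_decay] applies as it stands. *)
  have ex : expR x <= expR (x / 2) * 1.
    rewrite (_ : expR x = expR (x / 2) * expR (x / 2)); last by rewrite -expRD; congr expR; field.
    apply: ler_wpM2l; first exact: expR_ge0.
    rewrite -[leRHS]expR0 ler_expR; move: w3; rewrite wx -[ltRHS]expR0 ltr_expR; lra.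
  rewrite wx in L.
  have a1 : cabs u / c * nm (neck_log w) <= (`|x| + A) / c * (2 * C * expR (x / 2)).
    apply: ler_pM; rewrite ?nm_ge0 //.
    - by rewrite mulr_ge0 ?cabs_ge0 // invr_ge0 ltW.
    - by rewrite ler_wpM2r // invr_ge0 ltW.
    - apply: le_trans L _; rewrite ler_wpM2l //; last lra.
      exact: mulr_ge0.
  apply: le_trans a1 _.
  rewrite mulrAC ler_pdivrMr //; apply: le_trans hx.
  have n0 : 0 <= (`|x| + A) * expR (x / 2) by rewrite mulr_ge0 ?expR_ge0 // addr_ge0.
  clearbody A c; lra.
have [_ Z1] := hK Z ltac:(lra).
have -> : bexp Z * N - neck_value = (bexp Z - 1) * N + (N - neck_value).
  by rewrite mulrBl mul1r addrA subrK.
apply: le_trans (nmD _ _) _.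
have : nm ((bexp Z - 1) * N) <= K * k * v.
  apply: le_trans (nm_mul _ _) _; apply: ler_pM; rewrite ?nm_ge0 //.
  by apply: le_trans Z1 _; rewrite ler_wpM2l.
rewrite -/N in N1; lra.
Qed.

Lemma neck_fun_dif t : cabs t < q -> dif neck_fun t.
Proof.
have qp := q_gt0.
have off s : 0 < cabs s < q -> dif neck_fun s.
  move=> /andP[s0 sq]; have sn : s != 0 by rewrite -cabs_gt0.
  have [uE _] := log_branchP sn; set u := log_branch s in uE.
  have uq : expR (complex.Re u) < q by rewrite -cabs_cexp uE.
  pose m1 := Num.min (1 / 2) ((q - cabs s) / (2 * cabs s)).
  have m10 : 0 < m1 by rewrite /m1 lt_min !divr_gt0 ?mulr_gt0 ?subr_gt0.
  have [k k0 hk] := clog_small m10.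
  (* Near [s] a differentiable branch of the logarithm is [u] plus the principal logarithm of w /
     s. *)
  apply: (@dif_near R B (fun w => neck_lift (u + clog (1 + (w - s) / s))) _ s
    (Num.min k (Num.min 1 ((q - cabs s) / cabs s)) * cabs s)).
  - by rewrite mulr_gt0 // !lt_min k0 ltr01 divr_gt0 ?subr_gt0.
  - move=> w; rewrite -ltr_pdivrMr // -cabsV -cabsM !lt_min => /and3P[w1 _ w3].
    have [re _] := hk _ w1.
    have E : cexp (u + clog (1 + (w - s) / s)) = w.
      by rewrite cexpD uE cexp_clog //; field.
    rewrite -[in RHS]E neck_fun_lift // -cabs_cexp E.
    have := cabsD (w - s) s; rewrite subrK.
    move: w3; rewrite cabsM cabsV ltr_pM2r ?invr_gt0 //; lra.
  - apply: (dif_comp (u := fun w => u + clog (1 + (w - s) / s)) (f := neck_lift)).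
      apply: difD; first exact: dif_cst.
      apply: (dif_comp (u := fun w => (w - s) / s) (f := fun h => clog (1 + h))).
        apply: (@difM R R[i] (fun w => w - s) (fun=> s^-1)); last exact: dif_cst.
        by apply: difB; [exact: dif_id|exact: dif_cst].
      by rewrite subrr mul0r; exact: dif_clog1.
    by rewrite subrr mul0r addr0 clog1 addr0; exact: neck_lift_dif.
move=> tq; have [->|tn] := eqVneq t 0; last by apply: off; rewrite cabs_gt0 tn.
apply: (@removable R B _ 0 q) => //; first exact: neck_fun_cts0.
by move=> z; rewrite subr0; exact: off.
Qed.

End Descent.

End NeckLimit.

(** * Separately holomorphic functions *)

Section Separate.
Variables (R : realType) (V : banachType R).
Local Notation full := (fun _ : R[i] => True).
Implicit Types (h : R[i] -> R[i] -> V) (q : R).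

(** Separate differentiability with local boundedness. The class is stable under both partial
    derivatives and implies continuity, so one induction on words gives smoothness of every
    order. *)
Definition holo2 q h := forall x y, cabs x < q -> cabs y < q ->
  [/\ dif (h ^~ y) x, dif (h x) y & exists M, exists2 s : R, 0 < s &
     forall x' y', cabs (x' - x) < s -> cabs (y' - y) < s ->
       nm (h x' y') <= M].

Lemma holo2_swap q h : holo2 q h -> holo2 q (fun y x => h x y).
Proof.
move=> hh x y hx hy; have [h1 h2 [M [s s0 h3]]] := hh y x hy hx.
by split=> //; exists M, s => // x' y' a b; exact: h3.
Qed.

Lemma holo2_box q h x y : holo2 q h -> cabs x < q -> cabs y < q ->
  exists M, exists2 s : R, 0 < s & forall x' y', cabs (x' - x) < s -> cabs (y' - y) < s ->
    [/\ cabs x' < q, cabs y' < q, dif (h ^~ y') x', dif (h x') y' & nm (h x' y') <= M].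
Proof.
move=> hh hx hy; have [_ _ [M [s s0 hM]]] := hh x y hx hy.
exists M, (Num.min s (Num.min (q - cabs x) (q - cabs y))).
  by rewrite !lt_min s0 !subr_gt0 hx.
move=> x' y'; rewrite !lt_min => /and3P[a1 a2 _] /and3P[b1 _ b3].
have x'q : cabs x' < q by have := cabsD (x' - x) x; rewrite subrK; lra.
have y'q : cabs y' < q by have := cabsD (y' - y) y; rewrite subrK; lra.
have [h1 h2 _] := hh x' y' x'q y'q.
by split=> //; exact: hM.
Qed.

Lemma der_quotient (f : R[i] -> V) z D : der full f z D -> forall e : R, 0 < e ->
  exists2 d : R, 0 < d & forall k, 0 < cabs k -> cabs k < d ->
    nm (k^-1 *: (f (z + k) - f z) - D) <= e.
Proof.
move=> hD e e0; have [d d0 hd] := hD e e0; exists d => // k k0 kd.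
have := hd (z + k) I; rewrite [z + k - z]addrC addKr => /(_ kd) h.
have kn : k != 0 by rewrite -cabs_gt0.
have -> : k^-1 *: (f (z + k) - f z) - D = k^-1 *: (f (z + k) - f z - k *: D).
  by rewrite [RHS]scalerBr scalerA mulVf ?scale1r.
by rewrite nmZ cabsV mulrC ler_pdivrMr.
Qed.

(** In [x] this is differentiability of a derivative. In [y] the partial derivative is a uniform
    limit of difference quotients in [x] with fixed increment, each differentiable in [y]. *)
Lemma holo2_d1 q h : holo2 q h -> holo2 q (fun x y => D1 (h ^~ y) x).
Proof.
move=> hh x y hx hy.
have [M [s s0 box]] := holo2_box hh hx hy.
have xx : cabs (x - x) < s by rewrite subrr cabs0.
have yy : cabs (y - y) < s by rewrite subrr cabs0.
have dx y' : cabs (y' - y) < s -> forall x', cabs (x' - x) < s -> dif (h ^~ y') x'.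
  by move=> hy' x' hx'; have [] := box x' y' hx' hy'.
have bx y' : cabs (y' - y) < s -> forall x', cabs (x' - x) < s -> nm (h x' y') <= M.
  by move=> hy' x' hx'; have [] := box x' y' hx' hy'.
have dy x' : cabs (x' - x) < s -> forall y', cabs (y' - y) < s -> dif (h x') y'.
  by move=> hx' y' hy'; have [] := box x' y' hx' hy'.
have M0 : 0 <= M by apply: le_trans (bx y yy x xx); exact: nm_ge0.
split.
- by apply: (dif_D1 s0); exact: dx.
- pose M' := 8 * M / s + 1.
  apply: (@weierstrass R V (fun y' => D1 (h ^~ y') x) y s M' s0) => e e0.
  pose K := 64 * M / s ^+ 2.
  have K0 : 0 <= K by rewrite /K divr_ge0 ?sqr_ge0 // mulr_ge0.
  pose m := Num.min 1 e.
  have m0 : 0 < m by rewrite lt_min ltr01.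
  have m1 : m <= 1 by rewrite /m ge_min lexx.
  have m2 : m <= e by rewrite /m ge_min lexx orbT.
  clearbody m.
  pose k := Num.min (s / 8) (m / (K + 1)).
  have k0 : 0 < k by rewrite lt_min !divr_gt0 //; lra.
  have ks : k < s / 4 by rewrite gt_min; apply/orP; left; lra.
  have kK : K * k <= m.
    have : k * (K + 1) <= m.
      by rewrite -ler_pdivlMr; [rewrite /k ge_min lexx orbT|lra].
    have := k0; lra.
  clearbody k.
  have kc : cabs (k%:C : R[i]) = k by rewrite cabs_real gtr0_norm.
  have kn : (k%:C : R[i]) != 0 by rewrite -cabs_gt0 kc.
  have xk : cabs (x + k%:C - x) < s by rewrite [x + _]addrC addrK kc; lra.
  have close y' : cabs (y' - y) < s ->
      nm (D1 (h ^~ y') x - (k%:C : R[i])^-1 *: (h (x + k%:C) y' - h x y')) <= m.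
    move=> hy'; rewrite nmB.
    have := taylor2 s0 (dx y' hy') (bx y' hy') (h := k%:C); rewrite kc => /(_ ks) T.
    have -> : (k%:C : R[i])^-1 *: (h (x + k%:C) y' - h x y') - D1 (h ^~ y') x =
        (k%:C : R[i])^-1 *: (h (x + k%:C) y' - h x y' - k%:C *: D1 (h ^~ y') x).
      by rewrite [RHS]scalerBr scalerA mulVf ?scale1r.
    rewrite nmZ cabsV kc mulrC ler_pdivrMr //; apply: le_trans T _.
    by rewrite expr2 mulrA ler_wpM2r // ltW.
  exists (fun y' => (k%:C : R[i])^-1 *: (h (x + k%:C) y' - h x y')); split.
  + move=> y' hy'; apply: difZ; apply: difB; exact: dy.
  + move=> y' hy'; have := close y' hy'.
    have := D1_bound s0 (dx y' hy') (bx y' hy') (z := x); rewrite subrr cabs0 => /(_ ltac:(lra)).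
    rewrite nmB /M'; have := nm_bound ((k%:C : R[i])^-1 *: (h (x + k%:C) y' - h x y')) (D1 (h ^~ y') x).
    lra.
  + by move=> y' hy'; apply: le_trans (close y' hy') _.
- exists (8 * M / s), (s / 2); first lra.
  move=> x' y' hx' hy'; have hy's : cabs (y' - y) < s by lra.
  exact: (D1_bound s0 (dx y' hy's) (bx y' hy's)).
Qed.

(** The value [true] stands for the second variable, as in [has_partial]. *)
Definition partial (i : bool) h x y := if i then D1 (h x) y else D1 (h ^~ y) x.

Lemma holo2_partial q h i : holo2 q h -> holo2 q (partial i h).
Proof.
by case: i => hh; [exact: holo2_swap (holo2_d1 (holo2_swap hh))|exact: holo2_d1].
Qed.

Lemma holo2_iter q h w : holo2 q h -> holo2 q (foldr partial h w).
Proof. by move=> hh; elim: w => //= i w; exact: holo2_partial. Qed.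

Lemma holo2_cts q h x y : holo2 q h -> cabs x < q -> cabs y < q -> forall e : R, 0 < e ->
  exists2 d : R, 0 < d & forall x' y', cabs (x' - x) < d -> cabs (y' - y) < d ->
    nm (h x' y' - h x y) <= e.
Proof.
move=> hh hx hy e e0.
have [M [s s0 box]] := holo2_box hh hx hy.
have xx : cabs (x - x) < s by rewrite subrr cabs0.
have yy : cabs (y - y) < s by rewrite subrr cabs0.
have M0 : 0 <= M by have [_ _ _ _] := box x y xx yy; apply: le_trans; exact: nm_ge0.
pose K := 8 * M / s; have K0 : 0 <= K by rewrite /K divr_ge0 ?mulr_ge0 // ltW.
pose k := Num.min (s / 2) (e / (2 * (K + 1))).
have k0 : 0 < k by rewrite lt_min !divr_gt0 // mulr_gt0 //; lra.
have ks : k <= s / 2 by rewrite ge_min lexx.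
have kK : K * k <= e / 2.
  have : k * (2 * (K + 1)) <= e.
    by rewrite -ler_pdivlMr; [rewrite /k ge_min lexx orbT|rewrite mulr_gt0 //; lra].
  have := k0; lra.
clearbody k.
exists k => // x' y' hx' hy'.
have hx's : cabs (x' - x) < s by lra.
have L1 := @hol_lipschitz R V (h x') y s M s0
  (fun y' hy' => let: And5 _ _ _ a _ := box x' y' hx's hy' in a)
  (fun y' hy' => let: And5 _ _ _ _ a := box x' y' hx's hy' in a) y y'
  ltac:(by rewrite subrr cabs0; lra) ltac:(lra).
have L2 := @hol_lipschitz R V (h ^~ y) x s M s0
  (fun x' hx' => let: And5 _ _ a _ _ := box x' y hx' yy in a)
  (fun x' hx' => let: And5 _ _ _ _ a := box x' y hx' yy in a) x x'
  ltac:(by rewrite subrr cabs0; lra) ltac:(lra).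
rewrite -/K in L1 L2.
have a1 : K * cabs (y' - y) <= K * k by rewrite ler_wpM2l // ltW.
have a2 : K * cabs (x' - x) <= K * k by rewrite ler_wpM2l // ltW.
have -> : h x' y' - h x y = (h x' y' - h x' y) + (h x' y - h x y) by rewrite addrA subrK.
apply: le_trans (nmD _ _) _; lra.
Qed.

Lemma partial_der q h i x y : holo2 q h -> cabs x < q -> cabs y < q ->
  der full (fun k => h (x + (if i then 0 else k)) (y + (if i then k else 0))) 0 (partial i h x y).
Proof.
move=> hh hx hy; have [dx dy _] := hh x y hx hy.
have sh (z : R[i]) : der full (fun k => z + k * 1 : R[i]) 0 1 by exact: der_affine.
case: i.
- have := @der_comp R V full full (fun k => y + k * 1) (h x) 0 1 (partial true h x y) (sh y)
    (fun _ _ => I); rewrite mul0r addr0 => /(_ (D1P dy)); rewrite scale1r.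
  by apply: der_ext => k; rewrite addr0 mulr1.
- have := @der_comp R V full full (fun k => x + k * 1) (h ^~ y) 0 1 (partial false h x y) (sh x)
    (fun _ _ => I); rewrite mul0r addr0 => /(_ (D1P dx)); rewrite scale1r.
  by apply: der_ext => k; rewrite addr0 mulr1.
Qed.

End Separate.

(** * The result in an abstract Banach algebra *)

Section NeckTheorem.
Variables (R : realType) (B : balgType R).
Local Notation full := (fun _ : R[i] => True).

Lemma bexp_cts_holo2 (q : R) (K F : R[i] -> B) (c : R[i]) : 0 < q ->
  (forall t, cabs t < q -> dif K t) -> (forall t, cabs t < q -> dif F t) ->
  holo2 q (fun x y => bexp ((y / c) *: K x) * F x).
Proof.
move=> q0 dK dF x y hx hy.
have loc (f : R[i] -> B) : (forall t, cabs t < q -> dif f t) ->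
    exists M, exists2 d : R, 0 < d & forall z, cabs (z - x) < d -> cabs z < q /\ nm (f z) <= M.
  move=> df; have qx : 0 < q - cabs x by rewrite subr_gt0.
  have [|M [d /andP[d0 dq] h]] := @dif_locally_bounded R B f x (q - cabs x) qx.
    by move=> z hz; apply: df; have := cabsD (z - x) x; rewrite subrK; lra.
  exists M, d => // z hz; split; last exact: h.
  by have := cabsD (z - x) x; rewrite subrK; lra.
have [k [d1 d10 hk]] := loc K dK; have [m [d2 d20 hm]] := loc F dF.
have k0 : 0 <= k by have [_] := hk x ltac:(by rewrite subrr cabs0); apply: le_trans; exact: nm_ge0.
have m0 : 0 <= m by have [_] := hm x ltac:(by rewrite subrr cabs0); apply: le_trans; exact: nm_ge0.
have bd x' y' : cabs (x' - x) < d1 -> cabs y' < q -> nm ((y' / c) *: K x') <= q / cabs c * k.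
  move=> /hk[_ h] hy'; rewrite nmZ; apply: ler_pM; rewrite ?cabs_ge0 ?nm_ge0 //.
  by rewrite cabsM cabsV ler_wpM2r ?invr_ge0 ?cabs_ge0 // ltW.
split.
- apply: dif_mul; last exact: dF.
  apply: (@dif_bexp R B (fun x => (y / c) *: K x) x d1 (q / cabs c * k)) => // t ht.
    by apply: difZ; apply: dK; have [] := hk t ht.
  exact: bd.
- apply: dif_mul; last exact: dif_cst.
  apply: (@dif_bexp R B (fun y => (y / c) *: K x) y (q - cabs y) (q / cabs c * k)).
  + by rewrite subr_gt0.
  + move=> t ht; apply: difM; last exact: dif_cst.
    by apply: (@difM R R[i] (fun t => t) (fun=> c^-1)); [exact: dif_id|exact: dif_cst].
  + move=> t ht; apply: bd; first by rewrite subrr cabs0.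
    by have := cabsD (t - y) y; rewrite subrK; lra.
- exists (nm (1 : B) * expR (q / cabs c * k + 1) * m), (Num.min (Num.min d1 d2) (q - cabs y)).
    by rewrite !lt_min d10 d20 subr_gt0.
  move=> x' y'; rewrite !lt_min => /andP[/andP[a1 a2] _] /andP[_ b].
  have y'q : cabs y' < q by have := cabsD (y' - y) y; rewrite subrK; lra.
  apply: le_trans (nm_mul _ _) _; apply: ler_pM; rewrite ?nm_ge0 //.
    by apply: bexp_le; exact: bd.
  by have [] := hm x' a2.
Qed.

(** The square of t log t is O(t), so the second-order term of the exponential belongs to the error
    of the expansion. The constant comes from |x| exp(x / 2) <= 2 for x <= 0. *)
Lemma tlogt_small (t : R) : 0 < t -> t <= 1 -> (t * ln t) ^+ 2 <= 4 * t.
Proof.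
move=> t0 t1; set x := ln t; have tE : t = expR x by rewrite lnK.
have x0 : x <= 0 by rewrite -ler_expR -tE expR0.
have h2 : expR (x / 2) * expR (x / 2) = t by rewrite -expRD tE; congr expR; field.
have p := expR_gt0 (x / 2).
have a : - x * expR (x / 2) <= 2.
  have h := expR_ge1Dx (- x / 2).
  have E : expR (- x / 2) * expR (x / 2) = 1 by rewrite -expRD -[RHS]expR0; congr expR; field.
  have := ler_wpM2r (ltW p) h; rewrite E mulrDl mul1r; lra.
have b : 0 <= - x * expR (x / 2) by rewrite mulr_ge0 ?expR_ge0 //; lra.
have c : (- x * expR (x / 2)) ^+ 2 <= 2 ^+ 2 by rewrite lerXn2r // nnegrE.
have -> : (t * x) ^+ 2 = t * (- x * expR (x / 2)) ^+ 2.
  by rewrite [in RHS]exprMn !expr2 h2; ring.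
rewrite mulrC; apply: ler_wpM2r; first exact: ltW.
by apply: le_trans c _; rewrite expr2; lra.
Qed.

Lemma blog0 : blog (0 : B) = 0.
Proof.
have h : nm (0 : B) <= 2^-1 by rewrite nm0; lra.
by have := blog_le h; rewrite nm0 mulr0 => /nm_le0.
Qed.

Variables (r e' d M : R) (f : R[i] -> R[i] -> B) (g g' : R[i] -> B).
Hypotheses (e'_gt0 : 0 < e') (e'_lt : e' < r) (d_gt0 : 0 < d).
Hypotheses (fam : family r d M f g) (fam' : family r d M (fun t z => - f t (t / z)) g').

Local Notation lift := (neck_lift e' f g).
Local Notation mon := (monodromy e' f g).

(** All conclusions are gathered on one radius [q], on which the monodromy also stays within 1/2 of
    the identity, as the series of the logarithm requires. For loops only the definitions remain to
    be translated. *)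
Theorem neck_theorem : exists q, exists F : R[i] -> B, exists G : R[i] -> R[i] -> B,
  [/\ 0 < q <= Num.min d (r * e'),
      forall t, cabs t < q -> nm (mon t - 1) <= 2^-1,
      forall tau, expR (complex.Re tau) < q ->
        lift (tau + two_pi_i R) = lift tau /\ F (cexp tau) = lift tau,
      (forall t, cabs t < q -> dif F t) /\ F 0 = neck_value e' g g' &
      [/\ holo2 q G, G 0 0 = F 0,
        forall t : R, 0 < t < q -> neckpt e' f (ln t)%:C = G t%:C (t * ln t)%:C,
        dif mon 0 &
        exists C, forall t : R, 0 < t < q ->
         nm (neckpt e' f (ln t)%:C - (1 + ((t * ln t)%:C / two_pi_i R) *: D1 mon 0) * F 0) <= C * t]].
Proof.
have [q0 /andP[q00 q0m] [C C0 hC]] := monodromy_small e'_gt0 e'_lt d_gt0 fam.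
have half t : cabs t < q0 -> nm (mon t - 1) <= 2^-1 by case/hC.
have lin t : cabs t < q0 -> nm (mon t - 1) <= C * cabs t by case/hC.
pose F := neck_fun e' f g g'.
have dF t : cabs t < q0 -> dif F t by exact: (neck_fun_dif e'_gt0 e'_lt d_gt0 fam fam' q00 q0m C0 half lin).
pose L := neck_log e' f g.
have dL t : cabs t < q0 -> dif L t by exact: (neck_log_dif e'_gt0 e'_lt d_gt0 fam q0m half).
have L0 : L 0 = 0 by rewrite /L /neck_log (monodromy0 e'_gt0 e'_lt fam) subrr blog0.
(* The logarithm of the monodromy vanishes at 0; [K] is its quotient by [t], with the singularity
   removed. *)
pose K := quot L 0.
have z0 : cabs (0 : R[i]) < q0 by rewrite cabs0.
have dK t : cabs t < q0 -> dif K t.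
  have off s : s != 0 -> cabs s < q0 -> dif K s by move=> sn sq; apply: quot_dif => //; exact: dL.
  have [->|tn] := eqVneq t 0 => tq; last exact: off.
  apply: (@removable R B _ 0 q0) => //; first by apply: quot_cts; exact: dL.
  by move=> z; rewrite subr0 => /andP[h1 h2]; apply: off => //; rewrite -cabs_gt0.
have dmon : dif mon 0 by apply: (monodromy_dif e'_gt0 e'_lt d_gt0 fam); exact: lt_le_trans q0m.
have mon0 := monodromy0 e'_gt0 e'_lt fam.
(* [blog x] and [x] differ by a quadratic term, and the monodromy is the identity up to O(|t|). *)
have K0 : K 0 = D1 mon 0.
  rewrite /K /quot eqxx; apply: D1E => e e0.
  have [k k0 hk] := D1P dmon (ltac:(lra) : 0 < e / 2).
  pose c := Num.min (Num.min k q0) (e / (4 * (C * C + 1))).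
  have CC : 0 <= C * C by rewrite mulr_ge0.
  exists c; first by rewrite /c !lt_min k0 q00 divr_gt0 // mulr_gt0 //; lra.
  move=> w _; rewrite subr0 /c !lt_min => /andP[/andP[w1 w2] w3].
  have := hk w I; rewrite subr0 mon0 => /(_ w1) h1.
  have [_ _ h2] := blogP (half w w2); have h3 := lin w w2.
  have h4 : nm (mon w - 1) ^+ 2 <= (C * cabs w) ^+ 2.
    by rewrite lerXn2r // nnegrE ?nm_ge0 // mulr_ge0 ?cabs_ge0.
  have h5 : 2 * (C * C) * cabs w * cabs w <= e / 2 * cabs w.
    apply: ler_wpM2r; first exact: cabs_ge0.
    move: w3; rewrite ltr_pdivlMr; last by rewrite mulr_gt0 //; lra.
    by have := cabs_ge0 w; lra.
  rewrite L0 subr0.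
  have -> : L w - w *: D1 mon 0 = (blog (mon w - 1) - (mon w - 1)) + (mon w - 1 - w *: D1 mon 0).
    by rewrite addrA subrK.
  apply: le_trans (nmD _ _) _.
  move: h1 h2 h4 h5; rewrite !expr2; lra.
have logE t : cabs t < q0 -> L t = t *: K t.
  have [->|tn] := eqVneq t 0 => tq; first by rewrite L0 scale0r.
  by rewrite /K /quot (negbTE tn) L0 !subr0 scalerA mulfV // scale1r.
have liftE tau : expR (complex.Re tau) < q0 -> F (cexp tau) = lift tau.
  exact: (neck_fun_lift g' e'_gt0 e'_lt fam q0m half).
pose tpi := two_pi_i R.
(* Here t and t log t become independent variables: the coefficient of the exponent, -(log t) times
   the logarithm of the monodromy, equals -(t log t) times [K]. *)
pose G x y := bexp ((y / tpi) *: K x) * F x.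
have hG : holo2 q0 G by exact: bexp_cts_holo2.
have NG (t : R) : 0 < t < q0 -> neckpt e' f (ln t)%:C = G t%:C (t * ln t)%:C.
  move=> /andP[t0 tq].
  have tE : cexp (ln t)%:C = t%:C :> R[i] by rewrite cexp_real lnK.
  have ht : expR (complex.Re (ln t)%:C) < q0 by rewrite /= lnK.
  have tq' : cabs (t%:C : R[i]) < q0 by rewrite cabs_real gtr0_norm.
  rewrite /G -tE liftE // /neck_lift tE -/L logE // scalerA.
  have -> : - (ln t)%:C / tpi * t%:C = - ((t * ln t)%:C / tpi).
    by rewrite rmorphM mulNr mulNr mulrAC [t%:C * _]mulrC.
  by rewrite scaleNr mulrA bexpN mul1r.
have [kF kF0 hF] := der_lip (D1P (dF 0 z0)).
have [kK kK0 hK] := der_lip (D1P (dK 0 z0)).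
have [E E0 hE] := bexp_small B.
have [MK [dk /andP[dk0 _] hMK]] := dif_locally_bounded q00 (fun t ht => dK t (etrans (esym (congr1 (fun x => cabs x < q0) (subr0 t))) ht)).
have [MF [df /andP[df0 _] hMF]] := dif_locally_bounded q00 (fun t ht => dF t (etrans (esym (congr1 (fun x => cabs x < q0) (subr0 t))) ht)).
have MK0 : 0 <= MK by apply: le_trans (hMK 0 _); rewrite ?nm_ge0 // subrr cabs0.
have MF0 : 0 <= MF by apply: le_trans (hMF 0 _); rewrite ?nm_ge0 // subrr cabs0.
set LK := nm _ + 1 in hK; set LF := nm _ + 1 in hF.
have LK0 : 0 <= LK by rewrite /LK; have := nm_ge0 (D1 K 0); lra.
have LF0 : 0 <= LF by rewrite /LF; have := nm_ge0 (D1 F 0); lra.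
pose p := cabs tpi.
have p0 : 0 < p by rewrite cabs_gt0 two_pi_i_neq0.
pose b := MK / p.
have b0 : 0 <= b by rewrite /b divr_ge0 // ltW.
(* Through [tlogt_small] this forces |t log t| (b + 1) <= 1, so that the exponent has norm at most 1
   and [bexp_small] applies. *)
pose q1 := (b + 1)^-1 ^+ 2 / 4.
have q10 : 0 < q1 by rewrite /q1 divr_gt0 // exprn_gt0 // invr_gt0; lra.
pose q := Num.min (Num.min (Num.min q0 1) (Num.min kF kK)) (Num.min (Num.min dk df) q1).
have qq0 : q <= q0 by rewrite /q !ge_min lexx.
have qp : 0 < q by rewrite /q !lt_min q00 ltr01 kF0 kK0 dk0 df0 q10.
have qsub t : cabs t < q -> cabs t < q0 by move=> h; exact: lt_le_trans qq0.
exists q, F, G; split=> //.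
- by rewrite qp (le_trans qq0).
- by move=> t /qsub; exact: half.
- move=> tau ht; have ht0 : expR (complex.Re tau) < q0 by exact: lt_le_trans qq0.
  by split; [exact: (neck_lift_periodic e'_gt0 e'_lt fam q0m half)|exact: liftE].
- by split; [move=> t /qsub; exact: dF|rewrite /F /neck_fun eqxx].
split=> //.
- by move=> x y /qsub hx /qsub hy; exact: hG.
- by rewrite /G mul0r scale0r bexp0 mul1r.
- by move=> t /andP[t0 tq]; apply: NG; rewrite t0 (lt_le_trans tq).
exists (E * (4 * b ^+ 2) * MF + 2 * LF + 2 / p * LK * MF) => t /andP[t0].
rewrite /q !lt_min => /andP[/andP[/andP[tq0 t1] /andP[tF tK]] /andP[/andP[tk tf] tq1]].
rewrite NG ?t0 //.
have tc : cabs (t%:C - 0 : R[i]) = t by rewrite subr0 cabs_real gtr0_norm.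
have sq := tlogt_small t0 (ltW t1).
set y := t * ln t in sq *.
have y2 : `|y| <= 2.
  rewrite -(ler_pXn2r (n := 2)) ?nnegrE // -normrX ger0_norm ?sqr_ge0 //.
  by apply: le_trans sq _; rewrite expr2; lra.
have yb : `|y| * (b + 1) <= 1.
  have bp : 0 < b + 1 by lra.
  rewrite -ler_pdivlMr // -(ler_pXn2r (n := 2)) ?nnegrE //; last by rewrite divr_ge0 // ltW.
  rewrite -normrX ger0_norm ?sqr_ge0 //; apply: le_trans sq _.
  by move: tq1; rewrite /q1 div1r; lra.
set A := (y%:C / tpi) *: K t%:C.
have hKt := hMK t%:C ltac:(by rewrite tc).
have hFt := hMF t%:C ltac:(by rewrite tc).
have hF0 := hMF 0 ltac:(by rewrite subrr cabs0).
have Ay : nm A <= `|y| * b.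
  rewrite /A nmZ cabsM cabsV cabs_real -/p /b -mulrA [p^-1 * _]mulrC.
  apply: ler_wpM2l => //; apply: ler_wpM2r => //; by rewrite invr_ge0 ltW.
have A1 : nm A <= 1 by apply: le_trans Ay _; have := normr_ge0 y; lra.
have [A2 _] := hE A A1.
have A3 : nm A ^+ 2 <= 4 * b ^+ 2 * t.
  apply: (@le_trans _ _ ((`|y| * b) ^+ 2)).
    by rewrite lerXn2r // nnegrE ?nm_ge0 // mulr_ge0.
  rewrite exprMn -normrX ger0_norm ?sqr_ge0 //.
  have -> : 4 * b ^+ 2 * t = 4 * t * b ^+ 2 by ring.
  by rewrite ler_wpM2r // sqr_ge0.
have T1 : nm ((bexp A - 1 - A) * F t%:C) <= E * (4 * b ^+ 2) * MF * t.
  have -> : E * (4 * b ^+ 2) * MF * t = E * (4 * b ^+ 2 * t) * MF by ring.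
  apply: le_trans (nm_mul _ _) _; apply: ler_pM; rewrite ?nm_ge0 //.
  by apply: le_trans A2 _; exact: ler_wpM2l.
have hF' := hF t%:C I; rewrite tc in hF'; move/(_ tF): hF' => hF'.
have hK' := hK t%:C I; rewrite tc K0 in hK'; move/(_ tK): hK' => hK'.
have T2 : nm (F t%:C - F 0 + A * (F t%:C - F 0)) <= 2 * LF * t.
  apply: le_trans (nmD _ _) _.
  have : nm (A * (F t%:C - F 0)) <= 1 * (LF * t).
    by apply: le_trans (nm_mul _ _) _; apply: ler_pM; rewrite ?nm_ge0.
  lra.
have T3 : nm ((y%:C / tpi) *: (K t%:C - D1 mon 0) * F 0) <= 2 / p * LK * MF * t.
  have -> : 2 / p * LK * MF * t = 2 / p * (LK * t) * MF by ring.
  apply: le_trans (nm_mul _ _) _; apply: ler_pM; rewrite ?nm_ge0 //.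
  rewrite nmZ; apply: ler_pM; rewrite ?nm_ge0 ?cabs_ge0 //.
  by rewrite cabsM cabsV cabs_real ler_wpM2r // invr_ge0 ltW.
(* Three errors of order t: the quadratic remainder of the exponential, the variation of [F], and
   the variation of [K] multiplied by the bounded quantity t log t. *)
have -> : G t%:C y%:C - (1 + (y%:C / tpi) *: D1 mon 0) * F 0 =
   (bexp A - 1 - A) * F t%:C + (F t%:C - F 0 + A * (F t%:C - F 0)) +
   (y%:C / tpi) *: (K t%:C - D1 mon 0) * F 0.
  rewrite /G -/A /A scalerBr !mulrBl !mulrDl !mul1r mulrBr -!scalerAl; modring.
apply: le_trans (nmD _ _) _; move: (nmD ((bexp A - 1 - A) * F t%:C) (F t%:C - F 0 + A * (F t%:C - F 0))).
have -> : (E * (4 * b ^+ 2) * MF + 2 * LF + 2 / p * LK * MF) * t =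
    E * (4 * b ^+ 2) * MF * t + 2 * LF * t + 2 / p * LK * MF * t by rewrite [in LHS]mulrDl [in LHS]mulrDl.
lra.
Qed.

End NeckTheorem.

(** * The loop algebra as a Banach algebra *)

Section Window.
Variable R : realType.

(** Symmetric partial sums over the integers, indexed exactly as in [lmul]. *)
Definition window (V : nmodType) (N : nat) (u : int -> V) : V :=
  \sum_(j < (2 * N).+1) u (j%:Z - N%:Z).

Lemma window0 (V : nmodType) (u : int -> V) : window 0 u = u 0.
Proof. by rewrite /window big_ord_recl big_ord0 addr0 subrr. Qed.

Lemma windowS (V : nmodType) (u : int -> V) N :
  window N.+1 u = window N u + (u N.+1%:Z + u (- N.+1%:Z)).
Proof.
rewrite /window mulnS add2n big_ord_recl big_ord_recr /= sub0r.
rewrite [RHS]addrA [RHS]addrC; congr (_ + _); congr (_ + _).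
  by apply: eq_bigr => j _; congr u; rewrite /bump /=; lia.
by congr u; rewrite /bump /=; lia.
Qed.

Definition l1 (a : int -> R) (C : R) := forall N, window N a <= C.

Lemma window_ge0 (a : int -> R) N : (forall k, 0 <= a k) -> 0 <= window N a.
Proof. by move=> a0; apply: sumr_ge0. Qed.

Lemma window_le (a b : int -> R) N : (forall k, a k <= b k) -> window N a <= window N b.
Proof. by move=> ab; apply: ler_sum. Qed.

Lemma windowD (V : nmodType) N (u v : int -> V) :
  window N (fun k => u k + v k) = window N u + window N v.
Proof. exact: big_split. Qed.

Lemma windowM c (a : int -> R) N : window N (fun k => c * a k) = c * window N a.
Proof. by rewrite /window mulr_sumr. Qed.

Lemma l1_term (a : int -> R) C k : (forall k, 0 <= a k) -> l1 a C -> a k <= C.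
Proof.
move=> a0 hC; apply: le_trans (hC `|k|%N).
case: k => [[|k]|k] /=; first by rewrite window0.
  by rewrite windowS; have := a0 (- k.+1%:Z); have := window_ge0 k a0; lra.
rewrite windowS NegzE; have := a0 k.+1%:Z; have := window_ge0 k a0; lra.
Qed.

(** Windows are not invariant under translation, but a window shifted by one lies in the next larger
    window; longer shifts are iterated. *)
Lemma l1_shift (a : int -> R) C i : (forall k, 0 <= a k) -> l1 a C -> l1 (fun k => a (k - i)) C.
Proof.
have up (b : int -> R) : (forall k, 0 <= b k) -> l1 b C -> l1 (fun k => b (k - 1)) C.
  move=> b0 hb N; apply: le_trans (hb N.+1).
  suff -> : window N (fun k => b (k - 1)) = window N b + b (- N.+1%:Z) - b N%:Z.
    by rewrite windowS; have := b0 N.+1%:Z; have := b0 N%:Z; lra.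
  elim: N => [|N IH]; first by rewrite !window0; ring.
  rewrite !windowS IH.
  have -> : N.+1%:Z - 1 = N by lia.
  have -> : - N.+1%:Z - 1 = - N.+2%:Z by lia.
  ring.
have down (b : int -> R) : (forall k, 0 <= b k) -> l1 b C -> l1 (fun k => b (k + 1)) C.
  move=> b0 hb N; apply: le_trans (hb N.+1).
  suff -> : window N (fun k => b (k + 1)) = window N b + b N.+1%:Z - b (- N%:Z).
    by rewrite windowS; have := b0 (- N.+1%:Z); have := b0 (- N%:Z); lra.
  elim: N => [|N IH]; first by rewrite !window0 add0r oppr0 addrC addKr.
  rewrite !windowS IH.
  have -> : N.+1%:Z + 1 = N.+2 by lia.
  have -> : - N.+1%:Z + 1 = - N%:Z by lia.
  ring.
move=> a0 ha; case: i => i.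
  elim: i => [|i IH]; first by move=> N; rewrite /window; under eq_bigr do rewrite subr0; exact: ha.
  move=> N; have := up (fun k => a (k - i%:Z)) (fun k => a0 _) IH N.
  by rewrite /window; under eq_bigr do rewrite -addrA -opprD -intS.
elim: i => [|i IH].
  by move=> N; have := down a a0 ha N; rewrite /window NegzE opprK.
move=> N; have := down (fun k => a (k - Negz i)) (fun k => a0 _) IH N.
rewrite /window !NegzE !opprK; under eq_bigr do rewrite -addrA -intS.
by [].
Qed.

Lemma window_cauchy (a : int -> R) C : (forall k, 0 <= a k) -> l1 a C ->
  forall e : R, 0 < e -> exists N, forall M, (N <= M)%N -> window M a - window N a <= e.
Proof.
move=> a0 hC e e0; pose A : set R := [set x | exists N, x = window N a]%classic.
have ub : ubound A C by move=> x [N ->].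
have hs : has_sup A by split; [exists (window 0 a); exists 0%N|exists C].
have [x [N ->] hx] := sup_adherent e0 hs.
exists N => M _; have := ub_le_sup (ex_intro _ _ ub) (ex_intro _ M erefl : A (window M a)).
lra.
Qed.

Lemma nm_window (V : banachType R) (u : int -> V) N :
  nm (window N u) <= window N (fun k => nm (u k)).
Proof. exact: nm_sum. Qed.

Lemma nm_windowB (V : banachType R) (u : int -> V) N M : (N <= M)%N ->
  nm (window M u - window N u) <= window M (fun k => nm (u k)) - window N (fun k => nm (u k)).
Proof.
move=> /subnK <-; elim: (M - N)%N => [|k IH] /=; first by rewrite !subrr nm0.
rewrite addSn !windowS.
set x := window (k + N) u in IH *; set y := u _; set z := u _.
have -> : x + (y + z) - window N u = (x - window N u) + (y + z) by rewrite addrAC.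
have := nmD (x - window N u) (y + z); have := nmD y z; lra.
Qed.

Lemma window_cvg (V : banachType R) (u : int -> V) C : l1 (fun k => nm (u k)) C ->
  exists l, nm l <= C /\ forall e : R, 0 < e -> exists N0, forall N, (N0 <= N)%N ->
    nm (window N u - l) <= e.
Proof.
move=> hC; have pos k : 0 <= nm (u k) by exact: nm_ge0.
have [|l hl] := @nm_complete R V (fun N => window N u).
  move=> e e0; have [N hN] := window_cauchy pos hC (ltac:(lra) : 0 < e / 2).
  exists N => j k hj hk.
  have := nm_dist (window N u) (window j u) (window k u); rewrite [nm (window N u - _)]nmB.
  have := nm_windowB u hj; have := nm_windowB u hk; have := hN j hj; have := hN k hk; lra.
exists l; split=> //; apply/ler_addgt0Pl => e e0.
have [N hN] := hl e e0; have := nm_bound l (window N u); rewrite [nm (l - _)]nmB.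
have := hN N (leqnn N); have := nm_window u N; have := hC N; lra.
Qed.

End Window.

(** * The entrywise norm on matrices *)

Section MatrixNorm.
Variables (R : realType) (n : nat).
Local Notation M := 'M[R[i]]_n.+1.
Implicit Types A B : M.

Lemma mnorm_ge0 A : 0 <= mnorm A.
Proof. by apply: sumr_ge0 => i _; apply: sumr_ge0 => j _; exact: cabs_ge0. Qed.

Lemma mnormD A B : mnorm (A + B) <= mnorm A + mnorm B.
Proof.
rewrite /mnorm -big_split; apply: ler_sum => i _; rewrite -big_split; apply: ler_sum => j _.
by rewrite mxE; exact: cabsD.
Qed.

Lemma mnormZ (a : R[i]) A : mnorm (a *: A) = cabs a * mnorm A.
Proof.
rewrite /mnorm mulr_sumr; apply: eq_bigr => i _; rewrite mulr_sumr; apply: eq_bigr => j _.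
by rewrite mxE cabsM.
Qed.

Lemma mnorm0 : mnorm (0 : M) = 0.
Proof. by rewrite -(scale0r (0 : M)) mnormZ cabs0 mul0r. Qed.

Lemma mnorm_entry A i j : cabs (A i j) <= mnorm A.
Proof.
rewrite /mnorm (bigD1 i) //= (bigD1 j) //= -addrA lerDl addr_ge0 //.
  by apply: sumr_ge0 => k _; exact: cabs_ge0.
by apply: sumr_ge0 => k _; apply: sumr_ge0 => l _; exact: cabs_ge0.
Qed.

Lemma mnorm_eq0 A : mnorm A = 0 -> A = 0.
Proof.
move=> A0; apply/matrixP => i j; rewrite mxE; apply: cabs_eq0; apply/eqP.
by rewrite eq_le cabs_ge0 -[X in _ <= X]A0 mnorm_entry.
Qed.

Lemma mnormM A B : mnorm (A *m B) <= mnorm A * mnorm B.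
Proof.
have row_le k j : cabs (B k j) <= \sum_k' cabs (B k' j).
  by rewrite (bigD1 k) //= lerDl; apply: sumr_ge0 => l _; exact: cabs_ge0.
rewrite /mnorm mulr_suml; apply: ler_sum => i _.
rewrite [\sum_i0 \sum_j cabs (B i0 j)]exchange_big mulr_sumr; apply: ler_sum => j _.
rewrite mxE; apply: le_trans (_ : \sum_k cabs (A i k * B k j) <= _).
  exact: (@nm_sum R R[i]).
rewrite mulr_suml; apply: ler_sum => k _; rewrite cabsM ler_wpM2l ?cabs_ge0 //.
Qed.

Fact mnorm_complete (u : nat -> M) :
  (forall e : R, 0 < e -> exists N, forall j k, (N <= j)%N -> (N <= k)%N ->
     mnorm (u j - u k) <= e) ->
  exists l, forall e : R, 0 < e -> exists N, forall k, (N <= k)%N -> mnorm (u k - l) <= e.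
Proof.
move=> hu.
have [l hl] : exists l : 'I_n.+1 * 'I_n.+1 -> R[i], forall p (e : R), 0 < e -> exists N, forall k,
    (N <= k)%N -> cabs (u k p.1 p.2 - l p) <= e.
  apply: (choice (fun p l => forall e : R, 0 < e -> exists N, forall k,
    (N <= k)%N -> cabs (u k p.1 p.2 - l) <= e)) => p.
  apply: complex_complete => e /hu [N hN]; exists N => j k hj hk.
  by apply: le_trans (hN j k hj hk); have := mnorm_entry (u j - u k) p.1 p.2; rewrite !mxE.
exists (\matrix_(i, j) l (i, j)) => e e0.
pose c : R := n.+1%:R * n.+1%:R; have c0 : 0 < c by rewrite mulr_gt0 ?ltr0n.
have [N hN] : exists N : 'I_n.+1 * 'I_n.+1 -> nat, forall p k, (N p <= k)%N ->
    cabs (u k p.1 p.2 - l p) <= e / c.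
  apply: (choice (fun p N => forall k, (N <= k)%N -> cabs (u k p.1 p.2 - l p) <= e / c)) => p.
  by apply: hl; rewrite divr_gt0.
exists (\max_p N p) => k hk.
have -> : e = \sum_(i < n.+1) \sum_(j < n.+1) (e / c).
  by rewrite !sumr_const !card_ord -mulrnA -mulr_natr natrM -/c divfK // lt0r_neq0.
rewrite /mnorm; apply: ler_sum => i _; apply: ler_sum => j _; rewrite !mxE.
by apply: (hN (i, j)); apply: leq_trans hk; exact: (leq_bigmax (i, j)).
Qed.

HB.instance Definition _ := Lmodule_isBanach.Build R M mnormD mnormZ mnorm_eq0 mnorm_complete.

End MatrixNorm.

(** * The weighted norm on loops *)

Section LoopNorm.
Variables (R : realType) (n : nat) (rho : R).
Hypothesis rho1 : 1 < rho.
Local Notation M := 'M[R[i]]_n.+1.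
Local Notation L := (loop R n.+1).
Implicit Types f g h : L.

Definition weighted f (k : int) := mnorm (f k) * rho ^+ `|k|%N.

Lemma rho_pow (k : nat) : 1 <= rho ^+ k.
Proof. by rewrite exprn_ege1 // ltW. Qed.

Lemma weighted_ge0 f k : 0 <= weighted f k.
Proof. by rewrite mulr_ge0 ?mnorm_ge0 // (le_trans ler01) ?rho_pow. Qed.

(** The index moves by one: [wpart] counts the terms k < N, whereas [window] runs up to |k| = N. *)
Lemma wpart_window f N : wpart rho f N.+1 = window N (weighted f).
Proof.
rewrite /wpart; elim: N => [|N IH].
  by rewrite big_ord_recl big_ord0 addr0 /= window0 /weighted /= expr0 mulr1.
by rewrite big_ord_recr /= IH windowS /weighted mulrDl.
Qed.

Lemma lle_l1 f e : lle rho f e <-> l1 (weighted f) e.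
Proof.
split=> h N; first by rewrite -wpart_window.
case: N => [|N]; last by rewrite wpart_window.
rewrite /wpart big_ord0; apply: le_trans (h 0%N); apply: window_ge0; exact: weighted_ge0.
Qed.

Lemma lle_ge0 f e : lle rho f e -> 0 <= e.
Proof. by move/(_ 0%N); rewrite /wpart big_ord0. Qed.

Lemma lle0 : lle rho (0 : L) 0.
Proof.
apply/lle_l1 => N; rewrite /window big1 // => k _.
by rewrite /weighted [mnorm _]mnorm0 mul0r.
Qed.

Lemma lleD f g a b : lle rho f a -> lle rho g b -> lle rho (f + g) (a + b).
Proof.
move=> /lle_l1 hf /lle_l1 hg; apply/lle_l1 => N.
apply: le_trans (lerD (hf N) (hg N)); rewrite -windowD; apply: window_le => k.
rewrite /weighted -mulrDl; apply: ler_wpM2r; first by rewrite (le_trans ler01) ?rho_pow.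
exact: mnormD.
Qed.

Lemma lleZ (c : R[i]) f a : lle rho f a -> lle rho (c *: f) (cabs c * a).
Proof.
move=> /lle_l1 hf; apply/lle_l1 => N.
have -> : weighted (c *: f) = fun k => cabs c * weighted f k.
  by apply/funext => k; rewrite /weighted mulrA -mnormZ.
by rewrite windowM ler_wpM2l ?cabs_ge0.
Qed.

Lemma lleN f a : lle rho f a -> lle rho (- f) a.
Proof. by move=> h; rewrite -scaleN1r -[a]mul1r -(cabs1 R) -cabsN; exact: lleZ. Qed.

Lemma lle_coef f a k : lle rho f a -> mnorm (f k) <= a.
Proof.
move=> /lle_l1 h; apply: le_trans (l1_term k (weighted_ge0 f) h).
by rewrite /weighted ler_peMr ?rho_pow ?mnorm_ge0.
Qed.

(** Norm bounds survive coefficientwise limits, since each window involves finitely many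
    coefficients. Completeness rests on this. *)
Lemma lle_limit (v : nat -> L) (l : L) a :
  (forall N, lle rho (v N) a) ->
  (forall k (e : R), 0 < e -> exists N, forall j, (N <= j)%N -> mnorm (v j k - l k) <= e) ->
  lle rho l a.
Proof.
move=> hv hl; apply/lle_l1 => m.
have small (e : R) : 0 < e -> exists J, forall j, (J <= j)%N -> window m (weighted (v j - l)) <= e.
  have one k (e' : R) : 0 < e' -> exists N, forall j, (N <= j)%N -> weighted (v j - l) k <= e'.
    move=> e0; have r0 : 0 < rho ^+ `|k|%N by apply: lt_le_trans (rho_pow _).
    have [|N hN] := hl k (e' / rho ^+ `|k|%N); first by rewrite divr_gt0.
    by exists N => j hj; rewrite /weighted -ler_pdivlMr //; exact: hN.
  elim: m e => [|m IH] e e0.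
    by have [N hN] := one 0 e e0; exists N => j hj; rewrite window0; exact: hN.
  have [N1 h1] := IH (e / 3) ltac:(lra).
  have [N2 h2] := one m.+1%:Z (e / 3) ltac:(lra).
  have [N3 h3] := one (- m.+1%:Z) (e / 3) ltac:(lra).
  exists (maxn N1 (maxn N2 N3)) => j; rewrite !geq_max => /and3P[/h1 a1 /h2 a2 /h3 a3].
  by rewrite windowS; apply: le_trans (lerD a1 (lerD a2 a3)) _; lra.
apply/ler_addgt0Pr => e e0; have [J hJ] := small e e0.
have := hJ J (leqnn J); have /lle_l1/(_ m) := hv J.
have : window m (weighted l) <= window m (weighted (v J)) + window m (weighted (v J - l)).
  rewrite -windowD; apply: window_le => k; rewrite /weighted -mulrDl.
  apply: ler_wpM2r; first by rewrite (le_trans ler01) ?rho_pow.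
  by have := @nm_bound R M (l k) (v J k); rewrite [nm (l k - _)]nmB.
lra.
Qed.

End LoopNorm.

Definition inLb (R : realType) (n : nat) (rho : R) : {pred loop R n.+1} :=
  fun f => `[< inL rho f >].

(* The type depends on the proof of 1 < rho, without which the norm is not submultiplicative. *)
Record wiener (R : realType) (n : nat) (rho : R) (rho1 : 1 < rho) := Wiener {
  coef : loop R n.+1; coefP : coef \in inLb rho }.

(** * The Wiener algebra of loops *)

Section WienerSpace.
Variables (R : realType) (n : nat) (rho : R) (rho1 : 1 < rho).
Local Notation M := 'M[R[i]]_n.+1.
Local Notation L := (loop R n.+1).
Local Notation W := (@wiener R n rho rho1).

HB.instance Definition _ := [isSub of W for (@coef R n rho rho1)].
HB.instance Definition _ := [Choice of W by <:].

Fact inLb_closed : subsemimod_closed (@inLb R n rho).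
Proof.
split; first split.
- by apply/asboolP; exists 0; exact: lle0.
- move=> f g /asboolP[a ha] /asboolP[b hb]; apply/asboolP; exists (a + b); exact: lleD.
- move=> c f /asboolP[a ha]; apply/asboolP; exists (cabs c * a); exact: lleZ.
Qed.

HB.instance Definition _ := GRing.isSubmodClosed.Build R[i] L (@inLb R n rho) inLb_closed.
HB.instance Definition _ := [SubChoice_isSubLmodule of W by <:].

Lemma coefD (f g : W) : coef (f + g) = coef f + coef g. Proof. by []. Qed.
Lemma coefB (f g : W) : coef (f - g) = coef f - coef g. Proof. by []. Qed.
Lemma coefZ (c : R[i]) (f : W) : coef (c *: f) = c *: coef f. Proof. by []. Qed.

Lemma coef_sum (I : Type) (s : seq I) (P : pred I) (F : I -> W) :
  coef (\sum_(i <- s | P i) F i) = \sum_(i <- s | P i) coef (F i).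
Proof. by elim/big_rec2: _ => // i x y _ <-. Qed.

Lemma coef_window (u : int -> W) N k : coef (window N u) k = window N (fun j => coef (u j) k).
Proof. by rewrite coef_sum fct_sumE. Qed.

Lemma coef_inj (f g : W) : coef f = coef g -> f = g.
Proof. exact: val_inj. Qed.

Definition toW (f : L) : W := insubd 0 f.

Lemma coef_toW f : inL rho f -> coef (toW f) = f.
Proof. by move=> h; rewrite /toW /insubd insubT //; exact/asboolP. Qed.

Definition wnorm (f : W) : R := sup [set x | exists N, x = window N (weighted rho (coef f))]%classic.

Lemma wnorm_lle f e : wnorm f <= e <-> lle rho (coef f) e.
Proof.
have /asboolP[a ha] := coefP f.
have hs : has_sup [set x | exists N, x = window N (weighted rho (coef f))]%classic.
  split; first by exists (window 0 (weighted rho (coef f))); exists 0%N.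
  by exists a => x [N ->]; exact: (lle_l1 rho1 _ _).1.
split=> [h|/(lle_l1 rho1) h].
  apply/(lle_l1 rho1) => N; apply: le_trans h; apply: ub_le_sup; first by case: hs.
  by exists N.
by apply: ge_sup; [case: hs|move=> x [N ->]].
Qed.

Lemma lle_wnorm f : lle rho (coef f) (wnorm f).
Proof. exact/wnorm_lle. Qed.

Fact wnormD f g : wnorm (f + g) <= wnorm f + wnorm g.
Proof. by apply/wnorm_lle; apply: lleD => //; exact: lle_wnorm. Qed.

Lemma wnorm_ge0 f : 0 <= wnorm f.
Proof. exact: lle_ge0 (lle_wnorm f). Qed.

Fact wnormZ (c : R[i]) f : wnorm (c *: f) = cabs c * wnorm f.
Proof.
apply/eqP; rewrite eq_le; apply/andP; split.
  by apply/wnorm_lle; apply: lleZ => //; exact: lle_wnorm.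
have [->|cn] := eqVneq c 0; first by rewrite cabs0 mul0r wnorm_ge0.
have c0 : 0 < cabs c by rewrite cabs_gt0.
rewrite mulrC -ler_pdivlMr // mulrC -cabsV; apply/wnorm_lle.
rewrite -[coef f](scalerK cn); apply: (lleZ rho1); rewrite -coefZ; exact: lle_wnorm.
Qed.

Fact wnorm_eq0 f : wnorm f = 0 -> f = 0.
Proof.
move=> f0; apply: coef_inj; apply/funext => k; apply: mnorm_eq0.
apply/eqP; rewrite eq_le mnorm_ge0 andbT; apply: (lle_coef rho1).
by rewrite -f0; exact: lle_wnorm.
Qed.

Fact wnorm_complete (u : nat -> W) :
  (forall e : R, 0 < e -> exists N, forall j k, (N <= j)%N -> (N <= k)%N ->
     wnorm (u j - u k) <= e) ->
  exists l, forall e : R, 0 < e -> exists N, forall k, (N <= k)%N -> wnorm (u k - l) <= e.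
Proof.
move=> hu.
have [l hl] : exists l : L, forall k (e : R), 0 < e -> exists N, forall j,
    (N <= j)%N -> mnorm (coef (u j) k - l k) <= e.
  apply: (choice (fun k l => forall e : R, 0 < e -> exists N, forall j,
    (N <= j)%N -> mnorm (coef (u j) k - l) <= e)) => k.
  apply: mnorm_complete => e /hu [N hN]; exists N => i j hi hj.
  exact: (lle_coef rho1 (f := coef (u i - u j)) k ((wnorm_lle _ _).1 (hN i j hi hj))).
have step (e : R) : 0 < e -> exists N, forall i, (N <= i)%N -> lle rho (coef (u i) - l) e.
  move=> e0; have [N hN] := hu e e0; exists N => i hi.
  apply: (lle_limit rho1 (v := fun j => coef (u i) - coef (u (N + j)%N))).
    by move=> j; rewrite -coefB; apply/wnorm_lle; apply: hN => //; exact: leq_addr.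
  move=> k e' /(hl k) [J hJ]; exists J => j hj.
  have -> : (coef (u i) - coef (u (N + j)%N)) k - (coef (u i) - l) k =
      - (coef (u (N + j)%N) k - l k).
    have E (x y z : M) : x - y - (x - z) = - (y - z) by rewrite !opprB addrC addrA subrK.
    exact: E.
  have := @nmN R M (coef (u (N + j)%N) k - l k); rewrite /nm /= => ->.
  by apply: hJ; exact: leq_trans (leq_addl _ _).
have lL : inL rho l.
  have [N hN] := step 1 ltr01; exists (1 + wnorm (u N)).
  have -> : l = - (coef (u N) - l) + coef (u N) by rewrite opprB subrK.
  by apply: lleD => //; [apply: lleN => //; exact: hN|exact: lle_wnorm].
exists (toW l) => e /step [N hN]; exists N => k hk.
by apply/wnorm_lle; rewrite coefB coef_toW //; exact: hN.
Qed.

HB.instance Definition _ := Lmodule_isBanach.Build R W wnormD wnormZ wnorm_eq0 wnorm_complete.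

Lemma nm_lle (f : W) e : nm f <= e <-> lle rho (coef f) e.
Proof. exact: wnorm_lle. Qed.

Lemma nm_coef (f : W) k : mnorm (coef f k) <= nm f.
Proof. by apply: (lle_coef rho1); exact/nm_lle. Qed.

Lemma l1_nm (f : W) : l1 (weighted rho (coef f)) (nm f).
Proof. by apply/(lle_l1 rho1)/nm_lle. Qed.

Lemma nm_l1 (f : W) e : l1 (weighted rho (coef f)) e -> nm f <= e.
Proof. by move=> h; apply/nm_lle/(lle_l1 rho1). Qed.

Lemma cvg_unique_nm (V : banachType R) (u : nat -> V) l l' :
  (forall e : R, 0 < e -> exists N, forall k, (N <= k)%N -> nm (u k - l) <= e) ->
  (forall e : R, 0 < e -> exists N, forall k, (N <= k)%N -> nm (u k - l') <= e) -> l = l'.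
Proof.
move=> h h'; apply/eqP; rewrite -subr_eq0; apply/eqP/nm_small => e e0.
have [N hN] := h (e / 2) ltac:(lra); have [N' hN'] := h' (e / 2) ltac:(lra).
have := hN _ (leq_maxl N N'); have := hN' _ (leq_maxr N N').
have := nm_dist (u (maxn N N')) l l'; rewrite [nm (l - u _)]nmB; lra.
Qed.

(** [mlim] selects some limit; uniqueness of limits shows that it is the given one. *)
Lemma mlimE (u : nat -> M) l :
  (forall e : R, 0 < e -> exists N, forall k, (N <= k)%N -> mnorm (u k - l) <= e) -> mlim u = l.
Proof.
move=> h; have hl : mconv u l.
  by move=> e e0; have [N hN] := h (e / 2) ltac:(lra); exists N => m /hN; lra.
have : mconv u (mlim u) by apply: epsilon_spec; exists l.
move=> hm; apply: (@cvg_unique_nm M u) h => e /hm [N hN].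
by exists N => m /hN /ltW.
Qed.

(** The weight satisfies rho^|k| <= rho^|j| rho^|k - j| because rho > 1. This is the origin of
    submultiplicativity. *)
Fact shift_weight j (A : M) (f : W) :
  l1 (weighted rho (fun k => A *m coef f (k - j))) (mnorm A * rho ^+ `|j|%N * nm f).
Proof.
move=> N; have := l1_shift j (weighted_ge0 rho1 (coef f)) (@l1_nm f) N.
move/(ler_wpM2l (_ : 0 <= mnorm A * rho ^+ `|j|%N)).
rewrite mulr_ge0 ?mnorm_ge0 ?(le_trans ler01) ?rho_pow // => /(_ isT).
apply: le_trans; rewrite -windowM; apply: window_le => k; rewrite /weighted.
apply: (@le_trans _ _ ((mnorm A * mnorm (coef f (k - j))) * (rho ^+ `|j|%N * rho ^+ `|k - j|%N))).
  apply: ler_pM; rewrite ?mnorm_ge0 ?mnormM ?(le_trans ler01) ?rho_pow //.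
  rewrite -exprD ler_weXn2l ?(ltW rho1) //; lia.
by rewrite le_eqVlt; apply/orP; left; apply/eqP; ring.
Qed.

(* Closing the construction with [Qed] keeps unification from unfolding it. *)
Definition shift_sig :
  {s : int -> M -> W -> W | forall j A f, coef (s j A f) = fun k => A *m coef f (k - j)}.
Proof.
exists (fun j A f => toW (fun k => A *m coef f (k - j))) => j A f.
by rewrite coef_toW //; exists (mnorm A * rho ^+ `|j|%N * nm f); apply/(lle_l1 rho1)/shift_weight.
Qed.

(** Left multiplication by the monomial [A] lambda^j. *)
Definition shift := sval shift_sig.

Lemma coef_shift j A f : coef (shift j A f) = fun k => A *m coef f (k - j).
Proof. exact: (svalP shift_sig). Qed.

Lemma nm_shift j A f : nm (shift j A f) <= mnorm A * rho ^+ `|j|%N * nm f.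
Proof. by apply: nm_l1; rewrite coef_shift; exact: shift_weight. Qed.

Fact wmul_series (f g : W) :
  l1 (fun j => nm (shift j (coef f j) g)) (nm f * nm g).
Proof.
move=> N; apply: le_trans (_ : window N (fun j => nm g * weighted rho (coef f) j) <= _).
  by apply: window_le => j; rewrite mulrC; exact: nm_shift.
by rewrite windowM mulrC ler_wpM2r ?nm_ge0 //; exact: l1_nm.
Qed.

(** The product is the norm limit of the absolutely convergent series of f_j lambda^j g. Reading off
    coefficients gives [lmul]; convergence in norm is what the algebraic laws are derived from. *)
Definition wmul_sig : {m : W -> W -> W | forall f g, [/\ coef (m f g) = lmul (coef f) (coef g),
  nm (m f g) <= nm f * nm g & forall e : R, 0 < e -> exists N0, forall N, (N0 <= N)%N ->
    nm (window N (fun j => shift j (coef f j) g) - m f g) <= e]}.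
Proof.
exists (fun f g => toW (lmul (coef f) (coef g))) => f g.
have [l [ln lc]] := window_cvg (wmul_series f g).
suff E : coef l = lmul (coef f) (coef g).
  have EE : toW (lmul (coef f) (coef g)) = l.
    by apply: coef_inj; rewrite coef_toW -E //; exists (nm l); exact/nm_lle.
  by split=> //; rewrite EE.
apply/funext => k; apply/esym; apply: mlimE => e /lc [N0 h]; exists N0 => N /h.
apply: le_trans; apply: le_trans (@nm_coef _ k).
rewrite coefB [in leRHS]fctE /= coef_window le_eqVlt; apply/orP; left; apply/eqP.
congr (mnorm (_ - _)); apply: eq_bigr => j _; by rewrite coef_shift.
Qed.

Definition wmul := sval wmul_sig.

Lemma wmul_spec (f g : W) : [/\ coef (wmul f g) = lmul (coef f) (coef g),
  nm (wmul f g) <= nm f * nm g & forall e : R, 0 < e -> exists N0, forall N, (N0 <= N)%N ->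
    nm (window N (fun j => shift j (coef f j) g) - wmul f g) <= e].
Proof. exact: (svalP wmul_sig). Qed.

Lemma coef_wmul f g : coef (wmul f g) = lmul (coef f) (coef g).
Proof. by case: (wmul_spec f g). Qed.

Lemma nm_wmul f g : nm (wmul f g) <= nm f * nm g.
Proof. by case: (wmul_spec f g). Qed.

Lemma wmul_unique (f g l : W) :
  (forall e : R, 0 < e -> exists N0, forall N, (N0 <= N)%N ->
    nm (window N (fun j => shift j (coef f j) g) - l) <= e) -> wmul f g = l.
Proof. by case: (wmul_spec f g) => _ _ h h'; exact: cvg_unique_nm h h'. Qed.

Lemma shiftDl j A A' f : shift j (A + A') f = shift j A f + shift j A' f.
Proof. by apply: coef_inj; rewrite coefD !coef_shift; apply/funext => k; rewrite mulmxDl. Qed.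

Lemma shiftDr j A f g : shift j A (f + g) = shift j A f + shift j A g.
Proof. by apply: coef_inj; rewrite coefD !coef_shift; apply/funext => k; rewrite mulmxDr. Qed.

Lemma shiftZl j (c : R[i]) A f : shift j (c *: A) f = c *: shift j A f.
Proof. by apply: coef_inj; rewrite coefZ !coef_shift; apply/funext => k; rewrite -scalemxAl. Qed.

Lemma shiftZr j (c : R[i]) A f : shift j A (c *: f) = c *: shift j A f.
Proof. by apply: coef_inj; rewrite coefZ !coef_shift; apply/funext => k; rewrite -scalemxAr. Qed.

Lemma shift0 j f : shift j 0 f = 0.
Proof. by rewrite -(scale0r (0 : M)) shiftZl scale0r. Qed.

Lemma shift_shift i j A A' f : shift i A (shift j A' f) = shift (i + j) (A *m A') f.
Proof.
apply: coef_inj; rewrite !coef_shift; apply/funext => k; rewrite mulmxA; congr (_ *m coef f _).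
by rewrite opprD addrA.
Qed.

Lemma wmulDl f f' g : wmul (f + f') g = wmul f g + wmul f' g.
Proof.
apply: wmul_unique => e e0.
have [_ _ /(_ (e / 2) ltac:(lra)) [N1 h1]] := wmul_spec f g.
have [_ _ /(_ (e / 2) ltac:(lra)) [N2 h2]] := wmul_spec f' g.
exists (maxn N1 N2) => N; rewrite geq_max => /andP[/h1 a1 /h2 a2].
have -> : window N (fun j => shift j (coef (f + f') j) g) =
    window N (fun j => shift j (coef f j) g) + window N (fun j => shift j (coef f' j) g).
  by rewrite -windowD; apply: eq_bigr => j _; rewrite -shiftDl.
rewrite opprD addrACA; apply: le_trans (nmD _ _) _; apply: le_trans (lerD a1 a2) _; lra.
Qed.

Lemma wmulDr f g g' : wmul f (g + g') = wmul f g + wmul f g'.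
Proof.
apply: wmul_unique => e e0.
have [_ _ /(_ (e / 2) ltac:(lra)) [N1 h1]] := wmul_spec f g.
have [_ _ /(_ (e / 2) ltac:(lra)) [N2 h2]] := wmul_spec f g'.
exists (maxn N1 N2) => N; rewrite geq_max => /andP[/h1 a1 /h2 a2].
have -> : window N (fun j => shift j (coef f j) (g + g')) =
    window N (fun j => shift j (coef f j) g) + window N (fun j => shift j (coef f j) g').
  by rewrite -windowD; apply: eq_bigr => j _; rewrite -shiftDr.
rewrite opprD addrACA; apply: le_trans (nmD _ _) _; apply: le_trans (lerD a1 a2) _; lra.
Qed.

Lemma small_scale (c : R[i]) e : 0 < e -> exists2 e' : R, 0 < e' & cabs c * e' <= e.
Proof.
move=> e0; have c1 : 0 < cabs c + 1 by have := cabs_ge0 c; lra.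
exists (e / (cabs c + 1)); first exact: divr_gt0.
by rewrite mulrCA ger_pMr // ler_pdivrMr // mul1r; lra.
Qed.

Lemma wmulZl (c : R[i]) f g : c *: wmul f g = wmul (c *: f) g.
Proof.
apply/esym/wmul_unique => e /(small_scale c) [e' e'0 he].
have [_ _ /(_ e' e'0) [N1 h1]] := wmul_spec f g; exists N1 => N /h1 h.
under [window _ _]eq_bigr do rewrite shiftZl.
by rewrite -scaler_sumr -scalerBr nmZ; apply: le_trans he; rewrite ler_wpM2l ?cabs_ge0.
Qed.

Lemma wmulZr (c : R[i]) f g : c *: wmul f g = wmul f (c *: g).
Proof.
apply/esym/wmul_unique => e /(small_scale c) [e' e'0 he].
have [_ _ /(_ e' e'0) [N1 h1]] := wmul_spec f g; exists N1 => N /h1 h.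
under [window _ _]eq_bigr do rewrite shiftZr.
by rewrite -scaler_sumr -scalerBr nmZ; apply: le_trans he; rewrite ler_wpM2l ?cabs_ge0.
Qed.

Fact lone_lle : lle rho (lone : L) (mnorm (1%:M : M)).
Proof.
apply/(lle_l1 rho1); elim=> [|N IH]; first by rewrite window0 /weighted /lone eqxx expr0 mulr1.
by rewrite windowS /weighted /lone /= mnorm0 !mul0r !addr0; exact: IH.
Qed.

Definition wone : W := toW lone.

Lemma coef_wone : coef wone = lone.
Proof. by rewrite coef_toW //; eexists; exact: lone_lle. Qed.

Definition mono (j : int) (A : M) : W := shift j A wone.

Lemma coef_mono j A k : coef (mono j A) k = if k == j then A else 0.
Proof.
rewrite /mono coef_shift coef_wone /lone subr_eq0; case: eqP => _; first by rewrite mulmx1.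
by rewrite mulmx0.
Qed.

Lemma shift_mono i j A A' : shift i A (mono j A') = mono (i + j) (A *m A').
Proof. exact: shift_shift. Qed.

Lemma window_single (V : zmodType) (u : int -> V) j N : (forall k, k != j -> u k = 0) ->
  (`|j| <= N)%N -> window N u = u j.
Proof.
move=> hu hj; have z : forall m, (m < `|j|)%N -> window m u = 0.
  elim=> [|m IH] hm.
    by rewrite window0 hu //; apply/eqP => j0; rewrite -j0 in hm.
  rewrite windowS IH ?hu ?addr0 //; last exact: ltnW.
    by apply/eqP => h; rewrite -h /= in hm; lia.
  by apply/eqP => h; rewrite -h /= in hm; lia.
elim: N hj => [|N IH] hj.
  by rewrite window0; congr u; lia.
rewrite windowS; move: hj; rewrite leq_eqVlt => /orP[/eqP hj|hj].
  rewrite z ?add0r; last by rewrite hj.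
  have [jE|jE] : j = N.+1%:Z \/ j = - N.+1%:Z by lia.
    by rewrite -jE (hu (- j)) ?addr0 //; lia.
  by rewrite -jE (hu N.+1%:Z) ?add0r //; lia.
by rewrite IH // (hu N.+1%:Z) ?(hu (- N.+1%:Z)) ?addr0 //; apply/eqP => h; move: hj; rewrite -h; lia.
Qed.

Lemma wmul_mono j A g : wmul (mono j A) g = shift j A g.
Proof.
apply: wmul_unique => e e0; exists `|j|%N => N hN.
rewrite (@window_single _ _ j) //; first by rewrite coef_mono eqxx subrr nm0 ltW.
by move=> k kj; rewrite coef_mono (negbTE kj) shift0.
Qed.

(** Laurent polynomials are dense, so bounded additive maps are determined on monomials. Identities
    for products then follow without rearranging double series. *)
Lemma mono_dense (P Q : W -> W) C : 0 <= C ->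
  {morph P : f g / f + g >-> f + g} -> {morph Q : f g / f + g >-> f + g} ->
  (forall f, nm (P f) <= C * nm f) -> (forall f, nm (Q f) <= C * nm f) ->
  (forall j A, P (mono j A) = Q (mono j A)) -> P =1 Q.
Proof.
move=> C0 PD QD PC QC PQ f.
have P0 : P 0 = 0 by apply: (addIr (P 0)); rewrite add0r -PD addr0.
have Q0 : Q 0 = 0 by apply: (addIr (Q 0)); rewrite add0r -QD addr0.
pose T N : W := window N (fun j => mono j (coef f j)).
have PT N : P (T N) = Q (T N).
  rewrite /T /window !(big_morph _ PD P0) (big_morph _ QD Q0).
  by apply: eq_bigr => j _; exact: PQ.
have Tf (e : R) : 0 < e -> exists N, nm (f - T N) <= e.
  move=> e0.
  have [|l [_ hl]] := @window_cvg R W (fun j => mono j (coef f j)) (nm wone * nm f).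
    move=> N; apply: le_trans (_ : window N (fun j => nm wone * weighted rho (coef f) j) <= _).
      by apply: window_le => j; rewrite mulrC; exact: nm_shift.
    by rewrite windowM ler_wpM2l ?nm_ge0 //; exact: l1_nm.
  suff -> : f = l by have [N hN] := hl e e0; exists N; rewrite nmB; exact: hN.
  apply: coef_inj; apply/funext => k.
  apply: (@cvg_unique_nm M (fun N => coef (T N) k)) => e' e'0; last first.
    have [N hN] := hl e' e'0; exists N => m /hN; apply: le_trans.
    exact: (nm_coef (T m - l) k).
  exists `|k|%N => N hN.
  rewrite coef_window (@window_single _ _ k) //; first by rewrite coef_mono eqxx subrr nm0 ltW.
  by move=> j jk; rewrite coef_mono eq_sym (negbTE jk).
apply/eqP; rewrite -subr_eq0; apply/eqP/nm_small => e e0.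
have C1 : 0 < 2 * C + 1 by lra.
have [N hN] := Tf (e / (2 * C + 1)) ltac:(by rewrite divr_gt0).
have E (S : W -> W) : {morph S : f g / f + g >-> f + g} -> S f = S (f - T N) + S (T N).
  by move=> SD; rewrite -SD subrK.
rewrite (E P PD) (E Q QD) PT opprD addrACA subrr addr0.
apply: le_trans (nm_sub _ _) _.
have := PC (f - T N); have := QC (f - T N); move: hN; rewrite ler_pdivlMr //.
have := nm_ge0 (f - T N); move: (nm (f - T N)) (nm (P _)) (nm (Q _)) => x y z; lra.
Qed.

(** By density in [f] and then in [g] it suffices to multiply by monomials, where associativity is
    the composition of two shifts. *)
Lemma wmulA f g h : wmul f (wmul g h) = wmul (wmul f g) h.
Proof.
have bound3 a b c (x y : W) : nm (wmul (wmul a b) c) <= nm a * nm b * nm c.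
  by apply: le_trans (nm_wmul _ _) _; rewrite ler_wpM2r ?nm_ge0 // nm_wmul.
have bound3' a b c (x y : W) : nm (wmul a (wmul b c)) <= nm a * (nm b * nm c).
  by apply: le_trans (nm_wmul _ _) _; rewrite ler_wpM2l ?nm_ge0 // nm_wmul.
apply: (@mono_dense (fun f => wmul f (wmul g h)) (fun f => wmul (wmul f g) h) (nm g * nm h)).
- by rewrite mulr_ge0 ?nm_ge0.
- by move=> a b; rewrite wmulDl.
- by move=> a b; rewrite !wmulDl.
- by move=> a; rewrite mulrC; exact: bound3'.
- by move=> a; rewrite mulrC mulrA; exact: bound3.
move=> i A; rewrite !wmul_mono.
apply: (@mono_dense (fun g => shift i A (wmul g h)) (fun g => wmul (shift i A g) h)
  (mnorm A * rho ^+ `|i|%N * nm h)).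
- by rewrite !mulr_ge0 ?nm_ge0 ?mnorm_ge0 // (le_trans ler01) ?rho_pow.
- by move=> a b; rewrite wmulDl shiftDr.
- by move=> a b; rewrite shiftDr wmulDl.
- move=> a; apply: le_trans (nm_shift _ _ _) _.
  rewrite -[leRHS]mulrA [nm h * _]mulrC; apply: ler_wpM2l (nm_wmul _ _).
  by rewrite mulr_ge0 ?mnorm_ge0 // (le_trans ler01) ?rho_pow.
- move=> a; apply: le_trans (nm_wmul _ _) _.
  by rewrite mulrAC ler_wpM2r ?nm_ge0 // nm_shift.
by move=> j A'; rewrite shift_mono !wmul_mono shift_shift.
Qed.

Lemma wmul1 f : wmul wone f = f.
Proof.
have -> : wone = mono 0 1%:M.
  by apply: coef_inj; apply/funext => k; rewrite coef_mono coef_wone.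
by rewrite wmul_mono; apply: coef_inj; rewrite coef_shift; apply/funext => k; rewrite mul1mx subr0.
Qed.

Lemma wmulr1 f : wmul f wone = f.
Proof.
apply: (@mono_dense (fun f => wmul f wone) id (nm wone + 1)).
- by rewrite addr_ge0 ?nm_ge0.
- by move=> a b; rewrite wmulDl.
- by [].
- by move=> a; apply: le_trans (nm_wmul _ _) _; rewrite mulrC ler_wpM2r ?nm_ge0 //; lra.
- by move=> a; rewrite mulrDl mul1r lerDr mulr_ge0 ?nm_ge0.
by move=> j A; rewrite wmul_mono.
Qed.

Fact wone_neq0 : wone != 0.
Proof.
apply/eqP => /(congr1 (fun f => coef f 0 0 0)).
rewrite coef_wone /lone eqxx !mxE /= => /eqP; rewrite oner_eq0 //.
Qed.

HB.instance Definition _ := GRing.Zmodule_isNzRing.Build W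
  wmulA wmul1 wmulr1 wmulDl wmulDr wone_neq0.
HB.instance Definition _ := GRing.Lmodule_isLalgebra.Build R[i] W wmulZl.
HB.instance Definition _ := GRing.Lalgebra_isAlgebra.Build R[i] W wmulZr.
HB.instance Definition _ := Banach_isAlgebra.Build R W nm_wmul.

Lemma coefM (f g : W) : coef (f * g) = lmul (coef f) (coef g).
Proof. exact: coef_wmul. Qed.

Lemma coef1 : coef (1 : W) = lone.
Proof. exact: coef_wone. Qed.

End WienerSpace.

(** * Transfer to loops *)

Section Transfer.
Variables (R : realType) (n : nat) (rho : R) (rho1 : 1 < rho).
Local Notation L := (loop R n.+1).
Local Notation W := (@wiener R n rho rho1).
Local Notation full := (fun _ : R[i] => True).
Local Notation seg01 := (@unit_seg R).
Local Notation toW := (@toW R n rho rho1).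

Lemma inL_coef (f : W) : inL rho (coef f).
Proof. by exists (nm f); exact/nm_lle. Qed.

Lemma toW_coef (f : W) : toW (coef f) = f.
Proof. by apply: coef_inj; rewrite coef_toW //; exact: inL_coef. Qed.

(** The selected limit is first shown to have finite norm, so that uniqueness of limits in W can be
    applied to it. *)
Lemma llimE (u : nat -> W) (l : W) :
  (forall e : R, 0 < e -> exists N, forall k, (N <= k)%N -> nm (u k - l) <= e) ->
  llim rho (fun N => coef (u N)) = coef l.
Proof.
move=> h; have hl : lconv rho (fun N => coef (u N)) (coef l).
  by move=> e /h [N hN]; exists N => m /hN /nm_lle; rewrite coefB.
have : lconv rho (fun N => coef (u N)) (llim rho (fun N => coef (u N))).
  by apply: epsilon_spec; exists (coef l).
set l' := llim _ _ => h'.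
have l'L : inL rho l'.
  have [N hN] := h' 1 ltr01; exists (1 + nm (u N)).
  have -> : l' = - (coef (u N) - l') + coef (u N) by rewrite opprB subrK.
  by apply: (lleD rho1); [exact: (lleN rho1 (hN N (leqnn N)))|exact/nm_lle].
rewrite -(coef_toW rho1 l'L); congr coef.
apply: (@cvg_unique_nm R W u _ _ _ h) => e /h' [N hN].
by exists N => k /hN hk; apply/nm_lle; rewrite coefB coef_toW.
Qed.

Lemma lpow_coef (f : W) k : lpow (coef f) k = coef (f ^+ k).
Proof.
elim: k => [|k IH]; first by rewrite expr0 coef1.
by rewrite exprSr coefM -IH.
Qed.

Lemma lexp_coef (f : W) : lexp rho (coef f) = coef (bexp f).
Proof.
rewrite -(llimE (fun e e0 => @exp_series_cvg R W f e e0)); congr (llim rho _); apply/funext => N.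
by rewrite /exp_series coef_sum; apply: eq_bigr => k _; rewrite coefZ lpow_coef.
Qed.

Lemma llog_coef (f : W) : nm (f - 1) <= 2^-1 -> llog rho (coef f) = coef (blog (f - 1)).
Proof.
move=> h; have [hl _ _] := blogP h.
have cv (e : R) : 0 < e -> exists N, forall k, (N <= k)%N ->
    nm (log_series (f - 1) k - blog (f - 1)) <= e.
  move=> e0; have [N hN] := geo_small (2 * nm (f - 1)) e0; exists N => k /hN hk.
  by rewrite nmB; exact: le_trans (hl k) hk.
rewrite -(llimE cv); congr (llim rho _); apply/funext => N.
rewrite /log_series coef_sum; apply: eq_bigr => k _.
by rewrite coefZ -lpow_coef coefB coef1.
Qed.

Lemma lcpow_coef (f : W) (c : R[i]) : nm (f - 1) <= 2^-1 ->
  lcpow rho (coef f) c = coef (bexp (c *: blog (f - 1))).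
Proof. by move=> h; rewrite /lcpow llog_coef // -coefZ lexp_coef. Qed.

Lemma cderiv_dif (f : R[i] -> L) z d : 0 < d ->
  (forall w, cabs (w - z) < d -> inL rho (f w)) -> (exists D, has_cderiv rho f z D) ->
  dif (fun w => toW (f w)) z.
Proof.
move=> d0 fL [D [DL hD]]; exists (toW D) => e /hD [d' [d'0 hd']].
exists (Num.min d d'); first by rewrite lt_min d0.
move=> w _; rewrite lt_min => /andP[w1 w2].
have [->|wz] := eqVneq w z; first by rewrite !subrr scale0r subr0 nm0 cabs0 mulr0.
have wp : 0 < cabs (w - z) by rewrite cabs_gt0 subr_eq0.
have wn : w - z != 0 by rewrite subr_eq0.
have zL : inL rho (f z) by apply: fL; rewrite subrr cabs0.
have wE : z + (w - z) = w by rewrite addrC subrK.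
have := hd' (w - z) wp w2; rewrite wE => h.
have : nm ((w - z)^-1 *: (toW (f w) - toW (f z)) - toW D) <= e.
  by apply/nm_lle; rewrite coefB coefZ coefB !coef_toW //; exact: fL.
have -> : toW (f w) - toW (f z) - (w - z) *: toW D =
    (w - z) *: ((w - z)^-1 *: (toW (f w) - toW (f z)) - toW D).
  by rewrite [RHS]scalerBr scalerA mulfV // scale1r.
by rewrite nmZ mulrC => h'; rewrite ler_wpM2r ?cabs_ge0.
Qed.

Lemma dif_cderiv (F : R[i] -> W) z D : der full F z D ->
  has_cderiv rho (fun w => coef (F w)) z (coef D).
Proof.
move=> hD; split; first exact: inL_coef.
move=> e /(der_quotient hD) [d d0 hd]; exists d; split=> // h h0 h1.
by rewrite -coefB -coefZ -coefB; apply/nm_lle; exact: hd.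
Qed.

(** Since [principal] selects a solution, both directions are needed: the solution in W gives
    existence among loops, and every loop-valued solution, brought back to W, equals it by
    uniqueness. *)
Lemma principal_coef (a : R[i] -> L) (c dc : R -> R[i]) (b : R[i] -> W) : cts01 b ->
  (forall s : R, 0 <= s <= 1 -> dc s *: a (c s) = coef (b s%:C)) ->
  principal rho a c dc = coef (transport b).
Proof.
move=> cb hb.
have [Y [Y0 hY]] := sol_exists cb.
have : exists Y', is_solution rho a c dc Y' /\ Y' 1 = principal rho a c dc.
  apply: (epsilon_spec (inhabits (0 : L)) (fun X => exists Y', is_solution rho a c dc Y' /\ Y' 1 = X)).
  exists (coef (Y 1)), (fun s => coef (Y s%:C)); split=> //; split; last split.
  - by rewrite Y0 coef1.
  - by move=> s _; exact: inL_coef.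
  move=> s s01 e e0; have [d d0 hd] := hY s%:C (ex_intro2 _ _ s s01 erefl) e e0.
  exists d; split=> // h h0 hd' sh01.
  have hC : cabs (h%:C : R[i]) = `|h| by exact: cabs_real.
  have hn : (h%:C : R[i]) != 0 by rewrite -cabs_gt0 hC normr_gt0.
  have E : ((s + h)%:C - s%:C : R[i]) = h%:C by rewrite rmorphD addrC addKr.
  have := hd (s + h)%:C (ex_intro2 _ _ (s + h) sh01 erefl); rewrite E hC => /(_ hd') H.
  rewrite hb // -coefM -coefB -coefZ -coefB; apply/nm_lle.
  have -> : (h^-1)%:C *: (Y (s + h)%:C - Y s%:C) - Y s%:C * b s%:C =
      (h%:C)^-1 *: (Y (s + h)%:C - Y s%:C - h%:C *: (Y s%:C * b s%:C)).
    by rewrite [RHS]scalerBr scalerA mulVf // scale1r fmorphV.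
  by rewrite nmZ cabsV hC mulrC ler_pdivrMr ?normr_gt0.
move=> [Y' [[Y'0 [Y'L hY']] <-]].
(* A path on the real interval is extended to complex arguments through the real part, since
   solutions in W are functions on the plane restricted to [unit_seg]. *)
pose Z (z : R[i]) := toW (Y' (complex.Re z)).
have Z1 : coef (Z 1) = Y' 1 by rewrite coef_toW //; apply: Y'L; rewrite /= ler01 lexx.
suff hZ : sol b Z by rewrite -Z1 (transportE cb hZ).
split=> [|_ [s s01 ->]]; first by rewrite /Z /= Y'0 -(coef1 n rho1) toW_coef.
move=> e e0; have [d [d0 hd]] := hY' s s01 e e0; exists d => // _ [s' s'01 ->].
rewrite -rmorphB cabs_real => sd; rewrite /Z /=.
have [->|sn] := eqVneq s' s; first by rewrite !subrr scale0r subr0 nm0 normr0 mulr0.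
have hn : s' - s != 0 by rewrite subr_eq0.
have sE : s + (s' - s) = s' by rewrite addrC subrK.
have := hd (s' - s) hn sd; rewrite sE => /(_ s'01) H.
have : nm (((s' - s)^-1)%:C *: (toW (Y' s') - toW (Y' s)) - toW (Y' s) * b s%:C) <= e.
  by apply/nm_lle; rewrite coefB coefZ coefB coefM !coef_toW -?hb //; exact: Y'L.
have -> : toW (Y' s') - toW (Y' s) - (s' - s)%:C *: (toW (Y' s) * b s%:C) =
  (s' - s)%:C *: (((s' - s)^-1)%:C *: (toW (Y' s') - toW (Y' s)) - toW (Y' s) * b s%:C).
  rewrite [RHS]scalerBr scalerA fmorphV mulfV ?scale1r //.
  by rewrite -cabs_gt0 cabs_real normr_gt0.
by rewrite nmZ cabs_real mulrC => h'; rewrite ler_wpM2r.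
Qed.

(** * The given forms as a family on the neck *)

Section Forms.
Variables (eps e' : R) (a : R[i] -> R[i] -> L) (a0 ahat0 : R[i] -> L).
Hypotheses (e'_gt0 : 0 < e') (e'_lt : e' < eps).
Hypothesis hola : forall t, 0 < cabs t < eps ^+ 2 ->
  holo_on rho (fun z => cabs t / eps < cabs z < eps) (a t).
Hypothesis holt : forall z,
  holo_on rho (fun t => 0 < cabs t < eps ^+ 2 /\ cabs t / eps < cabs z < eps) (fun t => a t z).
Hypothesis hol0 : holo_on rho (fun z => cabs z < eps) a0.
Hypothesis holhat0 : holo_on rho (fun z => cabs z < eps) ahat0.
Hypothesis lim0 : forall r1 r2 : R, 0 < r1 -> r2 < eps -> forall e : R, 0 < e ->
  exists d : R, 0 < d /\ forall t, 0 < cabs t < d -> forall z, r1 <= cabs z <= r2 ->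
    lle rho (a t z - a0 z) e.
Hypothesis limhat0 : forall r1 r2 : R, 0 < r1 -> r2 < eps -> forall e : R, 0 < e ->
  exists d : R, 0 < d /\ forall t, 0 < cabs t < d -> forall z, r1 <= cabs z <= r2 ->
    lle rho (pullback a t z - ahat0 z) e.

Definition form_log t z : W := z *: toW (a t z).
Definition form0 z : W := toW (a0 z).
Definition formhat0 z : W := toW (ahat0 z).

Local Notation f := form_log.
Local Notation hat := (fun t z => - f t (t / z)).

Let eps_gt0 : 0 < eps. Proof. exact: lt_trans e'_lt. Qed.

Lemma disc_holo_dif (b : R[i] -> L) z : holo_on rho (fun z => cabs z < eps) b -> cabs z < eps ->
  dif (fun w => toW (b w)) z.
Proof.
move=> hb hz; have [d d0 hd] := disc0_open hz.
apply: (cderiv_dif d0); first by move=> w /hd /hb[].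
by have [] := hb z hz.
Qed.

Lemma form_inL t z : 0 < cabs t < eps ^+ 2 -> neck eps t z -> inL rho (a t z).
Proof. by move=> ht hz; have [] := hola ht hz. Qed.

Lemma form_dif t z : 0 < cabs t < eps ^+ 2 -> neck eps t z ->
  dif (f t) z /\ dif (f ^~ z) t.
Proof.
move=> ht hz; have [q q0 hq] := neck_open eps_gt0 ht hz.
have tt : cabs (t - t) < q by rewrite subrr cabs0.
have zz : cabs (z - z) < q by rewrite subrr cabs0.
split.
- apply: difM; first exact: dif_id.
  apply: (cderiv_dif q0); last by have [] := hola ht hz.
  by move=> w hw; have [_ h] := hq t w tt hw; exact: form_inL.
- apply: difZ; apply: (@cderiv_dif (fun t => a t z) t q q0).
    by move=> w hw; have [h1 h2] := hq w z hw zz; exact: form_inL.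
  by have [] := holt (conj ht hz).
Qed.

Lemma pullback_log t z : 0 < cabs t < eps ^+ 2 -> neck eps t z ->
  inL rho (pullback a t z) /\ - f t (t / z) = z *: toW (pullback a t z).
Proof.
move=> ht hz; have tn : t != 0 by rewrite -cabs_gt0; case/andP: ht.
have [zn hz'] := neck_swap eps_gt0 tn hz.
have aL := form_inL ht hz'.
have pE : pullback a t z = coef ((- (t / z ^+ 2)) *: toW (a t (t / z))).
  by rewrite coefZ coef_toW.
rewrite pE; split; first exact: inL_coef.
rewrite toW_coef /form_log scalerA -scaleNr; congr (_ *: _); by field.
Qed.

(** The limits control [a] only on compact subsets of the punctured disc. On |z| = s the limit of
    xi_t bounds the form; the circle |z| = |t| / s is carried by z -> t / z onto |z| = s, where the
    limit of the pullback applies. The annulus estimate bounds everything in between. *)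
Lemma neck_family : exists r d M, [/\ e' < r, r < eps, 0 < d, d <= eps ^+ 2 &
  family r d M f form0 /\ family r d M hat formhat0].
Proof.
have ep := e'_gt0; have el := e'_lt; have eg := eps_gt0.
(* Two intermediate radii: boundary data are taken at [s], and the uniform bound holds on the
   narrower neck of radius [r]. *)
pose r := (2 * e' + eps) / 3; pose s := (e' + 2 * eps) / 3.
have r1 : e' < r by rewrite /r; lra.
have rs : r < s by rewrite /r /s; lra.
have se : s < eps by rewrite /s; lra.
clearbody r s.
have r0 : 0 < r by lra.
have s0 : 0 < s by lra.
have dif0 z : cabs z < eps -> dif form0 z by exact: disc_holo_dif hol0.
have difh z : cabs z < eps -> dif formhat0 z by exact: disc_holo_dif holhat0.
have [M1 M10 hM1] := disc_bounded s0 se dif0.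
have [M2 M20 hM2] := disc_bounded s0 se difh.
have [d1 [d10 hd1]] := lim0 s0 se ltr01.
have [d2 [d20 hd2]] := limhat0 s0 se ltr01.
pose Q := Num.max M1 M2 + 1.
have Q1 : M1 + 1 <= Q by rewrite /Q lerD2r le_max lexx.
have Q2 : M2 + 1 <= Q by rewrite /Q lerD2r le_max lexx orbT.
clearbody Q.
(* The first two terms come from the annulus estimate; [Q] and [s * Q] cover the limit coefficients
   and their products with z. *)
pose M := s * Q * (s / (s - r)) + s * Q * (r / (s - r)) + Q + s * Q.
have sQ : 0 <= s * Q by apply: mulr_ge0; [exact: ltW|lra].
have P1 : 0 <= s * Q * (s / (s - r)).
  by apply: mulr_ge0 => //; rewrite divr_ge0 // ?subr_ge0; lra.
have P2 : 0 <= s * Q * (r / (s - r)).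
  by apply: mulr_ge0 => //; rewrite divr_ge0 // ?subr_ge0; lra.
pose d := Num.min (Num.min d1 d2) (Num.min (eps ^+ 2) (s * s)).
have d0 : 0 < d by rewrite /d !lt_min d10 d20 exprn_gt0 // mulr_gt0.
have de : d <= eps ^+ 2 by rewrite /d !ge_min lexx !orbT.
have neck_sub r' t z : 0 < r' -> r' <= eps -> neck r' t z -> neck eps t z.
  move=> r'0 r'e /andP[h1 h2]; rewrite /neck (lt_le_trans h2 r'e) andbT.
  apply: le_lt_trans h1; rewrite ler_wpM2l ?cabs_ge0 // lef_pV2 ?posrE //.
have disc_le0 (b : R[i] -> W) m : (forall z, cabs z < eps -> dif b z) ->
    (forall z, cabs z <= s -> nm (b z) <= m) -> 0 <= m -> m <= Q ->
    forall z, cabs z < r -> [/\ dif b z, nm (b z) <= M & nm (z *: b z) <= M].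
  move=> db hb m0 mQ z hz; have h := hb z ltac:(lra).
  split; first by apply: db; lra.
    by apply: (le_trans h); rewrite /M; lra.
  rewrite nmZ; apply: le_trans (_ : s * Q <= _); last by rewrite /M; lra.
  by apply: ler_pM; rewrite ?cabs_ge0 ?nm_ge0 //; lra.
have fam : family r d M f form0.
  split.
  - move=> t z /andP[t0]; rewrite /d !lt_min => /andP[/andP[t1 t2] /andP[t3 t4]] hz.
    have ht : 0 < cabs t < eps ^+ 2 by rewrite t0.
    have hz' : neck eps t z by apply: (neck_sub r) => //; lra.
    have [D1 D2] := form_dif ht hz'; split=> //.
    have tn : t != 0 by rewrite -cabs_gt0.
    have in_eps w : cabs t / s <= cabs w <= s -> neck eps t w.
      move=> /andP[w1 w2]; rewrite /neck (le_lt_trans w2 se) andbT.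
      by apply: lt_le_trans w1; rewrite ltr_pM2l // ltf_pV2 ?posrE.
    have ts : cabs t / s < s by rewrite ltr_pdivrMr.
    have z1 : cabs t / r < cabs z by case/andP: hz.
    have z2 : cabs z < r by case/andP: hz.
    have trs : cabs t / s < cabs t / r by rewrite ltr_pM2l // ltf_pV2 ?posrE.
    have := @cauchy_annulus R W (f t) z (cabs t / s) s (s * Q) (s * Q).
    rewrite divr_gt0 // (lt_trans trs z1) (lt_trans z2 rs) => /(_ isT isT) H.
    apply: le_trans (H _ _ _) _ => [w hw|w hw|w hw|].
    + by have [] := form_dif ht (in_eps w hw).
    (* On the inner circle [f t w] is rewritten through the pullback at t / w, a point of modulus
       [s]. *)
    + have wn : w != 0 by rewrite -cabs_gt0 hw divr_gt0.
      have sw : cabs (t / w) = s by rewrite cabsM cabsV hw invf_div mulrC divfK // lt0r_neq0.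
      have hv : neck eps t (t / w) by apply: in_eps; rewrite sw lexx ltW.
      have [pL pE] := pullback_log ht hv.
      have -> : f t w = - (- f t (t / (t / w))) by rewrite opprK; congr (f t _); field; exact/andP.
      rewrite pE nmN nmZ sw ler_wpM2l ?(ltW s0) //.
      have b1 : nm (toW (pullback a t (t / w)) - formhat0 (t / w)) <= 1.
        apply/nm_lle; rewrite coefB !coef_toW //; first by apply: hd2; rewrite ?t0 // sw lexx.
        by have [] := holhat0 (z := t / w) ltac:(by rewrite /= sw ?lexx).
      have b2 := hM2 (t / w) ltac:(by rewrite /= sw ?lexx).
      by have := nm_bound (toW (pullback a t (t / w))) (formhat0 (t / w)); lra.
    + have hv : neck eps t w by apply: in_eps; rewrite hw lexx ltW.
      rewrite /form_log nmZ hw ler_wpM2l ?(ltW s0) //.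
      have b1 : nm (toW (a t w) - form0 w) <= 1.
        apply/nm_lle; rewrite coefB !coef_toW //; first by apply: hd1; rewrite ?t0 // hw lexx.
          by have [] := hol0 (z := w) ltac:(by rewrite /= hw ?lexx).
        exact: form_inL.
      have b2 := hM1 w ltac:(by rewrite /= hw ?lexx).
      by have := nm_bound (toW (a t w)) (form0 w); lra.
    + have k1 : s * Q * (s / (s - cabs z)) <= s * Q * (s / (s - r)).
        apply: ler_wpM2l => //; apply: ler_wpM2l; first exact: ltW.
        by rewrite lef_pV2 ?posrE ?subr_gt0 ?(lt_trans z2 rs) // lerB // ltW.
      have k2 : s * Q * (cabs t / s / (cabs z - cabs t / s)) <= s * Q * (r / (s - r)).
        apply: ler_wpM2l => //.
        have -> : r / (s - r) = cabs t / s / (cabs t / r - cabs t / s).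
          have sn : s != 0 by exact: lt0r_neq0.
          have rn : r != 0 by exact: lt0r_neq0.
          have cn : cabs t != 0 by exact: lt0r_neq0.
          have srn : s - r != 0 by rewrite lt0r_neq0 // subr_gt0.
          have -> : cabs t / r - cabs t / s = cabs t * (s - r) / (r * s) by field; rewrite sn rn.
          by field; rewrite sn rn cn srn.
        apply: ler_wpM2l; first by rewrite divr_ge0 // ltW.
        by rewrite lef_pV2 ?posrE ?subr_gt0 ?(lt_trans trs z1) // lerB // ltW.
      by rewrite /M; lra.
  - by apply: (disc_le0 form0 M1) => //; lra.
  - move=> z /andP[z0 zr] e e0.
    have e1 : 0 < e / cabs z by rewrite divr_gt0.
    have [d' [d'0 hd']] := lim0 z0 (lt_trans zr (lt_trans rs se)) e1.
    exists (Num.min d' (Num.min d (r * cabs z))); first by rewrite lt_min d'0 lt_min d0 mulr_gt0.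
    move=> t /andP[t0]; rewrite lt_min => /andP[t1]; rewrite lt_min => /andP[t2 t3].
    have hz : neck eps t z.
      by apply: (neck_sub r) => //; [lra|rewrite /neck zr andbT ltr_pdivrMr // mulrC].
    rewrite /form_log -scalerBr nmZ mulrC -ler_pdivlMr //.
    apply/nm_lle; rewrite coefB !coef_toW //; first by apply: hd'; rewrite ?t0 ?lexx.
      by have [] := hol0 (z := z) ltac:(cbv beta; lra).
    by apply: form_inL => //; rewrite t0 (lt_le_trans t2).
have re : r < eps by lra.
exists r, d, M; split; [exact: r1|exact: re|exact: d0|exact: de|split; first exact: fam].
apply: (family_hat (g := form0)) => //.
  by apply: (disc_le0 formhat0 M2) => //; lra.
move=> z /andP[z0 zr] e e0.
have e1 : 0 < e / cabs z by rewrite divr_gt0.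
have [d' [d'0 hd']] := limhat0 z0 (lt_trans zr (lt_trans rs se)) e1.
exists (Num.min d' (Num.min d (r * cabs z))); first by rewrite lt_min d'0 lt_min d0 mulr_gt0.
move=> t /andP[t0]; rewrite lt_min => /andP[t1]; rewrite lt_min => /andP[t2 t3].
have hz : neck eps t z.
  by apply: (neck_sub r) => //; [lra|rewrite /neck zr andbT ltr_pdivrMr // mulrC].
have ht : 0 < cabs t < eps ^+ 2 by rewrite t0 (lt_le_trans t2 de).
have [pL ->] := pullback_log ht hz.
rewrite -scalerBr nmZ mulrC -ler_pdivlMr //.
apply/nm_lle; rewrite coefB !coef_toW //; first by apply: hd'; rewrite ?t0 ?lexx.
by have [] := holhat0 (z := z) ltac:(cbv beta; lra).
Qed.

Variables (r d M : R).
Hypotheses (r_gt : e' < r) (r_lt : r < eps) (d_gt0 : 0 < d) (d_le : d <= eps ^+ 2)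
  (fam : family r d M f form0) (famhat : family r d M hat formhat0).

Lemma neck_wider t z : neck r t z -> neck eps t z.
Proof.
have rp : 0 < r := lt_trans e'_gt0 r_gt.
move=> /andP[h1 h2]; rewrite /neck (lt_trans h2 r_lt) andbT.
by apply: le_lt_trans h1; rewrite ler_wpM2l ?cabs_ge0 // lef_pV2 ?posrE // ltW.
Qed.

Lemma form_log_coef t z (c : R[i]) : 0 < cabs t < d -> neck r t z ->
  (c * z) *: a t z = coef (c *: f t z).
Proof.
move=> /andP[t0 td] hz; rewrite /form_log scalerA coefZ coef_toW //.
by apply: form_inL; [rewrite t0 (lt_le_trans td)|exact: neck_wider].
Qed.

Lemma principal_beta tau : cabs (cexp tau) < Num.min d (r * e') ->
  principal rho (a (cexp tau)) (beta_path e' tau) (beta_dpath e' tau) = coef (neckpt e' f tau).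
Proof.
rewrite lt_min => /andP[td tr]; have rp : 0 < r := lt_trans e'_gt0 r_gt.
have t0 : 0 < cabs (cexp tau) by rewrite cabs_gt0 cexp_neq0.
have htd : 0 < cabs (cexp tau) < d by rewrite t0.
have cS := strip_convex rp (cexp_neq0 tau).
have Sb : strip r (cexp tau) (basept e') by apply: (basept_strip e'_gt0 r_gt); rewrite t0.
have Se := endpt_strip e'_gt0 r_gt tr.
apply: principal_coef.
  by apply: (cts_seg_coef cS) => // w; exact: (logcoef_dif fam htd).
move=> s s01; rewrite /beta_dpath /logcoef.
have E : beta_path e' tau s = cexp (basept e' + s%:C * (tau - basept e' - basept e')).
  rewrite /beta_path /basept; congr cexp; rewrite rmorphM rmorphB rmorphM rmorph1 rmorph_nat; ring.
have E2 : tau - (2 * ln e')%:C = tau - basept e' - basept e'.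
  by rewrite /basept rmorphM rmorph_nat; ring.
rewrite E E2 form_log_coef //.
apply: (seg_in_convex (S := strip r (cexp tau)) (z := basept e')) => //.
by exists s.
Qed.

Lemma gamma_pathE s : gamma_path e' s = e'%:C * cexp (s%:C * two_pi_i R).
Proof. by []. Qed.

Lemma principal_gamma t : cabs t < Num.min d (r * e') ->
  Pgamma rho e' a a0 t = coef (monodromy e' f form0 t).
Proof.
move=> tm; have rp : 0 < r := lt_trans e'_gt0 r_gt.
have cc := monodromy_coef_cts e'_gt0 r_gt fam tm.
have nz (s : R) : 0 <= s <= 1 -> cabs (e'%:C * cexp (s%:C * two_pi_i R)) = e'.
  by move=> s01; apply: circle_norm => //; exists s.
move: tm; rewrite lt_min => /andP[td tr].
rewrite /Pgamma; case: eqP => [t0|/eqP tn].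
  apply: principal_coef cc _ => s s01; rewrite /gamma_dpath /fill t0 eqxx gamma_pathE.
  rewrite !coefZ coef_toW ?scalerA //.
  have H : cabs (e'%:C * cexp (s%:C * two_pi_i R)) < eps by rewrite nz.
  by have [] := hol0 H.
apply: principal_coef cc _ => s s01; rewrite /gamma_dpath /fill (negbTE tn) gamma_pathE.
rewrite form_log_coef //; first by rewrite cabs_gt0 tn.
by rewrite /neck nz // r_gt ltr_pdivrMr // [e' * r]mulrC tr.
Qed.

Lemma principal_in :
  principal rho a0 (seg_in e') (seg_in_d e') = coef (Seg form0 e'%:C 0).
Proof.
have rp : 0 < r := lt_trans e'_gt0 r_gt.
have be : cabs (e'%:C : R[i]) < r by rewrite cabs_real gtr0_norm.
apply: principal_coef.
  apply: (cts_seg_coef (U := fun z => cabs z < r)) => //; last by rewrite cabs0.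
    exact: disc0_convex.
  by move=> z hz; have [_ h _] := fam; have [] := h z hz.
move=> s s01; rewrite /seg_in_d /seg_in.
have E : ((1 - s) * e')%:C = e'%:C + s%:C * (0 - e'%:C) :> R[i].
  by rewrite rmorphM rmorphB rmorph1; ring.
rewrite E coefZ coef_toW ?sub0r ?rmorphN //.
have [] // := hol0 (z := e'%:C + s%:C * - e'%:C).
rewrite -[- e'%:C]sub0r -E cabs_real; apply: le_lt_trans e'_lt.
by rewrite normrM (ger0_norm (ltW e'_gt0)) ger0_norm ?ler_piMl ?(ltW e'_gt0) //; lra.
Qed.

Lemma principal_out :
  principal rho ahat0 (seg_out e') (seg_out_d e') = coef (Seg formhat0 0 e'%:C).
Proof.
have rp : 0 < r := lt_trans e'_gt0 r_gt.
have be : cabs (e'%:C : R[i]) < r by rewrite cabs_real gtr0_norm.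
apply: principal_coef.
  apply: (cts_seg_coef (U := fun z => cabs z < r)) => //; last by rewrite cabs0.
    exact: disc0_convex.
  by move=> z hz; have [_ h _] := famhat; have [] := h z hz.
move=> s s01; rewrite /seg_out_d /seg_out.
have E : (s * e')%:C = 0 + s%:C * (e'%:C - 0) :> R[i] by rewrite rmorphM; ring.
rewrite E coefZ coef_toW ?subr0 //.
have [] // := holhat0 (z := 0 + s%:C * e'%:C).
rewrite -[e'%:C]subr0 -E cabs_real; apply: le_lt_trans e'_lt.
by rewrite normrM (ger0_norm (ltW e'_gt0)) ger0_norm ?ler_piMl ?(ltW e'_gt0) //; lra.
Qed.

End Forms.

End Transfer.

Section TrivialLoops.
Variable R : realType.

(** Matrices of size zero form the zero ring, which the Banach algebra construction excludes through
    1 != 0; for them every conclusion is trivial. *)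
Lemma loop0_eq (f g : loop R 0) : f = g.
Proof. by apply/funext => k; apply/matrixP => -[]. Qed.

Lemma lle_loop0 rho (f : loop R 0) e : 0 <= e -> lle rho f e.
Proof.
move=> e0 N; rewrite /wpart big1 // => k _.
by rewrite /mnorm !big_ord0 addr0 mul0r; case: eqP.
Qed.

End TrivialLoops.

Theorem theorem5 (R : realType) (n : nat) (rho eps eps' : R)
  (a : R[i] -> R[i] -> loop R n) (a0 ahat0 : R[i] -> loop R n) :
  1 < rho -> 0 < eps' -> eps' < eps ->
  (* xi_t is Lambda sl(n,C)-valued on the annulus A_t *)
  (forall t z, 0 < cabs t < eps ^+ 2 -> cabs t / eps < cabs z < eps ->
     is_sl rho (a t z)) ->
  (* holomorphic in z on A_t, and holomorphic in t *)
  (forall t, 0 < cabs t < eps ^+ 2 ->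
     holo_on rho (fun z => cabs t / eps < cabs z < eps) (a t)) ->
  (forall z, holo_on rho (fun t => 0 < cabs t < eps ^+ 2 /\ cabs t / eps < cabs z < eps)
                         (fun t => a t z)) ->
  (* xi_0 and hat xi_0 holomorphic in D(0, eps) *)
  holo_on rho (fun z => cabs z < eps) a0 ->
  holo_on rho (fun z => cabs z < eps) ahat0 ->
  (* xi_t -> xi_0 and hat xi_t -> hat xi_0 uniformly on compacts of D*(0,eps) *)
  (forall r1 r2 : R, 0 < r1 -> r2 < eps -> forall e : R, 0 < e ->
     exists d : R, 0 < d /\ forall t, 0 < cabs t < d -> forall z, r1 <= cabs z <= r2 ->
       lle rho (a t z - a0 z) e) ->
  (forall r1 r2 : R, 0 < r1 -> r2 < eps -> forall e : R, 0 < e ->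
     exists d : R, 0 < d /\ forall t, 0 < cabs t < d -> forall z, r1 <= cabs z <= r2 ->
       lle rho (pullback a t z - ahat0 z) e) ->
  exists delta : R, 0 < delta /\ exists F : R[i] -> loop R n,
    (* (1) periodicity of tilde F and descent to F *)
    (forall tau, expR (complex.Re tau) < delta ->
       Ftilde rho eps' a (tau + two_pi_i R) = Ftilde rho eps' a tau) /\
    (forall tau, expR (complex.Re tau) < delta ->
       F (cexp tau) = Ftilde rho eps' a tau) /\
    (* (2) F holomorphic on the whole disk D(0,delta), with the value at 0 *)
    holo_on rho (fun t => cabs t < delta) F /\
    F 0 = lmul (principal rho a0 (seg_in eps') (seg_in_d eps'))
               (principal rho ahat0 (seg_out eps') (seg_out_d eps')) /\
    (* (3) smooth function of t and t log t *)
    (exists r : R, exists g : R -> R -> loop R n, 0 < r /\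
       smooth_on2 rho r g /\ g 0 0 = F 0 /\
       forall t : R, 0 < t < r -> Pbeta rho eps' a t = g t (t * ln t)) /\
    (* (3) asymptotic expansion *)
    (exists D : loop R n, has_cderiv rho (Pgamma rho eps' a a0) 0 D /\
       exists K r : R, 0 < r /\ forall t : R, 0 < t < r ->
         lle rho (Pbeta rho eps' a t
                  - lmul (lone + ((t * ln t)%:C / two_pi_i R) *: D) (F 0)) (K * t)).
Proof.
case: n a a0 ahat0 => [|m] a a0 ahat0 rho1 e0 ee _ hola holt hol0 holh lim0 limh.
  have inL0 (f : loop R 0) : inL rho f by exists 0; exact: lle_loop0.
  exists 1; split=> //; exists (fun=> 0).
  do 2 (split; first by move=> *; exact: loop0_eq).
  have hc (f : R[i] -> loop R 0) z : has_cderiv rho f z 0.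
    by split=> // e /ltW e1; exists 1; split=> // *; exact: lle_loop0.
  split; first by move=> z _; split=> //; exists 0.
  split; first exact: loop0_eq.
  split; last first.
    exists 0; split=> //; exists 0, 1; split=> // t _; rewrite mul0r; exact: lle_loop0.
  exists 1, (fun _ _ => 0); split=> //; split; last first.
    by split=> [|t _]; exact: loop0_eq.
  exists (fun _ _ _ => 0); split=> // w; split=> //; split.
    by move=> x y _ e /ltW e1; exists 1; split=> // *; exact: lle_loop0.
  by move=> i x y _ e /ltW e1; exists 1; split=> // *; exact: lle_loop0.
have [r [d [M [re reps d0 dle [fam famh]]]]] :=
  neck_family rho1 e0 ee hola holt hol0 holh lim0 limh.
have [q [F [G [/andP[q0 qm] half lift [dF F0] [hG G0 NG dmon [C hC]]]]]] :=
  neck_theorem e0 re d0 fam famh.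
have beta tau : expR (complex.Re tau) < q ->
    principal rho (a (cexp tau)) (beta_path eps' tau) (beta_dpath eps' tau) =
    coef (neckpt eps' (form_log rho1 a) tau).
  move=> ht; apply: (principal_beta e0 ee hola re reps dle fam).
  by rewrite cabs_cexp; exact: lt_le_trans qm.
have gam t : cabs t < q -> Pgamma rho eps' a a0 t =
    coef (monodromy eps' (form_log rho1 a) (form0 rho1 a0) t).
  move=> ht; apply: (principal_gamma e0 ee hola hol0 re reps dle fam).
  exact: lt_le_trans qm.
have liftE tau : expR (complex.Re tau) < q ->
    Ftilde rho eps' a tau = coef (neck_lift eps' (form_log rho1 a) (form0 rho1 a0) tau).
  move=> ht; have tq : cabs (cexp tau) < q by rewrite cabs_cexp.
  rewrite /Ftilde beta // /neck_lift coefM; congr (lmul _ _).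
  have := gam _ tq; rewrite /Pgamma (negbTE (cexp_neq0 tau)) => ->.
  by rewrite lcpow_coef //; exact: half.
have rePi tau : expR (complex.Re (tau + two_pi_i R)) = expR (complex.Re tau).
  by rewrite -!cabs_cexp cexp_periodic.
have betaR (t : R) : 0 < t < q -> Pbeta rho eps' a t = coef (neckpt eps' (form_log rho1 a) (ln t)%:C).
  move=> /andP[t0 tq]; have tE : cexp (ln t)%:C = t%:C :> R[i] by rewrite cexp_real lnK.
  by rewrite /Pbeta -tE beta //= lnK.
exists q; split=> //; exists (fun t => coef (F t)).
split; last split; last split; last split; last split.
- move=> tau ht; have ht' : expR (complex.Re (tau + two_pi_i R)) < q by rewrite rePi.
  by rewrite (liftE _ ht') (liftE _ ht) (proj1 (lift tau ht)).
- by move=> tau ht; rewrite (liftE _ ht) (proj2 (lift tau ht)).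
- move=> t tq; split; first exact: inL_coef.
  by eexists; apply: dif_cderiv; apply: D1P; exact: dF.
- rewrite F0 /neck_value coefM.
  by rewrite (principal_in e0 ee hol0 re fam) (principal_out e0 ee holh re famh).
(* At real points the complex partial derivatives are also the real ones, so the iterated complex
   partials of [G] witness all orders at once. *)
- pose g w (x y : R) := coef (foldr (@partial R (wiener m rho1)) G w x%:C y%:C).
  have ball x y : ball2 q x y -> cabs (x%:C : R[i]) < q /\ cabs (y%:C : R[i]) < q.
    rewrite /ball2 !cabs_real => h.
    have hx := sqr_ge0 x; have hy := sqr_ge0 y.
    have H z : z ^+ 2 < q ^+ 2 -> `|z| < q.
      by move=> hz; rewrite -(ltr_pXn2r (n := 2)) ?nnegrE ?normr_ge0 ?(ltW q0) // real_normK ?num_real.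
    by split; apply: H; lra.
  exists q, (g [::]); split=> //; split.
    exists g; split=> // w; have hw := holo2_iter w hG.
    split; first by move=> x y _; exact: inL_coef.
    split.
      move=> x y /ball [hx hy] e /(holo2_cts hw hx hy) [k k0 hk]; exists k; split=> // x' y' _ h1 h2.
      rewrite -coefB; apply/nm_lle; apply: hk; by rewrite -rmorphB cabs_real.
    move=> i x y /ball [hx hy] e e1.
    have [k k0 hk] := der_quotient (partial_der i hw hx hy) e1.
    exists k; split=> // h hn hh.
    have := hk h%:C; rewrite cabs_real normr_gt0 => /(_ hn hh).
    rewrite /g -coefB -coefZ -coefB => H; apply/nm_lle; move: H.
    rewrite add0r /= !rmorphD fmorphV /=.
    by case: (i); rewrite ?rmorph0 !addr0.
  split; first by rewrite /g /= G0.
  by move=> t ht; rewrite betaR // NG.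
- exists (coef (D1 (monodromy eps' (form_log rho1 a) (form0 rho1 a0)) 0)); split.
    split; first exact: inL_coef.
    move=> e e1; have [k k0 hk] := der_quotient (D1P dmon) e1.
    (* The increment stays below [q], where [Pgamma] is identified with the holomorphic monodromy,
       the value at 0 included. *)
    exists (Num.min k q); split; first by rewrite lt_min k0.
    move=> h h0; rewrite lt_min => /andP[h1 h2].
    rewrite !gam ?add0r ?cabs0 // -coefB -coefZ -coefB; apply/nm_lle.
    by have := hk h h0 h1; rewrite add0r.
  exists C, q; split=> // t ht; rewrite betaR //.
  by rewrite -(coef1 m rho1) -coefZ -coefD -coefM -coefB; apply/nm_lle; exact: hC.
Qed.
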